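(* Let $\alpha\in(0,1)$, $\Omega=(0,l)\times(0,\pi)$ with $l<l_*$, and suppose the background solution $U_b$ satisfies the S-condition. Let $k\in\{2,3\}$, $h\in C^{k-2,\alpha}(\bar\Omega)$, $g_0\in C^{k-1,\alpha}(\Sigma_0)$, $g_l\in C^{k,\alpha}(\Sigma_l)$, such that the extensions of $h,g_0,g_l$ in $y$ that are even with respect to $y=j\pi$ for every $j\in\mathbb Z$ (hence $2\pi$-periodic in $y$) belong to the same Hölder classes on $[0,l]\times\mathbb R$ and $\mathbb R$ respectively. Then the nonlocal elliptic problem $$\mathcal L_1(\hat p)=h\ \text{ in }\Omega,\qquad \partial_y\hat p=0\ \text{ on }W_-\cup W_+,\qquad \partial_x\hat p+\lambda\gamma_0\hat p=g_0\ \text{ on }\Sigma_0,\qquad \hat p=g_l\ \text{ on }\Sigma_l,$$ where $$\begin{aligned}\mathcal L_1(\hat p)={}&e_1\partial_x^2\hat p-\partial_y^2\hat p+\lambda e_2\partial_x\hat p+e_3\hat p+e_6\int_0^\pi\partial_x\hat p(x,y)\,dy+e_7\int_0^\pi\hat p(x,y)\,dy\\&+\lambda e_{10}\int_0^xa_4(\lambda,t)\hat p(t,y)\,dt+\lambda e_{11}\int_0^xb_4(\lambda,t)\hat p(t,y)\,dt\\&+\lambda e_{12}\int_0^\pi\!\!\int_0^xa_4(\lambda,t)\hat p(t,y)\,dt\,dy+\lambda e_{13}\int_0^\pi\!\!\int_0^xb_4(\lambda,t)\hat p(t,y)\,dt\,dy\end{aligned}$$ (all $e_j$ evaluated at $(\lambda,x)$),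 has a unique solution $\hat p\in C^{k,\alpha}(\bar\Omega)$, and $$\|\hat p\|_{C^{k,\alpha}(\bar\Omega)}\le C\big(\|h\|_{C^{k-2,\alpha}(\bar\Omega)}+\|g_0\|_{C^{k-1,\alpha}(\Sigma_0)}+\|g_l\|_{C^{k,\alpha}(\Sigma_l)}\big),$$ where $C$ depends only on $U_b,\alpha,l$ and $k$.
   Context: Geometry: $\Sigma_0=\{(0,y):0<y<\pi\}$, $\Sigma_l=\{(l,y):0<y<\pi\}$, $W_-=\{(x,0):0<x<l\}$, $W_+=\{(x,\pi):0<x<l\}$. Gas and background solution. Constants $\gamma>1$, $\kappa_0,c_\nu>0$; $p=A(s)\rho^\gamma$, $A(s)=\kappa_0e^{s/c_\nu}$, $c=\sqrt{\gamma p/\rho}$, $M=|\mathbf u|/c$, $E=\frac12|\mathbf u|^2+\frac{c^2}{\gamma-1}$. Given $\lambda\in\mathbb R$, a positive $C^\infty$ function $m_b$ on $\{x\ge0\}$ and a uniform subsonic state $U_b(0)$ (positive constants $p_b(0),\rho_b(0),u_b(0)$ with $0<M_b(0)<1$), the background solution $U_b=(p_b,s_b,E_b,v_b\equiv0)$ is the smooth $x$-dependent solution, with the given values at $x=0$, of $(\rho_bu_b)'=\lambda\rho_bm_b$, $(\rho_bu_b^2+p_b)'=0$, $(\rho_bE_bu_b)'=0$. The critical length $l_*(\lambda)\in(0,\infty]$ is the supremum of $L$ such that it exists on $[0,L)$ with $\rho_b>0$, $u_b>0$, $0<M_b<1$. Coefficients (functions of $\lambda,x$; prime is $d/dx$;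 $A_b=A(s_b)$): $a_1=\frac{m_b}{u_b}\big[\frac12-\frac1{(\gamma-1)M_b^2}\big]$, $a_2=\frac{m_bE_b\rho_b^{\gamma-1}}{(\gamma-1)u_b^3}$, $a_3=\frac{m_bE_b}{\rho_bu_b^3}$; $b_1=\frac{\gamma m_bA_b}{u_b^3}\big[1+\frac{\gamma-1}2M_b^2\big]$, $b_2=\frac{m_b}{u_b}\big[\gamma+\frac12-\frac{(\gamma-1)^2}2M_b^2+\frac1{(\gamma-1)M_b^2}\big]$, $b_3=\frac{\gamma m_bA_b}{u_b^3\rho_b}\big[1+\frac{\gamma-1}2M_b^2+\frac{(\gamma-1)^2}2M_b^4\big]$; $c_1=\frac{1-M_b^2}{\rho_bu_b}$, $c_2=-\frac{\lambda m_b}{2\rho_bc_b^2}\frac{(\gamma-1)^2M_b^8+(\gamma-1)M_b^6+(5\gamma^2-12\gamma+10)M_b^4+(7\gamma-11)M_b^2+2}{M_b^2(1-M_b^2)}$, $c_3=\frac{\lambda m_b}{2u_b^2}\frac{3(\gamma-1)M_b^4+(\gamma+3)M_b^2+2}{1-M_b^2}$, $c_4=-\frac{\lambda m_b\rho_b^{\gamma-1}}{2c_b^2}\frac{(\gamma-1)M_b^8+(\gamma-1)M_b^6+(2\gamma-6)M_b^4+(\gamma+5)M_b^2+2}{M_b^2(1-M_b^2)}$; $d_1=-\frac{2u_b^2}{p_b}\big[1+\frac1{\gamma M_b^4}\big]p_b'+\frac{\lambda m_bc_b^2}{u_b}\big[\frac{(\gamma-1)^2}2M_b^4+\frac{\gamma-1}2M_b^2-1\big]$,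 $d_2=\frac{u_b^2}{p_b}\big[1+\frac1{\gamma M_b^4}\big](p_b')^2-\lambda\gamma u_b\big[1+\frac{\gamma-1}2M_b^2\big]m_b'+\gamma\lambda^2m_b^2\big[\frac{(\gamma-1)^2}4\frac{u_b^4}{c_b^4}-1\big]$, $d_3=2p_b''-\frac2{p_b}\big[1-\frac1{\gamma M_b^4}\big](p_b')^2-\lambda(\gamma-1)\rho_bu_bm_b'$, $d_4=\frac{\lambda m_b([3(\gamma-1)^2+2]M_b^2+(\gamma-1))}2p_b'-\frac{\gamma p_b(\lambda(\gamma-1)M_b^2+2\lambda)}2m_b'+\frac{\gamma\lambda^2(\gamma-1)^2m_b^2u_b^3p_b}{c_b^4}$, $d_5=-\frac{\gamma+1}{\gamma-1}p_b''+\frac2{(\gamma-1)p_b}\big[1-\frac{1+(\gamma-1)M_b^2}{\gamma M_b^4}\big](p_b')^2+\frac{\lambda m_b}{u_b}p_b'\big[1-\frac{(\gamma-1)^2M_b^4}2\big]+\lambda\rho_bu_b\big[1+\frac{\gamma-1}2M_b^2\big]m_b'-\frac{\gamma\lambda^2(\gamma-1)^2m_b^2u_b^4p_b}{2c_b^6}$, $d_{5+j}=\frac{\lambda\gamma m_bp_bc_j}\pi$ for $j=1,2,3,4$; $e_1=M_b^2-1$, $e_2=\frac{d_1}{c_b^2}$, $e_3=\frac{d_2}{c_b^2}+\frac{(\gamma-1)d_5-d_4/u_b}{\rho_bc_b^2}$, $e_4=\frac{d_3}{c_b^2}+\frac{d_4}{u_bc_b^2}$, $e_5=\frac{\rho_b^{\gamma-1}}{(\gamma-1)c_b^2}\big[(\gamma-1)d_5-\frac{d_4}{u_b}\big]$,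 $e_j=\frac{d_j}{c_b^2}$ for $j=6,7,8,9$. Let $\Phi(\lambda,x)$ be the $2\times2$ fundamental matrix of the system $\frac{d}{dx}(X,Y)^\top=\lambda\begin{pmatrix}a_1&a_2\\ b_1&b_2\end{pmatrix}(X,Y)^\top$ with $\Phi(\lambda,0)=I$. Put $[a_4,b_4]^\top=\Phi^{-1}[a_3,b_3]^\top$, $[e_{10},e_{11}]=[e_4,e_5]\Phi$, $[e_{12},e_{13}]=[e_8,e_9]\Phi$. Finally $\gamma_0=-\frac{\gamma m_b(0)u_b(0)}{c_b^2(0)}\cdot\frac{\frac{\gamma^2+1}{2\gamma}M_b^4(0)+\frac{\gamma^2+3}{2\gamma}M_b^2(0)+\frac{3\gamma-1}{2\gamma}}{(M_b^2(0)-1)^2}$. S-condition. $U_b$ satisfies the S-condition if for each $m=0,1,2,\dots$ the following problem on $(0,l)$ has only the trivial solution $p_m\equiv0$: the boundary conditions are $p_m'(0)+\lambda\gamma_0p_m(0)=0$, $p_m(l)=0$; for $m=0$ the equation is $$e_1p_0''+(\lambda e_2+\pi e_6)p_0'+(e_3+\pi e_7)p_0+\lambda(e_{10}+\pi e_{12})\int_0^xa_4(\lambda,t)p_0(t)\,dt+\lambda(e_{11}+\pi e_{13})\int_0^xb_4(\lambda,t)p_0(t)\,dt=0,$$ and for $m\ge1$ it is $$e_1p_m''+\lambda e_2p_m'+(e_3+m^2)p_m+\lambda e_{10}\int_0^xa_4(\lambda,t)p_m(t)\,dt+\lambda e_{11}\int_0^xb_4(\lambda,t)p_m(t)\,dt=0.$$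 *)

(* Defs.v *)
From Stdlib Require Export Reals.
From Coquelicot Require Export Coquelicot.
Open Scope R_scope.

(** In the function classes below, [D] is an open set and [E] lies between [D] and its closure.
    Derivatives are taken at points of [D] only and must have limits at the
    points of [E]; for order [0] the values on [E] are those limits. *)

Definition extends_to {V : UniformSpace} (D E : V -> Prop) (f : V -> R) : Prop :=
  forall z, E z -> exists v : R, filterlim f (within D (locally z)) (locally v).

Definition bounded_on {T : Type} (D : T -> Prop) (f : T -> R) : Prop :=
  exists K, forall z, D z -> Rabs (f z) <= K.

(** The norm of [R * R] is the Euclidean one.  [z <> w] is required because
    [Rpower 0 alpha] is not [0]. *)
Definition holder_on {V : NormedModule R_AbsRing} (alpha : R) (D : V -> Prop)
    (f : V -> R) : Prop :=
  exists K, forall z w, D z -> D w -> z <> w ->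
    Rabs (f z - f w) <= K * Rpower (norm (minus z w)) alpha.

(** [real] sends an infinite supremum to [0]: the two quantities below are
    meaningful only for functions satisfying [bounded_on], [holder_on]. *)
Definition sup_norm {T : Type} (D : T -> Prop) (f : T -> R) : R :=
  real (Lub_Rbar (fun r => exists z, D z /\ r = Rabs (f z))).

Definition holder_seminorm {V : NormedModule R_AbsRing} (alpha : R) (D : V -> Prop)
    (f : V -> R) : R :=
  real (Lub_Rbar (fun r => exists z w, D z /\ D w /\ z <> w /\
    r = Rabs (f z - f w) / Rpower (norm (minus z w)) alpha)).

Definition Ck1 (D E : R -> Prop) (k : nat) (f : R -> R) : Prop :=
  continuous_on E f /\
  forall n, (n <= k)%nat ->
    (forall x, D x -> ex_derive_n f n x) /\ extends_to D E (Derive_n f n).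

Definition Cinf1 (D E : R -> Prop) (f : R -> R) : Prop :=
  forall k, Ck1 D E k f.

Definition Cka1 (D E : R -> Prop) (k : nat) (alpha : R) (f : R -> R) : Prop :=
  Ck1 D E k f /\
  (forall n, (n <= k)%nat -> bounded_on D (Derive_n f n)) /\
  holder_on (V := R_NormedModule) alpha D (Derive_n f k).

Definition Cka1_norm (D : R -> Prop) (k : nat) (alpha : R) (f : R -> R) : R :=
  sum_n (fun n => sup_norm D (Derive_n f n)) k
  + holder_seminorm (V := R_NormedModule) alpha D (Derive_n f k).

Definition dx (f : R * R -> R) (z : R * R) : R :=
  Derive (fun t => f (t, snd z)) (fst z).
Definition dy (f : R * R -> R) (z : R * R) : R :=
  Derive (fun t => f (fst z, t)) (snd z).
Definition dxy (i j : nat) (f : R * R -> R) : R * R -> R :=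
  Nat.iter i dx (Nat.iter j dy f).

(** All partial derivatives of order at most [k], in every order of
    differentiation. *)
Fixpoint Ck2_aux (D E : R * R -> Prop) (k : nat) (f : R * R -> R) : Prop :=
  extends_to D E f /\
  match k with
  | O => True
  | S k' =>
      (forall z, D z -> ex_derive (fun t => f (t, snd z)) (fst z) /\
                        ex_derive (fun t => f (fst z, t)) (snd z)) /\
      Ck2_aux D E k' (dx f) /\ Ck2_aux D E k' (dy f)
  end.

Definition Ck2 (D E : R * R -> Prop) (k : nat) (f : R * R -> R) : Prop :=
  continuous_on E f /\ Ck2_aux D E k f.

Definition Cka2 (D E : R * R -> Prop) (k : nat) (alpha : R) (f : R * R -> R) : Prop :=
  Ck2 D E k f /\
  (forall i j, (i + j <= k)%nat -> bounded_on D (dxy i j f)) /\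
  (forall i j, (i + j = k)%nat ->
     holder_on (V := prod_NormedModule _ R_NormedModule R_NormedModule)
       alpha D (dxy i j f)).

Definition Cka2_norm (D : R * R -> Prop) (k : nat) (alpha : R) (f : R * R -> R) : R :=
  sum_n (fun n => sum_n (fun i => sup_norm D (dxy i (n - i) f)) n) k
  + sum_n (fun i =>
      holder_seminorm (V := prod_NormedModule _ R_NormedModule R_NormedModule)
        alpha D (dxy i (k - i) f)) k.

(** [v] is the derivative of [f] at [x] relative to [I]: one-sided when [x] is
    an end point of the interval [I]. *)
Definition is_derive_within (I : R -> Prop) (f : R -> R) (x v : R) : Prop :=
  filterlim (fun t => (f t - f x) / (t - x)) (within I (locally' x)) (locally v).

Definition Ioo (a b : R) (x : R) : Prop := a < x < b.
Definition Icc (a b : R) (x : R) : Prop := a <= x <= b.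

Definition Omega (l : R) (z : R * R) : Prop := Ioo 0 l (fst z) /\ Ioo 0 PI (snd z).
Definition Omega_bar (l : R) (z : R * R) : Prop := Icc 0 l (fst z) /\ Icc 0 PI (snd z).
Definition strip (l : R) (z : R * R) : Prop := Ioo 0 l (fst z).
Definition strip_bar (l : R) (z : R * R) : Prop := Icc 0 l (fst z).
Definition line (y : R) : Prop := True.

Definition even_about_multiples_of_PI (f : R -> R) : Prop :=
  forall (j : Z) (y : R), f (IZR j * PI + y) = f (IZR j * PI - y).

(** At the multiples of [PI], [G] is determined by continuity. *)
Definition even_extension_Cka1 (k : nat) (alpha : R) (g : R -> R) : Prop :=
  exists G : R -> R,
    (forall y, Ioo 0 PI y -> G y = g y) /\
    even_about_multiples_of_PI G /\
    Cka1 line line k alpha G.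

Definition even_extension_Cka2 (l : R) (k : nat) (alpha : R) (h : R * R -> R) : Prop :=
  exists H : R * R -> R,
    (forall z, Omega_bar l z -> H z = h z) /\
    (forall x, Icc 0 l x -> even_about_multiples_of_PI (fun y => H (x, y))) /\
    Cka2 (strip l) (strip_bar l) k alpha H.

(** The constants of the gas, the parameter [lambda], the function [m_b] and
    the state at [x = 0]. *)
Record data := Data {
  gamma : R; kappa0 : R; c_nu : R;
  lambda : R; mb : R -> R;
  p_in : R; rho_in : R; u_in : R }.

(** [v_b = 0]; pressure and [E_b] are functions of density, velocity and
    entropy. *)
Record flow := Flow { rhob : R -> R; ub : R -> R; sb : R -> R }.

Definition Aent (G : data) (s : R) : R := kappa0 G * exp (s / c_nu G).

Section Background.
Context (G : data) (U : flow).

Definition Ab (x : R) : R := Aent G (sb U x).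
Definition pb (x : R) : R := Ab x * Rpower (rhob U x) (gamma G).
Definition cb (x : R) : R := sqrt (gamma G * pb x / rhob U x).
(** The speed is [ub], since [v_b = 0] and [0 < ub]. *)
Definition Mb (x : R) : R := ub U x / cb x.
Definition Eb (x : R) : R := / 2 * ub U x ^ 2 + cb x ^ 2 / (gamma G - 1).

Definition Io (L : Rbar) (x : R) : Prop := 0 < x /\ Rbar_lt x L.
Definition Ico (L : Rbar) (x : R) : Prop := 0 <= x /\ Rbar_lt x L.

Definition background_on (L : Rbar) : Prop :=
  (pb 0 = p_in G /\ rhob U 0 = rho_in G /\ ub U 0 = u_in G) /\
  (Cinf1 (Io L) (Ico L) (rhob U) /\ Cinf1 (Io L) (Ico L) (ub U) /\
   Cinf1 (Io L) (Ico L) (sb U)) /\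
  (forall x, Ico L x -> 0 < rhob U x /\ 0 < ub U x /\ 0 < Mb x < 1) /\
  (forall x, Io L x ->
     is_derive (fun t => rhob U t * ub U t) x (lambda G * rhob U x * mb G x) /\
     is_derive (fun t => rhob U t * ub U t ^ 2 + pb t) x 0 /\
     is_derive (fun t => rhob U t * Eb t * ub U t) x 0).
End Background.

Definition admissible (G : data) : Prop :=
  (1 < gamma G /\ 0 < kappa0 G /\ 0 < c_nu G) /\
  (Cinf1 (Io p_infty) (Ico p_infty) (mb G) /\ forall x, 0 <= x -> 0 < mb G x) /\
  (0 < p_in G /\ 0 < rho_in G /\ 0 < u_in G /\
   u_in G / sqrt (gamma G * p_in G / rho_in G) < 1).

Definition l_star (G : data) : Rbar :=
  Lub_Rbar (fun L : R => 0 < L /\ exists U : flow, background_on G U L).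

Record mat22 := Mat22 { m11 : R; m12 : R; m21 : R; m22 : R }.

Section Coefficients.
Context (G : data) (U : flow).

Local Notation g := (gamma G).
Local Notation la := (lambda G).
Local Notation m := (mb G).
Local Notation rho := (rhob U).
Local Notation u := (ub U).
Local Notation A := (Ab G U).
Local Notation p := (pb G U).
Local Notation c := (cb G U).
Local Notation M := (Mb G U).
Local Notation En := (Eb G U).
Local Notation dm := (Derive (mb G)).
Local Notation dp := (Derive (pb G U)).
Local Notation ddp := (Derive_n (pb G U) 2).

Definition a1 x := m x / u x * (1 / 2 - 1 / ((g - 1) * M x ^ 2)).
Definition a2 x := m x * En x * Rpower (rho x) (g - 1) / ((g - 1) * u x ^ 3).
Definition a3 x := m x * En x / (rho x * u x ^ 3).

Definition b1 x := g * m x * A x / u x ^ 3 * (1 + (g - 1) / 2 * M x ^ 2).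
Definition b2 x :=
  m x / u x * (g + 1 / 2 - (g - 1) ^ 2 / 2 * M x ^ 2 + 1 / ((g - 1) * M x ^ 2)).
Definition b3 x :=
  g * m x * A x / (u x ^ 3 * rho x)
  * (1 + (g - 1) / 2 * M x ^ 2 + (g - 1) ^ 2 / 2 * M x ^ 4).

Definition c1 x := (1 - M x ^ 2) / (rho x * u x).
Definition c2 x :=
  - (la * m x / (2 * rho x * c x ^ 2))
  * (((g - 1) ^ 2 * M x ^ 8 + (g - 1) * M x ^ 6
      + (5 * g ^ 2 - 12 * g + 10) * M x ^ 4 + (7 * g - 11) * M x ^ 2 + 2)
     / (M x ^ 2 * (1 - M x ^ 2))).
Definition c3 x :=
  la * m x / (2 * u x ^ 2)
  * ((3 * (g - 1) * M x ^ 4 + (g + 3) * M x ^ 2 + 2) / (1 - M x ^ 2)).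
Definition c4 x :=
  - (la * m x * Rpower (rho x) (g - 1) / (2 * c x ^ 2))
  * (((g - 1) * M x ^ 8 + (g - 1) * M x ^ 6
      + (2 * g - 6) * M x ^ 4 + (g + 5) * M x ^ 2 + 2)
     / (M x ^ 2 * (1 - M x ^ 2))).

Definition d1 x :=
  - (2 * u x ^ 2 / p x) * (1 + 1 / (g * M x ^ 4)) * dp x
  + la * m x * c x ^ 2 / u x
    * ((g - 1) ^ 2 / 2 * M x ^ 4 + (g - 1) / 2 * M x ^ 2 - 1).
Definition d2 x :=
  u x ^ 2 / p x * (1 + 1 / (g * M x ^ 4)) * dp x ^ 2
  - la * g * u x * (1 + (g - 1) / 2 * M x ^ 2) * dm x
  + g * la ^ 2 * m x ^ 2 * ((g - 1) ^ 2 / 4 * (u x ^ 4 / c x ^ 4) - 1).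
Definition d3 x :=
  2 * ddp x - 2 / p x * (1 - 1 / (g * M x ^ 4)) * dp x ^ 2
  - la * (g - 1) * rho x * u x * dm x.
Definition d4 x :=
  la * m x * ((3 * (g - 1) ^ 2 + 2) * M x ^ 2 + (g - 1)) / 2 * dp x
  - g * p x * (la * (g - 1) * M x ^ 2 + 2 * la) / 2 * dm x
  + g * la ^ 2 * (g - 1) ^ 2 * m x ^ 2 * u x ^ 3 * p x / c x ^ 4.
Definition d5 x :=
  - ((g + 1) / (g - 1)) * ddp x
  + 2 / ((g - 1) * p x) * (1 - (1 + (g - 1) * M x ^ 2) / (g * M x ^ 4)) * dp x ^ 2
  + la * m x / u x * dp x * (1 - (g - 1) ^ 2 * M x ^ 4 / 2)
  + la * rho x * u x * (1 + (g - 1) / 2 * M x ^ 2) * dm x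
  - g * la ^ 2 * (g - 1) ^ 2 * m x ^ 2 * u x ^ 4 * p x / (2 * c x ^ 6).
Definition d6 x := la * g * m x * p x * c1 x / PI.
Definition d7 x := la * g * m x * p x * c2 x / PI.
Definition d8 x := la * g * m x * p x * c3 x / PI.
Definition d9 x := la * g * m x * p x * c4 x / PI.

Definition e1 x := M x ^ 2 - 1.
Definition e2 x := d1 x / c x ^ 2.
Definition e3 x :=
  d2 x / c x ^ 2 + ((g - 1) * d5 x - d4 x / u x) / (rho x * c x ^ 2).
Definition e4 x := d3 x / c x ^ 2 + d4 x / (u x * c x ^ 2).
Definition e5 x :=
  Rpower (rho x) (g - 1) / ((g - 1) * c x ^ 2) * ((g - 1) * d5 x - d4 x / u x).
Definition e6 x := d6 x / c x ^ 2.
Definition e7 x := d7 x / c x ^ 2.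
Definition e8 x := d8 x / c x ^ 2.
Definition e9 x := d9 x / c x ^ 2.

Definition gamma0 : R :=
  - (g * m 0 * u 0 / c 0 ^ 2)
  * (((g ^ 2 + 1) / (2 * g) * M 0 ^ 4 + (g ^ 2 + 3) / (2 * g) * M 0 ^ 2
      + (3 * g - 1) / (2 * g))
     / (M 0 ^ 2 - 1) ^ 2).

(** Together with continuity up to [0], the equation on the open interval
    determines [Phi] on [[0, L)]. *)
Definition is_fundamental_matrix (L : Rbar) (Phi : R -> mat22) : Prop :=
  Phi 0 = Mat22 1 0 0 1 /\
  (continuous_on (Ico L) (fun x => m11 (Phi x)) /\
   continuous_on (Ico L) (fun x => m12 (Phi x)) /\
   continuous_on (Ico L) (fun x => m21 (Phi x)) /\
   continuous_on (Ico L) (fun x => m22 (Phi x))) /\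
  forall x, Io L x ->
    is_derive (fun t => m11 (Phi t)) x (la * (a1 x * m11 (Phi x) + a2 x * m21 (Phi x))) /\
    is_derive (fun t => m12 (Phi t)) x (la * (a1 x * m12 (Phi x) + a2 x * m22 (Phi x))) /\
    is_derive (fun t => m21 (Phi t)) x (la * (b1 x * m11 (Phi x) + b2 x * m21 (Phi x))) /\
    is_derive (fun t => m22 (Phi t)) x (la * (b1 x * m12 (Phi x) + b2 x * m22 (Phi x))).

Context (Phi : R -> mat22).

Definition det22 (P : mat22) : R := m11 P * m22 P - m12 P * m21 P.

(** [(a4, b4)] is the inverse of [Phi x] (adjugate over determinant) applied to
    the column [(a3, b3)]. *)
Definition a4 x := (m22 (Phi x) * a3 x - m12 (Phi x) * b3 x) / det22 (Phi x).
Definition b4 x := (m11 (Phi x) * b3 x - m21 (Phi x) * a3 x) / det22 (Phi x).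

Definition e10 x := e4 x * m11 (Phi x) + e5 x * m21 (Phi x).
Definition e11 x := e4 x * m12 (Phi x) + e5 x * m22 (Phi x).
Definition e12 x := e8 x * m11 (Phi x) + e9 x * m21 (Phi x).
Definition e13 x := e8 x * m12 (Phi x) + e9 x * m22 (Phi x).

(** The equations for the modes come from [q(x, y) = sum_n q_n(x) cos(n y)]:
    the terms averaged over [y] only see [n = 0], with a factor [PI]. *)
Definition mode_bc (l : R) (q : R -> R) : Prop :=
  (exists d, is_derive_within (Icc 0 l) q 0 d /\ d + la * gamma0 * q 0 = 0) /\
  q l = 0.

Definition mode0_eq (q : R -> R) (x : R) : Prop :=
  e1 x * Derive_n q 2 x + (la * e2 x + PI * e6 x) * Derive q x
  + (e3 x + PI * e7 x) * q x
  + la * (e10 x + PI * e12 x) * RInt (fun t => a4 t * q t) 0 x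
  + la * (e11 x + PI * e13 x) * RInt (fun t => b4 t * q t) 0 x = 0.

Definition mode_eq (n : nat) (q : R -> R) (x : R) : Prop :=
  e1 x * Derive_n q 2 x + la * e2 x * Derive q x
  + (e3 x + INR n ^ 2) * q x
  + la * e10 x * RInt (fun t => a4 t * q t) 0 x
  + la * e11 x * RInt (fun t => b4 t * q t) 0 x = 0.

Definition S_condition (l : R) : Prop :=
  forall (n : nat) (q : R -> R),
    Ck1 (Ioo 0 l) (Icc 0 l) 2 q ->
    mode_bc l q ->
    (forall x, Ioo 0 l x ->
       match n with O => mode0_eq q x | S _ => mode_eq n q x end) ->
    forall x, Icc 0 l x -> q x = 0.

Definition L1op (q : R * R -> R) (z : R * R) : R :=
  let (x, y) := z in
  e1 x * dx (dx q) (x, y) - dy (dy q) (x, y) + la * e2 x * dx q (x, y)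
  + e3 x * q (x, y)
  + e6 x * RInt (fun y' => dx q (x, y')) 0 PI
  + e7 x * RInt (fun y' => q (x, y')) 0 PI
  + la * e10 x * RInt (fun t => a4 t * q (t, y)) 0 x
  + la * e11 x * RInt (fun t => b4 t * q (t, y)) 0 x
  + la * e12 x * RInt (fun y' => RInt (fun t => a4 t * q (t, y')) 0 x) 0 PI
  + la * e13 x * RInt (fun y' => RInt (fun t => b4 t * q (t, y')) 0 x) 0 PI.

Definition solves (l : R) (h : R * R -> R) (g0 gl : R -> R) (q : R * R -> R) : Prop :=
  (forall z, Omega l z -> L1op q z = h z) /\
  (forall x, Ioo 0 l x ->
     is_derive_within (Icc 0 PI) (fun t => q (x, t)) 0 0 /\
     is_derive_within (Icc 0 PI) (fun t => q (x, t)) PI 0) /\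
  (forall y, Ioo 0 PI y ->
     exists d, is_derive_within (Icc 0 l) (fun t => q (t, y)) 0 d /\
               d + la * gamma0 * q (0, y) = g0 y) /\
  (forall y, Ioo 0 PI y -> q (l, y) = gl y).
End Coefficients.

(* Main.v *)
(** Even reflection in [y] turns the problem into a family of nonlocal two-point problems
    for the cosine modes [v_n(x)].  The S-condition is uniqueness for each of them, hence
    solvability by shooting; for large [n] the maximum principle, applied with the weight
    [1 + exp (- n d x)], bounds [v_n] by [|f| / n ^ 2 + |g_0| / n + |g_l|] uniformly in [n].
    Hölder spaces in [y] are described by dyadic de la Vallée-Poussin blocks of the cosine series:
    the inequalities of Jackson and Bernstein relate the decay of the blocks to derivatives.
    The solution operators vary slowly with [n], because
    [S_n - S_m = (m ^ 2 - n ^ 2) R_n S_m] with [R_n] the resolvent of mode [n], so double summation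
    by parts shows that they act on a whole block as on a single mode.  Summing the blocks gives the
    solution with its [y]-derivatives; the remaining [x]-derivatives come from the equation.
    Conversely the modes of any solution solve the mode problems, which gives uniqueness. *)

(* Membership in a Hölder class is not visible in the size of single Fourier coefficients: bounding
   each mode and adding up would lose a power of the frequency. The unit of estimation is therefore
   the supremum of a whole dyadic block, and the solution operators have to be handled as an
   operator-valued multiplier. The scaling that makes this close is that on a block of frequency
   [N = 2 ^ j] one derivative in [x] costs the same factor [N] as one in [y]; both Hölder moduli
   then follow from one summation lemma, [dyadic_holder]. The multiplier argument speaks of cosine
   polynomials, so odd orders of differentiation are reached by interpolation; evenness of the data
   enters through the vanishing of their odd [y]-derivatives at [0] and [PI]. The averaged terms of
   the operator act on mode [0] alone. That mode has its own coefficients, is solved separately, and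
   is absent from every block. All constants have to be fixed before the data are given, and the
   background is smooth only relative to [[0, l_star)], so the coefficients are first replaced by
   continuous functions on the whole line. *)
Require Import Defs.
From Stdlib Require Import Lra Lia Psatz ClassicalEpsilon.

(** * Continuous functions, integrals and partial sums *)

(** [ring] and [field] do not recognise [R] as the carrier of [R_CompleteNormedModule]. *)
Ltac fold_R :=
  repeat match goal with
  | |- context [@RInt ?V ?f ?a ?b] =>
      pattern (@RInt V f a b);
      match goal with |- ?P _ =>
        cut (forall x : R, P x); [let H := fresh in intros H; exact (H _) | intro; cbv beta] end
  end; match goal with |- @eq _ ?a ?b => change (@eq R a b) end.

(** Functions given on an interval are represented by total functions continuous on all of [R],
    usually by composing with [clamp]; integrals, primitives and parameter integrals then have no
    side conditions. *)
Definition cont (f : R -> R) : Prop := forall x : R, continuous f x.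

Lemma cont_const (c : R) : cont (fun _ => c).
Proof. intros x; apply continuous_const. Qed.
Lemma cont_id : cont (fun x => x).
Proof. intros x; apply continuous_id. Qed.
Lemma cont_plus (f g : R -> R) : cont f -> cont g -> cont (fun x => f x + g x).
Proof. intros Hf Hg x; apply (continuous_plus f g x (Hf x) (Hg x)). Qed.
Lemma cont_opp (f : R -> R) : cont f -> cont (fun x => - f x).
Proof. intros Hf x; apply (continuous_opp f x (Hf x)). Qed.
Lemma cont_minus (f g : R -> R) : cont f -> cont g -> cont (fun x => f x - g x).
Proof. intros Hf Hg x; apply (continuous_minus f g x (Hf x) (Hg x)). Qed.
Lemma cont_mult (f g : R -> R) : cont f -> cont g -> cont (fun x => f x * g x).
Proof. intros Hf Hg x; apply (continuous_mult f g x (Hf x) (Hg x)). Qed.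
Lemma cont_comp (f g : R -> R) : cont f -> cont g -> cont (fun x => g (f x)).
Proof. intros Hf Hg x; apply (continuous_comp f g x (Hf x) (Hg _)). Qed.
Lemma cont_pt (f : R -> R) : (forall x, continuity_pt f x) -> cont f.
Proof. intros H x; apply continuity_pt_filterlim, H. Qed.
Lemma pt_cont (f : R -> R) : cont f -> forall x, continuity_pt f x.
Proof. intros H x; apply continuity_pt_filterlim, H. Qed.
Lemma cont_derive (f df : R -> R) : (forall x, is_derive f x (df x)) -> cont f.
Proof.
  intros H x; apply (ex_derive_continuous (V := R_NormedModule)); exists (df x); apply H.
Qed.
Lemma cont_cos : cont cos.
Proof. apply cont_pt, continuity_cos. Qed.
Lemma cont_sin : cont sin.
Proof. apply cont_pt, continuity_sin. Qed.
Lemma cont_abs (f : R -> R) : cont f -> cont (fun x => Rabs (f x)).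
Proof.
  intros Hf; apply (cont_comp f Rabs Hf). apply cont_pt, Rcontinuity_abs.
Qed.
Lemma cont_ext (f g : R -> R) : (forall x, f x = g x) -> cont f -> cont g.
Proof. intros H Hf x; apply (continuous_ext f g x H (Hf x)). Qed.

Lemma cont_cosl (a c : R) : cont (fun y => cos (a * y + c)).
Proof.
  apply (cont_comp (fun y => a * y + c) cos); [|apply cont_cos].
  apply cont_plus; [apply cont_mult|]; try apply cont_const; apply cont_id.
Qed.

#[export] Hint Resolve cont_const cont_id cont_plus cont_opp cont_minus cont_mult
  cont_cosl cont_abs : cont.

Lemma ex_RInt_cont (f : R -> R) (a b : R) : cont f -> ex_RInt f a b.
Proof.
  intros Hf. apply (ex_RInt_continuous (V := R_CompleteNormedModule)). intros z _; apply Hf.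
Qed.

Lemma RInt_cplus (f g : R -> R) (a b : R) : cont f -> cont g ->
  RInt (fun x => f x + g x) a b = RInt f a b + RInt g a b.
Proof. intros Hf Hg. apply (RInt_plus (V := R_CompleteNormedModule) f g); now apply ex_RInt_cont. Qed.
Lemma RInt_cminus (f g : R -> R) (a b : R) : cont f -> cont g ->
  RInt (fun x => f x - g x) a b = RInt f a b - RInt g a b.
Proof. intros Hf Hg. apply (RInt_minus (V := R_CompleteNormedModule) f g); now apply ex_RInt_cont. Qed.
Lemma RInt_cscal (f : R -> R) (k a b : R) : cont f ->
  RInt (fun x => k * f x) a b = k * RInt f a b.
Proof. intros Hf. apply (RInt_scal (V := R_CompleteNormedModule) f); now apply ex_RInt_cont. Qed.
Lemma RInt_cst (k a b : R) : RInt (fun _ => k) a b = (b - a) * k.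
Proof. rewrite RInt_const. reflexivity. Qed.
Lemma RInt_eq (f g : R -> R) (a b : R) : (forall x, f x = g x) -> RInt f a b = RInt g a b.
Proof. intros H; apply RInt_ext; intros; apply H. Qed.
Lemma RInt_eq_open (f g : R -> R) (a b : R) : a <= b -> (forall x, a < x < b -> f x = g x) ->
  RInt f a b = RInt g a b.
Proof.
  intros H H1; apply RInt_ext; intros x; rewrite Rmin_left, Rmax_right by easy; apply H1.
Qed.
Lemma RInt_mono (f g : R -> R) (a b : R) : a <= b -> cont f -> cont g ->
  (forall x, a <= x <= b -> f x <= g x) -> RInt f a b <= RInt g a b.
Proof.
  intros H Hf Hg Hx; apply RInt_le; try now apply ex_RInt_cont. easy. intros x X; apply Hx; lra.
Qed.
Lemma RInt_abs_le (f g : R -> R) (a b : R) : a <= b -> cont f -> cont g ->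
  (forall x, a <= x <= b -> Rabs (f x) <= g x) -> Rabs (RInt f a b) <= RInt g a b.
Proof.
  intros H Hf Hg Hx. eapply Rle_trans. apply abs_RInt_le; [easy|now apply ex_RInt_cont].
  apply RInt_mono; auto with cont.
Qed.
Lemma RInt_abs_cst (f : R -> R) (a b M : R) : a <= b -> cont f ->
  (forall x, a <= x <= b -> Rabs (f x) <= M) -> Rabs (RInt f a b) <= (b - a) * M.
Proof. intros; apply abs_RInt_le_const; auto. now apply ex_RInt_cont. Qed.
Lemma RInt_nil (f : R -> R) (a : R) : RInt f a a = 0.
Proof. apply (RInt_point (V := R_CompleteNormedModule)). Qed.
Lemma RInt_chasles (f : R -> R) (a b c : R) : cont f -> RInt f a b + RInt f b c = RInt f a c.
Proof.
  intros Hf. apply (RInt_Chasles (V := R_CompleteNormedModule) f); now apply ex_RInt_cont.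
Qed.
Lemma derive_RInt (f : R -> R) (a x : R) : cont f -> is_derive (fun x => RInt f a x) x (f x).
Proof.
  intros Hf. apply (is_derive_RInt (V := R_CompleteNormedModule) f _ a x); [|apply Hf].
  exists (mkposreal 1 Rlt_0_1). intros y _. apply (RInt_correct (V := R_CompleteNormedModule)). now apply ex_RInt_cont.
Qed.
Lemma cont_RInt (f : R -> R) (a : R) : cont f -> cont (fun x => RInt f a x).
Proof. intros Hf. apply (cont_derive _ f). intros; now apply derive_RInt. Qed.
Lemma RInt_ftc (f df : R -> R) (a b : R) : (forall x, is_derive f x (df x)) -> cont df ->
  RInt df a b = f b - f a.
Proof.
  intros H Hc. apply (is_RInt_unique (V := R_CompleteNormedModule)).
  apply (is_RInt_derive (V := R_CompleteNormedModule) f df); intros; [apply H|apply Hc].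
Qed.
#[export] Hint Resolve cont_RInt : cont.

(** The projection onto [[a, b]]. It does not increase distances, so composing with it extends a
    function from the interval to the line without changing its modulus of continuity. *)
Definition clamp (a b x : R) : R := Rmax a (Rmin b x).
Lemma clamp_in a b x : a <= b -> a <= clamp a b x <= b.
Proof. intros H; unfold clamp, Rmax, Rmin; repeat destruct Rle_dec; lra. Qed.
Lemma clamp_id a b x : a <= x <= b -> clamp a b x = x.
Proof. intros H; unfold clamp, Rmax, Rmin; repeat destruct Rle_dec; lra. Qed.
Lemma clamp_lip a b x y : Rabs (clamp a b x - clamp a b y) <= Rabs (x - y).
Proof.
  unfold clamp, Rmax, Rmin; repeat destruct Rle_dec; unfold Rabs; repeat destruct Rcase_abs; lra.
Qed.
Lemma cont_clamp a b : cont (clamp a b).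
Proof.
  apply cont_pt. intros x eps He. exists eps. split; [easy|].
  intros y [_ Hy]. simpl in *; unfold Rdist in *. eapply Rle_lt_trans; [apply clamp_lip|easy].
Qed.

Lemma derive_cst (k x : R) : is_derive (fun _ : R => k) x 0.
Proof. apply (is_derive_const (K := R_AbsRing) (V := R_NormedModule) k x). Qed.

Lemma mvt (f df : R -> R) (a b : R) : (forall x, Rmin a b <= x <= Rmax a b -> is_derive f x (df x)) ->
  exists c, Rmin a b <= c <= Rmax a b /\ f b - f a = df c * (b - a).
Proof.
  intros H. apply (MVT_gen f a b df).
  - intros x Hx. apply H; lra.
  - intros x Hx. apply continuity_pt_filterlim. apply (ex_derive_continuous (V := R_NormedModule)).
    exists (df x); now apply H.
Qed.

Lemma mvt_le (f df : R -> R) (lo hi a b K : R) : lo <= a <= hi -> lo <= b <= hi ->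
  (forall x, lo <= x <= hi -> is_derive f x (df x)) ->
  (forall x, lo <= x <= hi -> Rabs (df x) <= K) -> Rabs (f b - f a) <= K * Rabs (b - a).
Proof.
  intros Ha Hb H1 H2. destruct (mvt f df a b) as [c [Hc E]].
  - intros x Hx. apply H1. revert Hx; unfold Rmin, Rmax; destruct Rle_dec; lra.
  - rewrite E, Rabs_mult. apply Rmult_le_compat_r; [apply Rabs_pos|]. apply H2.
    revert Hc; unfold Rmin, Rmax; destruct Rle_dec; lra.
Qed.

(** * Partial sums and geometrically convergent series *)

Fixpoint psum (f : nat -> R) (n : nat) : R :=
  match n with O => 0 | S n => psum f n + f n end.

Lemma psum_ext f g n : (forall i, (i < n)%nat -> f i = g i) -> psum f n = psum g n.
Proof. induction n; simpl; intros H; [easy|]. rewrite IHn, H; auto. Qed.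
Lemma psum_plus f g n : psum (fun i => f i + g i) n = psum f n + psum g n.
Proof. induction n; simpl; [lra|]. rewrite IHn; lra. Qed.
Lemma psum_minus f g n : psum (fun i => f i - g i) n = psum f n - psum g n.
Proof. induction n; simpl; [lra|]. rewrite IHn; lra. Qed.
Lemma psum_scal k f n : psum (fun i => k * f i) n = k * psum f n.
Proof. induction n; simpl; [lra|]. rewrite IHn; lra. Qed.
Lemma psum_le f g n : (forall i, (i < n)%nat -> f i <= g i) -> psum f n <= psum g n.
Proof. induction n; simpl; intros H; [lra|]. apply Rplus_le_compat; auto. Qed.
Lemma psum_abs f n : Rabs (psum f n) <= psum (fun i => Rabs (f i)) n.
Proof.
  induction n; simpl; [rewrite Rabs_R0; lra|].
  eapply Rle_trans; [apply Rabs_triang|lra].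
Qed.
Lemma psum_const c n : psum (fun _ => c) n = INR n * c.
Proof. induction n; [simpl; lra|]. rewrite S_INR. simpl psum. rewrite IHn; lra. Qed.
Lemma psum_zero f n : (forall i, (i < n)%nat -> f i = 0) -> psum f n = 0.
Proof. induction n; simpl; intros H; [easy|]. rewrite IHn, H; auto; lra. Qed.
Lemma psum_tail f n m : (n <= m)%nat -> (forall i, (n <= i)%nat -> f i = 0) -> psum f m = psum f n.
Proof. intros H H1. induction H; [easy|]. simpl. rewrite IHle, H1; [lra|easy]. Qed.
Lemma psum_S f n : psum f (S n) = psum f n + f n.
Proof. easy. Qed.
Lemma psum_shift f n : psum f (S n) = f 0%nat + psum (fun i => f (S i)) n.
Proof. induction n; [simpl; lra|]. rewrite psum_S, IHn; simpl; lra. Qed.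
Lemma psum_cont (f : nat -> R -> R) n : (forall i, cont (f i)) -> cont (fun x => psum (fun i => f i x) n).
Proof. intros H. induction n; simpl; auto with cont. Qed.
#[export] Hint Resolve psum_cont : cont.
Lemma psum_RInt (f : nat -> R -> R) n a b : (forall i, cont (f i)) ->
  RInt (fun x => psum (fun i => f i x) n) a b = psum (fun i => RInt (f i) a b) n.
Proof.
  intros H. induction n; simpl; [rewrite RInt_cst; lra|].
  rewrite RInt_cplus; auto with cont. now rewrite IHn.
Qed.
Lemma psum_derive (f df : nat -> R -> R) n x : (forall i, is_derive (f i) x (df i x)) ->
  is_derive (fun x => psum (fun i => f i x) n) x (psum (fun i => df i x) n).
Proof.
  intros H. induction n; simpl.
  - apply (is_derive_const (K := R_AbsRing) (V := R_NormedModule) 0 x).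
  - apply (is_derive_plus (K := R_AbsRing) (V := R_NormedModule) (fun x => psum (fun i => f i x) n) (f n) x); auto.
Qed.

(** Double summation by parts; [L m n = phi m * c n] gives the usual form. *)
Lemma abel (L : nat -> nat -> R) (M : nat) : (forall m, L m 0%nat = 0) -> (forall m, L m 1%nat = 0) ->
  psum (fun i => L (S i) (S (S i)) - 2 * L (S i) (S i) + L (S i) i) M =
  psum (fun i => L (S (S i)) (S i) - 2 * L (S i) (S i) + L i (S i)) M
   + L M (S M) - L (S M) M + (L 1%nat 0%nat - L 0%nat 1%nat).
Proof.
  intros H0 H1. induction M; simpl; [rewrite !H0, !H1; lra|].
  rewrite IHM; lra.
Qed.

(** [Lim_seq] is total, so no proof of convergence is carried along; the value is meaningful under a
    geometric bound on the terms, see [ssum_tail]. *)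
Definition dsum (b : nat -> R) : R := real (Lim_seq (psum b)).

Lemma psum_geom r n : r <> 1 -> psum (fun i => r ^ i) n = (1 - r ^ n) / (1 - r).
Proof.
  intros H. induction n; simpl; [field; lra|]. rewrite IHn; field; lra.
Qed.

Lemma psum_split f n m : psum f (n + m) = psum f n + psum (fun i => f (n + i)%nat) m.
Proof.
  induction m; simpl; [rewrite Nat.add_0_r; lra|]. rewrite Nat.add_succ_r; simpl. rewrite IHm; lra.
Qed.

Lemma psum_geom_tail (b : nat -> R) (E r : R) n m : 0 <= r < 1 -> 0 <= E ->
  (forall j, Rabs (b j) <= E * r ^ j) ->
  Rabs (psum b (n + m) - psum b n) <= E * r ^ n / (1 - r).
Proof.
  intros Hr HE Hb. rewrite psum_split.
  replace (_ + _ - _) with (psum (fun i => b (n + i)%nat) m) by lra.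
  eapply Rle_trans; [apply psum_abs|].
  eapply Rle_trans. apply (psum_le _ (fun i => (E * r ^ n) * r ^ i)).
  { intros i _. rewrite Rmult_assoc, <- pow_add. apply Hb. }
  rewrite psum_scal, psum_geom by lra. unfold Rdiv. rewrite <- Rmult_assoc.
  apply Rmult_le_compat_r; [left; apply Rinv_0_lt_compat; lra|].
  rewrite <- (Rmult_1_r (E * r ^ n)) at 2. apply Rmult_le_compat_l.
  - apply Rmult_le_pos; [easy|apply pow_le; lra].
  - assert (0 <= r ^ m) by (apply pow_le; lra). lra.
Qed.

Lemma pow_small r eps : 0 <= r < 1 -> 0 < eps -> exists N, forall n, (N <= n)%nat -> r ^ n < eps.
Proof.
  intros Hr He. destruct (pow_lt_1_zero r) with (y := eps) as [N HN]; [rewrite Rabs_pos_eq; lra|lra|].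
  exists N. intros n Hn. specialize (HN n Hn). now rewrite Rabs_pos_eq in HN by (apply pow_le; lra).
Qed.

Lemma ssum_tail (b : nat -> R) (E r : R) n : 0 <= r < 1 -> 0 <= E ->
  (forall j, Rabs (b j) <= E * r ^ j) -> Rabs (dsum b - psum b n) <= E * r ^ n / (1 - r).
Proof.
  intros Hr HE Hb.
  assert (Hex : ex_finite_lim_seq (psum b)).
  { apply ex_lim_seq_cauchy_corr. intros eps.
    (* [E + 1] instead of [E] keeps the quotient defined when [E = 0]. *)
    assert (0 < eps * (1 - r) / (2 * (E + 1))) as H0.
    { apply Rdiv_lt_0_compat; [apply Rmult_lt_0_compat; [apply eps|lra]|lra]. }
    destruct (pow_small r _ Hr H0) as [N HN]. exists N.
    assert (forall n, (N <= n)%nat -> Rabs (psum b n - psum b N) < eps / 2) as H.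
    { intros k Hk. replace k with (N + (k - N))%nat by lia.
      eapply Rle_lt_trans; [apply psum_geom_tail with (E := E) (r := r); auto|].
      specialize (HN N (Nat.le_refl _)).
      apply (Rmult_lt_reg_r (1 - r)); [lra|].
      replace (E * r ^ N / (1 - r) * (1 - r)) with (E * r ^ N) by (field; lra).
      apply Rle_lt_trans with ((E + 1) * r ^ N).
      apply Rmult_le_compat_r; [apply pow_le|]; lra.
      replace (eps / 2 * (1 - r)) with ((E + 1) * (eps * (1 - r) / (2 * (E + 1)))) by (field; lra).
      apply Rmult_lt_compat_l; lra. }
    intros n0 m0 Hn Hm. specialize (H _ Hn) as Ha. specialize (H _ Hm) as Hb'.
    replace (psum b n0 - psum b m0) with ((psum b n0 - psum b N) - (psum b m0 - psum b N)) by lra.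
    unfold Rminus at 1. eapply Rle_lt_trans; [apply Rabs_triang|]. rewrite Rabs_Ropp. lra. }
  apply Lim_seq_correct' in Hex. fold (dsum b) in Hex.
  apply le_epsilon. intros eps Heps.
  apply is_lim_seq_spec in Hex. destruct (Hex (mkposreal eps Heps)) as [N HN].
  specialize (HN (n + N)%nat ltac:(lia)). simpl in HN.
  replace (dsum b - psum b n) with (- (psum b (n + N) - dsum b) + (psum b (n + N) - psum b n)) by lra.
  eapply Rle_trans; [apply Rabs_triang|]. rewrite Rabs_Ropp.
  pose proof (psum_geom_tail b E r n N Hr HE Hb). lra.
Qed.

Lemma ssum_bound (b : nat -> R) (E r : R) : 0 <= r < 1 -> 0 <= E ->
  (forall j, Rabs (b j) <= E * r ^ j) -> Rabs (dsum b) <= E / (1 - r).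
Proof.
  intros Hr HE Hb. pose proof (ssum_tail b E r 0 Hr HE Hb) as H. simpl in H.
  now rewrite Rminus_0_r, Rmult_1_r in H.
Qed.

(** Identities between sums of series are obtained by exhibiting both sides as limits of the same
    partial sums at a geometric rate; [eq_of_small] is the case of a constant sequence. *)
Lemma lim_unique_geom (s : nat -> R) (x y E r : R) : 0 <= r < 1 ->
  (forall n, Rabs (s n - x) <= E * r ^ n) -> (forall n, Rabs (s n - y) <= E * r ^ n) -> x = y.
Proof.
  intros Hr H1 H2. destruct (Req_dec x y) as [|Hn]; [easy|exfalso].
  assert (0 < Rabs (x - y)) by (apply Rabs_pos_lt; lra).
  assert (0 <= E). { specialize (H1 0%nat); simpl in H1. pose proof (Rabs_pos (s 0%nat - x)); lra. }
  destruct (pow_small r (Rabs (x - y) / (2 * E + 1)) Hr) as [N HN].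
  { apply Rdiv_lt_0_compat; lra. }
  specialize (HN N (Nat.le_refl _)). specialize (H1 N). specialize (H2 N).
  assert (Rabs (x - y) <= 2 * E * r ^ N).
  { replace (x - y) with (- (s N - x) + (s N - y)) by lra.
    eapply Rle_trans; [apply Rabs_triang|]. rewrite Rabs_Ropp. lra. }
  apply (Rmult_lt_compat_r (2 * E + 1)) in HN; [|lra].
  unfold Rdiv in HN. rewrite Rmult_assoc, Rinv_l in HN by lra.
  assert (0 <= r ^ N) by (apply pow_le; lra). lra.
Qed.

Lemma eq_of_small (x y C r : R) : 0 <= r < 1 -> (forall n, Rabs (x - y) <= C * r ^ n) -> x = y.
Proof.
  intros Hr H. apply (lim_unique_geom (fun _ => x) x y C r Hr); [|easy].
  intros n. replace (x - x) with 0 by lra. rewrite Rabs_R0. specialize (H n). pose proof (Rabs_pos (x - y)); lra.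
Qed.

(** Termwise differentiation: the mean value theorem bounds the increments of [F J - F N] by the
    difference of their derivatives, and letting [N] grow bounds those of [F J - f]. *)
Lemma derive_lim (F dF : nat -> R -> R) (f g : R -> R) (a b x E r : R) : 0 <= r < 1 -> a < x < b ->
  (forall J t, a < t < b -> is_derive (F J) t (dF J t)) ->
  (forall J t, a < t < b -> Rabs (F J t - f t) <= E * r ^ J) ->
  (forall J t, a < t < b -> Rabs (dF J t - g t) <= E * r ^ J) ->
  is_derive f x (g x).
Proof.
  intros Hr Hx HF H0 H1.
  assert (HE : 0 <= E). { specialize (H0 0%nat x Hx); simpl in H0. pose proof (Rabs_pos (F 0%nat x - f x)); lra. }
  assert (Hlim : forall J t, a < t < b -> Rabs ((F J t - f t) - (F J x - f x)) <= 2 * E * r ^ J * Rabs (t - x)).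
  { intros J t Ht. apply le_epsilon. intros eps Heps.
    (* The index [N] may depend on [t] and [eps]: it serves to pass to the limit and disappears from
       the bound. *)
    destruct (pow_small r (eps / (4 * E + 1 + E * Rabs (t - x))) Hr) as [N HN].
    { apply Rdiv_lt_0_compat; [easy|]. pose proof (Rmult_le_pos _ _ HE (Rabs_pos (t - x))). lra. }
    specialize (HN N (Nat.le_refl _)).
    assert (HM : Rabs ((F J t - F N t) - (F J x - F N x)) <= (E * r ^ J + E * r ^ N) * Rabs (t - x)).
    { apply (mvt_le (fun t => F J t - F N t) (fun t => dF J t - dF N t) (Rmin t x) (Rmax t x)).
      - unfold Rmin, Rmax; destruct Rle_dec; lra.
      - unfold Rmin, Rmax; destruct Rle_dec; lra.
      - intros z Hz. apply (is_derive_minus (K := R_AbsRing) (V := R_NormedModule) (F J) (F N));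
        apply HF; revert Hz; unfold Rmin, Rmax; destruct Rle_dec; lra.
      - intros z Hz. assert (a < z < b) as Hz' by (revert Hz; unfold Rmin, Rmax; destruct Rle_dec; lra).
        replace (dF J z - dF N z) with ((dF J z - g z) + - (dF N z - g z)) by lra.
        eapply Rle_trans; [apply Rabs_triang|]. rewrite Rabs_Ropp.
        apply Rplus_le_compat; now apply H1. }
    replace (F J t - f t - (F J x - f x)) with
      ((F J t - F N t - (F J x - F N x)) + ((F N t - f t) + - (F N x - f x))) by lra.
    eapply Rle_trans; [apply Rabs_triang|].
    assert (Rabs ((F N t - f t) + - (F N x - f x)) <= 2 * E * r ^ N).
    { eapply Rle_trans; [apply Rabs_triang|]. rewrite Rabs_Ropp.
      pose proof (H0 N t Ht). pose proof (H0 N x Hx). lra. }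
    set (D := Rabs (t - x)) in *. assert (0 <= D) by apply Rabs_pos.
    assert (0 <= E * D) by now apply Rmult_le_pos.
    apply (Rmult_lt_compat_r (4 * E + 1 + E * D)) in HN; [|lra].
    unfold Rdiv in HN. rewrite Rmult_assoc, Rinv_l in HN by lra.
    assert (0 <= r ^ N) by (apply pow_le; lra). assert (0 <= r ^ J) by (apply pow_le; lra).
    assert (0 <= E * r ^ J * D) by (repeat apply Rmult_le_pos; easy).
    assert (0 <= E * r ^ N) by (apply Rmult_le_pos; easy).
    assert (r ^ N * (4 * E + 1 + E * D) = 4 * (E * r ^ N) + r ^ N + E * r ^ N * D) as He2 by ring.
    nra. }
  apply is_derive_Reals. intros eps Heps.
  destruct (pow_small r (eps / (2 * (4 * E + 1))) Hr) as [J HJ].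
  { apply Rdiv_lt_0_compat; lra. }
  specialize (HJ J (Nat.le_refl _)).
  pose proof (HF J x Hx) as HD. apply is_derive_Reals in HD.
  destruct (HD (eps / 2) ltac:(lra)) as [del Hdel].
  assert (Hm : 0 < Rmin del (Rmin (x - a) (b - x))).
  { apply Rmin_glb_lt; [apply cond_pos|apply Rmin_glb_lt; lra]. }
  exists (mkposreal _ Hm). intros h Hh Hh2. simpl in Hh2.
  assert (Hh3 : Rabs h < del) by (eapply Rlt_le_trans; [apply Hh2|apply Rmin_l]).
  assert (Hh4 : a < x + h < b).
  { assert (Rabs h < x - a) by (eapply Rlt_le_trans; [apply Hh2|eapply Rle_trans; [apply Rmin_r|apply Rmin_l]]).
    assert (Rabs h < b - x) by (eapply Rlt_le_trans; [apply Hh2|eapply Rle_trans; [apply Rmin_r|apply Rmin_r]]).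
    revert H H2; unfold Rabs; destruct Rcase_abs; lra. }
  specialize (Hdel h Hh Hh3). specialize (Hlim J (x + h) Hh4).
  replace (x + h - x) with h in Hlim by lra.
  replace ((f (x + h) - f x) / h - g x) with
    (((F J (x + h) - F J x) / h - dF J x) + (- ((F J (x + h) - f (x + h) - (F J x - f x)) / h) + (dF J x - g x)))
    by (field; easy).
  eapply Rle_lt_trans; [apply Rabs_triang|].
  assert (Rabs (- ((F J (x + h) - f (x + h) - (F J x - f x)) / h) + (dF J x - g x)) <= 3 * E * r ^ J).
  { eapply Rle_trans; [apply Rabs_triang|]. rewrite Rabs_Ropp. unfold Rdiv. rewrite Rabs_mult, Rabs_inv.
    specialize (H1 J x Hx).
    assert (0 < Rabs h) by now apply Rabs_pos_lt.
    assert (Rabs (F J (x + h) - f (x + h) - (F J x - f x)) * / Rabs h <= 2 * E * r ^ J); [|lra].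
    apply (Rmult_le_reg_r (Rabs h)); [easy|]. rewrite Rmult_assoc, Rinv_l by lra. lra. }
  assert (3 * E * r ^ J < eps / 2); [|lra].
  apply (Rmult_lt_compat_r (2 * (4 * E + 1))) in HJ; [|lra].
  unfold Rdiv in HJ. rewrite Rmult_assoc, Rinv_l in HJ by lra.
  assert (0 <= r ^ J) by (apply pow_le; lra). nra.
Qed.

(** * Hölder moduli and dyadic series *)

(** [d ^ al] with the value [0] at [d = 0], where [Rpower] is not [0]. *)
Definition hpow (al d : R) : R := if Rle_dec d 0 then 0 else Rpower d al.

Lemma hpow_pos al d : 0 <= hpow al d.
Proof. unfold hpow; destruct Rle_dec; [lra|]. left; apply exp_pos. Qed.
Lemma hpow_Rpower al d : 0 < d -> hpow al d = Rpower d al.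
Proof. intros; unfold hpow; destruct Rle_dec; [lra|easy]. Qed.
Lemma hpow_0 al : hpow al 0 = 0.
Proof. unfold hpow; destruct Rle_dec; lra. Qed.
Lemma hpow_mono al d e : 0 < al -> d <= e -> hpow al d <= hpow al e.
Proof.
  intros Ha H. unfold hpow at 1; destruct Rle_dec; [apply hpow_pos|].
  rewrite hpow_Rpower by lra. apply Rle_Rpower_l; lra.
Qed.
Lemma hpow_scal al c d : 0 < c -> hpow al (c * d) = Rpower c al * hpow al d.
Proof.
  intros Hc. unfold hpow; destruct (Rle_dec d 0) as [H|H].
  - destruct Rle_dec; [lra|]. exfalso; apply n; nra.
  - destruct Rle_dec; [exfalso; apply H; nra|]. symmetry; apply Rpower_mult_distr; lra.
Qed.
(** Write [d = d ^ (1 - al) * d ^ al]; the base [1 + L] is at least [1], so its power [1 - al] is at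
    most [1 + L] itself. This turns Lipschitz bounds on bounded sets into Hölder bounds. *)
Lemma hpow_lin al d L : 0 < al < 1 -> 0 <= d <= L -> d <= (1 + L) * hpow al d.
Proof.
  intros Ha H. destruct (Req_dec d 0) as [->|Hd]; [rewrite hpow_0; lra|].
  rewrite hpow_Rpower by lra.
  replace d with (Rpower d (1 - al) * Rpower d al) at 1
    by (rewrite <- Rpower_plus; replace (1 - al + al) with 1 by ring; apply Rpower_1; lra).
  apply Rmult_le_compat_r; [left; apply exp_pos|].
  apply Rle_trans with (Rpower (1 + L) (1 - al)).
  - apply Rle_Rpower_l; lra.
  - rewrite <- (Rpower_1 (1 + L)) at 2 by lra. apply Rle_Rpower; lra.
Qed.
Lemma hpow_ge1 al d : 0 < al -> 1 <= d -> 1 <= hpow al d.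
Proof.
  intros. replace 1 with (hpow al 1) by (rewrite hpow_Rpower by lra; unfold Rpower; rewrite ln_1, Rmult_0_r, exp_0; easy).
  apply hpow_mono; lra.
Qed.

(** The block of frequency [2 ^ j] of an [al]-Hölder function has size of order [ratio al ^ j], and
    its derivative [(2 * ratio al) ^ j]. The two bases lie on opposite sides of [1] exactly when
    [0 < al < 1]. *)
Definition ratio (al : R) : R := Rpower 2 (- al).
Lemma ratio_bounds al : 0 < al < 1 -> / 2 < ratio al < 1.
Proof.
  intros H. unfold ratio. split.
  - replace (/ 2) with (Rpower 2 (- (1))) by (rewrite Rpower_Ropp, Rpower_1; lra).
    apply Rpower_lt; lra.
  - rewrite <- (Rpower_O 2) by lra. apply Rpower_lt; lra.
Qed.
Lemma ratio_pow al J : ratio al ^ J = hpow al ((/ 2) ^ J).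
Proof.
  assert (forall J, 0 < (/ 2) ^ J) by (intros; apply pow_lt; lra).
  rewrite hpow_Rpower by easy. unfold ratio. rewrite <- Rpower_pow by apply exp_pos.
  rewrite <- (Rpower_pow J (/ 2)) by lra. rewrite !Rpower_mult.
  unfold Rpower. f_equal. rewrite ln_Rinv by lra. ring.
Qed.

Lemma dyadic_scale d : 0 < d -> d <= 1 -> exists J, (/ 2) ^ (S J) < d <= (/ 2) ^ J.
Proof.
  intros H H1. destruct (pow_small (/ 2) d ltac:(lra) H) as [N HN].
  specialize (HN N (Nat.le_refl _)). induction N.
  - simpl in HN; lra.
  - destruct (Rle_dec d ((/ 2) ^ N)); [now exists N|]. apply IHN; lra.
Qed.

(** The blocks below the cut contribute [1 / (2 * ratio al - 1)], the two tails
    [2 / (1 - ratio al)]; the common factor [2] is lost in replacing the cut [2 ^ (- J)] by [d]. *)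
Definition hol_cst (al : R) : R := 2 / (2 * ratio al - 1) + 4 / (1 - ratio al).

Lemma hol_cst_pos al : 0 < al < 1 -> 0 < hol_cst al.
Proof.
  intros H; pose proof (ratio_bounds al H). unfold hol_cst.
  assert (0 < 2 / (2 * ratio al - 1)) by (apply Rdiv_lt_0_compat; lra).
  assert (0 < 4 / (1 - ratio al)) by (apply Rdiv_lt_0_compat; lra). lra.
Qed.

(** The sum is cut at the index [J] with [2 ^ (- J)] comparable to [d]. Before the cut the
    increments form a growing geometric sum dominated by its last term, after it the sizes form a
    decaying one dominated by its first; both are of order [d ^ al]. *)
Lemma dyadic_holder (al : R) (b b' : nat -> R) (E d : R) : 0 < al < 1 -> 0 <= E -> 0 <= d ->
  (forall j, Rabs (b j) <= E * ratio al ^ j) -> (forall j, Rabs (b' j) <= E * ratio al ^ j) ->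
  (forall j, Rabs (b j - b' j) <= E * (2 * ratio al) ^ j * d) ->
  Rabs (dsum b - dsum b') <= hol_cst al * E * hpow al d.
Proof.
  intros Ha HE Hd Hb Hb' Hbb. pose proof (ratio_bounds al Ha) as Hr. set (r := ratio al) in *.
  pose proof (hol_cst_pos al Ha) as HC.
  assert (H2 : 0 < 2 / (2 * r - 1)) by (apply Rdiv_lt_0_compat; lra).
  assert (H4 : 0 < 4 / (1 - r)) by (apply Rdiv_lt_0_compat; lra).
  destruct (Req_dec d 0) as [->|Hd0].
  { rewrite hpow_0, Rmult_0_r. replace (dsum b) with (dsum b'); [rewrite Rminus_diag_eq, Rabs_R0; lra|].
    unfold dsum. f_equal. apply Lim_seq_ext. intros n. apply psum_ext. intros i _.
    specialize (Hbb i). rewrite Rmult_0_r in Hbb. revert Hbb; unfold Rabs; destruct Rcase_abs; lra. }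
  destruct (Rle_dec d 1) as [H1|H1].
  - destruct (dyadic_scale d ltac:(lra) H1) as [J [HJ1 HJ2]].
    pose proof (ssum_tail b E r J ltac:(lra) HE Hb) as Ht.
    pose proof (ssum_tail b' E r J ltac:(lra) HE Hb') as Ht'.
    assert (Hm : Rabs (psum b J - psum b' J) <= E * r ^ J / (2 * r - 1)).
    { rewrite <- psum_minus. eapply Rle_trans; [apply psum_abs|].
      eapply Rle_trans; [apply (psum_le _ (fun j => (E * d) * (2 * r) ^ j))|].
      { intros i _. eapply Rle_trans; [apply Hbb|]. right; ring. }
      rewrite psum_scal, psum_geom by lra.
      replace ((1 - (2 * r) ^ J) / (1 - 2 * r)) with (((2 * r) ^ J - 1) / (2 * r - 1)) by (field; lra).
      unfold Rdiv. rewrite <- Rmult_assoc. apply Rmult_le_compat_r; [left; apply Rinv_0_lt_compat; lra|].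
      rewrite Rmult_assoc. apply Rmult_le_compat_l; [easy|].
      apply Rle_trans with (d * (2 * r) ^ J).
      { apply Rmult_le_compat_l; [easy|]. lra. }
      rewrite Rpow_mult_distr. rewrite <- Rmult_assoc.
      rewrite <- (Rmult_1_l (r ^ J)) at 2. apply Rmult_le_compat_r; [apply pow_le; lra|].
      assert (0 < 2 ^ J) by (apply pow_lt; lra).
      rewrite pow_inv in HJ2. apply (Rmult_le_compat_r (2 ^ J)) in HJ2; [|lra].
      rewrite Rinv_l in HJ2; lra. }
    assert (HrJ : r ^ J <= 2 * hpow al d).
    { apply Rle_trans with (Rpower 2 al * hpow al d).
      - rewrite <- hpow_scal by lra. unfold r; rewrite ratio_pow. apply hpow_mono; [lra|]. simpl in HJ1; lra.
      - apply Rmult_le_compat_r; [apply hpow_pos|]. rewrite <- (Rpower_1 2) at 2 by lra. apply Rle_Rpower; lra. }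
    replace (dsum b - dsum b') with ((psum b J - psum b' J) + ((dsum b - psum b J) + - (dsum b' - psum b' J))) by lra.
    eapply Rle_trans; [apply Rabs_triang|].
    assert (Rabs (dsum b - psum b J + - (dsum b' - psum b' J)) <= 2 * (E * r ^ J / (1 - r))).
    { eapply Rle_trans; [apply Rabs_triang|]. rewrite Rabs_Ropp. lra. }
    apply Rle_trans with (E * r ^ J * (hol_cst al / 2)).
    { unfold hol_cst; fold r.
      replace (E * r ^ J * ((2 / (2 * r - 1) + 4 / (1 - r)) / 2)) with
        (E * r ^ J / (2 * r - 1) + 2 * (E * r ^ J / (1 - r))) by (field; lra). lra. }
    assert (0 <= E * hol_cst al) by (apply Rmult_le_pos; lra). nra.
  (* For [d > 1] the bound on the sizes suffices, as [hpow al d >= 1]. *)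
  - pose proof (ssum_bound b E r ltac:(lra) HE Hb) as Ht.
    pose proof (ssum_bound b' E r ltac:(lra) HE Hb') as Ht'.
    unfold Rminus; eapply Rle_trans; [apply Rabs_triang|]. rewrite Rabs_Ropp.
    pose proof (hpow_ge1 al d ltac:(lra) ltac:(lra)) as H5.
    apply Rle_trans with (hol_cst al * E * 1).
    + assert (2 * (E / (1 - r)) <= hol_cst al * E); [|lra].
      unfold hol_cst; fold r. replace ((2 / (2 * r - 1) + 4 / (1 - r)) * E) with
       (2 / (2 * r - 1) * E + 4 * (E / (1 - r))) by (field; lra).
      assert (0 <= 2 / (2 * r - 1) * E) by (apply Rmult_le_pos; lra).
      assert (0 <= E / (1 - r)) by (apply Rdiv_le_0_compat; lra). lra.
    + apply Rmult_le_compat_l; [apply Rmult_le_pos; lra|easy].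
Qed.

(** * Cosine series and Fejér means *)

Definition cosn (n : nat) (y : R) : R := cos (INR n * y).

Lemma cont_cosn n : cont (cosn n).
Proof. unfold cosn. apply (cont_comp (fun y => INR n * y) cos); [auto with cont|apply cont_cos]. Qed.
#[export] Hint Resolve cont_cosn : cont.
Lemma cosn_0 y : cosn 0 y = 1.
Proof. unfold cosn; simpl; now rewrite Rmult_0_l, cos_0. Qed.

Lemma cosn_rec n t : cosn (S (S n)) t = 2 * cos t * cosn (S n) t - cosn n t.
Proof.
  unfold cosn. rewrite !S_INR. replace ((INR n + 1 + 1) * t) with ((INR n + 1) * t + t) by ring.
  replace (INR n * t) with ((INR n + 1) * t - t) by ring.
  rewrite cos_plus, cos_minus. ring.
Qed.
(** [cosn n] is the Chebyshev polynomial of degree [n] in [cos t], by the three-term recursion.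
    Kernels and cosine polynomials thus depend on [cos t] alone, which allows points to be folded
    into [[0, PI]]. *)
Lemma cosn_eq n t u : cos t = cos u -> cosn n t = cosn n u.
Proof.
  intros H. enough (cosn n t = cosn n u /\ cosn (S n) t = cosn (S n) u) by easy.
  induction n as [|n [IH1 IH2]].
  - rewrite !cosn_0. split; [easy|]. unfold cosn; simpl. now rewrite !Rmult_1_l.
  - split; [easy|]. now rewrite !cosn_rec, IH1, IH2, H.
Qed.

(** Normalised so that the cosine series is the plain sum of [fcoef f n * cosn n], with no factor
    left at [n = 0]. *)
Definition fcoef (f : R -> R) (n : nat) : R :=
  match n with O => 1 | _ => 2 end / PI * RInt (fun s => f s * cosn n s) 0 PI.

Fixpoint dirichlet (m : nat) (t : R) : R :=
  match m with O => 1 | S m => dirichlet m t + 2 * cosn (S m) t end.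
(** [fejer m] and [cesaro a m] are [m] times the usual kernel and the usual mean. Without the
    division the second difference of [cesaro a] is the sequence [a] itself, as [cesaro_diff2]
    records. *)
Fixpoint fejer (m : nat) (t : R) : R :=
  match m with O => 0 | S m => fejer m t + dirichlet m t end.
Fixpoint cesaro (a : nat -> R) (m : nat) : R :=
  match m with O => 0 | S m => cesaro a m + psum a (S m) end.

Lemma cesaro_S a m : cesaro a (S m) = cesaro a m + psum a (S m).
Proof. easy. Qed.
Lemma cesaro_ext a b m : (forall i, (i < m)%nat -> a i = b i) -> cesaro a m = cesaro b m.
Proof.
  induction m; intros H; [easy|]. rewrite ?cesaro_S. rewrite IHm by auto. f_equal. apply psum_ext; auto.
Qed.
Lemma cesaro_diff2 a i : cesaro a (S (S i)) - 2 * cesaro a (S i) + cesaro a i = a (S i).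
Proof. simpl. ring. Qed.
Lemma cesaro_zero a m : (forall i, (i < m)%nat -> a i = 0) -> cesaro a m = 0.
Proof.
  induction m; intros H; [easy|]. rewrite ?cesaro_S. rewrite IHm by auto. rewrite psum_zero by auto. ring.
Qed.
Lemma cesaro_psum a m M : (m <= M)%nat -> cesaro a m = psum (fun n => INR (m - n) * a n) M.
Proof.
  intros H. rewrite (psum_tail _ m M H).
  2:{ intros i Hi. replace (m - i)%nat with 0%nat by lia. simpl; ring. }
  clear H M. induction m; [easy|]. rewrite ?cesaro_S. rewrite IHm.
  rewrite (psum_S (fun n => INR (S m - n) * a n)), (psum_S a).
  replace (S m - m)%nat with 1%nat by lia. simpl (INR 1).
  rewrite <- Rplus_assoc, <- psum_plus. f_equal; [|ring].
  apply psum_ext; intros i Hi. replace (S m - i)%nat with (S (m - i)) by lia. rewrite S_INR; ring.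
Qed.

Lemma cont_dirichlet m : cont (dirichlet m).
Proof. induction m; simpl; auto 10 with cont. Qed.
Lemma cont_fejer m : cont (fejer m).
Proof. induction m; simpl; auto using cont_dirichlet with cont. Qed.
Lemma cont_fejer_minus m y : cont (fun s => fejer m (y - s)).
Proof. apply (cont_comp (fun s => y - s) (fejer m)); auto using cont_fejer with cont. Qed.
Lemma cont_fejer_plus m y : cont (fun s => fejer m (y + s)).
Proof. apply (cont_comp (fun s => y + s) (fejer m)); auto using cont_fejer with cont. Qed.
Lemma cont_dirichlet_minus m y : cont (fun s => dirichlet m (y - s)).
Proof. apply (cont_comp (fun s => y - s) (dirichlet m)); auto using cont_dirichlet with cont. Qed.
Lemma cont_dirichlet_plus m y : cont (fun s => dirichlet m (y + s)).
Proof. apply (cont_comp (fun s => y + s) (dirichlet m)); auto using cont_dirichlet with cont. Qed.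
Lemma cont_cosn_minus m y : cont (fun s => cosn m (y - s)).
Proof. apply (cont_comp (fun s => y - s) (cosn m)); auto with cont. Qed.
Lemma cont_cosn_plus m y : cont (fun s => cosn m (y + s)).
Proof. apply (cont_comp (fun s => y + s) (cosn m)); auto with cont. Qed.
#[export] Hint Resolve cont_fejer_minus cont_fejer_plus cont_dirichlet_minus cont_dirichlet_plus cont_cosn_minus cont_cosn_plus : cont.

Lemma dirichlet_cos m t : (1 - cos t) * dirichlet m t = cosn m t - cosn (S m) t.
Proof.
  induction m.
  - simpl. rewrite cosn_0. unfold cosn; simpl. rewrite Rmult_1_l; ring.
  - simpl dirichlet. rewrite cosn_rec, Rmult_plus_distr_l, IHm. ring.
Qed.
(** The closed form of the kernel with its denominator cleared. Both [1 - cos] factors are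
    nonnegative, so it gives positivity, and with a lower bound for [1 - cos t] the decay away from
    [0]. *)
Lemma fejer_cos m t : (1 - cos t) * fejer m t = 1 - cosn m t.
Proof.
  induction m.
  - simpl. rewrite cosn_0; ring.
  - simpl fejer. rewrite Rmult_plus_distr_l, IHm, dirichlet_cos. ring.
Qed.
Lemma dirichlet_0 m t : cos t = 1 -> dirichlet m t = 2 * INR m + 1.
Proof.
  intros H. induction m; [simpl; ring|]. simpl dirichlet. rewrite IHm, (cosn_eq (S m) t 0) by now rewrite cos_0.
  unfold cosn. rewrite Rmult_0_r, cos_0, S_INR. ring.
Qed.
Lemma fejer_0 m t : cos t = 1 -> fejer m t = INR m ^ 2.
Proof.
  intros H. induction m; [simpl; ring|]. simpl fejer. rewrite IHm, dirichlet_0, S_INR by easy. ring.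
Qed.
Lemma fejer_pos m t : 0 <= fejer m t.
Proof.
  destruct (Req_dec (cos t) 1) as [H|H].
  - rewrite fejer_0 by easy. apply pow2_ge_0.
  - pose proof (COS_bound t). pose proof (COS_bound (INR m * t)). pose proof (fejer_cos m t) as E.
    unfold cosn in E. nra.
Qed.
Lemma dirichlet_le m t : dirichlet m t <= 2 * INR m + 1.
Proof.
  induction m; [simpl; lra|]. simpl dirichlet. rewrite S_INR. pose proof (COS_bound (INR (S m) * t)).
  unfold cosn. lra.
Qed.
Lemma fejer_le m t : fejer m t <= INR m ^ 2.
Proof.
  induction m; [simpl; lra|]. simpl fejer. rewrite S_INR. pose proof (dirichlet_le m t). nra.
Qed.
Lemma dirichlet_eq m t u : cos t = cos u -> dirichlet m t = dirichlet m u.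
Proof. intros H. induction m; simpl; [easy|]. now rewrite IHm, (cosn_eq (S m) t u H). Qed.
Lemma fejer_eq m t u : cos t = cos u -> fejer m t = fejer m u.
Proof. intros H. induction m; simpl; [easy|]. now rewrite IHm, (dirichlet_eq m t u H). Qed.

(** The reflected term [y + s] comes from folding the integral of the even extension of [f] over
    [(- PI, PI)] back to [(0, PI)]. *)
Lemma fejer_rep1 f m y : cont f ->
  psum (fun n => fcoef f n * cosn n y) (S m) =
  / (2 * PI) * RInt (fun s => f s * (dirichlet m (y - s) + dirichlet m (y + s))) 0 PI.
Proof.
  intros Hf. pose proof PI_RGT_0. induction m.
  - simpl. rewrite cosn_0. rewrite (RInt_eq _ (fun s => 2 * (f s * cosn 0 s))) by (intros; rewrite cosn_0; ring).
    rewrite RInt_cscal by auto with cont. unfold fcoef. field. lra.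
  - rewrite psum_S, IHm. simpl dirichlet.
    rewrite (RInt_eq (fun s => f s * (dirichlet m (y - s) + 2 * cosn (S m) (y - s) + (dirichlet m (y + s) + 2 * cosn (S m) (y + s))))
      (fun s => f s * (dirichlet m (y - s) + dirichlet m (y + s)) + 4 * cosn (S m) y * (f s * cosn (S m) s))).
    + rewrite RInt_cplus, RInt_cscal; auto with cont. unfold fcoef. field. lra.
    + intros s. unfold cosn.
      replace (INR (S m) * (y - s)) with (INR (S m) * y - INR (S m) * s) by ring.
      replace (INR (S m) * (y + s)) with (INR (S m) * y + INR (S m) * s) by ring.
      rewrite cos_minus, cos_plus. ring.
Qed.
Lemma fejer_rep f m y : cont f ->
  cesaro (fun n => fcoef f n * cosn n y) m =
  / (2 * PI) * RInt (fun s => f s * (fejer m (y - s) + fejer m (y + s))) 0 PI.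
Proof.
  intros Hf. induction m.
  - simpl. rewrite (RInt_eq _ (fun _ => 0)) by (intros; ring). rewrite RInt_cst; ring.
  - rewrite ?cesaro_S. rewrite IHm, (fejer_rep1 f m y Hf). simpl fejer.
    rewrite <- Rmult_plus_distr_l, <- RInt_cplus by auto with cont. f_equal. apply RInt_eq; intros; ring.
Qed.

Lemma RInt_cos_int (z : Z) : z <> 0%Z -> RInt (fun s => cos (IZR z * s)) 0 PI = 0.
Proof.
  intros Hz. assert (IZR z <> 0) by now apply eq_IZR_contrapositive.
  rewrite (RInt_ftc (fun s => / IZR z * sin (IZR z * s)) (fun s => cos (IZR z * s))).
  - rewrite Rmult_0_r, sin_0. replace (sin (IZR z * PI)) with 0; [fold_R; ring|].
    symmetry; apply sin_eq_0_1. now exists z.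
  - intros x. auto_derive; [easy|]. field; easy.
  - apply (cont_ext (fun s => cos (IZR z * s + 0))); [intros; f_equal; ring|auto with cont].
Qed.
Lemma RInt_cosn n : (1 <= n)%nat -> RInt (cosn n) 0 PI = 0.
Proof.
  intros Hn. rewrite (RInt_eq _ (fun s => cos (IZR (Z.of_nat n) * s))).
  - apply RInt_cos_int; lia.
  - intros x. unfold cosn. now rewrite INR_IZR_INZ.
Qed.

Lemma fcoef_ext f g n : (forall s, 0 < s < PI -> f s = g s) -> fcoef f n = fcoef g n.
Proof.
  intros H. unfold fcoef. f_equal. apply RInt_eq_open; [left; apply PI_RGT_0|]. intros; now rewrite H.
Qed.
Lemma fcoef_plus f g n : cont f -> cont g -> fcoef (fun s => f s + g s) n = fcoef f n + fcoef g n.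
Proof.
  intros Hf Hg. unfold fcoef. rewrite <- Rmult_plus_distr_l, <- RInt_cplus by auto with cont.
  f_equal. apply RInt_eq; intros; ring.
Qed.
Lemma fcoef_scal k f n : cont f -> fcoef (fun s => k * f s) n = k * fcoef f n.
Proof.
  intros Hf. unfold fcoef. rewrite (RInt_eq _ (fun s => k * (f s * cosn n s))), RInt_cscal by (auto with cont; intros; ring). ring.
Qed.
Lemma fcoef_cosn k n : fcoef (cosn k) n = if Nat.eqb k n then 1 else 0.
Proof.
  pose proof PI_RGT_0. unfold fcoef.
  (* The difference of frequencies is taken in [Z]: subtraction in [nat] would truncate it when
     [k < n]. *)
  rewrite (RInt_eq _ (fun s => / 2 * cosn (k + n) s + / 2 * cos (IZR (Z.of_nat k - Z.of_nat n) * s))).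
  2:{ intros s. unfold cosn. rewrite plus_INR, minus_IZR, <- !INR_IZR_INZ.
      replace ((INR k + INR n) * s) with (INR k * s + INR n * s) by ring.
      replace ((INR k - INR n) * s) with (INR k * s - INR n * s) by ring.
      rewrite cos_plus, cos_minus. field. }
  assert (cont (fun s => cos (IZR (Z.of_nat k - Z.of_nat n) * s))) as Hc.
  { apply (cont_ext (fun s => cos (IZR (Z.of_nat k - Z.of_nat n) * s + 0))); [intros; f_equal; ring|auto with cont]. }
  rewrite RInt_cplus, !RInt_cscal by auto with cont.
  destruct (Nat.eqb_spec k n) as [->|Hk].
  - rewrite (RInt_eq (fun s => cos (IZR (Z.of_nat n - Z.of_nat n) * s)) (fun _ => 1)).
    2:{ intros; rewrite Z.sub_diag, Rmult_0_l; apply cos_0. }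
    rewrite RInt_cst. destruct n.
    + rewrite (RInt_eq (cosn (0 + 0)) (fun _ => 1)) by (intros; apply cosn_0). rewrite RInt_cst; field; lra.
    + rewrite RInt_cosn by lia. field; lra.
  - rewrite RInt_cosn by lia. rewrite RInt_cos_int by lia. ring.
Qed.
Lemma fcoef_poly (c : nat -> R) M n : (n < M)%nat -> fcoef (fun y => psum (fun k => c k * cosn k y) M) n = c n.
Proof.
  intros H. assert (fcoef (fun y => psum (fun k => c k * cosn k y) M) n = psum (fun k => c k * fcoef (cosn k) n) M) as ->.
  { clear H. induction M.
    - simpl. unfold fcoef. rewrite (RInt_eq _ (fun _ => 0)) by (intros; ring). rewrite RInt_cst; ring.
    - simpl. rewrite fcoef_plus, IHM, fcoef_scal; auto with cont. }
  induction M; [lia|]. simpl. rewrite fcoef_cosn. destruct (Nat.eqb_spec M n) as [->|Hn].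
  - rewrite psum_zero; [ring|]. intros i Hi. rewrite fcoef_cosn. destruct (Nat.eqb_spec i n); [lia|ring].
  - rewrite IHM by lia. ring.
Qed.

(** Read off from [fejer_rep] for the constant function [1], whose only nonzero coefficient is the
    mean. *)
Lemma kernel_mass m y :
  RInt (fun s => fejer m (y - s) + fejer m (y + s)) 0 PI = 2 * PI * INR m.
Proof.
  pose proof PI_RGT_0. pose proof (fejer_rep (fun _ => 1) m y ltac:(auto with cont)) as E.
  rewrite (RInt_eq (fun s => 1 * (fejer m (y - s) + fejer m (y + s))) (fun s => fejer m (y - s) + fejer m (y + s))) in E
    by (intros; ring).
  assert (cesaro (fun n => fcoef (fun _ => 1) n * cosn n y) m = INR m) as HC.
  { rewrite (cesaro_ext _ (fun n => if Nat.eqb n 0 then 1 else 0)).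
    - clear E. induction m; [easy|]. rewrite ?cesaro_S. rewrite IHm, S_INR. f_equal.
      change (psum (fun n => if Nat.eqb n 0 then 1 else 0) (S m) = 1).
      rewrite psum_shift. simpl. rewrite psum_zero; [ring|easy].
    - intros i _. rewrite (fcoef_ext _ (cosn 0)) by (intros; now rewrite cosn_0). rewrite fcoef_cosn.
      destruct i; simpl; [rewrite cosn_0; ring|ring]. }
  rewrite HC in E. assert (forall a X : R, a = / (2 * PI) * X -> X = 2 * PI * a) as G by (intros a X ->; field; lra).
  exact (G _ _ E).
Qed.

(** Positivity of the kernel turns its mass into the operator norm. The plain partial sums have no
    such bound uniform in [m], which is why the estimates pass through Cesàro sums. *)
Lemma fejer_contr f m y d : cont f -> (forall s, 0 <= s <= PI -> Rabs (f s) <= d) ->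
  Rabs (cesaro (fun n => fcoef f n * cosn n y) m) <= INR m * d.
Proof.
  intros Hf Hd. pose proof PI_RGT_0. rewrite fejer_rep by easy.
  rewrite Rabs_mult, Rabs_pos_eq by (left; apply Rinv_0_lt_compat; lra).
  apply Rle_trans with (/ (2 * PI) * RInt (fun s => d * (fejer m (y - s) + fejer m (y + s))) 0 PI).
  - apply Rmult_le_compat_l; [left; apply Rinv_0_lt_compat; lra|].
    apply RInt_abs_le; [lra|auto with cont|auto with cont|]. intros s Hs.
    pose proof (fejer_pos m (y - s)). pose proof (fejer_pos m (y + s)).
    rewrite Rabs_mult, (Rabs_pos_eq (_ + _)) by lra.
    apply Rmult_le_compat_r; [lra|]. now apply Hd.
  - rewrite RInt_cscal, kernel_mass by auto with cont. right; field; lra.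
Qed.

Lemma fejer_poly (c : nat -> R) M m y d : (forall n, (M < n)%nat -> c n = 0) ->
  (forall s, 0 <= s <= PI -> Rabs (psum (fun k => c k * cosn k s) (S M)) <= d) ->
  Rabs (cesaro (fun n => c n * cosn n y) m) <= INR m * d.
Proof.
  intros Hc Hd. set (K := (S M + m)%nat).
  assert (forall s, psum (fun k => c k * cosn k s) K = psum (fun k => c k * cosn k s) (S M)) as HK.
  { intros s. apply psum_tail; [lia|]. intros i Hi. rewrite Hc by lia; ring. }
  rewrite (cesaro_ext _ (fun n => fcoef (fun y => psum (fun k => c k * cosn k y) K) n * cosn n y)).
  2:{ intros i Hi. rewrite fcoef_poly; [easy|lia]. }
  apply fejer_contr; [auto with cont|]. intros s Hs. rewrite HK. now apply Hd.
Qed.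

(** * Decay of the Fejér kernel and rate of approximation *)

Lemma cos_lower r : 0 <= r <= PI -> r ^ 2 / 32 <= 1 - cos r.
Proof.
  intros H. pose proof PI_4. assert (0 <= r / 2 <= 2) as Hr by lra.
  replace r with (2 * (r / 2)) at 2 by field. rewrite cos_2a_sin.
  set (x := r / 2) in *. replace (r ^ 2 / 32) with (x ^ 2 / 8) by (unfold x; field).
  (* With [x = r / 2 <= 2] the Taylor lower bound for the sine is enough:
     [1 - cos r = 2 sin x ^ 2 >= x ^ 2 / 8], and this is [r ^ 2 / 32]. *)
  assert (x / 4 <= sin x).
  { destruct (Req_dec x 0) as [->|Hx]; [rewrite sin_0; lra|].
    assert (x <= PI) by (unfold x; lra).
    destruct (SIN x ltac:(lra) ltac:(lra)) as [Hs _]. eapply Rle_trans; [|apply Hs].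
    unfold sin_lb, sin_approx, sum_f_R0, sin_term; simpl.
    assert (x ^ 2 <= 4) by nra.
    replace (1 * (x * 1 / 1) + -1 * 1 * (x * (x * (x * 1)) / (1 + 1 + 1 + 1 + 1 + 1))) with (x - x * x ^ 2 / 6) by field.
    match goal with |- _ <= ?e => replace e with (x - x * x ^ 2 / 6 + x * (x ^ 2) ^ 2 * (1 - x ^ 2 / 42) / 120) by (field) end.
    assert (0 <= x * (x ^ 2) ^ 2 * (1 - x ^ 2 / 42) / 120).
    { apply Rmult_le_pos; [|lra]. repeat apply Rmult_le_pos; try lra. }
    nra. }
  assert (0 <= sin x) by lra. nra.
Qed.

(** What remains of a bound for [fejer m d * d ^ al] after the factor [m ^ (1 - al)] is taken out.
    Its integral over the half-line is [1 / (1 - al)], independent of [m]; here [al < 1] is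
    essential. *)
Definition ker_bd (m : nat) (al d : R) : R := INR m * Rpower (1 + INR m * d) (al - 2).

(** The trivial bound [m ^ 2] near [0] and [64 / r ^ 2] away from it, combined through
    [(1 + m r) ^ 2 <= 2 + 2 m ^ 2 r ^ 2]; hence [130 = 2 + 128]. *)
Lemma fejer_bound m r : 0 <= r <= PI -> (1 <= m)%nat -> fejer m r * (1 + INR m * r) ^ 2 <= 130 * INR m ^ 2.
Proof.
  intros Hr Hm. pose proof (le_INR 1 m Hm) as Hm1; simpl in Hm1.
  pose proof (fejer_pos m r) as Hp. pose proof (fejer_le m r) as Hl. pose proof (fejer_cos m r) as E.
  pose proof (COS_bound (INR m * r)) as Hc. unfold cosn in E. pose proof (cos_lower r Hr) as Hcl.
  assert (fejer m r * r ^ 2 <= 64) by nra.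
  assert ((1 + INR m * r) ^ 2 <= 2 + 2 * (INR m ^ 2 * r ^ 2)) by (pose proof (pow2_ge_0 (1 - INR m * r)); nra).
  apply Rle_trans with (fejer m r * (2 + 2 * (INR m ^ 2 * r ^ 2))); [now apply Rmult_le_compat_l|].
  nra.
Qed.

Lemma fejer_hpow m al r : 0 < al < 1 -> 0 <= r <= PI -> (1 <= m)%nat ->
  fejer m r * hpow al r <= 130 * (INR m * Rpower (INR m) (- al)) * ker_bd m al r.
Proof.
  intros Ha Hr Hm. pose proof (le_INR 1 m Hm) as Hm1; simpl in Hm1.
  assert (0 <= INR m * r) by (apply Rmult_le_pos; lra).
  assert (Hh : hpow al r <= Rpower (INR m) (- al) * Rpower (1 + INR m * r) al).
  { apply Rle_trans with (Rpower (INR m) (- al) * hpow al (INR m * r)).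
    - rewrite hpow_scal by lra. rewrite <- Rmult_assoc, <- Rpower_plus.
      replace (- al + al) with 0 by ring. rewrite Rpower_O by lra. lra.
    - apply Rmult_le_compat_l; [left; apply exp_pos|].
      rewrite <- hpow_Rpower by lra. apply hpow_mono; lra. }
  pose proof (fejer_bound m r Hr Hm) as HA. pose proof (fejer_pos m r).
  apply Rle_trans with (fejer m r * (Rpower (INR m) (- al) * Rpower (1 + INR m * r) al)).
  { now apply Rmult_le_compat_l. }
  unfold ker_bd. replace (al - 2) with (al + - (2)) by ring. rewrite Rpower_plus, (Rpower_Ropp _ 2).
  set (z := 1 + INR m * r) in *. assert (1 <= z) by (unfold z; lra).
  assert (Rpower z 2 = z ^ 2) as ->.
  { rewrite <- (Rpower_pow 2) by lra. f_equal. }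
  set (P := Rpower (INR m) (- al)). set (Q := Rpower z al).
  assert (0 < P) by apply exp_pos. assert (0 < Q) by apply exp_pos.
  apply (Rmult_le_reg_r (z ^ 2)); [nra|].
  replace (130 * (INR m * P) * (INR m * (Q * / z ^ 2)) * z ^ 2) with ((130 * INR m ^ 2) * (P * Q)) by (field; lra).
  replace (fejer m r * (P * Q) * z ^ 2) with ((fejer m r * z ^ 2) * (P * Q)) by ring.
  apply Rmult_le_compat_r; [|easy]. left; now apply Rmult_lt_0_compat.
Qed.

Lemma ker_bd_mono m al r s : 0 < al < 1 -> 0 <= r <= s -> ker_bd m al s <= ker_bd m al r.
Proof.
  intros Ha Hr. unfold ker_bd. apply Rmult_le_compat_l; [apply pos_INR|].
  pose proof (pos_INR m). assert (0 <= INR m * r <= INR m * s) by nra.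
  replace (al - 2) with (- (2 - al)) by ring. rewrite !Rpower_Ropp.
  apply Rinv_le_contravar; [apply exp_pos|]. apply Rle_Rpower_l; lra.
Qed.

Definition ker_bdc (m : nat) (al t : R) : R := ker_bd m al (Rabs t).

Lemma cont_ker_bdc m al y : cont (fun s => ker_bdc m al (y - s)).
Proof.
  unfold ker_bdc, ker_bd. apply cont_mult; [auto with cont|].
  intros s. apply (continuous_comp (fun s => 1 + INR m * Rabs (y - s)) (fun z => Rpower z (al - 2))).
  - apply (cont_plus (fun _ => 1) (fun s => INR m * Rabs (y - s))); auto with cont.
  - apply (ex_derive_continuous (V := R_NormedModule)). unfold Rpower. auto_derive.
    pose proof (pos_INR m). pose proof (Rabs_pos (y - s)). nra.
Qed.

Lemma ker_bd_int1 m al L : 0 < al < 1 -> (1 <= m)%nat -> 0 <= L ->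
  is_RInt (ker_bd m al) 0 L ((1 - Rpower (1 + INR m * L) (al - 1)) / (1 - al)).
Proof.
  intros Ha Hm HL. pose proof (le_INR 1 m Hm) as Hm1; simpl in Hm1.
  replace ((1 - Rpower (1 + INR m * L) (al - 1)) / (1 - al)) with
    (minus (- Rpower (1 + INR m * L) (al - 1) / (1 - al)) (- Rpower (1 + INR m * 0) (al - 1) / (1 - al))).
  2:{ unfold minus, plus, opp; simpl. rewrite Rmult_0_r, Rplus_0_r.
      replace (Rpower 1 (al - 1)) with 1 by (unfold Rpower; now rewrite ln_1, Rmult_0_r, exp_0). field; lra. }
  apply (is_RInt_derive (V := R_CompleteNormedModule) (fun d => - Rpower (1 + INR m * d) (al - 1) / (1 - al)) (ker_bd m al)).
  - intros x Hx. rewrite Rmin_left, Rmax_right in Hx by lra. unfold ker_bd, Rpower.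
    assert (0 < 1 + INR m * x) by nra.
    auto_derive; [easy|].
    replace ((al - 2) * ln (1 + INR m * x)) with ((al - 1) * ln (1 + INR m * x) + - ln (1 + INR m * x)) by ring.
    rewrite exp_plus, exp_Ropp, exp_ln by easy. unfold Rminus. field. lra.
  - intros x Hx. rewrite Rmin_left, Rmax_right in Hx by lra.
    apply (ex_derive_continuous (V := R_NormedModule)). unfold ker_bd, Rpower. auto_derive. nra.
Qed.

Lemma ker_bd_int m al y : 0 < al < 1 -> (1 <= m)%nat -> 0 <= y <= PI ->
  RInt (fun s => ker_bdc m al (y - s)) 0 PI <= 2 / (1 - al).
Proof.
  intros Ha Hm Hy. rewrite <- (RInt_chasles _ 0 y PI) by apply cont_ker_bdc.
  assert (HB : forall L, 0 <= L -> RInt (ker_bd m al) 0 L <= / (1 - al)).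
  { intros L HL. rewrite (is_RInt_unique _ _ _ _ (ker_bd_int1 m al L Ha Hm HL)).
    unfold Rdiv. rewrite <- (Rmult_1_l (/ (1 - al))) at 2. apply Rmult_le_compat_r.
    left; apply Rinv_0_lt_compat; lra. pose proof (exp_pos ((al - 1) * ln (1 + INR m * L))).
    unfold Rpower; lra. }
  assert (RInt (fun s => ker_bdc m al (y - s)) 0 y = RInt (ker_bd m al) 0 y) as ->.
  { pose proof (RInt_comp_lin (V := R_CompleteNormedModule) (ker_bd m al) (-1) y 0 y) as E.
    replace (-1 * 0 + y) with y in E by ring. replace (-1 * y + y) with 0 in E by ring.
    rewrite <- (opp_RInt_swap (V := R_CompleteNormedModule) (ker_bd m al) y 0).
    2:{ apply ex_RInt_swap; eexists. apply ker_bd_int1; easy || lra. }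
    rewrite <- E.
    2:{ apply ex_RInt_swap. eexists. apply ker_bd_int1; easy || lra. }
    transitivity (- (-1 * RInt (fun s => ker_bdc m al (y - s)) 0 y)); [fold_R; ring|].
    change (opp ?x) with (- x). f_equal. rewrite <- RInt_cscal by apply cont_ker_bdc.
    apply RInt_eq_open; [lra|]. intros x Hx. unfold ker_bdc, scal; simpl; unfold mult; simpl.
    rewrite Rabs_pos_eq by lra. f_equal. f_equal. ring. }
  assert (RInt (fun s => ker_bdc m al (y - s)) y PI = RInt (ker_bd m al) 0 (PI - y)) as ->.
  { pose proof (RInt_comp_lin (V := R_CompleteNormedModule) (ker_bd m al) 1 (- y) y PI) as E.
    replace (1 * y + - y) with 0 in E by ring. replace (1 * PI + - y) with (PI - y) in E by ring.
    rewrite <- E.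
    2:{ eexists. apply ker_bd_int1; easy || lra. }
    apply RInt_eq_open; [lra|]. intros x Hx. unfold ker_bdc, scal; simpl; unfold mult; simpl.
    rewrite Rabs_left by lra. rewrite Rmult_1_l. f_equal. ring. }
  pose proof (HB y ltac:(lra)). pose proof (HB (PI - y) ltac:(lra)).
  replace (2 / (1 - al)) with (/ (1 - al) + / (1 - al)) by (field; lra). lra.
Qed.

Lemma PI_3 : 3 < PI.
Proof. pose proof PI2_3_2. lra. Qed.

(** [r] is the representative of [y + s] in [[0, PI]] up to sign and period. Since it is at least
    [|y - s|], a decreasing majorant evaluated at [|y - s|] covers the reflected kernel too. *)
Lemma fold_point (y s : R) : 0 <= y <= PI -> 0 <= s <= PI ->
  let r := Rmin (y + s) (2 * PI - (y + s)) in
  0 <= r <= PI /\ cos (y + s) = cos r /\ Rabs (y - s) <= r.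
Proof.
  intros Hy Hs r. unfold r, Rmin. destruct Rle_dec; repeat split; try lra.
  - unfold Rabs; destruct Rcase_abs; lra.
  - rewrite <- (cos_neg (2 * PI - (y + s))). replace (- (2 * PI - (y + s))) with (y + s - 2 * PI) by ring.
    rewrite <- (cos_period (y + s - 2 * PI) 1). f_equal. simpl; ring.
  - unfold Rabs; destruct Rcase_abs; lra.
Qed.

(** One majorant for the direct and the reflected kernel. The third bound carries the larger weight
    at the reflected distance; it serves when a derivative is reflected oddly and is measured by its
    distance to the end points. *)
Lemma kernels (m : nat) (al y s : R) : 0 < al < 1 -> (1 <= m)%nat -> 0 <= y <= PI -> 0 <= s <= PI ->
  let X := 130 * (INR m * Rpower (INR m) (- al)) * ker_bdc m al (y - s) in
  fejer m (y - s) * hpow al (Rabs (y - s)) <= X /\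
  fejer m (y + s) * hpow al (Rabs (y - s)) <= X /\
  fejer m (y + s) * hpow al (Rmin (y + s) (2 * PI - (y + s))) <= X.
Proof.
  intros Ha Hm Hy Hs X. destruct (fold_point y s Hy Hs) as [Hr [Hc Hd]].
  set (r := Rmin (y + s) (2 * PI - (y + s))) in *.
  assert (0 <= 130 * (INR m * Rpower (INR m) (- al))) as HP.
  { pose proof (pos_INR m). pose proof (exp_pos (- al * ln (INR m))).
    repeat apply Rmult_le_pos; try lra. unfold Rpower; lra. }
  assert (H3 : fejer m (y + s) * hpow al r <= X).
  { rewrite (fejer_eq m _ _ Hc). eapply Rle_trans; [now apply fejer_hpow|].
    unfold X, ker_bdc. apply Rmult_le_compat_l; [easy|]. apply ker_bd_mono; [easy|]. split; [apply Rabs_pos|easy]. }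
  split; [|split]; [| |easy].
  - assert (cos (y - s) = cos (Rabs (y - s))) as Hc2.
    { unfold Rabs; destruct Rcase_abs; [now rewrite cos_neg|easy]. }
    rewrite (fejer_eq m _ _ Hc2). apply fejer_hpow; [easy| |easy]. split; [apply Rabs_pos|lra].
  - eapply Rle_trans; [|apply H3]. apply Rmult_le_compat_l; [apply fejer_pos|]. apply hpow_mono; lra.
Qed.

(** [200] is a round bound for [4 * 130 * 2 / 6]: the allowance [4 * K] of [kernel_int], the
    constant of [fejer_bound], the two halves of the integral of the majorant, and [2 * PI >= 6]. *)
Definition fejer_cst (al : R) : R := 200 / (1 - al).

Lemma fejer_cst_pos al : 0 < al < 1 -> 0 < fejer_cst al.
Proof. intros; unfold fejer_cst; apply Rdiv_lt_0_compat; lra. Qed.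

Lemma kernel_int (g : R -> R) m al y K : 0 < al < 1 -> (1 <= m)%nat -> 0 <= y <= PI -> 0 <= K -> cont g ->
  (forall s, 0 <= s <= PI -> Rabs (g s) <= 4 * K * (130 * (INR m * Rpower (INR m) (- al)) * ker_bdc m al (y - s))) ->
  Rabs (/ (2 * PI) * RInt g 0 PI) <= fejer_cst al * K * (INR m * Rpower (INR m) (- al)).
Proof.
  intros Ha Hm Hy HK Hg Hb. pose proof PI_3.
  set (P := INR m * Rpower (INR m) (- al)) in *.
  assert (0 <= P) as HP.
  { pose proof (pos_INR m). pose proof (exp_pos (- al * ln (INR m))).
    unfold P; apply Rmult_le_pos; try lra. unfold Rpower; lra. }
  rewrite Rabs_mult, Rabs_pos_eq by (left; apply Rinv_0_lt_compat; lra).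
  assert (H1 : Rabs (RInt g 0 PI) <= (520 * K * P) * (2 / (1 - al))).
  { apply Rle_trans with (RInt (fun s => (520 * K * P) * ker_bdc m al (y - s)) 0 PI).
    - apply RInt_abs_le; [lra|easy| |].
      + apply (cont_mult (fun _ => 520 * K * P)); [auto with cont|apply cont_ker_bdc].
      + intros s Hs. eapply Rle_trans; [now apply Hb|]. right; ring.
    - rewrite RInt_cscal by apply cont_ker_bdc. apply Rmult_le_compat_l; [|now apply ker_bd_int].
      apply Rmult_le_pos; [lra|easy]. }
  assert (0 < / (1 - al)) by (apply Rinv_0_lt_compat; lra).
  assert (/ (2 * PI) <= / 6) by (apply Rinv_le_contravar; lra).
  assert (0 < / (2 * PI)) by (apply Rinv_0_lt_compat; lra).
  apply Rle_trans with (/ 6 * ((520 * K * P) * (2 / (1 - al)))).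
  - apply Rmult_le_compat; try lra. apply Rabs_pos.
  - unfold fejer_cst, Rdiv. assert (0 <= K * P * / (1 - al)) by (apply Rmult_le_pos; [apply Rmult_le_pos|]; lra).
    replace (200 * / (1 - al) * K * P) with (200 * (K * P * / (1 - al))) by ring.
    replace (/ 6 * (520 * K * P * (2 * / (1 - al)))) with (1040 / 6 * (K * P * / (1 - al))) by (field; lra). lra.
Qed.

Definition holdI (al K : R) (f : R -> R) : Prop :=
  forall y s, 0 <= y <= PI -> 0 <= s <= PI -> Rabs (f y - f s) <= K * hpow al (Rabs (y - s)).

Lemma fejer_approx f m al K y : 0 < al < 1 -> (1 <= m)%nat -> 0 <= y <= PI -> 0 <= K -> cont f ->
  holdI al K f ->
  Rabs (cesaro (fun n => fcoef f n * cosn n y) m - INR m * f y) <= fejer_cst al * K * (INR m * Rpower (INR m) (- al)).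
Proof.
  intros Ha Hm Hy HK Hf Hh. pose proof PI_3.
  rewrite fejer_rep by easy.
  assert (INR m * f y = / (2 * PI) * RInt (fun s => f y * (fejer m (y - s) + fejer m (y + s))) 0 PI) as ->.
  { rewrite RInt_cscal by auto with cont. rewrite kernel_mass. field; lra. }
  rewrite <- Rmult_minus_distr_l, <- RInt_cminus by auto with cont.
  apply kernel_int with (y := y); auto with cont. intros s Hs.
  replace (f s * (fejer m (y - s) + fejer m (y + s)) - f y * (fejer m (y - s) + fejer m (y + s)))
    with ((f s - f y) * fejer m (y - s) + (f s - f y) * fejer m (y + s)) by ring.
  eapply Rle_trans; [apply Rabs_triang|]. rewrite !Rabs_mult, (Rabs_pos_eq (fejer _ _)), (Rabs_pos_eq (fejer _ (y + s)))
    by apply fejer_pos.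
  pose proof (Hh s y Hs Hy) as Hsy. rewrite (Rabs_minus_sym s y) in Hsy.
  destruct (kernels m al y s Ha Hm Hy Hs) as [K1 [K2 _]].
  pose proof (fejer_pos m (y - s)). pose proof (fejer_pos m (y + s)).
  set (X := 130 * _ * _) in *. set (h := hpow al (Rabs (y - s))) in *.
  apply Rle_trans with (K * h * fejer m (y - s) + K * h * fejer m (y + s)).
  - apply Rplus_le_compat; now apply Rmult_le_compat_r.
  - assert (0 <= X). { eapply Rle_trans; [|apply K1]. apply Rmult_le_pos; [easy|apply hpow_pos]. }
    assert (K * (fejer m (y - s) * h) <= K * X) by now apply Rmult_le_compat_l.
    assert (K * (fejer m (y + s) * h) <= K * X) by now apply Rmult_le_compat_l. nra.
Qed.

(** The derivative of order [l] of [cos (n y)], written with a phase shift so that even and odd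
    orders share one formula. *)
Definition dcosn (l n : nat) (y : R) : R := INR n ^ l * cos (INR n * y + INR l * (PI / 2)).
Lemma dcosn_0 n y : dcosn 0 n y = cosn n y.
Proof. unfold dcosn, cosn; simpl. rewrite Rmult_0_l, Rplus_0_r; ring. Qed.
Lemma dcosn_derive l n y : is_derive (dcosn l n) y (dcosn (S l) n y).
Proof.
  unfold dcosn. auto_derive; [easy|]. rewrite S_INR.
  replace (INR n * y + (INR l + 1) * (PI / 2)) with (INR n * y + INR l * (PI / 2) + PI / 2) by field.
  rewrite cos_plus, cos_PI2, sin_PI2. simpl. ring.
Qed.
Lemma cont_dcosn l n : cont (dcosn l n).
Proof. apply (cont_derive _ (dcosn (S l) n)), dcosn_derive. Qed.
#[export] Hint Resolve cont_dcosn : cont.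
Lemma dcosn_SS l n y : dcosn (S (S l)) n y = - INR n ^ 2 * dcosn l n y.
Proof.
  unfold dcosn. rewrite !S_INR. replace (INR n * y + (INR l + 1 + 1) * (PI / 2)) with (INR n * y + INR l * (PI / 2) + PI) by field.
  rewrite neg_cos. simpl; ring.
Qed.
Lemma dcosn_1 n y : dcosn 1 n y = - INR n * sin (INR n * y).
Proof. unfold dcosn. simpl (INR 1). rewrite Rmult_1_l, cos_plus, cos_PI2, sin_PI2. ring. Qed.
Lemma dcosn_0l l y : (1 <= l)%nat -> dcosn l 0 y = 0.
Proof. intros H. unfold dcosn. destruct l; [lia|]. simpl; ring. Qed.

Lemma fcoef_by_parts f df n : (forall y, is_derive f y (df y)) -> cont df ->
  RInt (fun s => f s * INR n * cosn n s) 0 PI = - RInt (fun s => df s * sin (INR n * s)) 0 PI.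
Proof.
  intros Hd Hc. assert (Hf : cont f) by now apply (cont_derive f df).
  assert (Hs : cont (fun s => sin (INR n * s))).
  { apply (cont_comp (fun s => INR n * s) sin); [auto with cont|apply cont_sin]. }
  assert (RInt (fun s => df s * sin (INR n * s) + f s * INR n * cosn n s) 0 PI = 0) as E.
  { rewrite (RInt_ftc (fun s => f s * sin (INR n * s))).
    - rewrite Rmult_0_r, sin_0. replace (sin (INR n * PI)) with 0; [fold_R; ring|].
      symmetry; apply sin_eq_0_1. exists (Z.of_nat n). now rewrite INR_IZR_INZ.
    - intros x. replace (df x * sin (INR n * x) + f x * INR n * cosn n x) with
        (df x * sin (INR n * x) + f x * (INR n * cos (INR n * x))) by (unfold cosn; ring).
      apply (is_derive_mult f (fun s => sin (INR n * s))); [apply Hd| |intros; apply Rmult_comm].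
      auto_derive; [easy|ring].
    - auto 10 with cont. }
  rewrite RInt_cplus in E by auto 10 with cont.
  assert (forall a b : R, a + b = 0 -> b = - a) as G by (intros; lra). exact (G _ _ E).
Qed.

(** After integration by parts the differentiated series is the sine series of [df], that is, the
    Fourier series of its odd extension; hence the minus sign before the reflected kernel. *)
Lemma fejer_rep_d f df m y : (forall y, is_derive f y (df y)) -> cont df ->
  cesaro (fun n => fcoef f n * dcosn 1 n y) m =
  / (2 * PI) * RInt (fun s => df s * (fejer m (y - s) - fejer m (y + s))) 0 PI.
Proof.
  intros Hd Hc. pose proof PI_3.
  assert (Hs : forall n, cont (fun s => sin (INR n * s))).
  { intros n. apply (cont_comp (fun s => INR n * s) sin); [auto with cont|apply cont_sin]. }
  assert (H1 : forall m, psum (fun n => fcoef f n * dcosn 1 n y) (S m) =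
     / (2 * PI) * RInt (fun s => df s * (dirichlet m (y - s) - dirichlet m (y + s))) 0 PI).
  { clear m. induction m.
    - simpl. rewrite dcosn_0l by lia. rewrite (RInt_eq _ (fun _ => 0)) by (intros; ring). rewrite RInt_cst. ring.
    - rewrite psum_S, IHm. simpl dirichlet.
      rewrite (RInt_eq (fun s => df s * (dirichlet m (y - s) + 2 * cosn (S m) (y - s) - (dirichlet m (y + s) + 2 * cosn (S m) (y + s))))
       (fun s => df s * (dirichlet m (y - s) - dirichlet m (y + s)) + (4 * sin (INR (S m) * y)) * (df s * sin (INR (S m) * s)))).
      + rewrite RInt_cplus, RInt_cscal by auto with cont.
        assert (fcoef f (S m) * INR (S m) = - (2 / PI) * RInt (fun s => df s * sin (INR (S m) * s)) 0 PI) as E.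
        { assert (forall a b c : R, a = - b -> c * a = - c * b) as G by (intros ? ? ? ->; ring).
          rewrite <- (G _ _ (2 / PI) (fcoef_by_parts f df (S m) Hd Hc)).
          unfold fcoef. rewrite (RInt_eq (fun s => f s * INR (S m) * cosn (S m) s) (fun s => INR (S m) * (f s * cosn (S m) s)))
            by (intros; ring). rewrite RInt_cscal; [ring|]. apply cont_mult; [|auto with cont].
          now apply (cont_derive f df). }
        rewrite dcosn_1. replace (fcoef f (S m) * (- INR (S m) * sin (INR (S m) * y))) with
          (- sin (INR (S m) * y) * (fcoef f (S m) * INR (S m))) by ring.
        rewrite E. field. lra.
      + intros s. unfold cosn.
        replace (INR (S m) * (y - s)) with (INR (S m) * y - INR (S m) * s) by ring.
        replace (INR (S m) * (y + s)) with (INR (S m) * y + INR (S m) * s) by ring.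
        rewrite cos_minus, cos_plus. ring. }
  induction m.
  - simpl. rewrite (RInt_eq _ (fun _ => 0)) by (intros; ring). rewrite RInt_cst; ring.
  - rewrite cesaro_S, IHm, H1. simpl fejer.
    rewrite <- Rmult_plus_distr_l, <- RInt_cplus by auto with cont. f_equal. apply RInt_eq; intros; ring.
Qed.

(** The odd extension of [df] is Hölder continuous across the ends because [df] vanishes there: the
    sum [df s + df y] is controlled since both points are within the reflected distance [r] of the
    same zero. *)
Lemma fejer_approx_d f df m al K y : 0 < al < 1 -> (1 <= m)%nat -> 0 <= y <= PI -> 0 <= K ->
  (forall y, is_derive f y (df y)) -> cont df -> holdI al K df -> df 0 = 0 -> df PI = 0 ->
  Rabs (cesaro (fun n => fcoef f n * dcosn 1 n y) m - INR m * df y) <= fejer_cst al * K * (INR m * Rpower (INR m) (- al)).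
Proof.
  intros Ha Hm Hy HK Hd Hf Hh H0 HP. pose proof PI_3.
  rewrite (fejer_rep_d f df) by easy.
  assert (INR m * df y = / (2 * PI) * RInt (fun s => df y * (fejer m (y - s) + fejer m (y + s))) 0 PI) as ->.
  { rewrite RInt_cscal by auto with cont. rewrite kernel_mass. field; lra. }
  rewrite <- Rmult_minus_distr_l, <- RInt_cminus by auto with cont.
  apply kernel_int with (y := y); auto with cont. intros s Hs.
  replace (df s * (fejer m (y - s) - fejer m (y + s)) - df y * (fejer m (y - s) + fejer m (y + s)))
    with ((df s - df y) * fejer m (y - s) + - ((df s + df y) * fejer m (y + s))) by ring.
  eapply Rle_trans; [apply Rabs_triang|]. rewrite Rabs_Ropp, !Rabs_mult, (Rabs_pos_eq (fejer _ _)), (Rabs_pos_eq (fejer _ (y + s)))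
    by apply fejer_pos.
  pose proof (Hh s y Hs Hy) as Hsy. rewrite (Rabs_minus_sym s y) in Hsy.
  destruct (kernels m al y s Ha Hm Hy Hs) as [K1 [_ K2]].
  pose proof (fejer_pos m (y - s)). pose proof (fejer_pos m (y + s)).
  set (X := 130 * _ * _) in *. set (h := hpow al (Rabs (y - s))) in *.
  set (r := Rmin _ _) in *.
  assert (H5 : forall z, 0 <= z <= PI -> z <= r \/ PI - z <= r -> Rabs (df z) <= K * hpow al r).
  { intros z Hz [Hr|Hr].
    - replace (df z) with (df z - df 0) by lra. eapply Rle_trans; [apply Hh; lra|].
      apply Rmult_le_compat_l; [easy|]. apply hpow_mono; [lra|]. rewrite Rabs_pos_eq; lra.
    - replace (df z) with (df z - df PI) by lra. eapply Rle_trans; [apply Hh; lra|].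
      apply Rmult_le_compat_l; [easy|]. apply hpow_mono; [lra|]. rewrite Rabs_minus_sym, Rabs_pos_eq; lra. }
  assert (H6 : Rabs (df s + df y) <= 2 * (K * hpow al r)).
  { eapply Rle_trans; [apply Rabs_triang|].
    assert (Rabs (df s) <= K * hpow al r) by (apply H5; [easy|unfold r, Rmin; destruct Rle_dec; lra]).
    assert (Rabs (df y) <= K * hpow al r) by (apply H5; [easy|unfold r, Rmin; destruct Rle_dec; lra]).
    lra. }
  apply Rle_trans with (K * h * fejer m (y - s) + 2 * (K * hpow al r) * fejer m (y + s)).
  - apply Rplus_le_compat; now apply Rmult_le_compat_r.
  - assert (0 <= X). { eapply Rle_trans; [|apply K1]. apply Rmult_le_pos; [easy|apply hpow_pos]. }
    assert (K * (fejer m (y - s) * h) <= K * X) by now apply Rmult_le_compat_l.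
    assert (K * (fejer m (y + s) * hpow al r) <= K * X) by now apply Rmult_le_compat_l. nra.
Qed.

(** * Dyadic blocks *)

(** de la Vallée-Poussin multipliers at the frequencies [2 ^ j]. *)
Definition vp_mult (j n : nat) : R :=
  match j with
  | O => match n with O => 1 | _ => 0 end
  | S i => (INR (2 * 2 ^ i - n) - INR (2 ^ i - n)) / INR (2 ^ i)
  end.
(** [vp_mult 0] is the indicator of mode [0], so the blocks telescope to all modes except the mean,
    and every block vanishes at [n = 0]. *)
Definition dyad (j n : nat) : R := vp_mult (S j) n - vp_mult j n.

Lemma pow2_ge1 j : (1 <= 2 ^ j)%nat.
Proof. induction j; simpl; lia. Qed.
Lemma INR_pow2 j : INR (2 ^ j) = 2 ^ j.
Proof. now rewrite pow_INR. Qed.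
Lemma pow2_pos j : 0 < 2 ^ j.
Proof. apply pow_lt; lra. Qed.

Lemma vp_mult_zero j n : (2 ^ j <= n)%nat -> vp_mult j n = 0.
Proof.
  intros H. destruct j; simpl in *; [destruct n; [lia|easy]|].
  replace (2 ^ j + (2 ^ j + 0) - n)%nat with 0%nat by lia. replace (2 ^ j - n)%nat with 0%nat by lia.
  simpl; unfold Rdiv; ring.
Qed.
Lemma vp_mult_one j n : (2 * n <= 2 ^ j)%nat -> vp_mult j n = 1.
Proof.
  intros H. destruct j; simpl in *; [destruct n; [easy|lia]|].
  rewrite !minus_INR by lia. rewrite plus_INR, Nat.add_0_r, INR_pow2. field. apply pow_nonzero; lra.
Qed.
Lemma dyad_lo j n : (2 * n < 2 ^ j)%nat -> dyad j n = 0.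
Proof.
  intros H. unfold dyad. rewrite !vp_mult_one; [ring| |simpl]; lia.
Qed.
Lemma dyad_hi j n : (2 * 2 ^ j <= n)%nat -> dyad j n = 0.
Proof. intros H. unfold dyad. rewrite !vp_mult_zero; [ring| |simpl]; lia. Qed.
Lemma dyad_0 j : dyad j 0 = 0.
Proof. apply dyad_lo. pose proof (pow2_ge1 j). lia. Qed.

Definition vpsum (j : nat) (a : nat -> R) : R := psum (fun n => vp_mult j n * a n) (2 ^ j).
Definition dyblock (j : nat) (a : nat -> R) : R := psum (fun n => dyad j n * a n) (2 * 2 ^ j).

Lemma dyblock_vpsum j a : dyblock j a = vpsum (S j) a - vpsum j a.
Proof.
  unfold dyblock, vpsum, dyad.
  rewrite <- (psum_tail (fun n => vp_mult j n * a n) (2 ^ j) (2 ^ S j)).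
  - rewrite <- psum_minus. apply psum_ext. intros; ring.
  - simpl; lia.
  - intros i Hi. rewrite vp_mult_zero by easy. ring.
Qed.
Lemma vpsum_tele J a : psum (fun j => dyblock j a) J = vpsum J a - a 0%nat.
Proof.
  induction J.
  - unfold vpsum; simpl; ring.
  - simpl psum. rewrite IHJ, dyblock_vpsum. ring.
Qed.
(** A difference of two Cesàro sums: the multiplier equals [1] on low modes and yet inherits the
    uniform bounds of the Fejér means. *)
Lemma vpsum_cesaro j a : vpsum (S j) a = (cesaro a (2 * 2 ^ j) - cesaro a (2 ^ j)) / INR (2 ^ j).
Proof.
  unfold vpsum. rewrite (cesaro_psum a (2 ^ j) (2 ^ S j)), (cesaro_psum a _ (2 ^ S j)) by (simpl; lia).
  rewrite <- psum_minus. unfold Rdiv. rewrite Rmult_comm, <- psum_scal. apply psum_ext. intros i _.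
  unfold vp_mult, Rdiv. ring.
Qed.

Lemma ratio_Rpower al j : Rpower (INR (2 ^ j)) (- al) = ratio al ^ j.
Proof.
  rewrite INR_pow2. unfold ratio. rewrite <- (Rpower_pow j (Rpower 2 (- al))) by apply exp_pos.
  rewrite <- (Rpower_pow j 2) by lra. rewrite !Rpower_mult. f_equal; ring.
Qed.

(** Stated for an arbitrary sequence [a] with limit [F], because it is applied both to a cosine
    series and to its differentiated series. *)
Lemma dyadic_approx (a : nat -> R) F B al : 0 < al < 1 -> 0 <= B ->
  (forall m, (1 <= m)%nat -> Rabs (cesaro a m - INR m * F) <= B * (INR m * Rpower (INR m) (- al))) ->
  forall j, Rabs (vpsum j a - F) <= 6 * B * ratio al ^ j.
Proof.
  intros Ha HB H j. destruct j.
  - specialize (H 1%nat ltac:(lia)). unfold vpsum. simpl in *.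

    assert (Rpower 1 (- al) = 1) as E by (unfold Rpower; now rewrite ln_1, Rmult_0_r, exp_0).
    rewrite E in H. replace (0 + 1 * a 0%nat - F) with (0 + (0 + a 0%nat) - 1 * F) by ring. lra.
  - rewrite vpsum_cesaro. pose proof (ratio_bounds al Ha) as Hr. pose proof (pow2_ge1 j) as Hj.
    pose proof (H (2 ^ j)%nat Hj) as H1. pose proof (H (2 * 2 ^ j)%nat ltac:(lia)) as H2.
    change (2 * 2 ^ j)%nat with (2 ^ S j)%nat in H2 at 2 3 4. rewrite !ratio_Rpower in *.
    change (2 ^ S j)%nat with (2 * 2 ^ j)%nat in H2. rewrite mult_INR in H2.
    pose proof (lt_INR 0 (2 ^ j) ltac:(lia)) as Hp. change (INR 0) with 0 in Hp. change (INR 2) with 2 in *.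
    set (m := INR (2 ^ j)) in *. set (C1 := cesaro a (2 ^ j)) in *. set (C2 := cesaro a (2 * 2 ^ j)) in *.
    assert (Hrj : 0 < ratio al ^ j) by (apply pow_lt; lra).
    replace ((C2 - C1) / m - F) with (((C2 - 2 * m * F) + - (C1 - m * F)) / m) by (field; lra).
    unfold Rdiv. rewrite Rabs_mult, (Rabs_pos_eq (/ m)) by (left; now apply Rinv_0_lt_compat).
    apply (Rmult_le_reg_r m); [easy|]. rewrite Rmult_assoc, Rinv_l, Rmult_1_r by lra.
    eapply Rle_trans; [apply Rabs_triang|]. rewrite Rabs_Ropp. simpl pow in *.
    set (q := ratio al ^ j) in *.
    assert (B * (2 * m * (ratio al * q)) <= B * m * q * 2).
    { replace (B * (2 * m * (ratio al * q))) with (B * m * q * (2 * ratio al)) by ring.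
      apply Rmult_le_compat_l; [|lra]. repeat apply Rmult_le_pos; lra. }
    assert (0 <= B * m * q) by (repeat apply Rmult_le_pos; lra). nra.
Qed.
Lemma dyadic_block (a : nat -> R) F B al : 0 < al < 1 -> 0 <= B ->
  (forall m, (1 <= m)%nat -> Rabs (cesaro a m - INR m * F) <= B * (INR m * Rpower (INR m) (- al))) ->
  forall j, Rabs (dyblock j a) <= 12 * B * ratio al ^ j.
Proof.
  intros Ha HB H j. rewrite dyblock_vpsum. pose proof (dyadic_approx a F B al Ha HB H) as HD.
  pose proof (HD j) as H1. pose proof (HD (S j)) as H2. pose proof (ratio_bounds al Ha) as Hr.
  replace (vpsum (S j) a - vpsum j a) with ((vpsum (S j) a - F) + - (vpsum j a - F)) by ring.
  eapply Rle_trans; [apply Rabs_triang|]. rewrite Rabs_Ropp. simpl in H2.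
  assert (Hrj : 0 < ratio al ^ j) by (apply pow_lt; lra).
  assert (0 <= B * ratio al ^ j) by (apply Rmult_le_pos; lra). nra.
Qed.

(** * Multipliers on a block and the inequalities of Bernstein and Jackson *)

Lemma abel_block (L : nat -> nat -> R) (N : nat) (B : R) : (1 <= N)%nat -> 0 <= B ->
  (forall m k, (2 * k <= N)%nat -> L m k = 0) -> (forall m, L m 1%nat = 0) ->
  (forall m, (2 <= m)%nat -> (N < 2 * m)%nat -> (m <= 2 * N)%nat ->
     Rabs (L (S m) m - 2 * L m m + L (pred m) m) <= B / INR N) ->
  Rabs (L (2 * N)%nat (S (2 * N)) - L (S (2 * N)) (2 * N)%nat) <= B ->
  Rabs (psum (fun i => L (S i) (S (S i)) - 2 * L (S i) (S i) + L (S i) i) (2 * N)) <= 3 * B.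
Proof.
  intros HN HB H0 H1 H2 H3. rewrite abel; [|intros; apply H0; lia|easy].
  pose proof (lt_INR 0 N ltac:(lia)) as Hp. change (INR 0) with 0 in Hp.
  assert (Hs : Rabs (psum (fun i => L (S (S i)) (S i) - 2 * L (S i) (S i) + L i (S i)) (2 * N)) <= 2 * B).
  (* There are [2 * N] terms of size at most [B / N], those below the block being zero. The boundary
     term contributes the third [B]. *)
  { eapply Rle_trans; [apply psum_abs|]. apply Rle_trans with (psum (fun _ => B / INR N) (2 * N)).
    - apply psum_le. intros i Hi.
      assert (0 <= B / INR N) by (apply Rdiv_le_0_compat; lra).
      destruct (Nat.eq_dec i 0) as [->|Hi0].
      { rewrite !H1. rewrite Rmult_0_r, Rminus_0_r, Rplus_0_r, Rabs_R0. easy. }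
      destruct (Nat.le_gt_cases (2 * S i) N).
      { rewrite !H0 by lia. rewrite Rmult_0_r, Rminus_0_r, Rplus_0_r, Rabs_R0. easy. }
      apply (H2 (S i)); lia.
    - rewrite psum_const, mult_INR. simpl (INR 2). right; field; lra. }
  rewrite H1, (H0 _ 0%nat) by lia. rewrite Rminus_0_r, Rplus_0_r.
  unfold Rminus at 1. rewrite Rplus_assoc.
  eapply Rle_trans; [apply Rabs_triang|]. unfold Rminus in H3. lra.
Qed.

Definition in_block (N : nat) (c : nat -> R) : Prop :=
  (forall n, (2 * n < N)%nat -> c n = 0) /\ (forall n, (2 * N < n)%nat -> c n = 0).

Lemma acos_fold y : exists s, 0 <= s <= PI /\ cos y = cos s.
Proof.
  exists (acos (cos y)). split; [apply acos_bound|]. rewrite cos_acos; [easy|]. apply COS_bound.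
Qed.

Lemma sup_fold (c : nat -> R) M d :
  (forall s, 0 <= s <= PI -> Rabs (psum (fun k => c k * cosn k s) M) <= d) ->
  forall y, Rabs (psum (fun k => c k * cosn k y) M) <= d.
Proof.
  intros H y. destruct (acos_fold y) as [s [Hs E]].
  rewrite (psum_ext _ (fun k => c k * cosn k s)); [now apply H|].
  intros i _. now rewrite (cosn_eq i y s E).
Qed.

(** The terms [c k * cosn k y] are second differences of Cesàro sums of size at most [m * d].
    Summing by parts twice moves the differences onto [phi], where they gain [N ^ -2] if [phi]
    varies at the scale of the block. *)
Lemma mult_block (phi : nat -> R) (c : nat -> R) (N : nat) (B d : R) : (1 <= N)%nat -> 0 <= B -> 0 <= d ->
  in_block N c ->
  (forall y, Rabs (psum (fun k => c k * cosn k y) (S (2 * N))) <= d) ->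
  (forall m, (2 <= m)%nat -> (N < 2 * m)%nat -> (m <= 2 * N)%nat ->
     Rabs (phi (S m) - 2 * phi m + phi (pred m)) * INR m <= B / INR N) ->
  Rabs (phi (2 * N)%nat) + Rabs (phi (2 * N)%nat - phi (S (2 * N))) * INR (2 * N) <= B ->
  forall y, Rabs (psum (fun k => phi k * (c k * cosn k y)) (S (2 * N))) <= 3 * (B * d).
Proof.
  intros HN HB Hd [Hc0 Hc1] Hs H2 H3 y. set (a := fun k => c k * cosn k y).
  assert (Hf : forall m, Rabs (cesaro a m) <= INR m * d).
  { intros m. apply fejer_poly with (M := (2 * N)%nat); [|intros; apply Hs]. intros n Hn; apply Hc1; lia. }
  rewrite psum_shift. rewrite (Hc0 0%nat) by lia. rewrite Rmult_0_l, Rmult_0_r, Rplus_0_l.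
  rewrite (psum_ext _ (fun i => phi (S i) * cesaro a (S (S i)) - 2 * (phi (S i) * cesaro a (S i)) + phi (S i) * cesaro a i)).
  2:{ intros i _. change (c (S i) * cosn (S i) y) with (a (S i)). rewrite <- (cesaro_diff2 a i). ring. }
  apply (abel_block (fun m k => phi m * cesaro a k)); [easy|now apply Rmult_le_pos| | | |].
  - intros m k Hk. rewrite cesaro_zero; [ring|]. intros i Hi. unfold a. rewrite Hc0 by lia. ring.
  - intros m. rewrite cesaro_zero; [ring|]. intros i Hi. unfold a. rewrite Hc0 by lia. ring.
  - intros m Hm1 Hm2 Hm3. replace (phi (S m) * cesaro a m - 2 * (phi m * cesaro a m) + phi (pred m) * cesaro a m)
      with ((phi (S m) - 2 * phi m + phi (pred m)) * cesaro a m) by ring.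
    rewrite Rabs_mult. apply Rle_trans with (Rabs (phi (S m) - 2 * phi m + phi (pred m)) * (INR m * d)).
    + apply Rmult_le_compat_l; [apply Rabs_pos|apply Hf].
    + rewrite <- Rmult_assoc. replace (B * d / INR N) with (B / INR N * d) by (unfold Rdiv; ring).
      apply Rmult_le_compat_r; [easy|]. now apply H2.
  (* The boundary term is split so that the full block sum, bounded by [d], appears, while the large
     Cesàro sum is multiplied by a difference of [phi]. *)
  - replace (phi (2 * N)%nat * cesaro a (S (2 * N)) - phi (S (2 * N)) * cesaro a (2 * N)) with
      (phi (2 * N)%nat * psum a (S (2 * N)) + (phi (2 * N)%nat - phi (S (2 * N))) * cesaro a (2 * N))
      by (rewrite cesaro_S; ring).
    eapply Rle_trans; [apply Rabs_triang|]. rewrite !Rabs_mult.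
    apply Rle_trans with ((Rabs (phi (2 * N)%nat) + Rabs (phi (2 * N)%nat - phi (S (2 * N))) * INR (2 * N)) * d).
    + rewrite Rmult_plus_distr_r. apply Rplus_le_compat.
      * apply Rmult_le_compat_l; [apply Rabs_pos|apply Hs].
      * rewrite Rmult_assoc. apply Rmult_le_compat_l; [apply Rabs_pos|apply Hf].
    + now apply Rmult_le_compat_r.
Qed.

(** The second derivative keeps cosines and is the multiplier [- k ^ 2], whose second differences
    are the constant [-2]. *)
Lemma bernstein2 (c : nat -> R) N d : (1 <= N)%nat -> 0 <= d -> in_block N c ->
  (forall y, Rabs (psum (fun k => c k * cosn k y) (S (2 * N))) <= d) ->
  forall y, Rabs (psum (fun k => - INR k ^ 2 * c k * cosn k y) (S (2 * N))) <= 60 * INR N ^ 2 * d.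
Proof.
  intros HN Hd Hc Hs y. pose proof (le_INR 1 N HN) as Hp. simpl in Hp.
  rewrite (psum_ext _ (fun k => - INR k ^ 2 * (c k * cosn k y))) by (intros; ring).
  replace (60 * INR N ^ 2 * d) with (3 * (20 * INR N ^ 2 * d)) by ring.
  apply (mult_block (fun k => - INR k ^ 2)); try easy.
  - nra.
  - intros m Hm1 Hm2 Hm3. destruct m as [|m]; [lia|]. simpl pred. rewrite !S_INR.
    replace (- (INR m + 1 + 1) ^ 2 - 2 * - (INR m + 1) ^ 2 + - INR m ^ 2) with (- (2)) by ring.
    rewrite Rabs_Ropp, Rabs_pos_eq by lra. apply le_INR in Hm3. rewrite mult_INR, S_INR in Hm3. simpl (INR 2) in Hm3.
    replace (20 * INR N ^ 2 / INR N) with (20 * INR N) by (field; lra). lra.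
  - rewrite S_INR, mult_INR. simpl (INR 2). rewrite Rabs_Ropp, Rabs_pos_eq by nra.
    replace (- (2 * INR N) ^ 2 - - (2 * INR N + 1) ^ 2) with (4 * INR N + 1) by ring.
    rewrite Rabs_pos_eq by lra. nra.
Qed.

(** Even orders are multipliers. A first derivative is a sine polynomial and is recovered by
    Landau's interpolation between orders [0] and [2] on an interval of length [1 / N];
    [62 = 60 + 2] collects both terms. The induction therefore carries two consecutive orders. *)
Lemma bernstein (l : nat) : forall (c : nat -> R) N d, (1 <= N)%nat -> 0 <= d -> in_block N c ->
  (forall y, Rabs (psum (fun k => c k * cosn k y) (S (2 * N))) <= d) ->
  forall y, Rabs (psum (fun k => c k * dcosn l k y) (S (2 * N))) <= 62 ^ l * INR N ^ l * d.
Proof.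
  enough (H : forall l,
   (forall c N d, (1 <= N)%nat -> 0 <= d -> in_block N c ->
     (forall y, Rabs (psum (fun k => c k * cosn k y) (S (2 * N))) <= d) ->
     forall y, Rabs (psum (fun k => c k * dcosn l k y) (S (2 * N))) <= 62 ^ l * INR N ^ l * d) /\
   (forall c N d, (1 <= N)%nat -> 0 <= d -> in_block N c ->
     (forall y, Rabs (psum (fun k => c k * cosn k y) (S (2 * N))) <= d) ->
     forall y, Rabs (psum (fun k => c k * dcosn (S l) k y) (S (2 * N))) <= 62 ^ S l * INR N ^ S l * d)) by apply (H l).
  clear l. intros l. induction l as [|l [IH1 IH2]].
  - split.
    + intros c N d HN Hd Hc Hs y. rewrite (psum_ext _ (fun k => c k * cosn k y)) by (intros; now rewrite dcosn_0).
      simpl. rewrite !Rmult_1_l. apply Hs.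
    + intros c N d HN Hd Hc Hs y. pose proof (le_INR 1 N HN) as Hp. simpl in Hp.
      pose proof (bernstein2 c N d HN Hd Hc Hs) as H2.
      set (T0 := fun y => psum (fun k => c k * cosn k y) (S (2 * N))).
      set (T1 := fun y => psum (fun k => c k * dcosn 1 k y) (S (2 * N))).
      set (T2 := fun y => psum (fun k => - INR k ^ 2 * c k * cosn k y) (S (2 * N))).
      assert (HT0 : forall y, is_derive T0 y (T1 y)).
      { intros z. apply (psum_derive (fun k y => c k * cosn k y) (fun k y => c k * dcosn 1 k y)). intros i.
        apply (is_derive_ext (fun y => scal (c i) (dcosn 0 i y))); [intros; unfold scal; simpl; unfold mult; simpl; now rewrite dcosn_0|].
        apply (is_derive_scal (dcosn 0 i) z (c i)), dcosn_derive. }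
      assert (HT1 : forall y, is_derive T1 y (T2 y)).
      { intros z. unfold T2.
        rewrite (psum_ext _ (fun k => c k * dcosn 2 k z)) by (intros; rewrite dcosn_SS, dcosn_0; ring).
        apply (psum_derive (fun k y => c k * dcosn 1 k y) (fun k y => c k * dcosn 2 k y)). intros i.
        apply (is_derive_scal (dcosn 1 i) z (c i)), dcosn_derive. }
      assert (Hi : 0 < / INR N) by (apply Rinv_0_lt_compat; lra).
      (* At [xi] the slope is at most [2 * d * N]; over the distance to [y], at most [1 / N], it
         changes by at most [60 * N * d]. *)
      destruct (mvt T0 T1 y (y + / INR N)) as [xi [Hxi E]]; [intros; apply HT0|].
      rewrite Rmin_left, Rmax_right in Hxi by lra.
      pose proof (mvt_le T1 T2 y (y + / INR N) xi y (60 * INR N ^ 2 * d) ltac:(lra) ltac:(lra)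
        ltac:(intros; apply HT1) ltac:(intros; apply H2)) as HM.
      fold (T1 y).
      assert (Rabs (T1 xi) <= 2 * d * INR N).
      { replace (T1 xi) with ((T0 (y + / INR N) - T0 y) * INR N) by (rewrite E; field; lra).
        rewrite Rabs_mult, (Rabs_pos_eq (INR N)) by lra. apply Rmult_le_compat_r; [lra|].
        unfold Rminus. eapply Rle_trans; [apply Rabs_triang|]. rewrite Rabs_Ropp.
        pose proof (Hs (y + / INR N)). pose proof (Hs y). unfold T0. lra. }
      assert (60 * INR N ^ 2 * d * Rabs (y - xi) <= 60 * INR N * d).
      { replace (60 * INR N * d) with (60 * INR N ^ 2 * d * / INR N) by (field; lra).
        apply Rmult_le_compat_l; [|rewrite Rabs_left1; lra]. nra. }
      replace (T1 y) with ((T1 y - T1 xi) + T1 xi) by ring.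
      eapply Rle_trans; [apply Rabs_triang|]. nra.
  - split; [exact IH2|]. intros c N d HN Hd Hc Hs y. pose proof (le_INR 1 N HN) as Hp. simpl in Hp.
    rewrite (psum_ext _ (fun k => (- INR k ^ 2 * c k) * dcosn l k y)) by (intros; rewrite dcosn_SS; ring).
    assert (0 <= 62 ^ l * INR N ^ l) by (apply Rmult_le_pos; apply pow_le; lra).
    eapply Rle_trans; [apply (IH1 (fun k => - INR k ^ 2 * c k) N (60 * INR N ^ 2 * d))|].
    + easy.
    + nra.
    + destruct Hc as [Hc0 Hc1]. split; intros; [rewrite Hc0|rewrite Hc1]; try easy; ring.
    + now apply bernstein2.
    + simpl. replace (62 ^ l * INR N ^ l * (60 * (INR N * (INR N * 1)) * d)) with ((62 ^ l * INR N ^ l) * (60 * (INR N ^ 2 * d))) by ring.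
      replace (62 * (62 * 62 ^ l) * (INR N * (INR N * INR N ^ l)) * d) with ((62 ^ l * INR N ^ l) * (3844 * (INR N ^ 2 * d))) by ring.
      apply Rmult_le_compat_l; [easy|]. nra.
Qed.

Lemma dyad_in_block j (b : nat -> R) : in_block (2 ^ j) (fun n => dyad j n * b n).
Proof.
  split; intros n Hn.
  - rewrite dyad_lo by easy; ring.
  - rewrite dyad_hi by lia; ring.
Qed.
Lemma dyblock_psum j (b : nat -> R) y : dyblock j (fun n => b n * cosn n y) = psum (fun k => (dyad j k * b k) * cosn k y) (S (2 * 2 ^ j)).
Proof.
  unfold dyblock. rewrite psum_S, dyad_hi by lia.
  rewrite (psum_ext (fun n => dyad j n * (b n * cosn n y)) (fun k => dyad j k * b k * cosn k y)) by (intros; ring). ring.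
Qed.

Lemma jackson0 f al K j : 0 < al < 1 -> 0 <= K -> cont f -> holdI al K f ->
  forall y, Rabs (dyblock j (fun n => fcoef f n * cosn n y)) <= 12 * fejer_cst al * K * ratio al ^ j.
Proof.
  intros Ha HK Hf Hh y. rewrite dyblock_psum. apply sup_fold. intros s Hs. rewrite <- dyblock_psum.
  replace (12 * fejer_cst al * K) with (12 * (fejer_cst al * K)) by ring.
  apply dyadic_block with (F := f s); [easy|apply Rmult_le_pos; [left; now apply fejer_cst_pos|easy]|].
  intros m Hm. now apply fejer_approx.
Qed.

(** Geometric mean of the two bounds. It makes a function with increments at most [A] and slope at
    most [D] Hölder continuous of exponent [1 / 2]. *)
Lemma interp_half x A D d : 0 <= x -> 0 <= d -> 0 <= A -> 0 <= D -> x <= A -> x <= D * d -> x <= sqrt (A * D) * hpow (/ 2) d.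
Proof.
  intros Hx Hd HA HD H1 H2.
  assert (hpow (/ 2) d = sqrt d) as ->.
  { destruct (Req_dec d 0) as [->|]; [rewrite hpow_0, sqrt_0; easy|]. rewrite hpow_Rpower by lra. apply Rpower_sqrt; lra. }
  assert (0 <= A * D) by nra.
  rewrite <- sqrt_mult by easy. rewrite <- (sqrt_square x) at 1 by easy. apply sqrt_le_1_alt. nra.
Qed.

(** The size of a block has to be recovered from that of its derivative, a sine polynomial and so
    outside [mult_block]. The block [T], with supremum [g] and slope [D], is [1 / 2]-Hölder with
    constant [sqrt (2 * g * D)]; having no low frequencies, it is its own error of Fejér
    approximation, which gives [g <= 400 * sqrt (2 * g * D) / sqrt m] and thus a bound of order
    [D / m]. *)
Lemma jackson1 f df al K j : 0 < al < 1 -> 0 <= K -> (forall y, is_derive f y (df y)) -> cont df ->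
  holdI al K df -> df 0 = 0 -> df PI = 0 ->
  forall y, Rabs (dyblock j (fun n => fcoef f n * cosn n y)) <= 7680000 * fejer_cst al * K * ratio al ^ j / 2 ^ j.
Proof.
  intros Ha HK Hd Hc Hh H0 HP y. pose proof (ratio_bounds al Ha) as Hr. pose proof (fejer_cst_pos al Ha) as HCB.
  rewrite dyblock_psum. revert y. apply sup_fold.
  set (T := fun y => dyblock j (fun n => fcoef f n * cosn n y)).
  set (T1 := fun y => dyblock j (fun n => fcoef f n * dcosn 1 n y)).
  set (D := 12 * (fejer_cst al * K) * ratio al ^ j).
  assert (HD : 0 <= D). { unfold D. apply Rmult_le_pos; [apply Rmult_le_pos; [lra|apply Rmult_le_pos; lra]|apply pow_le; lra]. }
  assert (HT1 : forall s, 0 <= s <= PI -> Rabs (T1 s) <= D).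
  { intros s Hs. apply dyadic_block with (F := df s); [easy|apply Rmult_le_pos; lra|].
    intros m Hm. now apply fejer_approx_d. }
  assert (HT : forall s, is_derive T s (T1 s)).
  { intros z. apply (psum_derive (fun k y => dyad j k * (fcoef f k * cosn k y)) (fun k y => dyad j k * (fcoef f k * dcosn 1 k y))). intros i.
    apply (is_derive_ext (fun y => scal (dyad j i * fcoef f i) (dcosn 0 i y))).
    { intros; unfold scal; simpl; unfold mult; simpl. rewrite dcosn_0. fold_R; ring. }
    replace (dyad j i * (fcoef f i * dcosn 1 i z)) with ((dyad j i * fcoef f i) * dcosn 1 i z) by ring.
    apply (is_derive_scal (dcosn 0 i) z (dyad j i * fcoef f i)), dcosn_derive. }
  assert (HTc : cont T) by (apply (cont_derive T T1 HT)).
  destruct (continuity_ab_maj (fun s => Rabs (T s)) 0 PI) as [s0 [Hmax Hs0]].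
  { pose proof PI_3; lra. }
  { intros c _. apply pt_cont. auto with cont. }
  set (g := Rabs (T s0)) in *. assert (Hg : 0 <= g) by apply Rabs_pos.
  assert (Hhalf : holdI (/ 2) (sqrt (2 * g * D)) T).
  { intros y s Hy Hs. apply interp_half; try lra; try apply Rabs_pos.
    - unfold Rminus. eapply Rle_trans; [apply Rabs_triang|]. rewrite Rabs_Ropp.
      pose proof (Hmax y Hy). pose proof (Hmax s Hs). lra.
    - apply (mvt_le T T1 0 PI s y D Hs Hy); [intros; apply HT|easy]. }
  (* The Fejér sum of order [m] uses the modes [n < m] only, and the block vanishes on all of
     them. *)
  set (m := match j with O => 1%nat | S i => (2 ^ i)%nat end).
  assert (Hm1 : (1 <= m)%nat) by (unfold m; destruct j; [lia|apply pow2_ge1]).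
  assert (Hm2 : 2 ^ j <= 2 * INR m).
  { unfold m; destruct j; [simpl; lra|]. rewrite INR_pow2. simpl; lra. }
  pose proof (fejer_approx T m (/ 2) (sqrt (2 * g * D)) s0 ltac:(lra) Hm1 Hs0 (sqrt_pos _) HTc Hhalf) as HF.
  rewrite cesaro_zero in HF.
  2:{ intros i Hi. assert (fcoef T i = dyad j i * fcoef f i) as ->.
      { unfold T. rewrite (fcoef_ext _ (fun y => psum (fun k => (dyad j k * fcoef f k) * cosn k y) (S (2 * 2 ^ j))))
          by (intros; apply dyblock_psum). rewrite fcoef_poly; [easy|].
        unfold m in Hi. destruct j; [lia|]. pose proof (pow2_ge1 j). simpl. lia. }
      rewrite dyad_lo; [ring|]. unfold m in Hi. destruct j; simpl; lia. }
  pose proof (le_INR 1 m Hm1) as Hmp. simpl in Hmp.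
  assert (HF2 : g <= 400 * sqrt (2 * g * D) * Rpower (INR m) (- / 2)).
  { replace (0 - INR m * T s0) with (- (INR m * T s0)) in HF by ring.
    rewrite Rabs_Ropp, Rabs_mult, Rabs_pos_eq in HF by lra. fold g in HF.
    unfold fejer_cst in HF. replace (200 / (1 - / 2)) with 400 in HF by field.
    apply (Rmult_le_reg_l (INR m)); [lra|]. lra. }
  assert (HF3 : g <= 320000 * D / INR m).
  { destruct (Req_dec g 0) as [->|Hg0]; [apply Rdiv_le_0_compat; nra|].
    apply (Rmult_le_reg_l g); [lra|].
    set (u := sqrt (2 * g * D)) in *. set (v := Rpower (INR m) (- / 2)) in *.
    assert (Hu : u * u = 2 * g * D) by (apply sqrt_sqrt; nra).
    assert (Hv : v * v = / INR m).
    { unfold v. rewrite <- Rpower_plus. replace (- / 2 + - / 2) with (- (1)) by field.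
      rewrite Rpower_Ropp, Rpower_1; lra. }
    assert (0 <= u) by apply sqrt_pos. assert (0 < v) by apply exp_pos.
    apply Rle_trans with ((400 * u * v) * (400 * u * v)).
    - apply Rmult_le_compat; lra.
    - replace (400 * u * v * (400 * u * v)) with (160000 * ((u * u) * (v * v))) by ring. rewrite Hu, Hv. right; field; lra. }
  intros s Hs. rewrite <- dyblock_psum. fold (T s). eapply Rle_trans; [apply (Hmax s Hs)|].
  eapply Rle_trans; [apply HF3|].
  pose proof (pow2_pos j) as H2j.
  (* [7680000 = 320000 * 12 * 2], where [320000 = 2 * 400 ^ 2] comes from squaring the inequality
     for [g]. *)
  replace (7680000 * fejer_cst al * K * ratio al ^ j / 2 ^ j) with (320000 * D * (2 / 2 ^ j)) by (unfold D; field; lra).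
  unfold Rdiv at 1. apply Rmult_le_compat_l; [lra|].
  replace (2 / 2 ^ j) with (/ (2 ^ j / 2)) by (field; lra). apply Rinv_le_contravar; lra.
Qed.

Lemma fcoef_second f df ddf n : (forall y, is_derive f y (df y)) -> (forall y, is_derive df y (ddf y)) -> cont ddf ->
  df 0 = 0 -> df PI = 0 -> fcoef ddf n = - INR n ^ 2 * fcoef f n.
Proof.
  intros Hf Hdf Hc H0 HP. assert (Hcd : cont df) by now apply (cont_derive df ddf).
  assert (Hs : cont (fun s => sin (INR n * s))).
  { apply (cont_comp (fun s => INR n * s) sin); [auto with cont|apply cont_sin]. }
  assert (RInt (fun s => ddf s * cosn n s - INR n * (df s * sin (INR n * s))) 0 PI = 0) as E.
  { rewrite (RInt_ftc (fun s => df s * cosn n s)).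
    - rewrite H0, HP. fold_R; ring.
    - intros x. replace (ddf x * cosn n x - INR n * (df x * sin (INR n * x))) with
        (ddf x * cosn n x + df x * dcosn 1 n x) by (rewrite dcosn_1; ring).
      apply (is_derive_mult df (cosn n)); [apply Hdf| |intros; apply Rmult_comm].
      apply (is_derive_ext (dcosn 0 n)); [intros; apply dcosn_0|apply dcosn_derive].
    - auto 10 with cont. }
  rewrite RInt_cminus, RInt_cscal in E by auto with cont.
  pose proof (fcoef_by_parts f df n Hf Hcd) as E2.
  rewrite (RInt_eq (fun s => f s * INR n * cosn n s) (fun s => INR n * (f s * cosn n s))) in E2 by (intros; ring).
  assert (cont f) by now apply (cont_derive f df). rewrite RInt_cscal in E2 by auto with cont.
  unfold fcoef.
  assert (forall k a b c d : R, a - d * b = 0 -> d * c = - b -> k * a = - d ^ 2 * (k * c)) as G.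
  { intros k a b c d E3 E4. replace a with (d * b) by lra. replace b with (- (d * c)) by lra. ring. }
  exact (G _ _ _ _ _ E E2).
Qed.

(** Division by [- k ^ 2] is a multiplier whose second differences on the block are of order
    [N ^ -4], so two derivatives gain [N ^ -2] by [mult_block] alone. *)
Lemma jackson_up f df ddf j B : (forall y, is_derive f y (df y)) -> (forall y, is_derive df y (ddf y)) -> cont ddf ->
  df 0 = 0 -> df PI = 0 -> 0 <= B ->
  (forall y, Rabs (dyblock j (fun n => fcoef ddf n * cosn n y)) <= B) ->
  forall y, Rabs (dyblock j (fun n => fcoef f n * cosn n y)) <= 400 * B / (2 ^ j) ^ 2.
Proof.
  intros Hf Hdf Hc H0 HP HB Hs y.
  pose proof (pow2_ge1 j) as HN. set (N := (2 ^ j)%nat) in *. rewrite <- INR_pow2. fold N.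
  pose proof (le_INR 1 N HN) as HNp. simpl in HNp.
  assert (Hf0 : forall k, dyad j k * fcoef f k = (- / INR k ^ 2) * (dyad j k * fcoef ddf k)).
  { intros k. rewrite (fcoef_second f df ddf k Hf Hdf Hc H0 HP). destruct k.
    - rewrite dyad_0. ring.
    - assert (INR (S k) <> 0) by (apply not_0_INR; lia). field; easy. }
  rewrite dyblock_psum. fold N.
  rewrite (psum_ext _ (fun k => (- / INR k ^ 2) * ((dyad j k * fcoef ddf k) * cosn k y))).
  2:{ intros. rewrite Hf0. ring. }
  replace (400 * B / INR N ^ 2) with (3 * ((400 / 3 / INR N ^ 2) * B)) by (field; lra).
  apply (mult_block (fun k => - / INR k ^ 2)).
  - easy.
  - apply Rdiv_le_0_compat; nra.
  - easy.
  - apply dyad_in_block.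
  - intros z. unfold N. rewrite <- dyblock_psum. apply Hs.
  - intros m Hm1 Hm2 Hm3. destruct m as [|m]; [lia|]. simpl pred. rewrite !S_INR.
    assert (1 <= INR m) by (change 1 with (INR 1); apply le_INR; lia).
    apply lt_INR in Hm2. rewrite mult_INR, (S_INR m) in Hm2. simpl (INR 2) in Hm2.
    set (x := INR m + 1) in *. replace (INR m) with (x - 1) by (unfold x; ring).
    assert (2 <= x) by (unfold x; lra).
    (* The second difference of [1 / x ^ 2] in closed form; [x >= 2] gives
       [x ^ 2 - 1 >= 3 / 4 * x ^ 2] and makes it of order [x ^ -4]. *)
    replace (- / (x + 1) ^ 2 - 2 * - / x ^ 2 + - / (x - 1) ^ 2) with
      (- ((6 * x ^ 2 - 2) / (x ^ 2 * (x ^ 2 - 1) ^ 2))) by (field; split; [nra|split; nra]).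
    rewrite Rabs_Ropp, Rabs_pos_eq.
    2:{ apply Rdiv_le_0_compat; [nra|]. apply Rmult_lt_0_compat; [nra|]. apply pow_lt; nra. }
    assert (Hx4 : 9 / 16 * x ^ 4 <= (x ^ 2 - 1) ^ 2).
    { replace (9 / 16 * x ^ 4) with ((3 / 4 * x ^ 2) ^ 2) by field. apply pow_incr. nra. }
    assert (0 < x ^ 2) by nra. assert (0 < x ^ 4) by (apply pow_lt; lra).
    apply Rle_trans with (6 * x ^ 2 / (x ^ 2 * (9 / 16 * x ^ 4)) * x).
    { apply Rmult_le_compat_r; [lra|]. unfold Rdiv at 1 2. apply Rmult_le_compat.
      - nra.
      - left; apply Rinv_0_lt_compat. apply Rmult_lt_0_compat; [easy|]. apply pow_lt; nra.
      - lra.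
      - apply Rinv_le_contravar; [nra|]. apply Rmult_le_compat_l; lra. }
    replace (6 * x ^ 2 / (x ^ 2 * (9 / 16 * x ^ 4)) * x) with (32 / 3 * / (x ^ 3)) by (field; lra).
    replace (400 / 3 / INR N ^ 2 / INR N) with (400 / 3 * / (INR N ^ 3)) by (field; lra).
    apply Rle_trans with (32 / 3 * / ((INR N / 2) ^ 3)).
    + apply Rmult_le_compat_l; [lra|]. apply Rinv_le_contravar; [apply pow_lt; lra|]. apply pow_incr; lra.
    + replace ((INR N / 2) ^ 3) with (INR N ^ 3 / 8) by field.
      assert (0 < / INR N ^ 3) by (apply Rinv_0_lt_compat, pow_lt; lra).
      replace (/ (INR N ^ 3 / 8)) with (8 * / INR N ^ 3) by (field; lra). lra.
  - rewrite S_INR, mult_INR. change (INR 2) with 2. set (x := INR N) in *.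
    rewrite Rabs_Ropp, Rabs_pos_eq by (left; apply Rinv_0_lt_compat, pow_lt; lra).
    replace (- / (2 * x) ^ 2 - - / (2 * x + 1) ^ 2) with (- ((4 * x + 1) / ((2 * x) ^ 2 * (2 * x + 1) ^ 2))) by (field; lra).
    assert (0 < (2 * x) ^ 2) by (apply pow_lt; lra). assert (0 < (2 * x + 1) ^ 2) by (apply pow_lt; lra).
    rewrite Rabs_Ropp, Rabs_pos_eq by (apply Rdiv_le_0_compat; [lra|now apply Rmult_lt_0_compat]).
    assert ((4 * x + 1) / ((2 * x) ^ 2 * (2 * x + 1) ^ 2) * (2 * x) <= 8 / x ^ 2).
    { replace ((4 * x + 1) / ((2 * x) ^ 2 * (2 * x + 1) ^ 2) * (2 * x)) with
       (((4 * x + 1) / (2 * (2 * x + 1) ^ 2) * x) * / x ^ 2) by (field; lra).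
      unfold Rdiv at 2. apply Rmult_le_compat_r; [left; apply Rinv_0_lt_compat; nra|].
      apply (Rmult_le_reg_r (2 * (2 * x + 1) ^ 2)); [lra|].
      replace ((4 * x + 1) / (2 * (2 * x + 1) ^ 2) * x * (2 * (2 * x + 1) ^ 2)) with ((4 * x + 1) * x) by (field; nra).
      nra. }
    replace (/ (2 * x) ^ 2) with (/ 4 * / x ^ 2) by (field; lra).
    assert (0 < / x ^ 2) by (apply Rinv_0_lt_compat; nra). unfold Rdiv in *. lra.
Qed.

(** * The nonlocal equation of one mode *)

Lemma unif_cont (g : nat -> R -> R) (f : R -> R) (E r : R) : 0 <= r < 1 -> (forall n, cont (g n)) ->
  (forall n x, Rabs (f x - g n x) <= E * r ^ n) -> cont f.
Proof.
  intros Hr Hg H. apply cont_pt. intros x eps Heps.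
  assert (HE : 0 <= E). { specialize (H 0%nat x); simpl in H. pose proof (Rabs_pos (f x - g 0%nat x)); lra. }
  destruct (pow_small r (eps / (4 * (E + 1))) Hr) as [N HN]; [apply Rdiv_lt_0_compat; lra|].
  specialize (HN N (Nat.le_refl _)).
  assert (E * r ^ N < eps / 4).
  { apply (Rmult_lt_compat_r (4 * (E + 1))) in HN; [|lra].
    unfold Rdiv in HN. rewrite Rmult_assoc, Rinv_l in HN by lra.
    assert (0 <= r ^ N) by (apply pow_le; lra). nra. }
  destruct (pt_cont _ (Hg N) x (eps / 2) ltac:(lra)) as [d [Hd Hc]].
  exists d. split; [easy|]. intros y Hy. specialize (Hc y Hy). simpl in *. unfold Rdist in *.
  replace (f y - f x) with ((f y - g N y) + ((g N y - g N x) + - (f x - g N x))) by ring.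
  eapply Rle_lt_trans; [apply Rabs_triang|].
  pose proof (Rabs_triang (g N y - g N x) (- (f x - g N x))) as H1. rewrite Rabs_Ropp in H1.
  pose proof (H N y). pose proof (H N x). lra.
Qed.

Lemma cont_bounded (f : R -> R) a b : a <= b -> cont f -> exists M, 0 <= M /\ forall x, a <= x <= b -> Rabs (f x) <= M.
Proof.
  intros Hab Hf. destruct (continuity_ab_maj (fun x => Rabs (f x)) a b Hab) as [x0 [H _]].
  - intros c _. apply pt_cont. auto with cont.
  - exists (Rabs (f x0)). split; [apply Rabs_pos|easy].
Qed.

Lemma right_inc (g : R -> R) x d : is_derive g x d -> 0 < d ->
  exists rho, 0 < rho /\ forall t, x < t < x + rho -> g x < g t.
Proof.
  intros H Hd. apply is_derive_Reals in H. destruct (H (d / 2) ltac:(lra)) as [del Hdel].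
  exists del. split; [apply cond_pos|]. intros t Ht.
  specialize (Hdel (t - x) ltac:(lra) ltac:(rewrite Rabs_pos_eq; lra)).
  replace (x + (t - x)) with t in Hdel by ring. apply Rabs_lt_between in Hdel.
  assert (0 < (g t - g x) / (t - x)) as H1 by lra.
  apply (Rmult_lt_compat_r (t - x)) in H1; [|lra]. unfold Rdiv in H1. rewrite Rmult_assoc, Rinv_l in H1 by lra. lra.
Qed.
Lemma left_dec (g : R -> R) x d : is_derive g x d -> d < 0 ->
  exists rho, 0 < rho /\ forall t, x - rho < t < x -> g x < g t.
Proof.
  intros H Hd. apply is_derive_Reals in H. destruct (H (- d / 2) ltac:(lra)) as [del Hdel].
  exists del. split; [apply cond_pos|]. intros t Ht.
  specialize (Hdel (t - x) ltac:(lra) ltac:(rewrite Rabs_left; lra)).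
  replace (x + (t - x)) with t in Hdel by ring. apply Rabs_lt_between in Hdel.
  assert ((g t - g x) / (t - x) < 0) as H1 by lra.
  assert (0 < (g t - g x) / (t - x) * (t - x)) by nra. unfold Rdiv in H0. rewrite Rmult_assoc, Rinv_l in H0 by lra. lra.
Qed.

(** Each integration gains [1 / mu] against the weight [exp (mu t)]. In this weighted norm the
    iteration below contracts on all of [[0, l]], whatever the size of the coefficients. *)
Lemma expint (g : R -> R) (K mu x : R) : 1 <= mu -> 0 <= K -> 0 <= x -> cont g ->
  (forall t, 0 <= t <= x -> Rabs (g t) <= K * exp (mu * t)) -> Rabs (RInt g 0 x) <= K / mu * exp (mu * x).
Proof.
  intros Hmu HK Hx Hg H.
  assert (Hce : cont (fun t => K * exp (mu * t))).
  { apply (cont_derive _ (fun t => K * (mu * exp (mu * t)))). intros y. auto_derive; [easy|ring]. }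
  eapply Rle_trans; [apply (RInt_abs_le g (fun t => K * exp (mu * t)) 0 x); easy|].
  rewrite (RInt_ftc (fun t => K / mu * exp (mu * t)) (fun t => K * exp (mu * t))); [| |easy].
  - rewrite Rmult_0_r, exp_0. assert (0 <= K / mu) by (apply Rdiv_le_0_compat; lra). lra.
  - intros y. auto_derive; [easy|]. field; lra.
Qed.

Lemma Rabs_sum5 a1 a2 a3 a4 a5 b1 b2 b3 b4 b5 : Rabs a1 <= b1 -> Rabs a2 <= b2 -> Rabs a3 <= b3 ->
  Rabs a4 <= b4 -> Rabs a5 <= b5 -> Rabs (a1 + a2 + a3 + a4 - a5) <= b1 + b2 + b3 + b4 + b5.
Proof.
  intros H1 H2 H3 H4 H5. apply Rabs_le_between in H1, H2, H3, H4, H5. apply Rabs_le; lra.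
Qed.

Section Mode.
Variables (l kap : R) (r b c r1 r2 aa bb : R -> R) (r0 Q : R).
Hypothesis l_pos : 0 < l.
Hypotheses (r_cont : cont r) (b_cont : cont b) (c_cont : cont c) (r1_cont : cont r1) (r2_cont : cont r2)
  (aa_cont : cont aa) (bb_cont : cont bb).
Hypothesis r0_pos : 0 < r0.
Hypothesis r_low : forall x, 0 <= x <= l -> r0 <= r x.
Hypothesis Q_pos : 1 <= Q.
Hypothesis Q_bound : forall x, 0 <= x <= l ->
  Rabs (r x) <= Q /\ Rabs (b x) <= Q /\ Rabs (c x) <= Q /\ Rabs (r1 x) <= Q /\ Rabs (r2 x) <= Q /\
  Rabs (aa x) <= Q /\ Rabs (bb x) <= Q.

Definition nonloc (v : R -> R) (x : R) : R :=
  r1 x * RInt (fun t => aa t * v t) 0 x + r2 x * RInt (fun t => bb t * v t) 0 x.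
(** The equation of a mode solved for [v'']: it is divided by [e1], and [r] stands for [- 1 / e1].
    For [nu = n ^ 2] the term [- dy (dy q)] becomes [n ^ 2 * r * v]; [r] is positive because the
    flow is subsonic. *)
Definition rhs (nu : R) (f v dv : R -> R) (x : R) : R :=
  nu * r x * v x + b x * dv x + c x * v x + nonloc v x - r x * f x.

Lemma cont_nonloc v : cont v -> cont (nonloc v).
Proof. intros Hv. unfold nonloc. auto 10 with cont. Qed.
Lemma cont_rhs nu f v dv : cont f -> cont v -> cont dv -> cont (rhs nu f v dv).
Proof. intros Hf Hv Hdv. unfold rhs. pose proof (cont_nonloc v Hv). auto 12 with cont. Qed.

Lemma nonloc_lin v w k x : cont v -> cont w -> nonloc (fun t => v t + k * w t) x = nonloc v x + k * nonloc w x.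
Proof.
  intros Hv Hw. unfold nonloc.
  rewrite (RInt_eq (fun t => aa t * (v t + k * w t)) (fun t => aa t * v t + k * (aa t * w t))) by (intros; ring).
  rewrite (RInt_eq (fun t => bb t * (v t + k * w t)) (fun t => bb t * v t + k * (bb t * w t))) by (intros; ring).
  rewrite !RInt_cplus, !RInt_cscal by auto 10 with cont. ring.
Qed.
Lemma nonloc_bound v V x : cont v -> 0 <= x <= l -> 0 <= V -> (forall t, 0 <= t <= x -> Rabs (v t) <= V) ->
  Rabs (nonloc v x) <= 2 * Q ^ 2 * l * V.
Proof.
  intros Hv Hx HV H. unfold nonloc. destruct (Q_bound x Hx) as [_ [_ [_ [H1 [H2 _]]]]].
  assert (HG : forall a, cont a -> (forall t, 0 <= t <= l -> Rabs (a t) <= Q) -> Rabs (RInt (fun t => a t * v t) 0 x) <= l * (Q * V)).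
  { intros a Ha Hb. eapply Rle_trans; [apply (RInt_abs_cst _ 0 x (Q * V)); [lra|auto with cont|]|].
    - intros t Ht. rewrite Rabs_mult. apply Rmult_le_compat; try apply Rabs_pos; [apply Hb; lra|now apply H].
    - rewrite Rminus_0_r. apply Rmult_le_compat_r; [nra|lra]. }
  eapply Rle_trans; [apply Rabs_triang|]. rewrite !Rabs_mult.
  pose proof (HG aa aa_cont ltac:(intros; now apply Q_bound)). pose proof (HG bb bb_cont ltac:(intros; now apply Q_bound)).
  replace (2 * Q ^ 2 * l * V) with (Q * (l * (Q * V)) + Q * (l * (Q * V))) by ring.
  apply Rplus_le_compat; apply Rmult_le_compat; try apply Rabs_pos; easy.
Qed.

(** [v] and [dv] are total, with [dv] the derivative of [v] on the whole line, whereas the equation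
    is imposed on [[0, l]] only. *)
Definition ode (nu : R) (f v dv : R -> R) : Prop :=
  (forall x, is_derive v x (dv x)) /\ cont dv /\
  forall x, 0 <= x <= l -> is_derive dv x (rhs nu f v dv x).

Lemma ode_lin nu f1 v1 d1 f2 v2 d2 k : ode nu f1 v1 d1 -> ode nu f2 v2 d2 ->
  ode nu (fun x => f1 x + k * f2 x) (fun x => v1 x + k * v2 x) (fun x => d1 x + k * d2 x).
Proof.
  intros [A1 [B1 C1]] [A2 [B2 C2]].
  assert (cont v1) by now apply (cont_derive v1 d1). assert (cont v2) by now apply (cont_derive v2 d2).
  split; [|split].
  - intros x. apply (is_derive_plus v1 (fun x => k * v2 x)); [apply A1|]. apply (is_derive_scal v2 x k), A2.
  - auto with cont.
  - intros x Hx. unfold rhs. rewrite nonloc_lin by easy.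
    replace (_ - _) with (rhs nu f1 v1 d1 x + k * rhs nu f2 v2 d2 x) by (unfold rhs; ring).
    apply (is_derive_plus d1 (fun x => k * d2 x)); [now apply C1|]. apply (is_derive_scal d2 x k). now apply C2.
Qed.
Lemma ode_ext nu f f' v dv : (forall x, 0 <= x <= l -> f x = f' x) -> ode nu f v dv -> ode nu f' v dv.
Proof.
  intros H [A1 [B1 C1]]. split; [easy|split; [easy|]]. intros x Hx. unfold rhs. rewrite <- H by easy. now apply C1.
Qed.

(** * The initial value problem by Picard iteration *)

Section Picard.
Variables (nu A B F : R) (f : R -> R).
Hypotheses (f_cont : cont f) (F_pos : 0 <= F) (f_bound : forall x, 0 <= x <= l -> Rabs (f x) <= F).
Let S := Rabs nu * Q + 2 * Q + 2 * Q ^ 2.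
Let mu := 1 + 2 * S.
Let D (w : R -> R) x := B + RInt w 0 x.
Let P (w : R -> R) x := A + RInt (D w) 0 x.
Let V (w : R -> R) := rhs nu f (P w) (D w).

Lemma S_pos : 2 <= S.
Proof. unfold S. pose proof (Rabs_pos nu). nra. Qed.
Lemma D_cont w : cont w -> cont (D w).
Proof. intros; unfold D; auto with cont. Qed.
Lemma P_cont w : cont w -> cont (P w).
Proof. intros; unfold P. pose proof (D_cont w H). auto with cont. Qed.
Lemma V_cont w : cont w -> cont (V w).
Proof. intros; unfold V. apply cont_rhs; [easy|now apply P_cont|now apply D_cont]. Qed.

(** The unknown is [w = v''], from which [D] and [P] recover [v'] and [v]. [S] bounds the sum of the
    coefficients, and [mu = 1 + 2 * S] is chosen so that the contraction factor [S / mu] is at most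
    [1 / 2]. *)
Lemma V_contr w1 w2 K : cont w1 -> cont w2 -> 0 <= K ->
  (forall x, 0 <= x <= l -> Rabs (w1 x - w2 x) <= K * exp (mu * x)) ->
  forall x, 0 <= x <= l -> Rabs (V w1 x - V w2 x) <= K / 2 * exp (mu * x).
Proof.
  intros H1 H2 HK H x Hx. pose proof S_pos as HS. assert (Hmu : 1 <= mu) by (unfold mu; lra).
  assert (HD : forall x, 0 <= x <= l -> Rabs (D w1 x - D w2 x) <= K / mu * exp (mu * x)).
  { intros y Hy. unfold D. replace (_ - _) with (RInt w1 0 y - RInt w2 0 y) by ring.
    rewrite <- RInt_cminus by easy. apply expint; [easy|easy|lra|auto with cont|]. intros; apply H; lra. }
  assert (HKm : 0 <= K / mu) by (apply Rdiv_le_0_compat; lra).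
  assert (Hle : forall z y, 0 <= z -> z / mu * exp (mu * y) <= z * exp (mu * y)).
  { intros z y Hz. apply Rmult_le_compat_r; [left; apply exp_pos|].
    unfold Rdiv. rewrite <- (Rmult_1_r z) at 2. apply Rmult_le_compat_l; [easy|].
    rewrite <- Rinv_1. apply Rinv_le_contravar; lra. }
  assert (HP : forall x, 0 <= x <= l -> Rabs (P w1 x - P w2 x) <= K / mu * exp (mu * x)).
  { intros y Hy. unfold P. replace (_ - _) with (RInt (D w1) 0 y - RInt (D w2) 0 y) by ring.
    rewrite <- RInt_cminus by now apply D_cont. eapply Rle_trans; [|apply (Hle (K / mu)); easy].
    apply expint; [easy|easy|lra|apply cont_minus; now apply D_cont|]. intros; apply HD; lra. }
  assert (HI : forall a y, cont a -> (forall t, 0 <= t <= l -> Rabs (a t) <= Q) -> 0 <= y <= l ->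
     Rabs (RInt (fun t => a t * (P w1 t + -1 * P w2 t)) 0 y) <= Q * (K / mu) * exp (mu * y)).
  { intros a y Ha Hb Hy. assert (0 <= Q * (K / mu)) by (apply Rmult_le_pos; lra).
    eapply Rle_trans; [|apply (Hle (Q * (K / mu))); easy]. apply expint; [easy|easy|lra| |].
    - apply cont_mult; [easy|]. apply cont_plus; [now apply P_cont|]. apply cont_mult; [auto with cont|now apply P_cont].
    - intros t Ht. rewrite Rabs_mult, Rmult_assoc. apply Rmult_le_compat; try apply Rabs_pos; [apply Hb; lra|].
      replace (P w1 t + -1 * P w2 t) with (P w1 t - P w2 t) by ring. apply HP; lra. }
  destruct (Q_bound x Hx) as [Qr [Qb [Qc [Q1 [Q2 _]]]]].
  set (e := exp (mu * x)) in *. assert (He : 0 < e) by apply exp_pos.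
  assert (HN : Rabs (nonloc (fun t => P w1 t + -1 * P w2 t) x) <= 2 * Q ^ 2 * (K / mu * e)).
  { unfold nonloc. eapply Rle_trans; [apply Rabs_triang|]. rewrite !Rabs_mult.
    pose proof (HI aa x aa_cont ltac:(intros; now apply Q_bound) Hx) as I1.
    pose proof (HI bb x bb_cont ltac:(intros; now apply Q_bound) Hx) as I2. fold e in I1, I2.
    replace (2 * Q ^ 2 * (K / mu * e)) with (Q * (Q * (K / mu) * e) + Q * (Q * (K / mu) * e)) by ring.
    apply Rplus_le_compat; apply Rmult_le_compat; try apply Rabs_pos; easy. }
  unfold V, rhs.
  replace (_ - _) with (nu * r x * (P w1 x - P w2 x) + (b x * (D w1 x - D w2 x) + (c x * (P w1 x - P w2 x) + nonloc (fun t => P w1 t + -1 * P w2 t) x))).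
  2:{ rewrite nonloc_lin by now apply P_cont. ring. }
  specialize (HP x Hx). specialize (HD x Hx). fold e in HP, HD.
  set (kk := K / mu * e) in *. assert (0 <= kk) by (unfold kk; apply Rmult_le_pos; lra).
  assert (Hkk : S * kk <= K / 2 * e).
  { unfold kk. replace (S * (K / mu * e)) with (S / mu * (K * e)) by (unfold Rdiv; ring).
    replace (K / 2 * e) with (/ 2 * (K * e)) by field. apply Rmult_le_compat_r; [nra|].
    apply (Rmult_le_reg_r mu); [lra|]. unfold Rdiv. rewrite Rmult_assoc, Rinv_l by lra. unfold mu. lra. }
  eapply Rle_trans; [|apply Hkk].
  eapply Rle_trans; [apply Rabs_triang|]. rewrite !Rabs_mult.
  assert (Rabs nu * Rabs (r x) * Rabs (P w1 x - P w2 x) <= Rabs nu * Q * kk).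
  { apply Rmult_le_compat; [|apply Rabs_pos| |easy]. apply Rmult_le_pos; apply Rabs_pos.
    apply Rmult_le_compat_l; [apply Rabs_pos|easy]. }
  assert (Rabs (b x * (D w1 x - D w2 x) + (c x * (P w1 x - P w2 x) + nonloc (fun t => P w1 t + -1 * P w2 t) x)) <= Q * kk + (Q * kk + 2 * Q ^ 2 * kk)).
  { eapply Rle_trans; [apply Rabs_triang|]. apply Rplus_le_compat.
    - rewrite Rabs_mult. apply Rmult_le_compat; try apply Rabs_pos; easy.
    - eapply Rle_trans; [apply Rabs_triang|]. apply Rplus_le_compat; [|easy].
      rewrite Rabs_mult. apply Rmult_le_compat; try apply Rabs_pos; easy. }
  unfold S. lra.
Qed.

Lemma picard : exists w, cont w /\ (forall x, 0 <= x <= l -> w x = V w x) /\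
  forall x, 0 <= x <= l -> Rabs (w x) <= 2 * exp (mu * l) * ((S + 1) * (Rabs A + (1 + l) * Rabs B + F) * (1 + l)).
Proof.
  pose proof S_pos as HS. assert (Hmu : 1 <= mu) by (unfold mu; lra).
  set (K := (S + 1) * (Rabs A + (1 + l) * Rabs B + F) * (1 + l)).
  pose proof (Rabs_pos A) as HA. pose proof (Rabs_pos B) as HBp.
  assert (HX : 0 <= Rabs A + (1 + l) * Rabs B + F) by nra.
  assert (HK : 0 <= K) by (unfold K; apply Rmult_le_pos; [apply Rmult_le_pos|]; lra).
  assert (Hz : cont (fun _ : R => 0)) by auto with cont.
  assert (HV0 : forall x, 0 <= x <= l -> Rabs (V (fun _ => 0) x) <= K).
  { intros x Hx.
    assert (HD0 : forall y, D (fun _ => 0) y = B) by (intros; unfold D; rewrite RInt_cst; ring).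
    assert (HP0 : forall y, P (fun _ => 0) y = A + B * y).
    { intros y. unfold P. rewrite (RInt_eq _ (fun _ => B)) by apply HD0. rewrite RInt_cst; ring. }
    set (G := Rabs A + (1 + l) * Rabs B).
    assert (HPb : forall y, 0 <= y <= l -> Rabs (P (fun _ => 0) y) <= G).
    { intros y Hy. rewrite HP0. eapply Rle_trans; [apply Rabs_triang|]. rewrite Rabs_mult, (Rabs_pos_eq y) by lra.
      unfold G. nra. }
    pose proof (nonloc_bound (P (fun _ => 0)) G x (P_cont _ Hz) Hx ltac:(unfold G; nra) ltac:(intros; apply HPb; lra)) as HN.
    specialize (HPb x Hx). destruct (Q_bound x Hx) as [Qr [Qb [Qc _]]]. specialize (f_bound x Hx).
    unfold V, rhs. rewrite HD0.
    assert (HG : 0 <= G) by (unfold G; nra). assert (HBG : Rabs B <= G) by (unfold G; nra).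
    apply Rle_trans with (Rabs nu * Q * G + Q * G + Q * G + 2 * Q ^ 2 * l * G + Q * F).
    - apply Rabs_sum5; [ | | |easy|].
      + rewrite !Rabs_mult. apply Rmult_le_compat; [|apply Rabs_pos| |easy]. apply Rmult_le_pos; apply Rabs_pos.
        apply Rmult_le_compat_l; [apply Rabs_pos|easy].
      + rewrite !Rabs_mult. apply Rmult_le_compat; try apply Rabs_pos; easy.
      + rewrite !Rabs_mult. apply Rmult_le_compat; try apply Rabs_pos; easy.
      + rewrite Rabs_mult. apply Rmult_le_compat; try apply Rabs_pos; easy.
    - unfold K. fold G. unfold S. pose proof (Rabs_pos nu).
      assert (0 <= Rabs nu * Q) by nra. assert (1 <= Q ^ 2) by nra.
      set (a := Rabs nu * Q) in *. set (q2 := Q ^ 2) in *.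
      assert (0 <= a * G) by nra. assert (0 <= Q * G) by nra. assert (0 <= q2 * G) by nra.
      assert (0 <= q2 * F) by nra. assert (0 <= Q * F) by nra. assert (0 <= a * F) by nra.
      assert (0 <= l * (a * G + 2 * (Q * G) + G + (a * F + 2 * (Q * F) + 2 * (q2 * F) + F))) by (apply Rmult_le_pos; lra).
      nra. }
  set (w := fix w n := match n with O => (fun _ : R => 0) | Datatypes.S n => V (w n) end).
  assert (Hwc : forall n, cont (w n)) by (induction n; simpl; auto using V_cont).
  assert (Hd : forall n x, 0 <= x <= l -> Rabs (w (Datatypes.S n) x - w n x) <= K * (/ 2) ^ n * exp (mu * x)).
  { induction n; intros x Hx.
    - simpl. rewrite Rminus_0_r, Rmult_1_r. eapply Rle_trans; [now apply HV0|].
      rewrite <- (Rmult_1_r K) at 1. apply Rmult_le_compat_l; [easy|]. rewrite <- exp_0.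
      destruct (Req_dec (mu * x) 0) as [->|]; [lra|]. left; apply exp_increasing. nra.
    - simpl pow. replace (K * (/ 2 * (/ 2) ^ n)) with (K * (/ 2) ^ n / 2) by field.
      apply (V_contr (w (Datatypes.S n)) (w n)); auto.
      apply Rmult_le_pos; [easy|apply pow_le; lra]. }
  (* The iterates are controlled on [[0, l]]; clamping the argument makes the convergence uniform on
     the line and the limit continuous there. *)
  set (cl := clamp 0 l). set (E := K * exp (mu * l)).
  assert (HE : 0 <= E) by (unfold E; apply Rmult_le_pos; [easy|left; apply exp_pos]).
  set (W := fun x => dsum (fun n => w (Datatypes.S n) (cl x) - w n (cl x))).
  assert (Hexp : forall x, 0 <= x <= l -> exp (mu * x) <= exp (mu * l)).
  { intros x Hx. destruct (Req_dec x l) as [->|]; [lra|]. left; apply exp_increasing. nra. }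
  assert (Hgeo : forall x n, Rabs (w (Datatypes.S n) (cl x) - w n (cl x)) <= E * (/ 2) ^ n).
  { intros x n. assert (0 <= cl x <= l) as Hcl by (apply clamp_in; lra).
    eapply Rle_trans; [now apply Hd|]. unfold E. rewrite Rmult_assoc, (Rmult_comm _ (exp _)), <- Rmult_assoc.
    apply Rmult_le_compat_r; [apply pow_le; lra|]. apply Rmult_le_compat_l; [easy|now apply Hexp]. }
  assert (Htail : forall n x, Rabs (W x - w n (cl x)) <= 2 * E * (/ 2) ^ n).
  { intros n x. replace (w n (cl x)) with (psum (fun n => w (Datatypes.S n) (cl x) - w n (cl x)) n).
    - eapply Rle_trans; [apply (ssum_tail _ E (/ 2) n); [lra|easy|apply Hgeo]|]. right; field.
    - clear. induction n; [easy|]. rewrite psum_S, IHn. ring. }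
  assert (HWc : cont W).
  { apply (unif_cont (fun n x => w n (cl x)) W (2 * E) (/ 2)); [lra| |easy].
    intros n. apply (cont_comp cl (w n)); [apply cont_clamp|apply Hwc]. }
  exists W. split; [easy|split].
  - intros x Hx. apply (eq_of_small _ _ (3 * E * exp (mu * l)) (/ 2)); [lra|]. intros n.
    assert (cl x = x) as Hcx by now apply clamp_id.
    assert (H1 : Rabs (V W x - V (w n) x) <= 2 * E * (/ 2) ^ n / 2 * exp (mu * x)).
    { apply V_contr; auto.
      - apply Rmult_le_pos; [lra|apply pow_le; lra].
      - intros y Hy. pose proof (Htail n y) as Ht. unfold cl in Ht. rewrite clamp_id in Ht by easy.
        eapply Rle_trans; [apply Ht|]. rewrite <- (Rmult_1_r (2 * E * (/ 2) ^ n)) at 1.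
        apply Rmult_le_compat_l; [apply Rmult_le_pos; [lra|apply pow_le; lra]|].
        rewrite <- exp_0. destruct (Req_dec (mu * y) 0) as [->|]; [lra|]. left; apply exp_increasing. nra. }
    pose proof (Htail (Datatypes.S n) x) as H2. rewrite Hcx in H2. change (w (Datatypes.S n) x) with (V (w n) x) in H2.
    replace (W x - V W x) with ((W x - V (w n) x) + - (V W x - V (w n) x)) by ring.
    eapply Rle_trans; [apply Rabs_triang|]. rewrite Rabs_Ropp. simpl in H2.
    assert (0 < (/ 2) ^ n) by (apply pow_lt; lra). specialize (Hexp x Hx).
    assert (1 <= exp (mu * l)).
    { rewrite <- exp_0. left. apply exp_increasing. nra. }
    set (p := (/ 2) ^ n) in *. set (e := exp (mu * l)) in *.
    assert (0 <= E * p) by nra.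
    assert (2 * E * p / 2 * exp (mu * x) <= E * p * e) by (replace (2 * E * p / 2) with (E * p) by field; apply Rmult_le_compat_l; easy).
    nra.
  - intros x Hx. pose proof (Htail 0%nat x) as Ht. simpl in Ht. rewrite Rminus_0_r in Ht. unfold E, K in *. lra.
Qed.
End Picard.

Lemma ivp nu : exists C, 0 <= C /\ forall f A B F, cont f -> 0 <= F -> (forall x, 0 <= x <= l -> Rabs (f x) <= F) ->
  exists v dv, ode nu f v dv /\ v 0 = A /\ dv 0 = B /\
    forall x, 0 <= x <= l -> Rabs (v x) <= C * (Rabs A + Rabs B + F) /\ Rabs (dv x) <= C * (Rabs A + Rabs B + F).
Proof.
  set (S := Rabs nu * Q + 2 * Q + 2 * Q ^ 2). set (mu := 1 + 2 * S).
  assert (HS : 2 <= S) by (unfold S; pose proof (Rabs_pos nu); nra).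
  set (C1 := 2 * exp (mu * l) * ((S + 1) * (1 + l) * (1 + l))).
  assert (HC1 : 0 <= C1).
  { unfold C1. pose proof (exp_pos (mu * l)). repeat apply Rmult_le_pos; lra. }
  exists ((1 + l) * (1 + l * (1 + C1)) + 1 + C1). split; [nra|].
  intros f A B F Hf HF Hb. destruct (picard nu A B F f Hf HF Hb) as [w [Hw [He HB]]].
  fold S in HB. fold mu in HB.
  pose proof (Rabs_pos A) as HA. pose proof (Rabs_pos B) as HBp.
  set (T := Rabs A + Rabs B + F). assert (HT : 0 <= T) by (unfold T; lra).
  assert (HwB : forall x, 0 <= x <= l -> Rabs (w x) <= C1 * T).
  { intros x Hx. eapply Rle_trans; [now apply HB|]. unfold C1.
    replace (2 * exp (mu * l) * ((S + 1) * (1 + l) * (1 + l)) * T) with (2 * exp (mu * l) * ((S + 1) * ((1 + l) * T) * (1 + l))) by ring.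
    apply Rmult_le_compat_l; [pose proof (exp_pos (mu * l)); lra|]. apply Rmult_le_compat_r; [lra|].
    apply Rmult_le_compat_l; [lra|]. unfold T. nra. }
  set (D := fun x => B + RInt w 0 x). set (P := fun x => A + RInt D 0 x).
  assert (HD : cont D) by (unfold D; auto with cont).
  exists P, D. split; [split; [|split]|split; [|split; [|intros x Hx; split]]].
  - intros x. unfold P. replace (D x) with (0 + D x) by ring.
    apply (is_derive_plus (fun _ => A) (fun x => RInt D 0 x)); [apply derive_cst|now apply derive_RInt].
  - easy.
  - intros x Hx. change (rhs nu f P D x) with (rhs nu f (fun x => A + RInt (fun x => B + RInt w 0 x) 0 x) (fun x => B + RInt w 0 x) x).
    rewrite <- (He x Hx : _ = rhs nu f (fun x => A + RInt (fun x => B + RInt w 0 x) 0 x) (fun x => B + RInt w 0 x) x). unfold D. replace (w x) with (0 + w x) by ring.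
    apply (is_derive_plus (fun _ => B) (fun x => RInt w 0 x)); [apply derive_cst|now apply derive_RInt].
  - unfold P. rewrite RInt_nil; ring.
  - unfold D. rewrite RInt_nil; ring.
  - assert (HDb : forall y, 0 <= y <= l -> Rabs (D y) <= (1 + l * C1) * T).
    { intros y Hy. unfold D. eapply Rle_trans; [apply Rabs_triang|].
      assert (Rabs (RInt w 0 y) <= (y - 0) * (C1 * T)) by (apply RInt_abs_cst; [lra|easy|intros; apply HwB; lra]).
      assert ((y - 0) * (C1 * T) <= l * (C1 * T)) by (apply Rmult_le_compat_r; [nra|lra]). unfold T in *; nra. }
    unfold P. eapply Rle_trans; [apply Rabs_triang|].
    assert (Rabs (RInt D 0 x) <= (x - 0) * ((1 + l * C1) * T)) by (apply RInt_abs_cst; [lra|easy|intros; apply HDb; lra]).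
    assert (0 <= l * C1) by nra. assert (0 <= (1 + l * C1) * T) by nra.
    assert ((x - 0) * ((1 + l * C1) * T) <= l * ((1 + l * C1) * T)) by (apply Rmult_le_compat_r; [easy|lra]).
    assert (Rabs A <= T) by (unfold T; lra).
    assert (0 <= l * T) by nra. assert (0 <= C1 * T) by nra. assert (0 <= l * (l * T)) by nra. assert (0 <= l * (C1 * T)) by nra. assert (0 <= l * (l * (C1 * T))) by nra. nra.
  - unfold D. eapply Rle_trans; [apply Rabs_triang|].
    assert (Rabs (RInt w 0 x) <= (x - 0) * (C1 * T)) by (apply RInt_abs_cst; [lra|easy|intros; apply HwB; lra]).
    assert ((x - 0) * (C1 * T) <= l * (C1 * T)) by (apply Rmult_le_compat_r; [nra|lra]).
    assert (Rabs B <= T) by (unfold T; lra).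
    assert (0 <= l * T) by nra. assert (0 <= C1 * T) by nra. assert (0 <= l * (l * T)) by nra. assert (0 <= l * (C1 * T)) by nra. assert (0 <= l * (l * (C1 * T))) by nra. nra.
Qed.

(** * The boundary value problem and bounds uniform in the mode *)

Definition uniq (nu : R) : Prop :=
  forall v dv, ode nu (fun _ => 0) v dv -> dv 0 + kap * v 0 = 0 -> v l = 0 -> forall x, 0 <= x <= l -> v x = 0.

Definition mode_sol_of (nu : R) (f : R -> R) (g0 gl : R) (v dv : R -> R) : Prop :=
  ode nu f v dv /\ dv 0 + kap * v 0 = g0 /\ v l = gl.

(** The solution [v1] of the homogeneous equation with [v1 0 = 1] and slope [- kap] satisfies the
    Robin condition and is not zero, so uniqueness forces [v1 l <> 0]; a multiple of it corrects the
    end value of a particular solution. The constant depends on [nu]. *)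
Lemma bvp nu : uniq nu -> exists C, 0 <= C /\ forall f g0 gl F, cont f -> 0 <= F -> (forall x, 0 <= x <= l -> Rabs (f x) <= F) ->
  exists v dv, mode_sol_of nu f g0 gl v dv /\
    forall x, 0 <= x <= l -> Rabs (v x) <= C * (F + Rabs g0 + Rabs gl) /\ Rabs (dv x) <= C * (F + Rabs g0 + Rabs gl).
Proof.
  intros Hu. destruct (ivp nu) as [C [HC Hivp]].
  destruct (Hivp (fun _ => 0) 1 (- kap) 0) as [v1 [d1 [O1 [V1 [D1 B1]]]]].
  { auto with cont. } { lra. } { intros; rewrite Rabs_R0; lra. }
  assert (Hl : v1 l <> 0).
  { intros H. assert (v1 0 = 0); [|lra]. apply (Hu v1 d1); [easy| |easy|lra]. rewrite V1, D1; ring. }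
  set (T1 := C * (Rabs 1 + Rabs (- kap) + 0)).
  assert (HT1 : 0 <= T1). { unfold T1. pose proof (Rabs_pos 1). pose proof (Rabs_pos (- kap)). apply Rmult_le_pos; lra. }
  assert (Hlp : 0 < / Rabs (v1 l)) by (apply Rinv_0_lt_compat, Rabs_pos_lt; easy).
  set (q := / Rabs (v1 l)) in *.
  exists (C + q * (1 + C) * T1). split; [assert (0 <= q * (1 + C)) by nra; nra|].
  intros f g0 gl F Hf HF Hb. destruct (Hivp f 0 g0 F Hf HF Hb) as [v2 [d2 [O2 [V2 [D2 B2]]]]].
  set (k := (gl - v2 l) / v1 l).
  exists (fun x => v2 x + k * v1 x), (fun x => d2 x + k * d1 x).
  split; [split; [|split]|].
  - apply (ode_ext nu (fun x => f x + k * 0)); [intros; ring|]. now apply ode_lin.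
  - rewrite V1, D1, V2, D2. ring.
  - unfold k. field. easy.
  - assert (HG0 : 0 <= Rabs g0) by apply Rabs_pos. assert (HGl : 0 <= Rabs gl) by apply Rabs_pos.
    set (T := F + Rabs g0 + Rabs gl). assert (HT : 0 <= T) by (unfold T; lra).
    assert (HB2 : C * (Rabs 0 + Rabs g0 + F) <= C * T) by (rewrite Rabs_R0; apply Rmult_le_compat_l; unfold T; lra).
    assert (Hk : Rabs k <= q * (1 + C) * T).
    { unfold k, Rdiv. rewrite Rabs_mult, Rabs_inv. fold q. rewrite (Rmult_comm _ q), Rmult_assoc.
      apply Rmult_le_compat_l; [lra|]. unfold Rminus. eapply Rle_trans; [apply Rabs_triang|]. rewrite Rabs_Ropp.
      destruct (B2 l ltac:(lra)) as [B2l _]. assert (Rabs gl <= T) by (unfold T; lra). nra. }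
    assert (Hgen : forall a a', Rabs a <= C * (Rabs 0 + Rabs g0 + F) -> Rabs a' <= T1 -> Rabs (a + k * a') <= (C + q * (1 + C) * T1) * T).
    { intros a a' Ha Ha'. eapply Rle_trans; [apply Rabs_triang|]. rewrite Rabs_mult.
      assert (Rabs k * Rabs a' <= q * (1 + C) * T * T1) by (apply Rmult_le_compat; try apply Rabs_pos; easy).
      lra. }
    intros x Hx. destruct (B1 x Hx). destruct (B2 x Hx). split; apply Hgen; easy.
Qed.

Lemma rhs_neg nu f v dv x : cont v -> rhs nu (fun x => - f x) (fun x => - v x) (fun x => - dv x) x = - rhs nu f v dv x.
Proof.
  intros Hv. unfold rhs, nonloc.
  rewrite (RInt_eq (fun t => aa t * - v t) (fun t => -1 * (aa t * v t))) by (intros; ring).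
  rewrite (RInt_eq (fun t => bb t * - v t) (fun t => -1 * (bb t * v t))) by (intros; ring).
  rewrite !RInt_cscal by auto with cont. ring.
Qed.

Lemma mode_sol_of_neg nu f g0 gl v dv : mode_sol_of nu f g0 gl v dv -> mode_sol_of nu (fun x => - f x) (- g0) (- gl) (fun x => - v x) (fun x => - dv x).
Proof.
  intros [[A [B C]] [D E]]. assert (Hv : cont v) by now apply (cont_derive v dv).
  split; [split; [|split]|lra].
  - intros x. apply (is_derive_opp v), A.
  - auto with cont.
  - intros x Hx. rewrite rhs_neg by easy. apply (is_derive_opp dv). now apply C.
Qed.

(** The factor [1 + exp (- n d x)] turns the Robin condition at [0] into one with the good sign. *)
Lemma max_principle : exists N C, 1 <= N /\ 0 <= C /\ forall n f g0 gl F v dv, N <= n -> 0 <= F ->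
  (forall x, 0 <= x <= l -> Rabs (f x) <= F) -> mode_sol_of (n ^ 2) f g0 gl v dv ->
  forall x, 0 <= x <= l -> Rabs (v x) <= C * (F / n ^ 2 + Rabs g0 / n + Rabs gl).
Proof.
  (* With this [d] the second derivative of the weight is at most [n ^ 2 * r0 / 4], a quarter of the
     good zeroth-order term. *)
  set (d := sqrt r0 / 2). assert (Hs : 0 < sqrt r0) by now apply sqrt_lt_R0.
  assert (Hd : 0 < d) by (unfold d; lra).
  assert (Hd2 : d ^ 2 = r0 / 4). { unfold d. replace ((sqrt r0 / 2) ^ 2) with (sqrt r0 * sqrt r0 / 4) by field. rewrite sqrt_sqrt; lra. }
  set (Z := Q * d + 2 * Q + 4 * Q ^ 2 * l).
  assert (HZ : 0 < Z) by (unfold Z; assert (0 < Q * d) by (apply Rmult_lt_0_compat; lra); assert (0 < Q ^ 2 * l) by (apply Rmult_lt_0_compat; [apply pow_lt|]; lra); lra).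
  (* Two requirements on [n]: the lower-order terms, bounded by [n * Z], are absorbed by
     [n ^ 2 * r0 / 4], and the Robin coefficient by the slope [- n * d] of the weight at [0]. *)
  set (N := 1 + 4 * Z / r0 + 4 * Rabs kap / d).
  assert (HN1 : 0 < 4 * Z / r0) by (apply Rdiv_lt_0_compat; lra).
  assert (HN2 : 0 <= 4 * Rabs kap / d) by (apply Rdiv_le_0_compat; [pose proof (Rabs_pos kap)|]; lra).
  set (C := 4 * Q / r0 + 8 / d + 2).
  assert (HC1 : 0 < 4 * Q / r0) by (apply Rdiv_lt_0_compat; lra).
  assert (HC2 : 0 < 8 / d) by (apply Rdiv_lt_0_compat; lra).
  exists N, C. split; [unfold N; lra|split; [unfold C; lra|]].
  intros n f g0 gl F v dv Hn HF Hb Hm.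
  assert (Hn1 : 1 <= n) by (unfold N in Hn; lra).
  (* The weight; locally this name hides the dyadic multiplier. Its values on [[0, l]] lie between
     [1] and [2], so dividing by it costs a factor [2]. *)
  set (dyad := fun x => 1 + exp (- (n * d * x))).
  assert (Hom : forall x, 0 <= x -> 1 < dyad x <= 2).
  { intros x Hx. unfold dyad. pose proof (exp_pos (- (n * d * x))).
    assert (exp (- (n * d * x)) <= 1); [|lra]. rewrite <- exp_0.
    assert (0 <= n * d * x) by (repeat apply Rmult_le_pos; lra).
    destruct (Req_dec (- (n * d * x)) 0) as [->|]; [lra|]. left; apply exp_increasing. lra. }
  assert (Homd : forall x, is_derive dyad x (- (n * d) * exp (- (n * d * x)))).
  { intros x. unfold dyad. auto_derive; [easy|ring]. }
  assert (Homp : forall x, 0 < dyad x) by (intros x; unfold dyad; pose proof (exp_pos (- (n * d * x))); lra).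
  assert (Hq0 : 0 <= F / n ^ 2) by (apply Rdiv_le_0_compat; nra).
  assert (Hq1 : forall g, 0 <= Rabs g / n) by (intros; apply Rdiv_le_0_compat; [apply Rabs_pos|lra]).
  assert (Hcv : forall v dv f g0 gl, mode_sol_of (n ^ 2) f g0 gl v dv -> cont v).
  { intros v1 dv1 f1 ? ? [[A _] _]. now apply (cont_derive v1 dv1). }
  assert (Homc : cont dyad) by (apply (cont_derive _ _ Homd)).
  assert (Hcz : forall v, cont v -> cont (fun x => v x / dyad x)).
  { intros v1 Hv1. apply cont_mult; [easy|]. intros x. apply continuity_pt_filterlim.
    apply continuity_pt_inv; [now apply pt_cont|]. pose proof (Homp x). lra. }
  destruct (continuity_ab_maj (fun x => Rabs (v x / dyad x)) 0 l) as [x0 [Hmax Hx0]].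
  { lra. } { intros z _. apply pt_cont. apply cont_abs, Hcz. now apply (Hcv v dv f g0 gl). }
  (* By linearity it suffices to treat a nonnegative maximum; otherwise the signs of solution and
     data are changed. *)
  enough (HH : forall f g0 gl v dv, mode_sol_of (n ^ 2) f g0 gl v dv -> (forall x, 0 <= x <= l -> Rabs (f x) <= F) ->
     (forall x, 0 <= x <= l -> Rabs (v x / dyad x) <= v x0 / dyad x0) ->
     v x0 / dyad x0 <= C / 2 * (F / n ^ 2 + Rabs g0 / n + Rabs gl)).
  { assert (HM : Rabs (v x0 / dyad x0) <= C / 2 * (F / n ^ 2 + Rabs g0 / n + Rabs gl)).
    { destruct (Rle_dec 0 (v x0 / dyad x0)) as [Hp|Hp].
      - rewrite Rabs_pos_eq in Hmax |- * by easy. now apply (HH f g0 gl v dv).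
      - rewrite Rabs_left in Hmax |- * by lra. rewrite <- (Rabs_Ropp g0), <- (Rabs_Ropp gl).
        replace (- (v x0 / dyad x0)) with (- v x0 / dyad x0) in * by (unfold Rdiv; ring).
        apply (HH (fun x => - f x) (- g0) (- gl) (fun x => - v x) (fun x => - dv x)); [now apply mode_sol_of_neg| |].
        + intros x Hx. rewrite Rabs_Ropp. now apply Hb.
        + intros x Hx. replace (- v x / dyad x) with (- (v x / dyad x)) by (unfold Rdiv; ring). rewrite Rabs_Ropp. now apply Hmax. }
    intros x Hx. specialize (Hmax x Hx). specialize (Hom x ltac:(lra)).
    replace (v x) with (v x / dyad x * dyad x) by (field; lra). rewrite Rabs_mult, (Rabs_pos_eq (dyad x)) by lra.
    replace (C * (F / n ^ 2 + Rabs g0 / n + Rabs gl)) with (C / 2 * (F / n ^ 2 + Rabs g0 / n + Rabs gl) * 2) by (field; lra).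
    apply Rmult_le_compat; try lra. apply Rabs_pos. }
  clear f g0 gl v dv Hb Hm Hmax. intros f g0 gl v dv Hm Hb Hmax.
  pose proof (Hcv v dv f g0 gl Hm) as Hv. destruct Hm as [[Hd1 [Hd1c Hd3]] [Hg0 Hgl]].
  set (M := v x0 / dyad x0) in *.
  assert (HMp : 0 <= M). { eapply Rle_trans; [|apply (Hmax x0 Hx0)]. apply Rabs_pos. }
  assert (Hvx0 : v x0 = M * dyad x0) by (unfold M; field; pose proof (Homp x0); lra).
  assert (Hvb : forall x, 0 <= x <= l -> Rabs (v x) <= 2 * M).
  { intros x Hx. specialize (Hmax x Hx). specialize (Hom x ltac:(lra)).
    replace (v x) with (v x / dyad x * dyad x) by (field; lra). rewrite Rabs_mult, (Rabs_pos_eq (dyad x)), Rmult_comm by lra.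
    apply Rmult_le_compat; try lra. apply Rabs_pos. }
  set (dom := fun x => - (n * d) * exp (- (n * d * x))).
  (* The numerator of the derivative of [v / dyad]: it has the sign of that derivative and avoids
     differentiating the quotient twice. *)
  set (phi := fun x => dv x * dyad x - v x * dom x).
  assert (Hz : forall x, is_derive (fun x => v x / dyad x) x (phi x / dyad x ^ 2)).
  { intros x. apply (is_derive_div v dyad); [apply Hd1|apply Homd|]. pose proof (Homp x); lra. }
  assert (Hzx : forall x, v x / dyad x <= M \/ ~ (0 <= x <= l)).
  { intros x. destruct (Rle_dec 0 x) as [H1|H1]; [destruct (Rle_dec x l) as [H2|H2]|]; try (right; lra).
    left. eapply Rle_trans; [apply Rle_abs|]. apply Hmax; lra. }
  assert (HT : forall g, 0 <= Rabs g) by apply Rabs_pos.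
  pose proof (Hq1 g0) as Hq1'. pose proof (HT gl) as Hgl'.
  destruct (Req_dec x0 l) as [El|El].
  { assert (M <= Rabs gl).
    { eapply Rle_trans; [|apply Rle_abs]. rewrite <- Hgl, <- El, Hvx0. pose proof (Hom x0 ltac:(lra)). nra. }
    apply Rle_trans with (1 * (F / n ^ 2 + Rabs g0 / n + Rabs gl)); [lra|]. apply Rmult_le_compat_r; unfold C; lra. }
  assert (Hright : phi x0 <= 0).
  { destruct (Rle_dec (phi x0) 0) as [|Hp]; [easy|exfalso].
    destruct (right_inc _ x0 _ (Hz x0)) as [rho [Hrho Hr]].
    { apply Rdiv_lt_0_compat; [lra|]. apply pow_lt, Homp. }
    set (t := x0 + Rmin rho (l - x0) / 2).
    assert (0 < Rmin rho (l - x0)) by (apply Rmin_glb_lt; lra).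
    pose proof (Rmin_l rho (l - x0)). pose proof (Rmin_r rho (l - x0)).
    specialize (Hr t ltac:(unfold t; lra)). destruct (Hzx t) as [Ht|Ht]; [unfold M in Ht; lra|apply Ht; unfold t; lra]. }
  destruct (Req_dec x0 0) as [E0|E0].
  (* At a maximum at [0] the quotient does not increase, which reads [2 * dv 0 + n * d * v 0 <= 0].
     The Robin condition replaces [dv 0], and half of [n * d * v 0] absorbs the term with [kap]. *)
  { subst x0. unfold phi, dom in Hright. rewrite Rmult_0_r, Ropp_0, exp_0 in Hright.
    assert (dyad 0 = 2) as Eo by (unfold dyad; rewrite Rmult_0_r, Ropp_0, exp_0; ring). rewrite Eo in *.
    replace (dv 0) with (g0 - kap * v 0) in Hright by lra.
    assert (Hnd : 4 * Rabs kap <= n * d).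
    { replace (4 * Rabs kap) with (4 * Rabs kap / d * d) by (field; lra). apply Rmult_le_compat_r; unfold N in Hn; lra. }
    assert (Hv0 : 0 <= v 0) by lra.
    assert (Hk : - Rabs kap <= kap <= Rabs kap) by (apply Rabs_le_between; lra).
    assert (Hg : - Rabs g0 <= g0) by (pose proof (Rle_abs (- g0)) as Hx; rewrite Rabs_Ropp in Hx; lra).
    assert (v 0 * (n * d) <= 4 * Rabs g0) by nra.
    assert (M <= 4 / d * (Rabs g0 / n)).
    { apply (Rmult_le_reg_r (n * d)); [nra|]. replace (4 / d * (Rabs g0 / n) * (n * d)) with (4 * Rabs g0) by (field; lra).
      assert (M * (n * d) <= v 0 * (n * d)); [|lra]. apply Rmult_le_compat_r; nra. }
    assert (4 / d * (Rabs g0 / n) <= C / 2 * (Rabs g0 / n)); [apply Rmult_le_compat_r; [easy|unfold C; lra]|].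
    assert (0 <= C / 2 * (F / n ^ 2 + Rabs gl)) by (apply Rmult_le_pos; unfold C; lra). lra. }
  assert (Hphi0 : phi x0 = 0).
  { apply Rle_antisym; [easy|]. destruct (Rle_dec 0 (phi x0)) as [|Hp]; [easy|exfalso].
    destruct (left_dec _ x0 _ (Hz x0)) as [rho [Hrho Hr]].
    { unfold Rdiv. assert (0 < / dyad x0 ^ 2) by apply Rinv_0_lt_compat, pow_lt, Homp. nra. }
    set (t := x0 - Rmin rho x0 / 2).
    assert (0 < Rmin rho x0) by (apply Rmin_glb_lt; lra).
    pose proof (Rmin_l rho x0). pose proof (Rmin_r rho x0).
    specialize (Hr t ltac:(unfold t; lra)). destruct (Hzx t) as [Ht|Ht]; [unfold M in Ht; lra|apply Ht; unfold t; lra]. }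
  set (ddom := (n * d) ^ 2 * exp (- (n * d * x0))).
  assert (Hddom : is_derive dom x0 ddom) by (unfold dom, ddom; auto_derive; [easy|ring]).
  set (R0 := rhs (n ^ 2) f v dv x0) in *.
  assert (Hdphi : is_derive phi x0 (R0 * dyad x0 - v x0 * ddom)).
  { unfold phi. replace (R0 * dyad x0 - v x0 * ddom) with
     ((R0 * dyad x0 + dv x0 * dom x0) - (dv x0 * dom x0 + v x0 * ddom)) by ring.
    apply (is_derive_minus (fun x => dv x * dyad x) (fun x => v x * dom x)).
    - apply (is_derive_mult dv dyad); [now apply Hd3|apply Homd|intros; apply Rmult_comm].
    - apply (is_derive_mult v dom); [apply Hd1|apply Hddom|intros; apply Rmult_comm]. }
  (* The second-derivative test: if [phi] increased through its zero at [x0], the quotient would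
     increase to the right of its maximum. The interval is halved because the mean value point of
     the first half may be [x0] itself, where [phi] is zero. *)
  assert (Hcomp : R0 * dyad x0 - v x0 * ddom <= 0).
  { destruct (Rle_dec (R0 * dyad x0 - v x0 * ddom) 0) as [|Hp]; [easy|exfalso].
    destruct (right_inc _ x0 _ Hdphi ltac:(lra)) as [rho [Hrho Hr]]. rewrite Hphi0 in Hr.
    set (t := x0 + Rmin rho (l - x0) / 2).
    assert (0 < Rmin rho (l - x0)) by (apply Rmin_glb_lt; lra).
    pose proof (Rmin_l rho (l - x0)). pose proof (Rmin_r rho (l - x0)).
    destruct (mvt (fun x => v x / dyad x) (fun x => phi x / dyad x ^ 2) x0 t) as [xi [Hxi Exi]]; [intros; apply Hz|].
    assert (Hxt : x0 < t) by (unfold t; lra). rewrite Rmin_left, Rmax_right in Hxi by lra.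
    destruct (Hzx t) as [Ht|Ht]; [|apply Ht; unfold t; lra].
    destruct (Hzx ((x0 + t) / 2)) as [Ht2|Ht2]; [|apply Ht2; unfold t; lra].
    fold M in Exi.
    destruct (mvt (fun x => v x / dyad x) (fun x => phi x / dyad x ^ 2) ((x0 + t) / 2) t) as [x2 [Hx2 Ex2]]; [intros; apply Hz|].
    rewrite Rmin_left, Rmax_right in Hx2 by lra.
    destruct (mvt (fun x => v x / dyad x) (fun x => phi x / dyad x ^ 2) x0 ((x0 + t) / 2)) as [x1 [Hx1 Ex1]]; [intros; apply Hz|].
    rewrite Rmin_left, Rmax_right in Hx1 by lra. fold M in Ex1.
    assert (0 < phi x2 / dyad x2 ^ 2).
    { apply Rdiv_lt_0_compat; [apply Hr; unfold t in *; lra|]. apply pow_lt, Homp. }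
    assert (0 <= phi x1 / dyad x1 ^ 2).
    { destruct (Req_dec x1 x0) as [->|]; [rewrite Hphi0; unfold Rdiv; lra|].
      left. apply Rdiv_lt_0_compat; [apply Hr; unfold t in *; lra|]. apply pow_lt, Homp. }
    nra. }
  assert (Hdvx0 : dv x0 = M * dom x0).
  { unfold phi in Hphi0. rewrite Hvx0 in Hphi0. pose proof (Homp x0).
    apply (Rmult_eq_reg_r (dyad x0)); lra. }
  rewrite Hvx0 in Hcomp.
  assert (HR0 : R0 <= M * ddom). { pose proof (Homp x0). apply (Rmult_le_reg_r (dyad x0)); lra. }
  set (e := exp (- (n * d * x0))) in *.
  assert (He : 0 < e <= 1). { pose proof (Hom x0 ltac:(lra)) as Ho. unfold dyad in Ho. fold e in Ho. split; [apply exp_pos|lra]. }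
  destruct (Q_bound x0 Hx0) as [Qr [Qb [Qc _]]]. pose proof (r_low x0 Hx0) as Hrl.
  pose proof (nonloc_bound v (2 * M) x0 Hv Hx0 ltac:(lra) ltac:(intros; apply Hvb; lra)) as HNl.
  unfold R0, rhs in HR0. rewrite Hdvx0, Hvx0 in HR0. pose proof (Hom x0 ltac:(lra)) as Ho.
  apply Rabs_le_between in HNl.
  assert (H1 : Rabs (b x0 * (M * dom x0)) <= Q * (M * (n * d))).
  { rewrite Rabs_mult. apply Rmult_le_compat; try apply Rabs_pos; [easy|].
    rewrite Rabs_mult, (Rabs_pos_eq M) by easy. apply Rmult_le_compat_l; [easy|]. unfold dom. fold e.
    assert (Hnd : 0 <= n * d) by (apply Rmult_le_pos; lra).
    rewrite Rabs_mult, Rabs_Ropp, (Rabs_pos_eq e), (Rabs_pos_eq (n * d)) by lra.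
    rewrite <- (Rmult_1_r (n * d)) at 2. apply Rmult_le_compat_l; lra. }
  assert (H2 : Rabs (c x0 * (M * dyad x0)) <= Q * (M * 2)).
  { rewrite Rabs_mult. apply Rmult_le_compat; try apply Rabs_pos; [easy|].
    rewrite Rabs_mult, (Rabs_pos_eq M), (Rabs_pos_eq (dyad x0)) by lra. apply Rmult_le_compat_l; lra. }
  assert (H3 : Rabs (r x0 * f x0) <= Q * F).
  { rewrite Rabs_mult. apply Rmult_le_compat; try apply Rabs_pos; [easy|now apply Hb]. }
  apply Rabs_le_between in H1, H2, H3.
  assert (H4 : n ^ 2 * r0 * M <= n ^ 2 * r x0 * (M * dyad x0)).
  { rewrite !Rmult_assoc. apply Rmult_le_compat_l; [nra|].
    apply Rmult_le_compat; try lra.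
    rewrite <- (Rmult_1_r M) at 1. apply Rmult_le_compat_l; lra. }
  assert (H5 : M * ddom <= M * (n ^ 2 * (r0 / 4))).
  { apply Rmult_le_compat_l; [easy|]. unfold ddom. fold e. rewrite Rpow_mult_distr, Hd2.
    assert (0 <= n ^ 2 * (r0 / 4)) by (apply Rmult_le_pos; [apply pow2_ge_0|lra]).
    rewrite <- (Rmult_1_r (n ^ 2 * (r0 / 4))) at 2. apply Rmult_le_compat_l; lra. }
  assert (H6 : n ^ 2 * (r0 / 4) >= n * Z).
  { assert (4 * Z / r0 <= n) by (unfold N in Hn; lra).
    assert (Z <= n * (r0 / 4)). { replace Z with (4 * Z / r0 * (r0 / 4)) by (field; lra). apply Rmult_le_compat_r; lra. }
    nra. }
  assert (H7 : Q * (M * (n * d)) + Q * (M * 2) + 2 * Q ^ 2 * l * (2 * M) <= M * (n * Z)).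
  { unfold Z. assert (H7 : 0 <= M * (2 * Q + 4 * Q ^ 2 * l)). { apply Rmult_le_pos; [easy|]. assert (0 < Q ^ 2 * l) by (apply Rmult_lt_0_compat; [apply pow_lt|]; lra). lra. }
    pose proof (Rmult_le_pos _ (n - 1) H7 ltac:(lra)). lra. }
  assert (H8 : M * (n * Z) <= M * (n ^ 2 * (r0 / 4))) by (apply Rmult_le_compat_l; lra).
  assert (H9 : M * (n ^ 2 * (r0 / 2)) <= Q * F) by lra.
  assert (H10 : M <= 2 * Q / r0 * (F / n ^ 2)).
  { apply (Rmult_le_reg_r (n ^ 2 * (r0 / 2))); [nra|].
    replace (2 * Q / r0 * (F / n ^ 2) * (n ^ 2 * (r0 / 2))) with (Q * F) by (field; nra). easy. }
  assert (2 * Q / r0 * (F / n ^ 2) <= C / 2 * (F / n ^ 2)); [apply Rmult_le_compat_r; [easy|unfold C; lra]|].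
  assert (0 <= C / 2 * (Rabs g0 / n + Rabs gl)) by (apply Rmult_le_pos; unfold C; lra). lra.
Qed.

(** From a maximum point of [|dv|], with value [D], one goes a step [h = eta / n]: some point on the
    way has slope at most [2 * V / h], and [dv] changes by at most [h * sup |v''|]. The part
    [h * Q * D] is absorbed since [eta * Q <= 1 / 2], and [eta <= l / 2] leaves room for the step
    inside [[0, l]]. *)
Lemma der_bound : exists C, 0 <= C /\ forall n f F v dv V, 1 <= n -> 0 <= V -> 0 <= F -> ode (n ^ 2) f v dv ->
  (forall x, 0 <= x <= l -> Rabs (v x) <= V) -> (forall x, 0 <= x <= l -> Rabs (f x) <= F) ->
  forall x, 0 <= x <= l -> Rabs (dv x) <= C * (n * V + F / n).
Proof.
  set (eta := Rmin (l / 2) (/ (2 * Q))).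
  assert (He : 0 < eta). { unfold eta. apply Rmin_glb_lt; [lra|apply Rinv_0_lt_compat; lra]. }
  assert (He1 : eta <= l / 2) by apply Rmin_l.
  assert (He2 : eta * Q <= / 2).
  { apply Rle_trans with (/ (2 * Q) * Q); [apply Rmult_le_compat_r; [lra|apply Rmin_r]|]. right; field; lra. }
  exists (4 / eta + 2 * eta * (2 * Q + 2 * Q ^ 2 * l) + 2 * eta * Q).
  assert (Hq : 0 <= 2 * Q + 2 * Q ^ 2 * l) by nra.
  assert (Hie : 0 < 4 / eta) by (apply Rdiv_lt_0_compat; lra).
  assert (Hp1 : 0 <= 2 * eta * (2 * Q + 2 * Q ^ 2 * l)) by (apply Rmult_le_pos; lra).
  assert (Hp2 : 0 <= 2 * eta * Q) by (apply Rmult_le_pos; lra).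
  split; [lra|].
  intros n f F v dv V Hn HV HF [O1 [O2 O3]] Hv Hf.
  assert (Hvc : cont v) by now apply (cont_derive v dv).
  destruct (continuity_ab_maj (fun x => Rabs (dv x)) 0 l) as [x0 [Hmax Hx0]].
  { lra. } { intros z _. apply pt_cont. auto with cont. }
  set (D := Rabs (dv x0)) in *. assert (HD : 0 <= D) by apply Rabs_pos.
  set (h := eta / n).
  assert (Hh : 0 < h) by (apply Rdiv_lt_0_compat; lra).
  assert (Hhe : h <= eta). { unfold h, Rdiv. rewrite <- (Rmult_1_r eta) at 2. apply Rmult_le_compat_l; [lra|]. rewrite <- Rinv_1. apply Rinv_le_contravar; lra. }
  set (G := Q * D + n ^ 2 * (2 * Q + 2 * Q ^ 2 * l) * V + Q * F).
  assert (HG : forall x, 0 <= x <= l -> Rabs (rhs (n ^ 2) f v dv x) <= G).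
  { intros x Hx. unfold rhs. destruct (Q_bound x Hx) as [Qr [Qb [Qc _]]].
    pose proof (nonloc_bound v V x Hvc Hx HV ltac:(intros; apply Hv; lra)) as HN.
    apply Rle_trans with (n ^ 2 * Q * V + Q * D + Q * V + 2 * Q ^ 2 * l * V + Q * F).
    - apply Rabs_sum5; [ | | |easy|].
      + rewrite !Rabs_mult, (Rabs_pos_eq (n ^ 2)) by (apply pow2_ge_0).
        apply Rmult_le_compat; try apply Rabs_pos; [|apply Rmult_le_compat_l; [apply pow2_ge_0|easy]|now apply Hv].
        apply Rmult_le_pos; [apply pow2_ge_0|apply Rabs_pos].
      + rewrite !Rabs_mult. apply Rmult_le_compat; try apply Rabs_pos; [easy|now apply Hmax].
      + rewrite !Rabs_mult. apply Rmult_le_compat; try apply Rabs_pos; [easy|now apply Hv].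
      + rewrite !Rabs_mult. apply Rmult_le_compat; try apply Rabs_pos; [easy|now apply Hf].
    - unfold G. assert (1 <= n ^ 2) by nra. assert (0 <= Q * V) by nra. assert (0 <= Q ^ 2 * l * V).
      { apply Rmult_le_pos; [apply Rmult_le_pos; [apply pow2_ge_0|lra]|lra]. }
      assert (0 <= (n ^ 2 - 1) * (Q * V + 2 * (Q ^ 2 * l * V))) by (apply Rmult_le_pos; lra). lra. }
  assert (Hx1 : exists x1, 0 <= x1 <= l /\ Rabs (x1 - x0) = h).
  { destruct (Rle_dec x0 (l / 2)); [exists (x0 + h)|exists (x0 - h)]; (split; [lra|]).
    - replace (x0 + h - x0) with h by ring. apply Rabs_pos_eq; lra.
    - replace (x0 - h - x0) with (- h) by ring. rewrite Rabs_Ropp. apply Rabs_pos_eq; lra. }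
  destruct Hx1 as [x1 [Hx1 Ex1]].
  destruct (mvt v dv x0 x1) as [xi [Hxi Exi]]; [intros; apply O1|].
  assert (Hxi2 : 0 <= xi <= l /\ Rabs (x0 - xi) <= h).
  { revert Hxi Ex1. unfold Rmin, Rmax, Rabs. destruct Rle_dec, Rcase_abs, Rcase_abs; lra. }
  assert (Hdxi : Rabs (dv xi) <= 2 * V / h).
  { apply (Rmult_le_reg_r h); [easy|]. rewrite <- Ex1 at 1. rewrite <- Rabs_mult, <- Exi.
    replace (2 * V / h * h) with (2 * V) by (field; lra). unfold Rminus. eapply Rle_trans; [apply Rabs_triang|].
    rewrite Rabs_Ropp. pose proof (Hv x0 Hx0). pose proof (Hv x1 Hx1). lra. }
  assert (HDD : D <= 2 * V / h + G * h).
  { unfold D. replace (dv x0) with (dv xi + (dv x0 - dv xi)) by ring.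
    eapply Rle_trans; [apply Rabs_triang|]. apply Rplus_le_compat; [easy|].
    eapply Rle_trans; [apply (mvt_le dv (rhs (n ^ 2) f v dv) 0 l xi x0 G); try easy|].
    apply Rmult_le_compat_l; [|easy]. eapply Rle_trans; [apply Rabs_pos|apply (HG x0 Hx0)]. }
  assert (Hfin : D / 2 <= 2 * V / h + (n ^ 2 * (2 * Q + 2 * Q ^ 2 * l) * V + Q * F) * h).
  { unfold G in HDD. assert (h * Q <= / 2) by (apply Rle_trans with (eta * Q); [apply Rmult_le_compat_r; lra|easy]).
    assert (Q * D * h <= D / 2) by (replace (Q * D * h) with ((h * Q) * D) by ring; nra). lra. }
  intros x Hx. eapply Rle_trans; [now apply Hmax|]. fold D.
  apply Rle_trans with (2 * (2 * V / h + (n ^ 2 * (2 * Q + 2 * Q ^ 2 * l) * V + Q * F) * h)); [lra|].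
  unfold h. set (q := 2 * Q + 2 * Q ^ 2 * l) in *.
  replace (2 * (2 * V / (eta / n) + (n ^ 2 * q * V + Q * F) * (eta / n))) with
    (4 / eta * (n * V) + 2 * eta * q * (n * V) + 2 * eta * Q * (F / n)) by (field; lra).
  assert (0 <= n * V) by nra. assert (0 <= F / n) by (apply Rdiv_le_0_compat; lra).
  assert (0 <= 4 / eta * (F / n)) by (apply Rmult_le_pos; lra).
  assert (0 <= 2 * eta * q * (F / n)) by (apply Rmult_le_pos; lra).
  assert (0 <= 2 * eta * Q * (n * V)) by (apply Rmult_le_pos; lra). lra.
Qed.

Lemma mode_sol_of_lin nu f1 g1 h1 v1 d1 f2 g2 h2 v2 d2 k : mode_sol_of nu f1 g1 h1 v1 d1 -> mode_sol_of nu f2 g2 h2 v2 d2 ->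
  mode_sol_of nu (fun x => f1 x + k * f2 x) (g1 + k * g2) (h1 + k * h2) (fun x => v1 x + k * v2 x) (fun x => d1 x + k * d2 x).
Proof.
  intros [A1 [B1 C1]] [A2 [B2 C2]]. split; [now apply ode_lin|]. split; [|rewrite C1, C2; ring].
  rewrite <- B1, <- B2. ring.
Qed.
Lemma mode_sol_of_ext nu f f' g0 gl v dv : (forall x, 0 <= x <= l -> f x = f' x) -> mode_sol_of nu f g0 gl v dv -> mode_sol_of nu f' g0 gl v dv.
Proof. intros H [A B]. split; [now apply (ode_ext nu f f')|easy]. Qed.
Lemma mode_sol_of_shift nu nu' f g0 gl v dv : mode_sol_of nu' f g0 gl v dv -> mode_sol_of nu (fun x => f x - (nu' - nu) * v x) g0 gl v dv.
Proof.
  intros [[A [B C]] D]. split; [|easy]. split; [easy|split; [easy|]]. intros x Hx.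
  replace (rhs nu (fun x => f x - (nu' - nu) * v x) v dv x) with (rhs nu' f v dv x) by (unfold rhs; ring). now apply C.
Qed.

Definition bnd (n : nat) (F g h : R) : R := F / INR n ^ 2 + g / INR n + h.

Lemma bnd_pos n F g h : 0 <= F -> 0 <= g -> 0 <= h -> (1 <= n)%nat -> 0 <= bnd n F g h.
Proof.
  intros HF Hg Hh Hn. apply le_INR in Hn. simpl in Hn. unfold bnd.
  assert (0 <= F / INR n ^ 2) by (apply Rdiv_le_0_compat; nra).
  assert (0 <= g / INR n) by (apply Rdiv_le_0_compat; lra). lra.
Qed.

Hypothesis uniq_n : forall n : nat, (1 <= n)%nat -> uniq (INR n ^ 2).

Lemma mode_sol_of_eq n f g0 gl v dv v' dv' : (1 <= n)%nat -> mode_sol_of (INR n ^ 2) f g0 gl v dv -> mode_sol_of (INR n ^ 2) f g0 gl v' dv' ->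
  forall x, 0 <= x <= l -> v x = v' x /\ dv x = dv' x.
Proof.
  intros Hn H H'. pose proof (mode_sol_of_lin _ _ _ _ _ _ _ _ _ _ _ (-1) H H') as [O [B E]].
  assert (O' : ode (INR n ^ 2) (fun _ => 0) (fun x => v x + -1 * v' x) (fun x => dv x + -1 * dv' x)).
  { apply (ode_ext _ (fun x => f x + -1 * f x)); [intros; ring|easy]. }
  pose proof (uniq_n n Hn _ _ O' ltac:(lra) ltac:(lra)) as Hz.
  (* Uniqueness concerns [v]; the derivatives agree because [der_bound], applied to the difference
     with [V = 0] and zero data, gives the bound [0]. *)
  destruct der_bound as [C [HC Hd]]. apply le_INR in Hn. simpl in Hn.
  pose proof (Hd (INR n) _ 0 _ _ 0 Hn ltac:(lra) ltac:(lra) O' ltac:(intros x Hx; cbv beta in *; rewrite (Hz x Hx), Rabs_R0; lra)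
    ltac:(intros; cbv beta; rewrite Rabs_R0; lra)) as Hd'.
  intros x Hx. specialize (Hz x Hx). specialize (Hd' x Hx). split; [lra|].
  replace (C * (INR n * 0 + 0 / INR n)) with 0 in Hd' by (field; lra).
  pose proof (Rabs_pos (dv x + -1 * dv' x)). assert (Rabs (dv x + -1 * dv' x) = 0) as H1 by lra.
  destruct (Req_dec (dv x + -1 * dv' x) 0) as [|H2]; [lra|]. now apply Rabs_no_R0 in H2.
Qed.

(** [max_principle] covers all large [n]; the finitely many remaining modes take their constants
    from [bvp], collected by induction on the threshold. *)
Lemma mode_solvable : exists C, 0 <= C /\ forall (n : nat) f g0 gl F, (1 <= n)%nat -> cont f -> 0 <= F ->
  (forall x, 0 <= x <= l -> Rabs (f x) <= F) ->
  exists v dv, mode_sol_of (INR n ^ 2) f g0 gl v dv /\ forall x, 0 <= x <= l ->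
    Rabs (v x) <= C * bnd n F (Rabs g0) (Rabs gl) /\ Rabs (dv x) <= C * INR n * bnd n F (Rabs g0) (Rabs gl).
Proof.
  destruct max_principle as [N0 [C1 [HN0 [HC1 HM]]]].
  destruct (INR_unbounded N0) as [N HN].
  assert (Hlow : exists C2, 0 <= C2 /\ forall (n : nat) f g0 gl F, (1 <= n)%nat -> (n < N)%nat -> cont f -> 0 <= F ->
    (forall x, 0 <= x <= l -> Rabs (f x) <= F) -> exists v dv, mode_sol_of (INR n ^ 2) f g0 gl v dv /\ forall x, 0 <= x <= l ->
    Rabs (v x) <= C2 * bnd n F (Rabs g0) (Rabs gl)).
  { clear HN. induction N as [|N [C2 [HC2 IH]]]; [exists 0; split; [lra|intros; lia]|].
    destruct (Nat.eq_dec N 0) as [->|HN]; [exists 0; split; [lra|intros; lia]|].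
    destruct (bvp (INR N ^ 2) (uniq_n N ltac:(lia))) as [C3 [HC3 HB]].
    assert (1 <= INR N) as HNp by (change 1 with (INR 1); apply le_INR; lia).
    exists (C2 + C3 * INR N ^ 2). split; [nra|].
    intros n f g0 gl F Hn1 HnN Hf HF Hb. pose proof (bnd_pos n F (Rabs g0) (Rabs gl) HF (Rabs_pos _) (Rabs_pos _) Hn1) as Hp.
    destruct (Nat.eq_dec n N) as [->|Hne].
    - destruct (HB f g0 gl F Hf HF Hb) as [v [dv [Hm Hv]]]. exists v, dv. split; [easy|]. intros x Hx.
      destruct (Hv x Hx) as [Hv1 _]. eapply Rle_trans; [apply Hv1|].
      assert (F + Rabs g0 + Rabs gl <= INR N ^ 2 * bnd N F (Rabs g0) (Rabs gl)).
      { unfold bnd. replace (INR N ^ 2 * (F / INR N ^ 2 + Rabs g0 / INR N + Rabs gl)) with (F + INR N * Rabs g0 + INR N ^ 2 * Rabs gl) by (field; lra).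
        pose proof (Rabs_pos g0). pose proof (Rabs_pos gl). assert (1 <= INR N ^ 2) by nra.
        assert (1 * Rabs g0 <= INR N * Rabs g0) by (apply Rmult_le_compat_r; lra).
        assert (1 * Rabs gl <= INR N ^ 2 * Rabs gl) by (apply Rmult_le_compat_r; lra). lra. }
      assert (C3 * (F + Rabs g0 + Rabs gl) <= C3 * (INR N ^ 2 * bnd N F (Rabs g0) (Rabs gl))) by now apply Rmult_le_compat_l.
      assert (0 <= C2 * bnd N F (Rabs g0) (Rabs gl)) by now apply Rmult_le_pos. lra.
    - destruct (IH n f g0 gl F Hn1 ltac:(lia) Hf HF Hb) as [v [dv [Hm Hv]]]. exists v, dv. split; [easy|]. intros x Hx.
      eapply Rle_trans; [now apply Hv|]. apply Rmult_le_compat_r; [easy|]. nra. }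
  destruct Hlow as [C2 [HC2 Hlow]]. destruct der_bound as [C4 [HC4 Hder]].
  set (C := C1 + C2).
  exists (C + C4 * (C + 1)). split; [unfold C; nra|].
  intros n f g0 gl F Hn Hf HF Hb. pose proof (bnd_pos n F (Rabs g0) (Rabs gl) HF (Rabs_pos _) (Rabs_pos _) Hn) as Hp.
  pose proof (le_INR _ _ Hn) as Hnp. simpl in Hnp.
  assert (Hex : exists v dv, mode_sol_of (INR n ^ 2) f g0 gl v dv /\ forall x, 0 <= x <= l -> Rabs (v x) <= C * bnd n F (Rabs g0) (Rabs gl)).
  { destruct (Nat.lt_ge_cases n N) as [HnN|HnN].
    - destruct (Hlow n f g0 gl F Hn HnN Hf HF Hb) as [v [dv [Hm Hv]]]. exists v, dv. split; [easy|]. intros x Hx.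
      eapply Rle_trans; [now apply Hv|]. apply Rmult_le_compat_r; [easy|]. unfold C; lra.
    - destruct (bvp (INR n ^ 2) (uniq_n n Hn)) as [C3 [HC3 HB]]. destruct (HB f g0 gl F Hf HF Hb) as [v [dv [Hm _]]].
      exists v, dv. split; [easy|]. intros x Hx.
      apply le_INR in HnN. eapply Rle_trans; [apply (HM (INR n) f g0 gl F v dv); try easy; lra|].
      apply Rmult_le_compat_r; [easy|]. unfold C; lra. }
  destruct Hex as [v [dv [Hm Hv]]]. exists v, dv. split; [easy|]. intros x Hx.
  set (b0 := bnd n F (Rabs g0) (Rabs gl)) in *.
  assert (HCb : 0 <= C * b0) by (apply Rmult_le_pos; [unfold C; lra|easy]).
  split.
  - eapply Rle_trans; [now apply Hv|]. apply Rmult_le_compat_r; [easy|]. unfold C; nra.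
  - eapply Rle_trans; [apply (Hder (INR n) f F v dv (C * b0)); try easy; apply Hm|].
    assert (F / INR n <= INR n * b0).
    { unfold b0, bnd. replace (F / INR n) with (INR n * (F / INR n ^ 2)) by (field; lra).
      apply Rmult_le_compat_l; [lra|]. assert (0 <= Rabs g0 / INR n) by (apply Rdiv_le_0_compat; [apply Rabs_pos|lra]).
      pose proof (Rabs_pos gl). lra. }
    assert (0 <= INR n * b0) by nra.
    assert (0 <= C * (INR n * b0)) by (apply Rmult_le_pos; [unfold C; lra|easy]).
    assert (C4 * (INR n * (C * b0) + F / INR n) <= C4 * (INR n * (C * b0) + INR n * b0)) by (apply Rmult_le_compat_l; lra).
    lra.
Qed.

(** * Blocks of modes *)

(** Choosing the solution by [epsilon] makes it a function of the data, so that linearity and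
    differences in [n] can be written as equations. They hold on [[0, l]], where the solution is
    unique. *)
Definition the_sol (n : nat) (f : R -> R) (g0 gl : R) : (R -> R) * (R -> R) :=
  epsilon (inhabits ((fun _ => 0), (fun _ => 0))) (fun p => mode_sol_of (INR n ^ 2) f g0 gl (fst p) (snd p)).

Section Block.
Variable C : R.
Hypotheses (C_pos : 0 <= C) (C_sol : forall (n : nat) f g0 gl F, (1 <= n)%nat -> cont f -> 0 <= F ->
  (forall x, 0 <= x <= l -> Rabs (f x) <= F) ->
  exists v dv, mode_sol_of (INR n ^ 2) f g0 gl v dv /\ forall x, 0 <= x <= l ->
    Rabs (v x) <= C * bnd n F (Rabs g0) (Rabs gl) /\ Rabs (dv x) <= C * INR n * bnd n F (Rabs g0) (Rabs gl)).

Lemma the_sol_spec n f g0 gl : (1 <= n)%nat -> cont f -> mode_sol_of (INR n ^ 2) f g0 gl (fst (the_sol n f g0 gl)) (snd (the_sol n f g0 gl)).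
Proof.
  intros Hn Hf. unfold the_sol. apply epsilon_spec.
  destruct (cont_bounded f 0 l ltac:(lra) Hf) as [F [HF Hb]].
  destruct (C_sol n f g0 gl F Hn Hf HF Hb) as [v [dv [H _]]]. now exists (v, dv).
Qed.
Lemma the_sol_cont n f g0 gl : (1 <= n)%nat -> cont f -> cont (fst (the_sol n f g0 gl)).
Proof. intros Hn Hf. destruct (the_sol_spec n f g0 gl Hn Hf) as [[H _] _]. apply (cont_derive _ _ H). Qed.
Lemma the_sol_eq n f g0 gl v dv : (1 <= n)%nat -> cont f -> mode_sol_of (INR n ^ 2) f g0 gl v dv -> forall x, 0 <= x <= l ->
  fst (the_sol n f g0 gl) x = v x /\ snd (the_sol n f g0 gl) x = dv x.
Proof. intros Hn Hf H. apply (mode_sol_of_eq n f g0 gl); auto. now apply the_sol_spec. Qed.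

Variable flag : bool.
Variable x : R.
Hypothesis x_in : 0 <= x <= l.
(** [x] and [flag] are fixed so that one argument serves the values of the solution and those of its
    derivative; the latter lose a factor [n], recorded in [der_fac]. *)
Definition sol_at (n : nat) (f : R -> R) (g0 gl : R) : R :=
  if flag then snd (the_sol n f g0 gl) x else fst (the_sol n f g0 gl) x.
Definition der_fac (n : nat) : R := if flag then INR n else 1.

Lemma der_fac_pos n : 0 <= der_fac n.
Proof. unfold der_fac; destruct flag; [apply pos_INR|lra]. Qed.
Lemma der_fac_mono n m : (n <= m)%nat -> der_fac n <= der_fac m.
Proof. intros H; unfold der_fac; destruct flag; [now apply le_INR|lra]. Qed.

Lemma sol_at_bound n f g0 gl F g h : (1 <= n)%nat -> cont f -> 0 <= F -> (forall x, 0 <= x <= l -> Rabs (f x) <= F) ->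
  Rabs g0 <= g -> Rabs gl <= h -> Rabs (sol_at n f g0 gl) <= C * der_fac n * bnd n F g h.
Proof.
  intros Hn Hf HF Hb Hg Hh. destruct (C_sol n f g0 gl F Hn Hf HF Hb) as [v [dv [Hm Hv]]].
  destruct (the_sol_eq n f g0 gl v dv Hn Hf Hm x x_in) as [E1 E2]. destruct (Hv x x_in) as [B1 B2].
  assert (bnd n F (Rabs g0) (Rabs gl) <= bnd n F g h).
  { unfold bnd. apply le_INR in Hn. simpl in Hn. apply Rplus_le_compat; [|easy]. apply Rplus_le_compat_l.
    unfold Rdiv. apply Rmult_le_compat_r; [left; apply Rinv_0_lt_compat; lra|easy]. }
  pose proof (der_fac_pos n). unfold sol_at, der_fac in *. destruct flag; [rewrite E2|rewrite E1].
  - eapply Rle_trans; [apply B2|]. apply Rmult_le_compat_l; [now apply Rmult_le_pos|easy].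
  - eapply Rle_trans; [apply B1|]. rewrite Rmult_1_r. now apply Rmult_le_compat_l.
Qed.
Lemma sol_at_lin n f1 g1 h1 f2 g2 h2 k : (1 <= n)%nat -> cont f1 -> cont f2 ->
  sol_at n (fun x => f1 x + k * f2 x) (g1 + k * g2) (h1 + k * h2) = sol_at n f1 g1 h1 + k * sol_at n f2 g2 h2.
Proof.
  intros Hn H1 H2. pose proof (mode_sol_of_lin _ _ _ _ _ _ _ _ _ _ _ k (the_sol_spec n f1 g1 h1 Hn H1) (the_sol_spec n f2 g2 h2 Hn H2)) as Hm.
  destruct (the_sol_eq n (fun x => f1 x + k * f2 x) _ _ _ _ Hn ltac:(auto with cont) Hm x x_in) as [E1 E2].
  unfold sol_at. destruct flag; easy.
Qed.
Lemma sol_at_ext n f f' g0 g0' gl gl' : (1 <= n)%nat -> cont f -> cont f' -> (forall x, 0 <= x <= l -> f x = f' x) -> g0 = g0' -> gl = gl' ->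
  sol_at n f g0 gl = sol_at n f' g0' gl'.
Proof.
  intros Hn H H' He <- <-. pose proof (mode_sol_of_ext _ _ _ _ _ _ _ He (the_sol_spec n f g0 gl Hn H)) as Hm.
  destruct (the_sol_eq n f' _ _ _ _ Hn H' Hm x x_in) as [E1 E2]. unfold sol_at. destruct flag; easy.
Qed.
Definition resolv n v := sol_at n v 0 0.
(** The solution for mode [m] solves the problem of mode [n] with the extra right-hand side
    [(n ^ 2 - m ^ 2) v_m], so differences in the mode number are again values of mode solutions. *)
Lemma sol_at_diff n m f g0 gl : (1 <= n)%nat -> (1 <= m)%nat -> cont f ->
  sol_at n f g0 gl - sol_at m f g0 gl = (INR m ^ 2 - INR n ^ 2) * resolv n (fst (the_sol m f g0 gl)).
Proof.
  intros Hn Hm Hf. pose proof (the_sol_spec m f g0 gl Hm Hf) as HS. pose proof (the_sol_cont m f g0 gl Hm Hf) as Hc.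
  set (p := the_sol m f g0 gl) in *. pose proof (mode_sol_of_shift (INR n ^ 2) _ _ _ _ _ _ HS) as H1.
  assert (E : sol_at m f g0 gl = sol_at n (fun x => f x + - (INR m ^ 2 - INR n ^ 2) * fst p x) (g0 + - (INR m ^ 2 - INR n ^ 2) * 0) (gl + - (INR m ^ 2 - INR n ^ 2) * 0)).
  { rewrite (sol_at_ext n _ (fun x => f x - (INR m ^ 2 - INR n ^ 2) * fst p x) _ g0 _ gl) by (auto with cont; intros; ring).
    destruct (the_sol_eq n (fun x => f x - (INR m ^ 2 - INR n ^ 2) * fst p x) _ _ _ _ Hn ltac:(auto with cont) H1 x x_in) as [E1 E2].
    unfold sol_at. fold p. destruct flag; easy. }
  rewrite E, sol_at_lin by easy. unfold resolv. ring.
Qed.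

Lemma the_sol_bound n f g0 gl F g h : (1 <= n)%nat -> cont f -> 0 <= F -> (forall x, 0 <= x <= l -> Rabs (f x) <= F) ->
  Rabs g0 <= g -> Rabs gl <= h -> forall x, 0 <= x <= l -> Rabs (fst (the_sol n f g0 gl) x) <= C * bnd n F g h.
Proof.
  intros Hn Hf HF Hb Hg Hh z Hz. destruct (C_sol n f g0 gl F Hn Hf HF Hb) as [v [dv [Hm Hv]]].
  destruct (the_sol_eq n f g0 gl v dv Hn Hf Hm z Hz) as [E1 E2]. destruct (Hv z Hz) as [B1 B2].
  rewrite E1. eapply Rle_trans; [apply B1|]. apply Rmult_le_compat_l; [easy|].
  unfold bnd. apply le_INR in Hn. simpl in Hn. apply Rplus_le_compat; [|easy]. apply Rplus_le_compat_l.
  unfold Rdiv. apply Rmult_le_compat_r; [left; apply Rinv_0_lt_compat; lra|easy].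
Qed.
Lemma resolv_bound n v V : (1 <= n)%nat -> cont v -> 0 <= V -> (forall x, 0 <= x <= l -> Rabs (v x) <= V) ->
  Rabs (resolv n v) <= C * der_fac n * (V / INR n ^ 2).
Proof.
  intros Hn Hv HV Hb. replace (V / INR n ^ 2) with (bnd n V 0 0) by (unfold bnd, Rdiv; ring).
  apply sol_at_bound; auto; rewrite Rabs_R0; lra.
Qed.

Lemma sol_at_diff1 n f g0 gl F g h : (1 <= n)%nat -> cont f -> 0 <= F -> (forall x, 0 <= x <= l -> Rabs (f x) <= F) ->
  Rabs g0 <= g -> Rabs gl <= h -> Rabs (sol_at n f g0 gl - sol_at (S n) f g0 gl) <= 2 * C ^ 2 * der_fac (S n) * bnd n F g h / INR n.
Proof.
  intros Hn Hf HF Hb Hg Hh. rewrite Rabs_minus_sym, sol_at_diff by (auto; lia).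
  pose proof (Rabs_pos g0). pose proof (Rabs_pos gl).
  pose proof (bnd_pos n F g h HF ltac:(lra) ltac:(lra) Hn) as Hp.
  pose proof (resolv_bound (S n) (fst (the_sol n f g0 gl)) (C * bnd n F g h) ltac:(lia) (the_sol_cont n f g0 gl Hn Hf) ltac:(now apply Rmult_le_pos)
    (the_sol_bound n f g0 gl F g h Hn Hf HF Hb Hg Hh)) as HR.
  pose proof (der_fac_pos (S n)). rewrite S_INR in *. apply le_INR in Hn. simpl in Hn.
  rewrite Rabs_mult. replace (INR n ^ 2 - (INR n + 1) ^ 2) with (- (2 * INR n + 1)) by ring.
  rewrite Rabs_Ropp, Rabs_pos_eq by lra.
  eapply Rle_trans; [apply Rmult_le_compat_l; [lra|apply HR]|].
  set (k := der_fac (S n)) in *. set (b0 := bnd n F g h) in *.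
  replace ((2 * INR n + 1) * (C * k * (C * b0 / (INR n + 1) ^ 2))) with ((C ^ 2 * k * b0) * ((2 * INR n + 1) / (INR n + 1) ^ 2)) by (field; lra).
  replace (2 * C ^ 2 * k * b0 / INR n) with ((C ^ 2 * k * b0) * (2 / INR n)) by (field; lra).
  apply Rmult_le_compat_l.
  - apply Rmult_le_pos; [apply Rmult_le_pos; [apply pow2_ge_0|easy]|easy].
  - apply (Rmult_le_reg_r (INR n * (INR n + 1) ^ 2)); [apply Rmult_lt_0_compat; [lra|apply pow_lt; lra]|].
    replace ((2 * INR n + 1) / (INR n + 1) ^ 2 * (INR n * (INR n + 1) ^ 2)) with ((2 * INR n + 1) * INR n) by (field; lra).
    replace (2 / INR n * (INR n * (INR n + 1) ^ 2)) with (2 * (INR n + 1) ^ 2) by (field; lra). nra.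
Qed.

(** Both neighbours are compared with mode [n] by [sol_at_diff]. The factors [- (2 n + 1)] and
    [2 n - 1] would leave [-2] if the resolvents agreed, and the difference of the two resolvents is
    [4 n] times their product. Each resolvent gains [n ^ -2]. *)
Lemma sol_at_diff2 n f g0 gl F g h : (2 <= n)%nat -> cont f -> 0 <= F -> (forall x, 0 <= x <= l -> Rabs (f x) <= F) ->
  Rabs g0 <= g -> Rabs gl <= h ->
  Rabs (sol_at (S n) f g0 gl - 2 * sol_at n f g0 gl + sol_at (pred n) f g0 gl) <= 34 * (1 + C) ^ 3 * der_fac (S n) * bnd n F g h / INR n ^ 2.
Proof.
  intros Hn Hf HF Hb Hg Hh. destruct n as [|m]; [lia|]. simpl pred.
  set (n := S m) in *. set (v := fst (the_sol n f g0 gl)).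
  assert (Hn1 : (1 <= n)%nat) by lia.
  assert (Hv : cont v) by now apply the_sol_cont.
  assert (Hw : cont (fst (the_sol (S n) v 0 0))) by (apply the_sol_cont; [lia|easy]).
  pose proof (sol_at_diff (S n) n f g0 gl ltac:(lia) Hn1 Hf) as E1. pose proof (sol_at_diff m n f g0 gl ltac:(lia) Hn1 Hf) as E2. fold v in E1, E2.
  pose proof (sol_at_diff m (S n) v 0 0 ltac:(lia) ltac:(lia) Hv) as E3.
  set (w := fst (the_sol (S n) v 0 0)) in *.
  pose proof (Rabs_pos g0). pose proof (Rabs_pos gl).
  pose proof (bnd_pos n F g h HF ltac:(lra) ltac:(lra) Hn1) as Hp. set (b0 := bnd n F g h) in *.
  assert (HCb : 0 <= C * b0) by now apply Rmult_le_pos.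
  assert (Hvb : forall x, 0 <= x <= l -> Rabs (v x) <= C * b0) by now apply (the_sol_bound n f g0 gl F g h).
  assert (HR1 : Rabs (resolv (S n) v) <= C * der_fac (S n) * (C * b0 / INR (S n) ^ 2)) by (apply resolv_bound; auto; lia).
  assert (Hwb : forall x, 0 <= x <= l -> Rabs (w x) <= C * (C * b0 / INR (S n) ^ 2)).
  { replace (C * b0 / INR (S n) ^ 2) with (bnd (S n) (C * b0) 0 0) by (unfold bnd, Rdiv; ring).
    apply the_sol_bound; auto; try lia; rewrite Rabs_R0; lra. }
  assert (Hm1 : 1 <= INR m) by (change 1 with (INR 1); apply le_INR; lia).
  assert (ES : INR (S n) = INR m + 2) by (unfold n; rewrite !S_INR; ring).
  assert (En : INR n = INR m + 1) by (unfold n; rewrite !S_INR; ring).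
  assert (HCw : 0 <= C * (C * b0 / INR (S n) ^ 2)).
  { apply Rmult_le_pos; [easy|]. apply Rdiv_le_0_compat; [easy|]. rewrite ES. apply pow_lt; lra. }
  assert (HR2 : Rabs (resolv m w) <= C * der_fac m * (C * (C * b0 / INR (S n) ^ 2) / INR m ^ 2)) by (apply resolv_bound; auto; lia).
  replace (sol_at (S n) f g0 gl - 2 * sol_at n f g0 gl + sol_at m f g0 gl) with
    ((sol_at (S n) f g0 gl - sol_at n f g0 gl) + (sol_at m f g0 gl - sol_at n f g0 gl)) by ring.
  rewrite E1, E2. replace (resolv m v) with (resolv (S n) v + (INR (S n) ^ 2 - INR m ^ 2) * resolv m w) by (unfold resolv in *; lra).
  rewrite ES, En in *. set (y := INR m) in *.
  replace (((y + 1) ^ 2 - (y + 2) ^ 2) * resolv (S n) v + ((y + 1) ^ 2 - y ^ 2) * (resolv (S n) v + ((y + 2) ^ 2 - y ^ 2) * resolv m w))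
    with (- (2 * resolv (S n) v) + (4 * (y + 1) * (2 * y + 1)) * resolv m w) by ring.
  eapply Rle_trans; [apply Rabs_triang|]. rewrite Rabs_Ropp, !Rabs_mult, (Rabs_pos_eq 2) by lra.
  rewrite (Rabs_pos_eq 4), (Rabs_pos_eq (y + 1)), (Rabs_pos_eq (2 * y + 1)) by lra.
  pose proof (der_fac_mono m (S n) ltac:(unfold n; lia)) as Hk. pose proof (der_fac_pos m) as Hkm. set (k := der_fac (S n)) in *.
  assert (Hk0 : 0 <= k) by apply der_fac_pos.
  assert (HkB : 0 <= k * b0) by now apply Rmult_le_pos.
  apply Rle_trans with (2 * (C * k * (C * b0 / (y + 2) ^ 2)) + 4 * (y + 1) * (2 * y + 1) * (C * k * (C * (C * b0 / (y + 2) ^ 2) / y ^ 2))).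
  { apply Rplus_le_compat; [apply Rmult_le_compat_l; [lra|easy]|]. apply Rmult_le_compat_l; [nra|].
    eapply Rle_trans; [apply HR2|]. apply Rmult_le_compat_r; [|now apply Rmult_le_compat_l].
    apply Rdiv_le_0_compat; [easy|]. apply pow_lt; lra. }
  replace (2 * (C * k * (C * b0 / (y + 2) ^ 2)) + 4 * (y + 1) * (2 * y + 1) * (C * k * (C * (C * b0 / (y + 2) ^ 2) / y ^ 2)))
    with ((k * b0) * (2 * C ^ 2 * / (y + 2) ^ 2 + C ^ 3 * (4 * (y + 1) * (2 * y + 1) / ((y + 2) ^ 2 * y ^ 2)))) by (field; lra).
  replace (34 * (1 + C) ^ 3 * k * b0 / (y + 1) ^ 2) with ((k * b0) * (34 * (1 + C) ^ 3 * / (y + 1) ^ 2)) by (field; lra).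
  apply Rmult_le_compat_l; [easy|].
  assert (H1 : / (y + 2) ^ 2 <= / (y + 1) ^ 2) by (apply Rinv_le_contravar; [apply pow_lt; lra|apply pow_incr; lra]).
  assert (H2 : 4 * (y + 1) * (2 * y + 1) / ((y + 2) ^ 2 * y ^ 2) <= 32 * / (y + 1) ^ 2).
  { assert (0 < (y + 2) ^ 2 * y ^ 2) by (apply Rmult_lt_0_compat; apply pow_lt; lra).
    apply (Rmult_le_reg_r ((y + 2) ^ 2 * y ^ 2 * (y + 1) ^ 2)); [apply Rmult_lt_0_compat; [easy|apply pow_lt; lra]|].
    replace (4 * (y + 1) * (2 * y + 1) / ((y + 2) ^ 2 * y ^ 2) * ((y + 2) ^ 2 * y ^ 2 * (y + 1) ^ 2)) with (4 * (2 * y + 1) * ((y + 1) * (y + 1) ^ 2)) by (field; lra).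
    replace (32 * / (y + 1) ^ 2 * ((y + 2) ^ 2 * y ^ 2 * (y + 1) ^ 2)) with (32 * ((y + 2) ^ 2 * y ^ 2)) by (field; lra).
    assert (0 <= y - 1) as Hy1 by lra. set (u := y - 1) in *. replace y with (u + 1) by (unfold u; ring). ring_simplify.
    pose proof (pow_le u 2 Hy1). pose proof (pow_le u 3 Hy1). pose proof (pow_le u 4 Hy1). lra. }
  assert (0 < / (y + 1) ^ 2) by (apply Rinv_0_lt_compat, pow_lt; lra).
  set (q := / (y + 1) ^ 2) in *.
  assert (HC3 : 0 <= C ^ 3) by now apply pow_le. assert (HC2 : 0 <= C ^ 2) by now apply pow_le.
  apply Rle_trans with (2 * C ^ 2 * q + C ^ 3 * (32 * q)).
  - apply Rplus_le_compat; apply Rmult_le_compat_l; lra.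
  - replace (34 * (1 + C) ^ 3 * q) with (q * (34 + 102 * C + 102 * C ^ 2 + 34 * C ^ 3)) by ring.
    replace (2 * C ^ 2 * q + C ^ 3 * (32 * q)) with (q * (2 * C ^ 2 + 32 * C ^ 3)) by ring.
    apply Rmult_le_compat_l; lra.
Qed.

(** Since second differences of the solution operators in the mode number are [O(N ^ -2)] on a
    block, summation by parts bounds the block as if all of its modes had the same operator. *)
Lemma block_bound (N : nat) (fn : nat -> R -> R) (an bn : nat -> R) (d y : R) : (1 <= N)%nat -> 0 <= d ->
  (forall n, cont (fn n)) -> (forall x, in_block N (fun n => fn n x)) -> in_block N an -> in_block N bn ->
  (forall x y, 0 <= x <= l -> Rabs (psum (fun k => fn k x * cosn k y) (S (2 * N))) <= INR N ^ 2 * d) ->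
  (forall y, Rabs (psum (fun k => an k * cosn k y) (S (2 * N))) <= INR N * d) ->
  (forall y, Rabs (psum (fun k => bn k * cosn k y) (S (2 * N))) <= d) ->
  Rabs (psum (fun i => sol_at (S i) (fn (S i)) (an (S i)) (bn (S i)) * cosn (S i) y) (2 * N)) <= 2100 * (1 + C) ^ 3 * der_fac (S (2 * N)) * d.
Proof.
  intros HN Hd Hfc Hfb Hab Hbb Hf Ha Hb.
  pose proof (le_INR _ _ HN) as HNp. simpl in HNp.
  set (Fk := fun k x => cesaro (fun n => fn n x * cosn n y) k).
  set (Gk := fun k => cesaro (fun n => an n * cosn n y) k). set (Hk := fun k => cesaro (fun n => bn n * cosn n y) k).
  assert (HFc : forall k, cont (Fk k)).
  { intros k. induction k.
    - apply (cont_ext (fun _ => 0)); [easy|auto with cont].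
    - apply (cont_ext (fun x => Fk k x + psum (fun n => fn n x * cosn n y) (S k))); [easy|].
      apply cont_plus; [easy|]. apply (psum_cont (fun n x => fn n x * cosn n y)). intros i. auto with cont. }
  assert (HFb : forall k z, 0 <= z <= l -> Rabs (Fk k z) <= INR k * (INR N ^ 2 * d)).
  { intros k z Hz. apply fejer_poly with (M := (2 * N)%nat); [intros; apply (Hfb z); lia|intros; now apply Hf]. }
  assert (HGb : forall k, Rabs (Gk k) <= INR k * (INR N * d)).
  { intros k. apply fejer_poly with (M := (2 * N)%nat); [intros; apply Hab; lia|intros; now apply Ha]. }
  assert (HHb : forall k, Rabs (Hk k) <= INR k * d).
  { intros k. apply fejer_poly with (M := (2 * N)%nat); [intros; apply Hbb; lia|intros; now apply Hb]. }
  (* The first index selects the solution operator, the second how far the data have been summed;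
     the original terms are second differences in [k]. Mode [0] is outside the range of the
     operators and gets the value [0]. *)
  set (L := fun m k => match m with O => 0 | _ => sol_at m (Fk k) (Gk k) (Hk k) end).
  assert (HL : forall m k, (1 <= m)%nat -> L m k = sol_at m (Fk k) (Gk k) (Hk k)) by (intros m k Hm; destruct m; [lia|easy]).
  assert (Hz0 : forall m k, (1 <= m)%nat -> (forall x, Fk k x = 0) -> Gk k = 0 -> Hk k = 0 -> sol_at m (Fk k) (Gk k) (Hk k) = 0).
  { intros m k Hm E1 E2 E3. pose proof (sol_at_bound m (Fk k) (Gk k) (Hk k) 0 0 0 Hm (HFc k) ltac:(lra)
      ltac:(intros; rewrite E1, Rabs_R0; lra) ltac:(rewrite E2, Rabs_R0; lra) ltac:(rewrite E3, Rabs_R0; lra)) as HT.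
    replace (bnd m 0 0 0) with 0 in HT by (unfold bnd, Rdiv; ring). rewrite Rmult_0_r in HT.
    pose proof (Rabs_pos (sol_at m (Fk k) (Gk k) (Hk k))).
    destruct (Req_dec (sol_at m (Fk k) (Gk k) (Hk k)) 0) as [|Hne]; [easy|]. apply Rabs_no_R0 in Hne. lra. }
  assert (HCsz : forall cf k, in_block N cf -> (2 * k <= N)%nat \/ k = 1%nat -> cesaro (fun n => cf n * cosn n y) k = 0).
  { intros cf k [Hc _] Hk'. apply cesaro_zero. intros i Hi. rewrite Hc by lia. ring. }
  assert (HLz : forall m k, (2 * k <= N)%nat \/ k = 1%nat -> L m k = 0).
  { intros m k Hk'. destruct m; [easy|]. rewrite HL by lia. apply Hz0; [lia| | |].
    - intros z. apply (HCsz (fun n => fn n z)); easy.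
    - now apply HCsz.
    - now apply HCsz. }
  rewrite (psum_ext _ (fun i => L (S i) (S (S i)) - 2 * L (S i) (S i) + L (S i) i)).
  2:{ intros i _. rewrite !HL by lia.
      transitivity (sol_at (S i) (fun x => (Fk (S (S i)) x + -2 * Fk (S i) x) + 1 * Fk i x) ((Gk (S (S i)) + -2 * Gk (S i)) + 1 * Gk i) ((Hk (S (S i)) + -2 * Hk (S i)) + 1 * Hk i)).
      - transitivity (sol_at (S i) (fun x => 0 + cosn (S i) y * fn (S i) x) (0 + cosn (S i) y * an (S i)) (0 + cosn (S i) y * bn (S i))).
        + rewrite sol_at_lin by (auto with cont; lia).
          assert (sol_at (S i) (fun _ => 0) 0 0 = 0) as ->.
          { transitivity (sol_at (S i) (Fk 0%nat) (Gk 0%nat) (Hk 0%nat)); [apply sol_at_ext; [lia|auto with cont|apply HFc|easy|easy|easy]|apply Hz0; [lia|easy|easy|easy]]. }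
          ring.
        + assert (HD : forall a : nat -> R, 0 + a (S i) = (cesaro a (S (S i)) + -2 * cesaro a (S i)) + 1 * cesaro a i) by (intros a; rewrite <- cesaro_diff2; ring).
          apply sol_at_ext; [lia|auto with cont|auto 10 with cont| | |].
          * intros z _. unfold Fk. rewrite <- HD. ring.
          * unfold Gk. rewrite <- HD. ring.
          * unfold Hk. rewrite <- HD. ring.
      - rewrite sol_at_lin by (auto with cont; lia). rewrite sol_at_lin by (auto with cont; lia). ring. }
  set (kM := der_fac (S (2 * N))). assert (HkM : 0 <= kM) by apply der_fac_pos.
  assert (HC1 : 1 <= (1 + C) ^ 3) by (apply pow_R1_Rle; lra).
  set (K := (1 + C) ^ 3) in *.
  assert (HKd : 0 <= K * kM * d) by (apply Rmult_le_pos; [apply Rmult_le_pos; lra|easy]).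
  replace (2100 * K * kM * d) with (3 * (700 * (K * kM * d))) by ring.
  (* Cesàro sums of order [m] are larger than the data by the factor [m], so [bnd] becomes of order
     [N * d]; a second difference gains [m ^ -2], which leaves terms of order [d / N]. *)
  assert (Hbnd : forall m, (N < 2 * m)%nat -> (m <= 2 * N)%nat -> bnd m (INR m * (INR N ^ 2 * d)) (INR m * (INR N * d)) (INR m * d) <= 5 * INR N * d).
  { intros m H1 H2. unfold bnd. apply lt_INR in H1. apply le_INR in H2. rewrite mult_INR in H1, H2. change (INR 2) with 2 in *.
    assert (Hm : 0 < INR m) by lra.
    replace (INR m * (INR N ^ 2 * d) / INR m ^ 2 + INR m * (INR N * d) / INR m + INR m * d) with ((INR N / INR m * INR N + INR N + INR m) * d) by (field; lra).
    apply Rmult_le_compat_r; [easy|]. assert (INR N / INR m <= 2).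
    { apply (Rmult_le_reg_r (INR m)); [easy|]. unfold Rdiv; rewrite Rmult_assoc, Rinv_l; lra. }
    assert (INR N / INR m * INR N <= 2 * INR N) by (apply Rmult_le_compat_r; lra). lra. }
  assert (HkF : forall m k, (m <= S (2 * N))%nat -> 0 <= k -> k * der_fac m <= k * kM) by (intros; apply Rmult_le_compat_l; [easy|now apply der_fac_mono]).
  assert (HNd : 0 <= INR N * d) by (apply Rmult_le_pos; lra).
  assert (HN2d : 0 <= INR N ^ 2 * d) by (apply Rmult_le_pos; [apply pow2_ge_0|lra]).
  apply (abel_block L N (700 * (K * kM * d))); [easy|lra| | | |].
  - intros m k Hk'. apply HLz; now left.
  - intros m. apply HLz; now right.
  - intros m H1 H2 H3. rewrite !HL by lia.
    eapply Rle_trans; [apply (sol_at_diff2 m (Fk m) (Gk m) (Hk m) (INR m * (INR N ^ 2 * d)) (INR m * (INR N * d)) (INR m * d)); auto|].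
    { apply Rmult_le_pos; [apply pos_INR|easy]. }
    pose proof (Hbnd m H2 H3) as Hbm. apply lt_INR in H2. rewrite mult_INR in H2. change (INR 2) with 2 in *.
    assert (Hm : 0 < INR m) by lra. fold K.
    assert (HB0 : 0 <= bnd m (INR m * (INR N ^ 2 * d)) (INR m * (INR N * d)) (INR m * d)).
    { apply bnd_pos; try lia; apply Rmult_le_pos; lra. }
    apply Rle_trans with (34 * K * kM * (5 * INR N * d) * / INR m ^ 2).
    { unfold Rdiv. apply Rmult_le_compat_r; [left; apply Rinv_0_lt_compat, pow_lt; lra|].
      apply Rmult_le_compat; [|easy| |easy]. apply Rmult_le_pos; [lra|apply der_fac_pos]. apply HkF; [lia|lra]. }
    replace (34 * K * kM * (5 * INR N * d) * / INR m ^ 2) with ((K * kM * d) * (170 * INR N * / INR m ^ 2)) by ring.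
    replace (700 * (K * kM * d) / INR N) with ((K * kM * d) * (700 * / INR N)) by (unfold Rdiv; ring).
    apply Rmult_le_compat_l; [easy|].
    apply Rle_trans with (170 * INR N * / (INR N / 2) ^ 2).
    + apply Rmult_le_compat_l; [lra|]. apply Rinv_le_contravar; [apply pow_lt; lra|]. apply pow_incr; lra.
    + replace (170 * INR N * / (INR N / 2) ^ 2) with (680 * / INR N) by (field; lra).
      apply Rmult_le_compat_r; [left; apply Rinv_0_lt_compat|]; lra.
  - set (M := (2 * N)%nat) in *. assert (HM1 : (1 <= M)%nat) by (unfold M; lia). rewrite !HL by lia.
    assert (EM : INR M = 2 * INR N) by (unfold M; rewrite mult_INR; easy).
    (* The last Cesàro step adds the full block sum of the data; the boundary term then consists of
       the solution for that sum and of a first difference in the mode. *)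
    assert (E : sol_at M (Fk (S M)) (Gk (S M)) (Hk (S M)) = sol_at M (Fk M) (Gk M) (Hk M) + 1 * sol_at M (fun x => psum (fun n => fn n x * cosn n y) (S M)) (psum (fun n => an n * cosn n y) (S M)) (psum (fun n => bn n * cosn n y) (S M))).
    { assert (cont (fun x => psum (fun n => fn n x * cosn n y) (S M))) by (apply (psum_cont (fun n x => fn n x * cosn n y)); intros; auto with cont).
      rewrite <- sol_at_lin by easy. apply sol_at_ext; auto with cont.
      - intros z _. unfold Fk. rewrite cesaro_S. ring.
      - unfold Gk. rewrite cesaro_S. ring.
      - unfold Hk. rewrite cesaro_S. ring. }
    rewrite E. set (TT := sol_at M (fun x => psum _ _) _ _).
    assert (HTT : Rabs TT <= C * der_fac M * (3 * d)).
    { eapply Rle_trans; [apply (sol_at_bound M _ _ _ (INR N ^ 2 * d) (INR N * d) d); auto|].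
      - apply (psum_cont (fun n x => fn n x * cosn n y)); intros; auto with cont.
      - apply Rmult_le_compat_l; [apply Rmult_le_pos; [easy|apply der_fac_pos]|]. unfold bnd. rewrite EM.
        replace (INR N ^ 2 * d / (2 * INR N) ^ 2 + INR N * d / (2 * INR N) + d) with (7 / 4 * d) by (field; lra). lra. }
    pose proof (sol_at_diff1 M (Fk M) (Gk M) (Hk M) (INR M * (INR N ^ 2 * d)) (INR M * (INR N * d)) (INR M * d) HM1 (HFc M)
      ltac:(apply Rmult_le_pos; [apply pos_INR|easy]) ltac:(intros; now apply HFb) (HGb M) (HHb M)) as HD1.
    replace (sol_at M (Fk M) (Gk M) (Hk M) + 1 * TT - sol_at (S M) (Fk M) (Gk M) (Hk M)) with (TT + (sol_at M (Fk M) (Gk M) (Hk M) - sol_at (S M) (Fk M) (Gk M) (Hk M))) by ring.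
    eapply Rle_trans; [apply Rabs_triang|].
    pose proof (Hbnd M ltac:(unfold M; lia) ltac:(unfold M; lia)) as HbM.
    fold kM in HD1. rewrite EM in HD1 at 4.
    assert (HD1' : 2 * C ^ 2 * kM * bnd M (INR M * (INR N ^ 2 * d)) (INR M * (INR N * d)) (INR M * d) / (2 * INR N) <= 5 * C ^ 2 * kM * d).
    { apply Rle_trans with (2 * C ^ 2 * kM * (5 * INR N * d) / (2 * INR N)); [|right; field; lra].
      unfold Rdiv. apply Rmult_le_compat_r; [left; apply Rinv_0_lt_compat; lra|]. apply Rmult_le_compat_l; [|easy].
      apply Rmult_le_pos; [|easy]. pose proof (pow2_ge_0 C); lra. }
    assert (HkpM : C * der_fac M * (3 * d) <= C * kM * (3 * d)).
    { apply Rmult_le_compat_r; [lra|]. apply HkF; [lia|easy]. }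
    assert (HCK : C + C ^ 2 <= K).
    { unfold K. pose proof (pow_le C 2 C_pos). pose proof (pow_le C 3 C_pos). lra. }
    assert (0 <= kM * d) by now apply Rmult_le_pos.
    assert ((C + C ^ 2) * (kM * d) <= K * (kM * d)) by now apply Rmult_le_compat_r.
    assert (0 <= C * (kM * d)) by now apply Rmult_le_pos. assert (0 <= C ^ 2 * (kM * d)) by (apply Rmult_le_pos; [apply pow2_ge_0|easy]).
    set (X := 2 * C ^ 2 * kM * bnd M (INR M * (INR N ^ 2 * d)) (INR M * (INR N * d)) (INR M * d)) in *.
    lra.
Qed.
End Block.

(** [N ^ 2 * d], [N * d] and [d] are the natural sizes, at frequency [N], of the right-hand side,
    the Robin datum and the Dirichlet datum. [K] is fixed before [N] and the data. *)
Definition block_bound_by (K : R) : Prop := forall (N : nat) (fn : nat -> R -> R) (an bn : nat -> R) (v dv : nat -> R -> R) (d : R),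
  (1 <= N)%nat -> 0 <= d ->
  (forall n, cont (fn n)) -> (forall x, in_block N (fun n => fn n x)) -> in_block N an -> in_block N bn ->
  (forall x y, 0 <= x <= l -> Rabs (psum (fun k => fn k x * cosn k y) (S (2 * N))) <= INR N ^ 2 * d) ->
  (forall y, Rabs (psum (fun k => an k * cosn k y) (S (2 * N))) <= INR N * d) ->
  (forall y, Rabs (psum (fun k => bn k * cosn k y) (S (2 * N))) <= d) ->
  (forall n, (1 <= n)%nat -> mode_sol_of (INR n ^ 2) (fn n) (an n) (bn n) (v n) (dv n)) ->
  forall x y, 0 <= x <= l ->
    Rabs (psum (fun i => v (S i) x * cosn (S i) y) (2 * N)) <= K * d /\
    Rabs (psum (fun i => dv (S i) x * cosn (S i) y) (2 * N)) <= K * INR N * d.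
Lemma mode_block_bound : exists K, 0 <= K /\ block_bound_by K.
Proof.
  destruct mode_solvable as [C [HC HS]]. exists (6300 * (1 + C) ^ 3). split; [pose proof (pow_le (1 + C) 3 ltac:(lra)); lra|].
  intros N fn an bn v dv d HN Hd Hfc Hfb Hab Hbb Hf Ha Hb Hm x y Hx.
  pose proof (fun fl => block_bound C HC HS fl x Hx N fn an bn d y HN Hd Hfc Hfb Hab Hbb Hf Ha Hb) as HB.
  assert (He : forall n, (1 <= n)%nat -> fst (the_sol n (fn n) (an n) (bn n)) x = v n x /\ snd (the_sol n (fn n) (an n) (bn n)) x = dv n x).
  { intros n Hn. apply (the_sol_eq C); auto. }
  assert (HK : 1 <= (1 + C) ^ 3) by (apply pow_R1_Rle; lra). set (K := (1 + C) ^ 3) in *.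
  assert (HKd : 0 <= K * d) by (apply Rmult_le_pos; lra).
  split.
  - specialize (HB false). unfold der_fac, sol_at in HB. rewrite (psum_ext _ (fun i => v (S i) x * cosn (S i) y)) in HB.
    + eapply Rle_trans; [apply HB|]. lra.
    + intros i _. f_equal. apply He; lia.
  - specialize (HB true). unfold der_fac, sol_at in HB. rewrite (psum_ext _ (fun i => dv (S i) x * cosn (S i) y)) in HB.
    + eapply Rle_trans; [apply HB|]. rewrite S_INR, mult_INR. change (INR 2) with 2. apply le_INR in HN. simpl in HN.
      replace (2100 * K * (2 * INR N + 1) * d) with ((K * d) * (2100 * (2 * INR N + 1))) by ring.
      replace (6300 * K * INR N * d) with ((K * d) * (6300 * INR N)) by ring. apply Rmult_le_compat_l; lra.
    + intros i _. f_equal. apply He; lia.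
Qed.

Lemma mode_sol_of_scal nu f g0 gl v dv k : mode_sol_of nu f g0 gl v dv -> mode_sol_of nu (fun x => k * f x) (k * g0) (k * gl) (fun x => k * v x) (fun x => k * dv x).
Proof.
  intros [[A [B C]] [D E]]. assert (cont v) by now apply (cont_derive v dv).
  split; [split; [|split]|split].
  - intros x. apply (is_derive_scal v x k), A.
  - auto with cont.
  - intros x Hx. replace (rhs nu (fun x => k * f x) (fun x => k * v x) (fun x => k * dv x) x) with (k * rhs nu f v dv x).
    + apply (is_derive_scal dv x k). now apply C.
    + assert (nonloc (fun x => k * v x) x = k * nonloc v x) as EE; [|unfold rhs; rewrite EE; ring].
      unfold nonloc. rewrite (RInt_eq (fun t => aa t * (k * v t)) (fun t => k * (aa t * v t))) by (intros; ring).
      rewrite (RInt_eq (fun t => bb t * (k * v t)) (fun t => k * (bb t * v t))) by (intros; ring).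
      rewrite !RInt_cscal by auto with cont. ring.
  - rewrite <- D. ring.
  - now rewrite E.
Qed.

Lemma nonloc_psum (w : nat -> R -> R) n x : (forall i, cont (w i)) -> nonloc (fun t => psum (fun i => w i t) n) x = psum (fun i => nonloc (w i) x) n.
Proof.
  intros Hw. induction n.
  - unfold nonloc. simpl. rewrite (RInt_eq (fun t => aa t * 0) (fun _ => 0)), (RInt_eq (fun t => bb t * 0) (fun _ => 0)) by (intros; ring). rewrite !RInt_cst. ring.
  - rewrite psum_S, <- IHn. simpl.
    rewrite <- (Rmult_1_l (nonloc (w n) x)), <- nonloc_lin by auto with cont. unfold nonloc. f_equal; f_equal; apply RInt_eq; intros; ring.
Qed.

(** * The series of the blocks *)

Section Sum.
Variables (al E KB : R) (k : nat) (fn : nat -> R -> R) (an bn : nat -> R) (v dv : nat -> R -> R).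
Hypotheses (al_in : 0 < al < 1) (E_pos : 0 <= E) (KB_pos : 1 <= KB).
Hypothesis HKB : block_bound_by KB.

(** The size at frequency [2 ^ j] of a quantity of order [i] attached to a function in [C^(k, al)]:
    order [2] for the right-hand side, [1] for the Robin datum, [0] for the Dirichlet datum. *)
Definition block_size (i j : nat) : R := E * ratio al ^ j * (2 ^ j) ^ i / (2 ^ j) ^ k.

Hypothesis fn_cont : forall n, cont (fn n).
Hypothesis fn_bd : forall j x y, 0 <= x <= l -> Rabs (dyblock j (fun n => fn n x * cosn n y)) <= block_size 2 j.
Hypothesis an_bd : forall j y, Rabs (dyblock j (fun n => an n * cosn n y)) <= block_size 1 j.
Hypothesis bn_bd : forall j y, Rabs (dyblock j (fun n => bn n * cosn n y)) <= block_size 0 j.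
Hypothesis v_sol : forall n, (1 <= n)%nat -> mode_sol_of (INR n ^ 2) (fn n) (an n) (bn n) (v n) (dv n).
Hypothesis v_zero : forall x, v 0%nat x = 0.
Hypothesis dv_zero : forall x, dv 0%nat x = 0.

Lemma ratio_pow_pos j : 0 < ratio al ^ j.
Proof. pose proof (ratio_bounds al al_in). apply pow_lt; lra. Qed.
Lemma block_size_pos i j : 0 <= block_size i j.
Proof.
  unfold block_size. pose proof (ratio_pow_pos j). pose proof (pow2_pos j).
  apply Rdiv_le_0_compat; [|now apply pow_lt]. apply Rmult_le_pos; [apply Rmult_le_pos; lra|]. apply pow_le; lra.
Qed.
Lemma block_size_mul i m j : (2 ^ j) ^ m * block_size i j = block_size (m + i) j.
Proof. unfold block_size. rewrite pow_add. unfold Rdiv. ring. Qed.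
Lemma block_size_mono i i' j : (i <= i')%nat -> block_size i j <= block_size i' j.
Proof.
  intros H. replace i' with ((i' - i) + i)%nat by lia. rewrite <- block_size_mul.
  rewrite <- (Rmult_1_l (block_size i j)) at 1. apply Rmult_le_compat_r; [apply block_size_pos|].
  apply pow_R1_Rle. apply pow_R1_Rle. lra.
Qed.
Lemma block_size_k i j : (i <= k)%nat -> block_size i j <= E * ratio al ^ j.
Proof.
  intros H. eapply Rle_trans; [apply (block_size_mono i k j H)|]. unfold block_size. right; field. apply pow_nonzero. pose proof (pow2_pos j); lra.
Qed.
Lemma block_size_k1 i j : (i <= S k)%nat -> block_size i j <= E * (2 * ratio al) ^ j.
Proof.
  intros H. eapply Rle_trans; [apply (block_size_mono i (S k) j H)|]. unfold block_size. rewrite Rpow_mult_distr. simpl. right; field. apply pow_nonzero. pose proof (pow2_pos j); lra.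
Qed.

Definition mode_d (i n : nat) : R -> R := match i with O => v n | _ => dv n end.
Definition ublock (i q j : nat) (x y : R) : R := psum (fun n => dyad j n * mode_d i n x * dcosn q n y) (S (2 * 2 ^ j)).
Definition fblock (q j : nat) (x y : R) : R := psum (fun n => dyad j n * fn n x * dcosn q n y) (S (2 * 2 ^ j)).
(** The second [x]-derivative read off the equation: on cosines [n ^ 2 * r * v] is [- r] times two
    [y]-derivatives, so no mode number is left and the formula survives summation over blocks. *)
Definition ublock_xx (q j : nat) (x y : R) : R :=
  b x * ublock 1 q j x y + c x * ublock 0 q j x y + nonloc (fun t => ublock 0 q j t y) x - r x * (ublock 0 (S (S q)) j x y + fblock q j x y).

Lemma v_ode n : (forall x, is_derive (v n) x (dv n x)) /\ cont (dv n).
Proof.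
  destruct n.
  - split.
    + intros x. rewrite dv_zero. apply (is_derive_ext (fun _ => 0)); [intros; now rewrite v_zero|apply derive_cst].
    + apply (cont_ext (fun _ => 0)); [intros; now rewrite dv_zero|auto with cont].
  - destruct (v_sol (S n) ltac:(lia)) as [[A [B _]] _]. easy.
Qed.
Lemma v_cont n : cont (v n).
Proof. apply (cont_derive _ (dv n)), v_ode. Qed.
Lemma mode_d_cont i n : cont (mode_d i n).
Proof. destruct i; [apply v_cont|apply v_ode]. Qed.

Lemma ublock_base i j x y : 0 <= x <= l -> (i <= 1)%nat -> Rabs (psum (fun n => dyad j n * mode_d i n x * cosn n y) (S (2 * 2 ^ j))) <= KB * block_size i j.
Proof.
  intros Hx Hi. pose proof (pow2_ge1 j) as HN.
  assert (HW : forall a y, psum (fun k => dyad j k * a k * cosn k y) (S (2 * 2 ^ j)) = dyblock j (fun n => a n * cosn n y)).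
  { intros a z. now rewrite dyblock_psum. }
  assert (Eg : forall m, INR (2 ^ j) ^ m * block_size 0 j = block_size m j).
  { intros m. rewrite INR_pow2, block_size_mul. now rewrite Nat.add_0_r. }
  destruct (HKB (2 ^ j)%nat (fun n x => dyad j n * fn n x) (fun n => dyad j n * an n) (fun n => dyad j n * bn n)
    (fun n x => dyad j n * v n x) (fun n x => dyad j n * dv n x) (block_size 0 j) HN (block_size_pos 0 j)) with (x := x) (y := y) as [H1 H2].
  - intros n. auto with cont.
  - intros z. apply (dyad_in_block j (fun n => fn n z)).
  - apply dyad_in_block.
  - apply dyad_in_block.
  - intros z w Hz. rewrite (HW (fun n => fn n z)), Eg. now apply fn_bd.
  - intros w. rewrite HW. replace (INR (2 ^ j)) with (INR (2 ^ j) ^ 1) by (simpl; ring). rewrite Eg. apply an_bd.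
  - intros w. rewrite HW. apply bn_bd.
  - intros n Hn. now apply mode_sol_of_scal, v_sol.
  - easy.
  - rewrite psum_shift, dyad_0, Rmult_0_l, Rmult_0_l, Rplus_0_l.
    destruct i as [|[|i]]; [| |lia]; simpl mode_d.
    + easy.
    + replace (INR (2 ^ j)) with (INR (2 ^ j) ^ 1) in H2 by (simpl; ring). rewrite Rmult_assoc, Eg in H2. easy.
Qed.

Lemma ublock_bound i q j x y : 0 <= x <= l -> (i <= 1)%nat -> Rabs (ublock i q j x y) <= 62 ^ q * KB * block_size (q + i) j.
Proof.
  intros Hx Hi. unfold ublock. eapply Rle_trans.
  - apply (bernstein q (fun n => dyad j n * mode_d i n x) (2 ^ j) (KB * block_size i j) (pow2_ge1 j)).
    + apply Rmult_le_pos; [lra|apply block_size_pos].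
    + apply (dyad_in_block j (fun n => mode_d i n x)).
    + intros w. now apply ublock_base.
  - rewrite <- block_size_mul, INR_pow2. right; ring.
Qed.
Lemma fblock_bound q j x y : 0 <= x <= l -> Rabs (fblock q j x y) <= 62 ^ q * block_size (q + 2) j.
Proof.
  intros Hx. unfold fblock. eapply Rle_trans.
  - apply (bernstein q (fun n => dyad j n * fn n x) (2 ^ j) (block_size 2 j) (pow2_ge1 j)).
    + apply block_size_pos.
    + apply (dyad_in_block j (fun n => fn n x)).
    + intros w. rewrite <- (dyblock_psum j (fun n => fn n x)). now apply fn_bd.
  - rewrite <- block_size_mul, INR_pow2. right; ring.
Qed.
Lemma ublock_cont i q j y : cont (fun x => ublock i q j x y).
Proof.
  unfold ublock. apply (psum_cont (fun n x => dyad j n * mode_d i n x * dcosn q n y)). intros n. pose proof (mode_d_cont i n). auto with cont.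
Qed.

Definition K2 : R := 2 * Q + 2 * Q ^ 2 * l + 62 ^ 2 * Q + Q.
Lemma K2_pos : 0 <= K2.
Proof. unfold K2. assert (0 <= Q ^ 2 * l) by (apply Rmult_le_pos; [apply pow2_ge_0|lra]). lra. Qed.

Lemma ublock_xx_bound q j x y : 0 <= x <= l -> Rabs (ublock_xx q j x y) <= K2 * (62 ^ q * KB * block_size (q + 2) j).
Proof.
  intros Hx. unfold ublock_xx. destruct (Q_bound x Hx) as [Qr [Qb [Qc _]]].
  pose proof (ublock_bound 1 q j x y Hx ltac:(lia)) as H1. pose proof (fun t Ht => ublock_bound 0 q j t y Ht ltac:(lia)) as H0.
  pose proof (ublock_bound 0 (S (S q)) j x y Hx ltac:(lia)) as H2. pose proof (fblock_bound q j x y Hx) as Hh.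
  pose proof (block_size_mono (q + 0) (q + 2) j ltac:(lia)) as G0. pose proof (block_size_mono (q + 1) (q + 2) j ltac:(lia)) as G1.
  replace (S (S q) + 0)%nat with (q + 2)%nat in H2 by lia.
  set (g := block_size (q + 2) j) in *. assert (Hg : 0 <= g) by apply block_size_pos.
  assert (HP : 0 < 62 ^ q) by (apply pow_lt; lra).
  set (X := 62 ^ q * KB * g). assert (HPK : 0 <= 62 ^ q * KB) by (apply Rmult_le_pos; lra).
  assert (HX : 0 <= X) by (unfold X; now apply Rmult_le_pos).
  assert (B0 : forall t, 0 <= t <= l -> Rabs (ublock 0 q j t y) <= X).
  { intros t Ht. eapply Rle_trans; [now apply H0|]. unfold X. now apply Rmult_le_compat_l. }
  assert (B1 : Rabs (ublock 1 q j x y) <= X).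
  { eapply Rle_trans; [apply H1|]. unfold X. now apply Rmult_le_compat_l. }
  assert (BN : Rabs (nonloc (fun t => ublock 0 q j t y) x) <= 2 * Q ^ 2 * l * X).
  { apply nonloc_bound; auto; [apply ublock_cont|]. intros; apply B0; lra. }
  assert (B2 : Rabs (ublock 0 (S (S q)) j x y + fblock q j x y) <= 62 ^ 2 * X + X).
  { eapply Rle_trans; [apply Rabs_triang|]. apply Rplus_le_compat.
    - eapply Rle_trans; [apply H2|]. unfold X. simpl. right; ring.
    - eapply Rle_trans; [apply Hh|]. unfold X. apply Rmult_le_compat_r; [easy|].
      rewrite <- (Rmult_1_r (62 ^ q)) at 1. apply Rmult_le_compat_l; lra. }
  replace (K2 * X) with (Q * X + Q * X + 2 * Q ^ 2 * l * X + 0 + Q * (62 ^ 2 * X + X)) by (unfold K2; ring).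
  rewrite <- (Rplus_0_r (b x * ublock 1 q j x y + c x * ublock 0 q j x y + nonloc (fun t => ublock 0 q j t y) x)).
  apply Rabs_sum5.
  - rewrite Rabs_mult. apply Rmult_le_compat; try apply Rabs_pos; easy.
  - rewrite Rabs_mult. apply Rmult_le_compat; try apply Rabs_pos; [easy|now apply B0].
  - easy.
  - rewrite Rabs_R0; lra.
  - rewrite Rabs_mult. apply Rmult_le_compat; try apply Rabs_pos; easy.
Qed.

Lemma ublock_dy i q j x y : is_derive (fun y => ublock i q j x y) y (ublock i (S q) j x y).
Proof.
  unfold ublock. apply (psum_derive (fun n y => dyad j n * mode_d i n x * dcosn q n y) (fun n y => dyad j n * mode_d i n x * dcosn (S q) n y)).
  intros n. apply (is_derive_scal (dcosn q n) y (dyad j n * mode_d i n x)), dcosn_derive.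
Qed.
Lemma ublock_dx0 q j x y : is_derive (fun x => ublock 0 q j x y) x (ublock 1 q j x y).
Proof.
  unfold ublock. apply (psum_derive (fun n x => dyad j n * mode_d 0 n x * dcosn q n y) (fun n x => dyad j n * mode_d 1 n x * dcosn q n y)).
  intros n. apply (is_derive_ext (fun x => (dyad j n * dcosn q n y) * v n x)); [intros; simpl; fold_R; ring|].
  replace (dyad j n * mode_d 1 n x * dcosn q n y) with ((dyad j n * dcosn q n y) * dv n x) by (simpl; ring).
  apply (is_derive_scal (v n) x (dyad j n * dcosn q n y)), v_ode.
Qed.
Lemma ublock_dx1 q j x y : 0 <= x <= l -> is_derive (fun x => ublock 1 q j x y) x (ublock_xx q j x y).
Proof.
  intros Hx. unfold ublock.
  assert (ublock_xx q j x y = psum (fun n => dyad j n * (match n with O => 0 | _ => rhs (INR n ^ 2) (fn n) (v n) (dv n) x end) * dcosn q n y) (S (2 * 2 ^ j))) as ->.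
  { unfold ublock_xx. unfold ublock at 3.
    rewrite (nonloc_psum (fun n t => dyad j n * mode_d 0 n t * dcosn q n y)).
    2:{ intros n. pose proof (mode_d_cont 0 n). auto with cont. }
    unfold ublock, fblock. rewrite <- !psum_plus, <- !psum_scal, <- !psum_plus, <- psum_minus. apply psum_ext. intros n _.
    destruct n.
    - rewrite dyad_0. unfold nonloc.
      rewrite (RInt_eq (fun t => aa t * (0 * mode_d 0 0 t * dcosn q 0 y)) (fun _ => 0)), (RInt_eq (fun t => bb t * (0 * mode_d 0 0 t * dcosn q 0 y)) (fun _ => 0)) by (intros; ring).
      rewrite !RInt_cst. ring.
    - assert (nonloc (fun t => dyad j (S n) * mode_d 0 (S n) t * dcosn q (S n) y) x = (dyad j (S n) * dcosn q (S n) y) * nonloc (v (S n)) x) as ->.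
      { unfold nonloc. pose proof (v_cont (S n)).
        rewrite (RInt_eq (fun t => aa t * (dyad j (S n) * mode_d 0 (S n) t * dcosn q (S n) y)) (fun t => (dyad j (S n) * dcosn q (S n) y) * (aa t * v (S n) t))) by (intros; simpl; ring).
        rewrite (RInt_eq (fun t => bb t * (dyad j (S n) * mode_d 0 (S n) t * dcosn q (S n) y)) (fun t => (dyad j (S n) * dcosn q (S n) y) * (bb t * v (S n) t))) by (intros; simpl; ring).
        rewrite !RInt_cscal by auto with cont. ring. }
      rewrite dcosn_SS. unfold rhs. simpl mode_d. ring. }
  apply (psum_derive (fun n x => dyad j n * mode_d 1 n x * dcosn q n y) (fun n x => dyad j n * (match n with O => 0 | _ => rhs (INR n ^ 2) (fn n) (v n) (dv n) x end) * dcosn q n y)).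
  intros n. apply (is_derive_ext (fun x => (dyad j n * dcosn q n y) * dv n x)); [intros; simpl; fold_R; ring|].
  destruct n.
  - rewrite dyad_0. replace (0 * 0 * dcosn q 0 y) with 0 by ring.
    apply (is_derive_ext (fun _ => 0)); [intros; simpl; fold_R; ring|apply derive_cst].
  - replace (dyad j (S n) * rhs (INR (S n) ^ 2) (fn (S n)) (v (S n)) (dv (S n)) x * dcosn q (S n) y) with ((dyad j (S n) * dcosn q (S n) y) * rhs (INR (S n) ^ 2) (fn (S n)) (v (S n)) (dv (S n)) x) by ring.
    apply (is_derive_scal (dv (S n)) x (dyad j (S n) * dcosn q (S n) y)). destruct (v_sol (S n) ltac:(lia)) as [[_ [_ H]] _]. now apply H.
Qed.

(** The blocks are estimated for [x] in [[0, l]]; clamping gives a function with the same bounds for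
    every [x]. *)
Definition useries (i q : nat) (x y : R) : R := dsum (fun j => ublock i q j (clamp 0 l x) y).
(** The exponent [4]: up to three [y]-derivatives occur for [k = 3], and the Hölder estimates take
    one more. *)
Definition ublock_cst : R := 62 ^ 4 * (1 + K2) * KB.

Lemma cl_in x : 0 <= clamp 0 l x <= l.
Proof. apply clamp_in; lra. Qed.
Lemma r_in : 0 <= ratio al < 1.
Proof. pose proof (ratio_bounds al al_in). lra. Qed.
Lemma pow62 q : (q <= 4)%nat -> 0 < 62 ^ q <= 62 ^ 4.
Proof. intros H. split; [apply pow_lt; lra|]. apply Rle_pow; [lra|easy]. Qed.
Lemma ublock_cst_pos : 0 <= ublock_cst.
Proof. unfold ublock_cst. pose proof K2_pos. apply Rmult_le_pos; [|lra]. apply Rmult_le_pos; lra. Qed.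
Lemma Ko_bl i q j x y : 0 <= x <= l -> (i <= 1)%nat -> (q <= 4)%nat -> Rabs (ublock i q j x y) <= ublock_cst * block_size (q + i) j.
Proof.
  intros Hx Hi Hq. eapply Rle_trans; [now apply ublock_bound|]. apply Rmult_le_compat_r; [apply block_size_pos|].
  unfold ublock_cst. pose proof (pow62 q Hq). pose proof K2_pos. apply Rmult_le_compat_r; [lra|].
  apply Rle_trans with (62 ^ 4 * 1); [lra|]. apply Rmult_le_compat_l; lra.
Qed.
Lemma Ko_bl2 q j x y : 0 <= x <= l -> (q <= 4)%nat -> Rabs (ublock_xx q j x y) <= ublock_cst * block_size (q + 2) j.
Proof.
  intros Hx Hq. eapply Rle_trans; [now apply ublock_xx_bound|].
  replace (K2 * (62 ^ q * KB * block_size (q + 2) j)) with ((62 ^ q * K2 * KB) * block_size (q + 2) j) by ring.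
  apply Rmult_le_compat_r; [apply block_size_pos|]. unfold ublock_cst. pose proof (pow62 q Hq). pose proof K2_pos.
  apply Rmult_le_compat_r; [lra|]. apply Rmult_le_compat; lra.
Qed.
Lemma KoE j i : (i <= k)%nat -> ublock_cst * block_size i j <= ublock_cst * E * ratio al ^ j.
Proof. intros H. rewrite Rmult_assoc. apply Rmult_le_compat_l; [apply ublock_cst_pos|now apply block_size_k]. Qed.
Lemma KoE1 j i : (i <= S k)%nat -> ublock_cst * block_size i j <= ublock_cst * E * (2 * ratio al) ^ j.
Proof. intros H. rewrite Rmult_assoc. apply Rmult_le_compat_l; [apply ublock_cst_pos|now apply block_size_k1]. Qed.
Lemma ublock_cst_E_pos : 0 <= ublock_cst * E.
Proof. apply Rmult_le_pos; [apply ublock_cst_pos|easy]. Qed.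

Lemma ublock_geo i q j x y : 0 <= x <= l -> (i <= 1)%nat -> (q <= 3)%nat -> (q + i <= k)%nat -> Rabs (ublock i q j x y) <= ublock_cst * E * ratio al ^ j.
Proof. intros Hx Hi Hq Hk. eapply Rle_trans; [apply Ko_bl; auto; lia|now apply KoE]. Qed.

Lemma useries_tail i q x y J : (i <= 1)%nat -> (q <= 3)%nat -> (q + i <= k)%nat ->
  Rabs (useries i q x y - psum (fun j => ublock i q j (clamp 0 l x) y) J) <= ublock_cst * E / (1 - ratio al) * ratio al ^ J.
Proof.
  intros Hi Hq Hk. unfold useries. eapply Rle_trans; [apply (ssum_tail _ (ublock_cst * E) (ratio al) J r_in ublock_cst_E_pos)|].
  - intros j. apply ublock_geo; auto. apply cl_in.
  - right. pose proof (ratio_bounds al al_in). field; lra.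
Qed.
Lemma useries_lim i q x y J : (i <= 1)%nat -> (q <= 3)%nat -> (q + i <= k)%nat -> 0 <= x <= l ->
  Rabs (psum (fun j => ublock i q j x y) J - useries i q x y) <= ublock_cst * E / (1 - ratio al) * ratio al ^ J.
Proof.
  intros Hi Hq Hk Hx. rewrite Rabs_minus_sym. pose proof (useries_tail i q x y J Hi Hq Hk) as H.
  rewrite clamp_id in H by easy. exact H.
Qed.
Lemma useries_bound i q x y : (i <= 1)%nat -> (q <= 3)%nat -> (q + i <= k)%nat -> Rabs (useries i q x y) <= ublock_cst * E / (1 - ratio al).
Proof.
  intros Hi Hq Hk. unfold useries. apply (ssum_bound _ (ublock_cst * E) (ratio al) r_in ublock_cst_E_pos). intros j. apply ublock_geo; auto. apply cl_in.
Qed.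
Lemma useries_hol_y i q x y y' : (i <= 1)%nat -> (q <= 3)%nat -> (q + i <= k)%nat ->
  Rabs (useries i q x y - useries i q x y') <= hol_cst al * (ublock_cst * E) * hpow al (Rabs (y - y')).
Proof.
  intros Hi Hq Hk. unfold useries. apply dyadic_holder; auto using ublock_cst_E_pos, Rabs_pos.
  - intros j. apply ublock_geo; auto. apply cl_in.
  - intros j. apply ublock_geo; auto. apply cl_in.
  - intros j. apply (mvt_le (fun y => ublock i q j (clamp 0 l x) y) (fun y => ublock i (S q) j (clamp 0 l x) y) (Rmin y y') (Rmax y y')).
    + unfold Rmin, Rmax; destruct Rle_dec; lra.
    + unfold Rmin, Rmax; destruct Rle_dec; lra.
    + intros; apply ublock_dy.
    + intros z _. eapply Rle_trans; [apply Ko_bl; auto; [apply cl_in|lia]|]. apply KoE1; lia.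
Qed.
(** An [x]-derivative of a block costs the same factor [2 ^ j] as a [y]-derivative, so
    [dyadic_holder] applies in the [x]-direction as well; for [i = 1] the increment is controlled by
    [ublock_xx]. *)
Lemma useries_hol_x i q x x' y : (i <= 1)%nat -> (q <= 3)%nat -> (q + i <= k)%nat ->
  Rabs (useries i q x y - useries i q x' y) <= hol_cst al * (ublock_cst * E) * hpow al (Rabs (x - x')).
Proof.
  intros Hi Hq Hk. apply Rle_trans with (hol_cst al * (ublock_cst * E) * hpow al (Rabs (clamp 0 l x - clamp 0 l x'))).
  2:{ apply Rmult_le_compat_l; [apply Rmult_le_pos; [left; now apply hol_cst_pos|apply ublock_cst_E_pos]|]. apply hpow_mono; [lra|apply clamp_lip]. }
  unfold useries. apply dyadic_holder; auto using ublock_cst_E_pos, Rabs_pos.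
  - intros j. apply ublock_geo; auto. apply cl_in.
  - intros j. apply ublock_geo; auto. apply cl_in.
  - intros j. pose proof (cl_in x). pose proof (cl_in x'). destruct i as [|[|i]]; [| |lia].
    + apply (mvt_le (fun x => ublock 0 q j x y) (fun x => ublock 1 q j x y) 0 l); auto.
      * intros; apply ublock_dx0.
      * intros z Hz. eapply Rle_trans; [apply Ko_bl; auto; lia|]. apply KoE1; lia.
    + apply (mvt_le (fun x => ublock 1 q j x y) (fun x => ublock_xx q j x y) 0 l); auto.
      * intros; now apply ublock_dx1.
      * intros z Hz. eapply Rle_trans; [apply Ko_bl2; auto; lia|]. apply KoE1; lia.
Qed.
Lemma useries_cont i q y : (i <= 1)%nat -> (q <= 3)%nat -> (q + i <= k)%nat -> cont (fun x => useries i q x y).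
Proof.
  intros Hi Hq Hk. apply (unif_cont (fun J x => psum (fun j => ublock i q j (clamp 0 l x) y) J) _ (ublock_cst * E / (1 - ratio al)) (ratio al) r_in).
  - intros J. apply (cont_comp (clamp 0 l) (fun x => psum (fun j => ublock i q j x y) J)); [apply cont_clamp|].
    apply (psum_cont (fun j x => ublock i q j x y)). intros; apply ublock_cont.
  - intros J x. now apply useries_tail.
Qed.

Lemma useries_dy i q x y : (i <= 1)%nat -> (S q <= 3)%nat -> (S q + i <= k)%nat -> is_derive (fun y => useries i q x y) y (useries i (S q) x y).
Proof.
  intros Hi Hq Hk. apply (derive_lim (fun J y => psum (fun j => ublock i q j (clamp 0 l x) y) J) (fun J y => psum (fun j => ublock i (S q) j (clamp 0 l x) y) J)
    (fun y => useries i q x y) (fun y => useries i (S q) x y) (y - 1) (y + 1) y (ublock_cst * E / (1 - ratio al)) (ratio al) r_in); [lra| | |].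
  - intros J t _. apply (psum_derive (fun j y => ublock i q j (clamp 0 l x) y) (fun j y => ublock i (S q) j (clamp 0 l x) y)). intros; apply ublock_dy.
  - intros J t _. rewrite Rabs_minus_sym. apply useries_tail; lia.
  - intros J t _. rewrite Rabs_minus_sym. apply useries_tail; lia.
Qed.
Lemma useries_dx0 q x y : 0 < x < l -> (q <= 3)%nat -> (S q <= k)%nat -> is_derive (fun x => useries 0 q x y) x (useries 1 q x y).
Proof.
  intros Hx Hq Hk. apply (derive_lim (fun J x => psum (fun j => ublock 0 q j x y) J) (fun J x => psum (fun j => ublock 1 q j x y) J)
    (fun x => useries 0 q x y) (fun x => useries 1 q x y) 0 l x (ublock_cst * E / (1 - ratio al)) (ratio al) r_in); [lra| | |].
  - intros J t _. apply (psum_derive (fun j x => ublock 0 q j x y) (fun j x => ublock 1 q j x y)). intros; apply ublock_dx0.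
  - intros J t Ht. apply useries_lim; (lia || lra).
  - intros J t Ht. apply useries_lim; (lia || lra).
Qed.

Variables (Hs : nat -> R -> R -> R) (E' : R).
Hypothesis E'_pos : 0 <= E'.
Hypothesis Hs_lim : forall q J x y, (q + 2 <= k)%nat -> 0 < x < l -> 0 < y < PI ->
  Rabs (psum (fun j => fblock q j x y) J - Hs q x y) <= E' * ratio al ^ J.

Definition useries_xx (q : nat) (x y : R) : R :=
  b x * useries 1 q x y + c x * useries 0 q x y + nonloc (fun t => useries 0 q t y) x - r x * (useries 0 (S (S q)) x y + Hs q x y).

Lemma useries_dx1 q x y : 0 < x < l -> 0 < y < PI -> (q <= 1)%nat -> (q + 2 <= k)%nat -> is_derive (fun x => useries 1 q x y) x (useries_xx q x y).
Proof.
  intros Hx Hy Hq Hk. set (KE := ublock_cst * E / (1 - ratio al)).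
  assert (HKE : 0 <= KE). { unfold KE. pose proof (ratio_bounds al al_in). apply Rdiv_le_0_compat; [apply ublock_cst_E_pos|lra]. }
  assert (HQ2 : 0 <= 2 * Q ^ 2 * l) by (pose proof (pow2_ge_0 Q); apply Rmult_le_pos; lra).
  set (EE := Q * KE + Q * KE + 2 * Q ^ 2 * l * KE + 0 + Q * (KE + E')).
  assert (HEE : KE <= EE).
  { unfold EE. assert (0 <= 2 * Q ^ 2 * l * KE) by now apply Rmult_le_pos. assert (0 <= Q * E') by (apply Rmult_le_pos; lra). nra. }
  assert (Ht : forall i q J x, (i <= 1)%nat -> (q <= 3)%nat -> (q + i <= k)%nat -> 0 <= x <= l ->
    Rabs (psum (fun j => ublock i q j x y) J - useries i q x y) <= KE * ratio al ^ J).
  { intros i q' J t Hi Hq' Hk' Ht. now apply useries_lim. }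
  apply (derive_lim (fun J x => psum (fun j => ublock 1 q j x y) J) (fun J x => psum (fun j => ublock_xx q j x y) J)
    (fun x => useries 1 q x y) (fun x => useries_xx q x y) 0 l x EE (ratio al) r_in); [lra| | |].
  - intros J t Ht'. apply (psum_derive (fun j x => ublock 1 q j x y) (fun j x => ublock_xx q j x y)). intros; apply ublock_dx1; lra.
  - intros J t Ht'. pose proof (ratio_pow_pos J). apply Rle_trans with (KE * ratio al ^ J); [|apply Rmult_le_compat_r; lra]. apply Ht; (lia || lra).
  - intros J t Ht'. destruct (Q_bound t ltac:(lra)) as [Qr [Qb [Qc _]]]. pose proof (ratio_pow_pos J) as HrJ.
    assert (E1 : psum (fun j => ublock_xx q j t y) J = b t * psum (fun j => ublock 1 q j t y) J + c t * psum (fun j => ublock 0 q j t y) J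
      + nonloc (fun s => psum (fun j => ublock 0 q j s y) J) t - r t * (psum (fun j => ublock 0 (S (S q)) j t y) J + psum (fun j => fblock q j t y) J)).
    { rewrite (nonloc_psum (fun j s => ublock 0 q j s y)) by (intros; apply ublock_cont).
      rewrite <- psum_plus, <- !psum_scal, <- !psum_plus, <- psum_minus. apply psum_ext. intros; unfold ublock_xx; ring. }
    assert (HN : Rabs (nonloc (fun s => psum (fun j => ublock 0 q j s y) J + -1 * useries 0 q s y) t) <= 2 * Q ^ 2 * l * (KE * ratio al ^ J)).
    { apply nonloc_bound; [|lra|apply Rmult_le_pos; lra|].
      - apply cont_plus; [apply (psum_cont (fun j s => ublock 0 q j s y)); intros; apply ublock_cont|].
        apply cont_mult; [auto with cont|]. apply useries_cont; lia.
      - intros s Hs'. replace (psum (fun j => ublock 0 q j s y) J + -1 * useries 0 q s y) with (psum (fun j => ublock 0 q j s y) J - useries 0 q s y) by ring.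
        apply Ht; (lia || lra). }
    rewrite nonloc_lin in HN; [|apply (psum_cont (fun j s => ublock 0 q j s y)); intros; apply ublock_cont|apply useries_cont; lia].
    rewrite E1. unfold useries_xx, EE.
    match goal with |- Rabs ?z <= _ => replace z with
      (b t * (psum (fun j => ublock 1 q j t y) J - useries 1 q t y) + c t * (psum (fun j => ublock 0 q j t y) J - useries 0 q t y)
      + (nonloc (fun s => psum (fun j => ublock 0 q j s y) J) t + -1 * nonloc (fun s => useries 0 q s y) t) + 0
      - r t * ((psum (fun j => ublock 0 (S (S q)) j t y) J - useries 0 (S (S q)) t y) + (psum (fun j => fblock q j t y) J - Hs q t y))) by ring end.
    rewrite !Rmult_plus_distr_r. apply Rabs_sum5.
    + rewrite Rabs_mult, Rmult_assoc. apply Rmult_le_compat; try apply Rabs_pos; [easy|apply Ht; (lia || lra)].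
    + rewrite Rabs_mult, Rmult_assoc. apply Rmult_le_compat; try apply Rabs_pos; [easy|apply Ht; (lia || lra)].
    + lra.
    + rewrite Rabs_R0; lra.
    + rewrite Rabs_mult. replace (Q * (KE + E') * ratio al ^ J) with (Q * (KE * ratio al ^ J + E' * ratio al ^ J)) by ring.
      apply Rmult_le_compat; try apply Rabs_pos; [easy|].
      eapply Rle_trans; [apply Rabs_triang|]. apply Rplus_le_compat; [apply Ht; (lia || lra)|apply Hs_lim; (lia || lra)].
Qed.

(** Every block satisfies the condition by linearity; the partial sums of the block data converge
    both to the combination of the series and to [A], so the two agree. *)
Lemma useries_bc0 y A : (1 <= k)%nat -> (forall J, Rabs (psum (fun j => dyblock j (fun n => an n * cosn n y)) J - A) <= E' * ratio al ^ J) ->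
  useries 1 0 0 y + kap * useries 0 0 0 y = A.
Proof.
  intros Hk HA. set (KE := ublock_cst * E / (1 - ratio al)).
  apply (lim_unique_geom (psum (fun j => dyblock j (fun n => an n * cosn n y))) _ _ (KE + Rabs kap * KE + E') (ratio al) r_in).
  - intros J. pose proof (ratio_pow_pos J).
    assert (psum (fun j => dyblock j (fun n => an n * cosn n y)) J = psum (fun j => ublock 1 0 j 0 y) J + kap * psum (fun j => ublock 0 0 j 0 y) J) as ->.
    { rewrite <- psum_scal, <- psum_plus. apply psum_ext. intros j _. rewrite dyblock_psum. unfold ublock.
      rewrite <- psum_scal, <- psum_plus. apply psum_ext. intros n _. rewrite dcosn_0. simpl mode_d. destruct n; [rewrite dyad_0; ring|].
      destruct (v_sol (S n) ltac:(lia)) as [_ [H1 _]]. rewrite <- H1. ring. }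
    replace (_ - _) with ((psum (fun j => ublock 1 0 j 0 y) J - useries 1 0 0 y) + kap * (psum (fun j => ublock 0 0 j 0 y) J - useries 0 0 0 y)) by ring.
    eapply Rle_trans; [apply Rabs_triang|]. rewrite Rabs_mult.
    pose proof (useries_lim 1 0 0 y J ltac:(lia) ltac:(lia) ltac:(lia) ltac:(lra)) as L1.
    pose proof (useries_lim 0 0 0 y J ltac:(lia) ltac:(lia) ltac:(lia) ltac:(lra)) as L0. fold KE in L1, L0.
    pose proof (Rmult_le_compat_l _ _ _ (Rabs_pos kap) L0). assert (0 <= E' * ratio al ^ J) by (apply Rmult_le_pos; lra). lra.
  - intros J. eapply Rle_trans; [apply HA|]. pose proof (ratio_pow_pos J). apply Rmult_le_compat_r; [lra|].
    assert (0 <= KE). { unfold KE. pose proof (ratio_bounds al al_in). apply Rdiv_le_0_compat; [apply ublock_cst_E_pos|lra]. }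
    assert (0 <= Rabs kap * KE) by (apply Rmult_le_pos; [apply Rabs_pos|easy]). lra.
Qed.
Lemma useries_bcl y A : (forall J, Rabs (psum (fun j => dyblock j (fun n => bn n * cosn n y)) J - A) <= E' * ratio al ^ J) ->
  useries 0 0 l y = A.
Proof.
  intros HA. set (KE := ublock_cst * E / (1 - ratio al)).
  assert (0 <= KE). { unfold KE. pose proof (ratio_bounds al al_in). apply Rdiv_le_0_compat; [apply ublock_cst_E_pos|lra]. }
  apply (lim_unique_geom (psum (fun j => dyblock j (fun n => bn n * cosn n y))) _ _ (KE + E') (ratio al) r_in).
  - intros J. pose proof (ratio_pow_pos J).
    assert (psum (fun j => dyblock j (fun n => bn n * cosn n y)) J = psum (fun j => ublock 0 0 j l y) J) as ->.
    { apply psum_ext. intros j _. rewrite dyblock_psum. unfold ublock. apply psum_ext. intros n _. rewrite dcosn_0. simpl mode_d. destruct n; [rewrite dyad_0; ring|].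
      destruct (v_sol (S n) ltac:(lia)) as [_ [_ H1]]. rewrite <- H1. ring. }
    eapply Rle_trans; [apply useries_lim; (lia || lra)|]. apply Rmult_le_compat_r; [lra|]. fold KE. lra.
  - intros J. eapply Rle_trans; [apply HA|]. pose proof (ratio_pow_pos J). apply Rmult_le_compat_r; lra.
Qed.
(** Blocks contain no mode [0]. Consequently the averaged terms of the operator vanish on the series
    and concern the zero mode alone. *)
Lemma useries_mean i x : (i <= 1)%nat -> (i + 1 <= k)%nat -> RInt (fun y => useries i 0 x y) 0 PI = 0.
Proof.
  intros Hi Hk. set (KE := ublock_cst * E / (1 - ratio al)). pose proof PI_3.
  assert (Hc : cont (fun y => useries i 0 x y)) by (apply (cont_derive _ (useries i 1 x)); intros; apply useries_dy; lia).
  apply (eq_of_small _ _ (PI * KE) (ratio al) r_in). intros J.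
  assert (E0 : RInt (fun y => psum (fun j => ublock i 0 j (clamp 0 l x) y) J) 0 PI = 0).
  { rewrite (psum_RInt (fun j y => ublock i 0 j (clamp 0 l x) y)).
    - apply psum_zero. intros j _. unfold ublock.
      rewrite (psum_RInt (fun n y => dyad j n * mode_d i n (clamp 0 l x) * dcosn 0 n y)) by (intros; auto with cont).
      apply psum_zero. intros n _. rewrite RInt_cscal by auto with cont. destruct n; [rewrite dyad_0; ring|].
      rewrite (RInt_eq (dcosn 0 (S n)) (cosn (S n))) by (intros; apply dcosn_0). rewrite RInt_cosn by lia. ring.
    - intros j. apply (cont_derive _ (fun y => ublock i 1 j (clamp 0 l x) y)). intros; apply ublock_dy. }
  assert (Hcp : cont (fun y => psum (fun j => ublock i 0 j (clamp 0 l x) y) J)).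
  { apply (psum_cont (fun j y => ublock i 0 j (clamp 0 l x) y)). intros j. apply (cont_derive _ (fun y => ublock i 1 j (clamp 0 l x) y)). intros; apply ublock_dy. }
  replace (RInt (fun y => useries i 0 x y) 0 PI - 0) with (RInt (fun y => useries i 0 x y) 0 PI - RInt (fun y => psum (fun j => ublock i 0 j (clamp 0 l x) y) J) 0 PI)
    by (rewrite E0; ring).
  rewrite <- RInt_cminus by easy. replace (PI * KE * ratio al ^ J) with ((PI - 0) * (KE * ratio al ^ J)) by ring.
  apply RInt_abs_cst; [lra|auto with cont|]. intros y _. apply useries_tail; lia.
Qed.
Lemma useries_int_mean (a : R -> R) x : (2 <= k)%nat -> 0 <= x <= l -> cont a ->
  RInt (fun y => RInt (fun t => a t * useries 0 0 t y) 0 x) 0 PI = 0.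
Proof.
  intros Hk Hx Ha. set (KE := ublock_cst * E / (1 - ratio al)). pose proof PI_3.
  destruct (cont_bounded a 0 l ltac:(lra) Ha) as [A [HA HAb]].
  set (w := fun j y => RInt (fun t => a t * ublock 0 0 j (clamp 0 l t) y) 0 x).
  assert (Hclc : forall j y, cont (fun t => ublock 0 0 j (clamp 0 l t) y)).
  { intros j y. apply (cont_comp (clamp 0 l) (fun t => ublock 0 0 j t y)); [apply cont_clamp|apply ublock_cont]. }
  assert (Hw : forall j y, w j y = psum (fun n => (RInt (fun t => a t * (dyad j n * mode_d 0 n (clamp 0 l t))) 0 x) * cosn n y) (S (2 * 2 ^ j))).
  { intros j y. unfold w, ublock.
    assert (Hvc : forall n, cont (fun t => mode_d 0 n (clamp 0 l t))) by (intros n; apply (cont_comp (clamp 0 l) (mode_d 0 n)); [apply cont_clamp|apply mode_d_cont]).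
    rewrite (RInt_eq _ (fun t => psum (fun n => cosn n y * (a t * (dyad j n * mode_d 0 n (clamp 0 l t)))) (S (2 * 2 ^ j)))).
    - rewrite (psum_RInt (fun n t => cosn n y * (a t * (dyad j n * mode_d 0 n (clamp 0 l t))))) by (intros n; specialize (Hvc n); auto 10 with cont).
      apply psum_ext. intros n _. specialize (Hvc n). rewrite RInt_cscal by auto with cont. fold_R; ring.
    - intros t. rewrite <- psum_scal. apply psum_ext. intros n _. rewrite dcosn_0. ring. }
  assert (Hwc : forall j, cont (w j)).
  { intros j. apply (cont_ext (fun y => psum (fun n => (RInt (fun t => a t * (dyad j n * mode_d 0 n (clamp 0 l t))) 0 x) * cosn n y) (S (2 * 2 ^ j)))); [intros; now rewrite Hw|].
    apply (psum_cont (fun n y => (RInt (fun t => a t * (dyad j n * mode_d 0 n (clamp 0 l t))) 0 x) * cosn n y)). auto with cont. }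
  assert (Hw0 : forall j, RInt (w j) 0 PI = 0).
  { intros j. rewrite (RInt_eq _ _ _ _ (Hw j)).
    rewrite (psum_RInt (fun n y => (RInt (fun t => a t * (dyad j n * mode_d 0 n (clamp 0 l t))) 0 x) * cosn n y)) by auto with cont.
    apply psum_zero. intros n _. rewrite RInt_cscal by auto with cont. destruct n.
    - rewrite (RInt_eq (fun t => a t * (dyad j 0 * mode_d 0 0 (clamp 0 l t))) (fun _ => 0)) by (intros; rewrite dyad_0; ring). rewrite RInt_cst. ring.
    - rewrite RInt_cosn by lia. ring. }
  assert (HKE : 0 <= KE). { unfold KE. pose proof (ratio_bounds al al_in). apply Rdiv_le_0_compat; [apply ublock_cst_E_pos|lra]. }
  assert (Hlim : forall J y, Rabs (RInt (fun t => a t * useries 0 0 t y) 0 x - psum (fun j => w j y) J) <= x * (A * KE) * ratio al ^ J).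
  { intros J y. unfold w. rewrite <- (psum_RInt (fun j t => a t * ublock 0 0 j (clamp 0 l t) y)) by (intros; auto with cont).
    assert (cont (fun t => useries 0 0 t y)) by (apply useries_cont; lia).
    rewrite <- RInt_cminus; [|auto with cont|apply (psum_cont (fun j t => a t * ublock 0 0 j (clamp 0 l t) y)); auto with cont].
    replace (x * (A * KE) * ratio al ^ J) with ((x - 0) * (A * (KE * ratio al ^ J))) by ring.
    apply RInt_abs_cst; [lra| |].
    - apply cont_minus; [auto with cont|apply (psum_cont (fun j t => a t * ublock 0 0 j (clamp 0 l t) y)); auto with cont].
    - intros t Ht. rewrite psum_scal, <- Rmult_minus_distr_l, Rabs_mult.
      apply Rmult_le_compat; try apply Rabs_pos; [apply HAb; lra|apply useries_tail; lia]. }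
  assert (Hpc : forall J, cont (fun y => psum (fun j => w j y) J)) by (intros; now apply (psum_cont w)).
  assert (Hc : cont (fun y => RInt (fun t => a t * useries 0 0 t y) 0 x)).
  { apply (unif_cont (fun J y => psum (fun j => w j y) J) _ (x * (A * KE)) (ratio al) r_in); easy. }
  apply (eq_of_small _ _ (PI * (x * (A * KE))) (ratio al) r_in). intros J.
  assert (E0 : RInt (fun y => psum (fun j => w j y) J) 0 PI = 0).
  { rewrite (psum_RInt w) by easy. apply psum_zero; intros; apply Hw0. }
  match goal with |- Rabs (?a - 0) <= _ => replace (a - 0) with (a - RInt (fun y => psum (fun j => w j y) J) 0 PI) by (rewrite E0; ring) end.
  rewrite <- RInt_cminus by easy. replace (PI * (x * (A * KE)) * ratio al ^ J) with ((PI - 0) * (x * (A * KE) * ratio al ^ J)) by ring.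
  apply RInt_abs_cst; [lra|auto with cont|]. intros y _. apply Hlim.
Qed.
End Sum.
End Mode.

(** * Coefficients of the problem *)

Lemma proper_within {V : UniformSpace} (D : V -> Prop) (z : V) :
  (forall d : posreal, exists y, ball z d y /\ D y) -> ProperFilter (within D (locally z)).
Proof.
  intros H. constructor; [|apply within_filter, locally_filter].
  intros P [d Hd]. destruct (H d) as [y [H1 H2]]. exists y. now apply Hd.
Qed.

Lemma ball_R (x e y : R) : ball x e y <-> Rabs (y - x) < e.
Proof. easy. Qed.

Lemma locally_Ioo (a b x : R) : a < x < b -> locally x (fun y => a < y < b).
Proof.
  intros H. set (m := Rmin (x - a) (b - x)).
  assert (Hm : 0 < m <= x - a /\ m <= b - x) by (unfold m, Rmin; destruct Rle_dec; lra).
  assert (G : forall y : R, Rabs (y - x) < m -> a < y < b).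
  { intros y Hy. apply Rabs_lt_between in Hy. lra. }
  exists (mkposreal m (proj1 (proj1 Hm))). intros y Hy. apply G. exact Hy.
Qed.

(** Functions are prescribed on [D], with limits at the points of [E]. Choosing these limits gives a
    continuous representative; the limits at two neighbouring points are compared through a common
    point of [D]. *)
Lemma extend_cont {V : UniformSpace} (D E : V -> Prop) (f : V -> R) :
  (forall z, E z -> forall d : posreal, exists y, ball z d y /\ D y) -> extends_to D E f ->
  exists F, continuous_on E F /\ forall z, D z -> E z -> F z = f z.
Proof.
  intros HE Hf.
  set (F := fun z => epsilon (inhabits 0) (fun v : R => filterlim f (within D (locally z)) (locally v))).
  assert (HF : forall z, E z -> filterlim f (within D (locally z)) (locally (F z))).
  { intros z Hz. apply (epsilon_spec (inhabits 0) (fun v : R => filterlim f (within D (locally z)) (locally v))). now apply Hf. }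
  assert (HF' : forall z, E z -> forall eps : posreal, within D (locally z) (fun y => Rabs (f y - F z) < eps)).
  { intros z Hz eps. apply (proj1 (filterlim_locally f (F z)) (HF z Hz) eps). }
  exists F. split.
  - intros z0 Hz0. apply (filterlim_locally (F := within E (locally z0)) F (F z0)). intros eps.
    destruct (HF' z0 Hz0 (pos_div_2 eps)) as [d Hd].
    exists (pos_div_2 d). intros z1 Hz1 Ez1.
    change (Rabs (F z1 - F z0) < eps).
    pose proof (HF' z1 Ez1 (pos_div_2 eps)) as H1.
    pose proof (proper_within D z1 (HE z1 Ez1)) as HP.
    assert (H2 : within D (locally z1) (fun y => Rabs (f y - F z0) < pos_div_2 eps)).
    { exists (pos_div_2 d). intros y Hy Dy. apply Hd; [|easy].
      replace (pos d) with (pos_div_2 d + pos_div_2 d) by (simpl; field). now apply ball_triangle with z1. }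
    destruct (filter_ex _ (filter_and _ _ H1 H2)) as [y [Ha Hb]]. simpl in Ha, Hb.
    replace (F z1 - F z0) with (- (f y - F z1) + (f y - F z0)) by ring.
    eapply Rle_lt_trans; [apply Rabs_triang|]. rewrite Rabs_Ropp. lra.
  - intros z Dz Ez. destruct (Req_dec (F z) (f z)) as [|Hn]; [easy|exfalso].
    assert (0 < Rabs (f z - F z)) as Hp by (apply Rabs_pos_lt; lra).
    specialize (HF' z Ez (mkposreal _ Hp)). apply locally_singleton in HF'. specialize (HF' Dz). simpl in HF'. lra.
Qed.

(** Keeps an argument at or above a positive [m], where inverse, [ln] and [sqrt] are continuous,
    without changing values already there. The formula with the absolute value makes continuity
    immediate. *)
Definition maxr (m z : R) : R := (m + z + Rabs (m - z)) / 2.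
Lemma maxr_ge m z : m <= maxr m z.
Proof. unfold maxr, Rabs. destruct Rcase_abs; lra. Qed.
Lemma maxr_id m z : m <= z -> maxr m z = z.
Proof. intros H; unfold maxr. rewrite Rabs_left1; lra. Qed.
Lemma cont_maxr m : cont (maxr m).
Proof.
  unfold maxr, Rdiv. apply cont_mult; [|auto with cont]. apply cont_plus; [apply cont_plus; auto using cont_id with cont|].
  apply cont_abs. apply cont_minus; auto using cont_id with cont.
Qed.

(** [good l j f]: [f] is [C^j] on the open interval and its derivatives up to order [j] extend continuously. *)
Fixpoint good (l : R) (j : nat) (f : R -> R) : Prop :=
  (exists F, cont F /\ forall x, 0 < x < l -> f x = F x) /\
  match j with
  | O => True
  | S j => exists f', (forall x, 0 < x < l -> is_derive f x (f' x)) /\ good l j f'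
  end.

Section Good.
Variable l : R.
Hypothesis l_pos : 0 < l.

Lemma good_0 j f : good l j f -> good l 0 f.
Proof. destruct j; simpl; intros [H _]; easy. Qed.
Lemma good_S j f : good l (S j) f -> good l j f.
Proof.
  revert f; induction j; intros f H; [now apply good_0 in H|].
  destruct H as [H0 [f' [H1 H2]]]. split; [easy|]. exists f'. split; [easy|now apply IHj].
Qed.
Lemma is_derive_eq_on (f g : R -> R) x d : (forall x, 0 < x < l -> f x = g x) -> 0 < x < l -> is_derive f x d -> is_derive g x d.
Proof.
  intros H Hx Hd. apply (is_derive_ext_loc f); [|easy].
  exists (mkposreal (Rmin x (l - x)) ltac:(apply Rmin_glb_lt; lra)). intros y Hy. apply H.
  unfold ball in Hy; simpl in Hy; unfold AbsRing_ball, abs, minus, plus, opp in Hy; simpl in Hy.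
  pose proof (Rmin_l x (l - x)). pose proof (Rmin_r x (l - x)). apply Rabs_lt_between in Hy. lra.
Qed.
Lemma good_ext j f g : (forall x, 0 < x < l -> f x = g x) -> good l j f -> good l j g.
Proof.
  intros H. destruct j; intros [[F [HF HE]] HD].
  - split; [|easy]. exists F. split; [easy|]. intros x Hx. rewrite <- H by easy. now apply HE.
  - split.
    + exists F. split; [easy|]. intros x Hx. rewrite <- H by easy. now apply HE.
    + destruct HD as [f' [H1 H2]]. exists f'. split; [|easy]. intros x Hx. apply (is_derive_eq_on f); auto.
Qed.
Lemma good_of_derive0 j f : (forall x, 0 < x < l -> is_derive f x 0) -> cont f -> good l j f.
Proof.
  intros H Hc. assert (Hz : good l j (fun _ => 0)).
  { clear. induction j; (split; [exists (fun _ => 0); split; [apply cont_const|easy]|]); [easy|].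
    exists (fun _ => 0). split; [intros; apply derive_cst|easy]. }
  destruct j; (split; [now exists f|]); [easy|]. exists (fun _ => 0). split; [easy|]. now apply good_S.
Qed.
Lemma good_const j k : good l j (fun _ => k).
Proof. apply good_of_derive0; [intros; apply derive_cst|apply cont_const]. Qed.
Lemma good_plus j f g : good l j f -> good l j g -> good l j (fun x => f x + g x).
Proof.
  revert f g; induction j; intros f g [[F [HF EF]] Hf] [[G [HG EG]] Hg]; (split;
    [exists (fun x => F x + G x); split; [now apply cont_plus|intros; now rewrite EF, EG]|]); [easy|].
  destruct Hf as [f' [Hf1 Hf2]], Hg as [g' [Hg1 Hg2]]. exists (fun x => f' x + g' x). split; [|auto].
  intros x Hx. apply (is_derive_plus f g); auto.
Qed.
Lemma good_mult j f g : good l j f -> good l j g -> good l j (fun x => f x * g x).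
Proof.
  revert f g; induction j; intros f g Hf Hg; pose proof Hf as [[F [HF EF]] Hf']; pose proof Hg as [[G [HG EG]] Hg']; (split;
    [exists (fun x => F x * G x); split; [now apply cont_mult|intros; now rewrite EF, EG]|]); [easy|].
  destruct Hf' as [f' [Hf1 Hf2]], Hg' as [g' [Hg1 Hg2]]. exists (fun x => f' x * g x + f x * g' x). split.
  - intros x Hx. apply (is_derive_mult f g); auto. intros; apply Rmult_comm.
  - apply good_plus; apply IHj; auto; now apply good_S.
Qed.
Lemma good_opp j f : good l j f -> good l j (fun x => - f x).
Proof. intros H. apply (good_ext j (fun x => -1 * f x)); [intros; ring|]. apply good_mult; [apply good_const|easy]. Qed.
Lemma good_minus j f g : good l j f -> good l j g -> good l j (fun x => f x - g x).
Proof. intros Hf Hg. apply good_plus; [easy|now apply good_opp]. Qed.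
Lemma good_pow j f n : good l j f -> good l j (fun x => f x ^ n).
Proof. intros H. induction n; simpl; [apply good_const|]. now apply good_mult. Qed.

Definition bdd_below (f : R -> R) : Prop := exists m, 0 < m /\ forall x, 0 < x < l -> m <= f x.

(** One induction for all outer functions. The last hypothesis may assume regularity of [phi]
    composed with [f], because for [exp], inverse and [sqrt] the derivative [dphi] is expressed
    through [phi] itself. [P] records the domain, with [m] as a uniform lower bound. *)
Lemma good_comp (phi dphi : R -> R) (P : R -> R -> Prop) :
  (forall m z, P m z -> is_derive phi z (dphi z)) ->
  (forall j f m, (forall x, 0 < x < l -> P m (f x)) -> good l j f -> good l 0 (fun x => phi (f x))) ->
  (forall j f m, (forall x, 0 < x < l -> P m (f x)) -> good l j f -> good l j (fun x => phi (f x)) -> good l j (fun x => dphi (f x))) ->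
  forall j f m, (forall x, 0 < x < l -> P m (f x)) -> good l j f -> good l j (fun x => phi (f x)).
Proof.
  intros HD H0 H1. induction j; intros f m Hm Hf; [now apply (H0 0%nat f m)|].
  split; [apply (H0 (S j) f m Hm Hf)|]. pose proof Hf as [_ [f' [Hf1 Hf2]]].
  exists (fun x => f' x * dphi (f x)). split.
  - intros x Hx. apply (is_derive_comp phi f); [apply (HD m); auto|auto].
  - apply good_mult; [easy|]. apply (H1 j f m Hm); [now apply good_S|]. apply (IHj f m Hm). now apply good_S.
Qed.

Lemma good_inv0 f m : 0 < m -> (forall x, 0 < x < l -> m <= f x) -> good l 0 f -> good l 0 (fun x => / f x).
Proof.
  intros Hm H [[F [HF E]] _]. split; [|easy]. exists (fun x => / maxr m (F x)). split.
  - apply cont_pt. intros x. apply continuity_pt_inv.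
    + apply pt_cont. apply (cont_comp F (maxr m)); [easy|apply cont_maxr].
    + pose proof (maxr_ge m (F x)). lra.
  - intros x Hx. rewrite maxr_id; rewrite <- E by easy; auto.
Qed.
Lemma good_inv j f : bdd_below f -> good l j f -> good l j (fun x => / f x).
Proof.
  intros [m [Hm H]] Hf.
  apply (good_comp Rinv (fun z => - (/ z * / z)) (fun m z => 0 < m <= z)) with (m := m).
  - intros k z Hz. replace (- (/ z * / z)) with (- 1 / z ^ 2) by (field; lra).
    apply (is_derive_inv (fun z => z) z 1); [apply (is_derive_id (K := R_AbsRing))|lra].
  - intros i g k Hk Hg. apply (good_inv0 g k); [apply (Hk (l / 2)); lra|intros; now apply Hk|now apply good_0 in Hg].
  - intros i g k _ _ Hg. apply good_opp. now apply good_mult.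
  - intros x Hx. split; [easy|auto].
  - easy.
Qed.
Lemma good_div j f g : bdd_below g -> good l j f -> good l j g -> good l j (fun x => f x / g x).
Proof. intros Hl Hf Hg. apply good_mult; [easy|now apply good_inv]. Qed.

Lemma cont_exp : cont exp.
Proof. apply (cont_derive exp exp). intros x. apply is_derive_exp. Qed.
Lemma good_exp j f : good l j f -> good l j (fun x => exp (f x)).
Proof.
  intros Hf. refine (good_comp exp exp (fun _ _ => True) _ _ _ j f 0 _ Hf); auto.
  - intros _ z _. apply is_derive_exp.
  - intros i g _ _ Hg. apply good_0 in Hg. destruct Hg as [[F [HF E]] _]. split; [|easy].
    exists (fun x => exp (F x)). split; [apply (cont_comp F exp); [easy|apply cont_exp]|]. intros x Hx. now rewrite E.
Qed.
Lemma cont_comp_pos (phi dphi : R -> R) (F : R -> R) m : 0 < m -> (forall z, 0 < z -> is_derive phi z (dphi z)) -> cont F ->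
  cont (fun x => phi (maxr m (F x))).
Proof.
  intros Hm Hd HF x. apply (continuous_comp (fun x => maxr m (F x)) phi).
  - apply (cont_comp F (maxr m)); [easy|apply cont_maxr].
  - apply (ex_derive_continuous (V := R_NormedModule)). exists (dphi (maxr m (F x))). apply Hd. pose proof (maxr_ge m (F x)). lra.
Qed.
Lemma good_comp_pos0 (phi dphi : R -> R) f m : 0 < m -> (forall z, 0 < z -> is_derive phi z (dphi z)) -> (forall x, 0 < x < l -> m <= f x) ->
  good l 0 f -> good l 0 (fun x => phi (f x)).
Proof.
  intros Hm Hd Hb [[F [HF E]] _]. split; [|easy]. exists (fun x => phi (maxr m (F x))). split.
  - now apply (cont_comp_pos phi dphi).
  - intros x Hx. rewrite maxr_id; rewrite <- E by easy; auto.
Qed.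
Lemma der_ln z : 0 < z -> is_derive ln z (/ z).
Proof. intros H. auto_derive; [easy|field; lra]. Qed.
Lemma der_sqrt z : 0 < z -> is_derive sqrt z (/ (2 * sqrt z)).
Proof. intros H. auto_derive; [easy|]. field. apply Rgt_not_eq. now apply sqrt_lt_R0. Qed.
Lemma good_ln j f : bdd_below f -> good l j f -> good l j (fun x => ln (f x)).
Proof.
  intros [m [Hm Hb]] Hf. apply (good_comp ln Rinv (fun m z => 0 < m <= z)) with (m := m); auto.
  - intros k z Hz. apply der_ln; lra.
  - intros i g k Hk Hg. apply good_0 in Hg. apply (good_comp_pos0 ln Rinv g k); auto; [apply (Hk (l / 2)); lra|apply der_ln|intros; now apply Hk].
  - intros i g k Hk Hg _. apply good_inv; [|easy]. exists k. split; [apply (Hk (l / 2)); lra|intros; now apply Hk].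
Qed.
Lemma bdd_below_sqrt f : bdd_below f -> bdd_below (fun x => sqrt (f x)).
Proof.
  intros [m [Hm Hb]]. exists (sqrt m). split; [now apply sqrt_lt_R0|]. intros x Hx. apply sqrt_le_1_alt. auto.
Qed.
Lemma good_sqrt j f : bdd_below f -> good l j f -> good l j (fun x => sqrt (f x)).
Proof.
  intros [m [Hm Hb]] Hf. apply (good_comp sqrt (fun z => / (2 * sqrt z)) (fun m z => 0 < m <= z)) with (m := m); auto.
  - intros k z Hz. apply der_sqrt; lra.
  - intros i g k Hk Hg. apply good_0 in Hg. apply (good_comp_pos0 sqrt (fun z => / (2 * sqrt z)) g k); auto; [apply (Hk (l / 2)); lra|apply der_sqrt|intros; now apply Hk].
  - intros i g k Hk Hg Hs. apply (good_inv i (fun x => 2 * sqrt (g x))).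
    + destruct (bdd_below_sqrt g) as [q [Hq Hb']]; [exists k; split; [apply (Hk (l / 2)); lra|intros; now apply Hk]|].
      exists (2 * q). split; [lra|]. intros x Hx. specialize (Hb' x Hx). lra.
    + apply good_mult; [apply good_const|easy].
Qed.
Lemma good_Rpower j f a : bdd_below f -> good l j f -> good l j (fun x => Rpower (f x) a).
Proof. intros Hl Hf. unfold Rpower. apply good_exp. apply good_mult; [apply good_const|now apply good_ln]. Qed.
Lemma good_Derive j f : good l (S j) f -> good l j (Derive f).
Proof.
  intros [_ [f' [H1 H2]]]. apply (good_ext j f'); [|easy]. intros x Hx. symmetry. apply is_derive_unique. auto.
Qed.

Lemma bdd_below_mult f g : bdd_below f -> bdd_below g -> bdd_below (fun x => f x * g x).
Proof.
  intros [m [Hm Hb]] [k [Hk Hc]]. exists (m * k). split; [nra|]. intros x Hx. specialize (Hb x Hx). specialize (Hc x Hx).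
  apply Rmult_le_compat; lra.
Qed.
Lemma bdd_below_pow f n : bdd_below f -> bdd_below (fun x => f x ^ n).
Proof.
  intros [m [Hm Hb]]. exists (m ^ n). split; [now apply pow_lt|]. intros x Hx. apply pow_incr. specialize (Hb x Hx). lra.
Qed.
Lemma bdd_below_const k : 0 < k -> bdd_below (fun _ => k).
Proof. intros; exists k; split; [easy|intros; lra]. Qed.
Lemma bdd_below_inv f : bdd_below f -> good l 0 f -> bdd_below (fun x => / f x).
Proof.
  intros [m [Hm Hb]] [[F [HF E]] _]. destruct (cont_bounded F 0 l ltac:(lra) HF) as [M [HM HMb]].
  exists (/ (M + 1)). split; [apply Rinv_0_lt_compat; lra|]. intros x Hx. apply Rinv_le_contravar; [specialize (Hb x Hx); lra|].
  rewrite E by easy. specialize (HMb x ltac:(lra)). pose proof (Rle_abs (F x)). lra.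
Qed.

Lemma cont_on_clamp (f : R -> R) (D : R -> Prop) a b : a <= b -> (forall x, a <= x <= b -> D x) -> continuous_on D f ->
  cont (fun x => f (clamp a b x)).
Proof.
  intros Hab HD Hf x. specialize (Hf (clamp a b x) (HD _ (clamp_in a b x Hab))).
  intros P HP. specialize (Hf P HP). unfold filtermap in *. unfold within in Hf.
  pose proof (cont_clamp a b x _ Hf) as H. unfold filtermap in H. revert H. apply filter_imp. intros z Hz. apply Hz.
  apply HD. now apply clamp_in.
Qed.
Lemma bdd_below_of_cont (f : R -> R) : cont f -> (forall x, 0 <= x <= l -> 0 < f x) -> exists m, 0 < m /\ forall x, 0 <= x <= l -> m <= f x.
Proof.
  intros Hf Hp. destruct (continuity_ab_min f 0 l ltac:(lra)) as [x0 [H1 H2]]; [intros; now apply pt_cont|].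
  exists (f x0). split; auto.
Qed.

(** Since [l < L] strictly, [[0, l]] lies in the half-open interval on which all derivatives have
    limits. *)
Lemma good_Ck1 (L : Rbar) f : Rbar_lt l L -> Cinf1 (Io L) (Ico L) f -> forall j, good l j f.
Proof.
  intros HL Hf.
  assert (HI : forall x, 0 < x <= l -> Io L x).
  { intros x Hx. split; [easy|]. apply (Rbar_le_lt_trans x l); [simpl; lra|easy]. }
  assert (Hder : forall n x, 0 < x < l -> is_derive (Derive_n f n) x (Derive_n f (S n) x)).
  { intros n x Hx. destruct (Hf (S n)) as [_ H]. destruct (H (S n) (Nat.le_refl _)) as [H1 _].
    apply Derive_correct. apply (H1 x). apply HI; lra. }
  assert (H0 : forall n, good l 0 (Derive_n f n)).
  { intros n. split; [|easy]. destruct (Hf n) as [_ H]. destruct (H n (Nat.le_refl _)) as [_ Hlim].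
    destruct (extend_cont (Io L) (Ico L) (Derive_n f n)) as [F [HF HE]]; [|easy|].
    - intros z [Hz HzL] d.
      assert (exists b : R, z < b /\ Rbar_le b L) as [b [Hlb HbL]].
      { destruct L as [L| |]; simpl in HzL; [exists L; split; [easy|simpl; lra]|exists (z + 1); split; [lra|easy]|easy]. }
      assert (0 < Rmin d (b - z)) by (apply Rmin_glb_lt; [apply cond_pos|lra]).
      pose proof (Rmin_l d (b - z)). pose proof (Rmin_r d (b - z)).
      exists (z + Rmin d (b - z) / 2). split.
      + apply ball_R. replace (z + Rmin d (b - z) / 2 - z) with (Rmin d (b - z) / 2) by ring. rewrite Rabs_pos_eq; lra.
      + split; [lra|]. apply (Rbar_lt_le_trans _ b); [simpl; lra|easy].
    - exists (fun x => F (clamp 0 l x)). split.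
      + apply (cont_on_clamp F (Ico L)); [lra| |easy]. intros x Hx. split; [lra|]. apply (Rbar_le_lt_trans x l); [simpl; lra|easy].
      + intros x Hx. rewrite clamp_id by lra. symmetry. destruct (HI x ltac:(lra)). apply HE; [apply HI; lra|split; [lra|easy]]. }
  enough (HG : forall j n, good l j (Derive_n f n)) by (intros j; apply (HG j 0%nat)).
  induction j; intros n; [apply H0|]. split; [apply (H0 n)|]. exists (Derive_n f (S n)). split; [apply Hder|apply IHj].
Qed.
End Good.

Lemma cont_div (f g : R -> R) : cont f -> cont g -> (forall x, g x <> 0) -> cont (fun x => f x / g x).
Proof.
  intros Hf Hg H. apply cont_mult; [easy|]. apply cont_pt. intros x. apply continuity_pt_inv; [now apply pt_cont|apply H].
Qed.
Lemma cont_ln (f : R -> R) : cont f -> (forall x, 0 < f x) -> cont (fun x => ln (f x)).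
Proof.
  intros Hf H x. apply (continuous_comp f ln); [apply Hf|]. apply (ex_derive_continuous (V := R_NormedModule)).
  exists (/ f x). now apply der_ln.
Qed.

(** * Regularity of the coefficients built from the background solution *)

Section Coef.
Variables (G : data) (U : flow) (Phi : R -> mat22) (l : R).
Hypotheses (Hadm : admissible G) (Hbg : background_on G U (l_star G)) (Hfm : is_fundamental_matrix G U (l_star G) Phi).
Hypotheses (l_pos : 0 < l) (l_lt : Rbar_lt l (l_star G)).

Lemma in_Ico x : 0 <= x <= l -> Ico (l_star G) x.
Proof. intros Hx. split; [easy|]. apply (Rbar_le_lt_trans x l); [simpl; lra|easy]. Qed.
Lemma in_Io x : 0 < x <= l -> Io (l_star G) x.
Proof. intros Hx. split; [easy|]. apply (Rbar_le_lt_trans x l); [simpl; lra|easy]. Qed.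

Let rho := rhob U.
Let u := ub U.
Let s := sb U.

Lemma g_pos : 1 < gamma G.
Proof. destruct Hadm as [[H _] _]; easy. Qed.
Lemma G_rho j : good l j rho.
Proof. destruct Hbg as [_ [[H _] _]]. now apply (good_Ck1 l l_pos (l_star G)). Qed.
Lemma G_u j : good l j u.
Proof. destruct Hbg as [_ [[_ [H _]] _]]. now apply (good_Ck1 l l_pos (l_star G)). Qed.
Lemma G_s j : good l j s.
Proof. destruct Hbg as [_ [[_ [_ H]] _]]. now apply (good_Ck1 l l_pos (l_star G)). Qed.
Lemma G_m j : good l j (mb G).
Proof. destruct Hadm as [_ [[H _] _]]. now apply (good_Ck1 l l_pos p_infty). Qed.

Lemma C_clamp f : continuous_on (Ico (l_star G)) f -> cont (fun x => f (clamp 0 l x)).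
Proof. intros H. apply (cont_on_clamp f (Ico (l_star G))); [lra|apply in_Ico|easy]. Qed.
Lemma C_rho : cont (fun x => rho (clamp 0 l x)).
Proof. apply C_clamp. destruct Hbg as [_ [[H _] _]]. apply (H 0%nat). Qed.
Lemma C_u : cont (fun x => u (clamp 0 l x)).
Proof. apply C_clamp. destruct Hbg as [_ [[_ [H _]] _]]. apply (H 0%nat). Qed.
Lemma C_s : cont (fun x => s (clamp 0 l x)).
Proof. apply C_clamp. destruct Hbg as [_ [[_ [_ H]] _]]. apply (H 0%nat). Qed.
Lemma pos_bg x : 0 <= x <= l -> 0 < rho x /\ 0 < u x /\ 0 < Mb G U x < 1.
Proof. intros Hx. destruct Hbg as [_ [_ [H _]]]. apply H. now apply in_Ico. Qed.

Lemma bdd_below_clamp f : cont (fun x => f (clamp 0 l x)) -> (forall x, 0 <= x <= l -> 0 < f x) -> bdd_below l f.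
Proof.
  intros Hc Hp. destruct (bdd_below_of_cont l l_pos (fun x => f (clamp 0 l x)) Hc) as [m [Hm Hb]].
  - intros x Hx. rewrite clamp_id; auto.
  - exists m. split; [easy|]. intros x Hx. specialize (Hb x ltac:(lra)). now rewrite clamp_id in Hb by lra.
Qed.
Lemma L_rho : bdd_below l rho.
Proof. apply bdd_below_clamp; [apply C_rho|]. intros x Hx. apply (pos_bg x Hx). Qed.
Lemma L_u : bdd_below l u.
Proof. apply bdd_below_clamp; [apply C_u|]. intros x Hx. apply (pos_bg x Hx). Qed.
Lemma bdd_below_exp f : good l 0 f -> bdd_below l (fun x => exp (f x)).
Proof.
  intros [[F [HF E]] _]. destruct (cont_bounded F 0 l ltac:(lra) HF) as [M [HM HMb]].
  exists (exp (- (M + 1))). split; [apply exp_pos|]. intros x Hx. left. apply exp_increasing. rewrite E by easy.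
  specialize (HMb x ltac:(lra)). apply Rabs_le_between in HMb. lra.
Qed.
Lemma bdd_below_ext f g : (forall x, 0 < x < l -> f x = g x) -> bdd_below l f -> bdd_below l g.
Proof. intros H [m [Hm Hb]]. exists m. split; [easy|]. intros x Hx. rewrite <- H by easy. auto. Qed.
Lemma L_Rpower f a : bdd_below l f -> good l 0 f -> bdd_below l (fun x => Rpower (f x) a).
Proof. intros Hl Hf. unfold Rpower. apply bdd_below_exp. apply good_mult; [apply good_const|now apply good_ln]. Qed.

Lemma G_A j : good l j (Ab G U).
Proof.
  unfold Ab, Aent. apply (good_mult l j (fun _ => kappa0 G)); [apply good_const|]. apply good_exp.
  apply (good_mult l j (sb U) (fun _ => / c_nu G)); [apply G_s|apply good_const].
Qed.
Lemma L_A : bdd_below l (Ab G U).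
Proof.
  unfold Ab, Aent. apply (bdd_below_mult l (fun _ => kappa0 G)); [apply bdd_below_const; apply Hadm|]. apply bdd_below_exp.
  apply (good_mult l 0 (sb U) (fun _ => / c_nu G)); [apply G_s|apply good_const].
Qed.
Lemma G_p j : good l j (pb G U).
Proof. unfold pb. apply (good_mult l j (Ab G U)); [apply G_A|]. apply good_Rpower; [easy|apply L_rho|apply G_rho]. Qed.
Lemma L_p : bdd_below l (pb G U).
Proof. unfold pb. apply (bdd_below_mult l (Ab G U)); [apply L_A|]. apply L_Rpower; [apply L_rho|apply G_rho]. Qed.
Lemma c_aux j : good l j (fun x => gamma G * pb G U x / rhob U x) /\ bdd_below l (fun x => gamma G * pb G U x / rhob U x).
Proof.
  pose proof g_pos. split.
  - apply good_div; [easy|apply L_rho| |apply G_rho]. apply (good_mult l j (fun _ => gamma G)); [apply good_const|apply G_p].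
  - apply (bdd_below_mult l (fun x => gamma G * pb G U x) (fun x => / rhob U x)).
    + apply (bdd_below_mult l (fun _ => gamma G)); [apply bdd_below_const; lra|apply L_p].
    + apply bdd_below_inv; [easy|apply L_rho|apply G_rho].
Qed.
Lemma G_c j : good l j (cb G U).
Proof. unfold cb. apply good_sqrt; [easy|apply (c_aux j)|apply c_aux]. Qed.
Lemma L_c : bdd_below l (cb G U).
Proof. unfold cb. apply bdd_below_sqrt. apply (c_aux 0). Qed.
Lemma G_M j : good l j (Mb G U).
Proof. unfold Mb. apply good_div; [easy|apply L_c|apply G_u|apply G_c]. Qed.
Lemma L_M : bdd_below l (Mb G U).
Proof. unfold Mb. apply (bdd_below_mult l (ub U) (fun x => / cb G U x)); [apply L_u|]. apply bdd_below_inv; [easy|apply L_c|apply G_c]. Qed.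
Lemma C_M : cont (fun x => Mb G U (clamp 0 l x)).
Proof.
  assert (Hp : forall x, 0 < rho (clamp 0 l x)) by (intros x; apply pos_bg, clamp_in; lra).
  assert (Hk : 0 < kappa0 G) by apply Hadm. pose proof g_pos.
  assert (Hpp : forall x, 0 < gamma G * pb G U (clamp 0 l x) / rhob U (clamp 0 l x)).
  { intros x. apply Rdiv_lt_0_compat; [|apply Hp]. apply Rmult_lt_0_compat; [lra|]. unfold pb, Ab, Aent.
    apply Rmult_lt_0_compat; [|apply exp_pos]. apply Rmult_lt_0_compat; [easy|apply exp_pos]. }
  unfold Mb. apply (cont_div (fun x => ub U (clamp 0 l x))); [apply C_u| |].
  - unfold cb. apply (cont_comp (fun x => gamma G * pb G U (clamp 0 l x) / rhob U (clamp 0 l x)) sqrt).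
    + apply cont_div; [|apply C_rho|intros; apply Rgt_not_eq, Hp]. apply cont_mult; [auto with cont|].
      unfold pb, Ab, Aent, Rpower. apply cont_mult; [apply cont_mult; [auto with cont|]|].
      * apply (cont_comp (fun x => sb U (clamp 0 l x) / c_nu G) exp); [|apply cont_exp].
        apply cont_mult; [apply C_s|auto with cont].
      * apply (cont_comp (fun x => gamma G * ln (rhob U (clamp 0 l x))) exp); [|apply cont_exp].
        apply cont_mult; [auto with cont|]. apply cont_ln; [apply C_rho|apply Hp].
    + intros x. apply continuous_sqrt.
  - intros x. apply Rgt_not_eq. unfold cb. now apply sqrt_lt_R0.
Qed.
(** Here [l < l_star] matters: the Mach number stays below [1] on the closed interval, so by
    compactness the equation is uniformly elliptic and can be divided by [e1]. *)
Lemma L_e1 : bdd_below l (fun x => 1 - Mb G U x ^ 2).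
Proof.
  apply bdd_below_clamp.
  - apply cont_minus; [auto with cont|]. pose proof C_M. simpl. auto with cont.
  - intros x Hx. destruct (pos_bg x Hx) as [_ [_ H]]. nra.
Qed.
Lemma G_En j : good l j (Eb G U).
Proof.
  pose proof g_pos. unfold Eb. apply good_plus; [|apply good_div; [easy|apply bdd_below_const; lra| |apply good_const]].
  - apply (good_mult l j (fun _ => / 2)); [apply good_const|apply good_pow, G_u].
  - apply good_pow, G_c.
Qed.
Lemma G_dp j : good l j (Derive (pb G U)).
Proof. apply good_Derive, G_p. Qed.
Lemma G_ddp j : good l j (Derive_n (pb G U) 2).
Proof. apply (good_Derive l j (Derive (pb G U))), G_dp. Qed.
Lemma G_dm j : good l j (Derive (mb G)).
Proof. apply good_Derive, G_m. Qed.

Ltac bdd_below_auto := lazymatch goal with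
  | |- bdd_below _ (fun x => _ * _) => apply bdd_below_mult; bdd_below_auto
  | |- bdd_below _ (fun x => _ ^ _) => apply bdd_below_pow; bdd_below_auto
  | |- _ => first [apply L_rho | apply L_u | apply L_p | apply L_c | apply L_M | apply L_e1 | apply bdd_below_const; pose proof g_pos; pose proof PI_RGT_0; lra]
  end.
(** Follows the syntax of a coefficient. Every denominator is a product of powers of [rho], [u],
    [p], [c], [M], [1 - M ^ 2] and positive constants, each bounded below. *)
Ltac good_auto := lazymatch goal with
  | |- good _ _ (fun x => _ + _) => apply good_plus; good_auto
  | |- good _ _ (fun x => _ - _) => apply good_minus; good_auto
  | |- good _ _ (fun x => - _) => apply good_opp; good_auto
  | |- good _ _ (fun x => _ / _) => first [apply good_const | apply good_div; [exact l_pos | bdd_below_auto | good_auto | good_auto]]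
  | |- good _ _ (fun x => _ * _) => first [apply good_const | apply good_mult; good_auto]
  | |- good _ _ (fun x => _ ^ _) => first [apply good_const | apply good_pow; good_auto]
  | |- good _ _ (fun x => Rpower _ _) => apply good_Rpower; [exact l_pos | bdd_below_auto | good_auto]
  | |- _ => first [apply good_const | apply G_rho | apply G_u | apply G_m | apply G_A | apply G_p | apply G_c | apply G_M | apply G_En
                  | apply G_dp | apply G_ddp | apply G_dm]
  end.

Lemma G_a1 j : good l j (a1 G U). Proof. unfold a1. good_auto. Qed.
Lemma G_a2 j : good l j (a2 G U). Proof. unfold a2. good_auto. Qed.
Lemma G_a3 j : good l j (a3 G U). Proof. unfold a3. good_auto. Qed.
Lemma G_b1 j : good l j (b1 G U). Proof. unfold b1. good_auto. Qed.
Lemma G_b2 j : good l j (b2 G U). Proof. unfold b2. good_auto. Qed.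
Lemma G_b3 j : good l j (b3 G U). Proof. unfold b3. good_auto. Qed.
Lemma G_c1 j : good l j (c1 G U). Proof. unfold c1. good_auto. Qed.
Lemma G_c2 j : good l j (c2 G U). Proof. unfold c2. good_auto. Qed.
Lemma G_c3 j : good l j (c3 G U). Proof. unfold c3. good_auto. Qed.
Lemma G_c4 j : good l j (c4 G U). Proof. unfold c4. good_auto. Qed.
Lemma G_d1 j : good l j (d1 G U). Proof. unfold d1. good_auto. Qed.
Lemma G_d2 j : good l j (d2 G U). Proof. unfold d2. good_auto. Qed.
Lemma G_d3 j : good l j (d3 G U). Proof. unfold d3. good_auto. Qed.
Lemma G_d4 j : good l j (d4 G U). Proof. unfold d4. good_auto. Qed.
Lemma G_d5 j : good l j (d5 G U). Proof. unfold d5. good_auto. Qed.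
Ltac good_auto1 := first [apply G_d1 | apply G_d2 | apply G_d3 | apply G_d4 | apply G_d5 | apply G_c1 | apply G_c2 | apply G_c3 | apply G_c4 | good_auto].
Lemma G_d6 j : good l j (d6 G U). Proof. unfold d6. apply good_div; [easy|bdd_below_auto| |good_auto]. apply good_mult; good_auto1. Qed.
Lemma G_d7 j : good l j (d7 G U). Proof. unfold d7. apply good_div; [easy|bdd_below_auto| |good_auto]. apply good_mult; good_auto1. Qed.
Lemma G_d8 j : good l j (d8 G U). Proof. unfold d8. apply good_div; [easy|bdd_below_auto| |good_auto]. apply good_mult; good_auto1. Qed.
Lemma G_d9 j : good l j (d9 G U). Proof. unfold d9. apply good_div; [easy|bdd_below_auto| |good_auto]. apply good_mult; good_auto1. Qed.
Lemma G_e2 j : good l j (e2 G U). Proof. unfold e2. apply good_div; [easy|bdd_below_auto|good_auto1|good_auto]. Qed.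
Lemma G_e45 j : good l j (fun x => (gamma G - 1) * d5 G U x - d4 G U x / ub U x).
Proof. apply good_minus; [apply good_mult; good_auto1|apply good_div; [easy|bdd_below_auto|good_auto1|good_auto]]. Qed.
Lemma G_e3 j : good l j (e3 G U).
Proof. unfold e3. apply good_plus; [apply good_div; [easy|bdd_below_auto|good_auto1|good_auto]|apply good_div; [easy|bdd_below_auto|apply G_e45|good_auto]]. Qed.
Lemma G_e4 j : good l j (e4 G U).
Proof. unfold e4. apply good_plus; apply good_div; [easy|bdd_below_auto|good_auto1|good_auto|easy|bdd_below_auto|good_auto1|good_auto]. Qed.
Lemma G_e5 j : good l j (e5 G U).
Proof. unfold e5. apply good_mult; [good_auto|apply G_e45]. Qed.
Lemma G_e6 j : good l j (e6 G U). Proof. unfold e6. apply good_div; [easy|bdd_below_auto|apply G_d6|good_auto]. Qed.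
Lemma G_e7 j : good l j (e7 G U). Proof. unfold e7. apply good_div; [easy|bdd_below_auto|apply G_d7|good_auto]. Qed.
Lemma G_e8 j : good l j (e8 G U). Proof. unfold e8. apply good_div; [easy|bdd_below_auto|apply G_d8|good_auto]. Qed.
Lemma G_e9 j : good l j (e9 G U). Proof. unfold e9. apply good_div; [easy|bdd_below_auto|apply G_d9|good_auto]. Qed.

(** Indexing the four entries lets one induction treat the whole linear system: the derivative of
    each entry is a combination of entries. *)
Definition Phi_entry (i : nat) (x : R) : R :=
  match i with O => m11 (Phi x) | 1%nat => m12 (Phi x) | 2%nat => m21 (Phi x) | _ => m22 (Phi x) end.

Lemma C_Phi_entry i : cont (fun x => Phi_entry i (clamp 0 l x)).
Proof. apply C_clamp. destruct Hfm as [_ [[H1 [H2 [H3 H4]]] _]]. destruct i as [|[|[|i]]]; easy. Qed.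
Lemma G_Phi_entry j : forall i, good l j (Phi_entry i).
Proof.
  assert (H0 : forall i, good l 0 (Phi_entry i)).
  { intros i. split; [|easy]. exists (fun x => Phi_entry i (clamp 0 l x)). split; [apply C_Phi_entry|]. intros x Hx. now rewrite clamp_id by lra. }
  induction j; intros i; [apply H0|]. split; [apply (H0 i)|].
  assert (Hc : forall a b x y, (forall j, good l j a) -> (forall j, good l j b) -> good l j (fun t => lambda G * (a t * Phi_entry x t + b t * Phi_entry y t))).
  { intros a b x y Ha Hb. apply good_mult; [apply good_const|]. apply good_plus; apply good_mult; auto. }
  destruct i as [|[|[|i]]].
  - exists (fun t => lambda G * (a1 G U t * Phi_entry 0 t + a2 G U t * Phi_entry 2 t)). split; [|apply Hc; [apply G_a1|apply G_a2]].
    intros x Hx. apply (proj2 (proj2 Hfm) x). apply in_Io; lra.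
  - exists (fun t => lambda G * (a1 G U t * Phi_entry 1 t + a2 G U t * Phi_entry 3 t)). split; [|apply Hc; [apply G_a1|apply G_a2]].
    intros x Hx. apply (proj2 (proj2 Hfm) x). apply in_Io; lra.
  - exists (fun t => lambda G * (b1 G U t * Phi_entry 0 t + b2 G U t * Phi_entry 2 t)). split; [|apply Hc; [apply G_b1|apply G_b2]].
    intros x Hx. apply (proj2 (proj2 Hfm) x). apply in_Io; lra.
  - exists (fun t => lambda G * (b1 G U t * Phi_entry 1 t + b2 G U t * Phi_entry 3 t)). split; [|apply Hc; [apply G_b1|apply G_b2]].
    intros x Hx. apply (proj2 (proj2 Hfm) x). apply in_Io; lra.
Qed.

Definition detPhi (x : R) : R := Phi_entry 0 x * Phi_entry 3 x - Phi_entry 1 x * Phi_entry 2 x.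
Lemma G_detPhi j : good l j detPhi.
Proof. unfold detPhi. apply good_minus; apply good_mult; apply G_Phi_entry. Qed.
(** By Liouville's formula the determinant is the exponential of an integral. *)
Lemma L_detPhi : bdd_below l detPhi.
Proof.
  assert (HA : good l 0 (fun x => lambda G * (a1 G U x + b2 G U x))).
  { apply good_mult; [apply good_const|apply good_plus; [apply G_a1|apply G_b2]]. }
  destruct HA as [[F [HF E]] _].
  set (B := fun x => RInt F 0 x).
  assert (HB : cont B) by (unfold B; auto with cont).
  (* The logarithmic derivative of the determinant is the trace of the system, so [D] has zero
     derivative and keeps its value [1] at [0]. *)
  set (D := fun x => detPhi (clamp 0 l x) * exp (- B x)).
  assert (HD : cont D).
  { apply cont_mult.
    - unfold detPhi. pose proof C_Phi_entry. auto with cont.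
    - apply (cont_comp (fun x => - B x) exp); [auto with cont|apply cont_exp]. }
  assert (HDer : forall x, 0 < x < l -> is_derive D x 0).
  { intros x Hx. destruct (proj2 (proj2 Hfm) x ltac:(apply in_Io; lra)) as [H1 [H2 [H3 H4]]].
    assert (Hdt : is_derive detPhi x (lambda G * (a1 G U x + b2 G U x) * detPhi x)).
    { replace (lambda G * (a1 G U x + b2 G U x) * detPhi x) with
        ((lambda G * (a1 G U x * m11 (Phi x) + a2 G U x * m21 (Phi x)) * Phi_entry 3 x + Phi_entry 0 x * (lambda G * (b1 G U x * m12 (Phi x) + b2 G U x * m22 (Phi x))))
         - (lambda G * (a1 G U x * m12 (Phi x) + a2 G U x * m22 (Phi x)) * Phi_entry 2 x + Phi_entry 1 x * (lambda G * (b1 G U x * m11 (Phi x) + b2 G U x * m21 (Phi x)))))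
        by (unfold detPhi; simpl; ring).
      apply (is_derive_minus (fun x => Phi_entry 0 x * Phi_entry 3 x) (fun x => Phi_entry 1 x * Phi_entry 2 x)).
      - apply (is_derive_mult (Phi_entry 0) (Phi_entry 3)); [apply H1|apply H4|intros; apply Rmult_comm].
      - apply (is_derive_mult (Phi_entry 1) (Phi_entry 2)); [apply H2|apply H3|intros; apply Rmult_comm]. }
    apply (is_derive_eq_on l (fun x => detPhi x * exp (- B x))); [intros y Hy; unfold D; now rewrite clamp_id by lra|easy|].
    assert (He : is_derive (fun x => exp (- B x)) x (- F x * exp (- B x))).
    { apply (is_derive_comp exp (fun x => - B x)); [apply is_derive_exp|]. apply (is_derive_opp B). now apply derive_RInt. }
    replace 0 with (lambda G * (a1 G U x + b2 G U x) * detPhi x * exp (- B x) + detPhi x * (- F x * exp (- B x))).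
    - apply (is_derive_mult detPhi (fun x => exp (- B x))); [easy|easy|intros; apply Rmult_comm].
    - rewrite <- E by easy. ring. }
  assert (HD0 : D 0 = 1).
  { unfold D, B. rewrite clamp_id, RInt_nil, Ropp_0, exp_0 by lra. unfold detPhi, Phi_entry. destruct Hfm as [-> _]. simpl. ring. }
  assert (HDc : forall x, 0 < x < l -> D x = 1).
  { intros x Hx. destruct (MVT_gen D 0 x (fun _ => 0)) as [z [_ Hz]].
    - intros t Ht. rewrite Rmin_left, Rmax_right in Ht by lra. apply HDer; lra.
    - intros t Ht. now apply pt_cont.
    - lra. }
  apply (bdd_below_ext (fun x => exp (B x))).
  - intros x Hx. specialize (HDc x Hx). unfold D in HDc. rewrite clamp_id in HDc by lra.
    rewrite exp_Ropp in HDc. pose proof (exp_pos (B x)). apply (Rmult_eq_reg_r (/ exp (B x))); [|apply Rinv_neq_0_compat; lra].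
    rewrite HDc. field. lra.
  - apply bdd_below_exp. split; [exists B; split; [easy|easy]|easy].
Qed.

Lemma G_a4 j : good l j (a4 G U Phi).
Proof.
  apply (good_ext l j (fun x => (Phi_entry 3 x * a3 G U x - Phi_entry 1 x * b3 G U x) / detPhi x)); [easy|].
  apply good_div; [easy|apply L_detPhi| |apply G_detPhi]. apply good_minus; apply good_mult; first [apply G_Phi_entry|apply G_a3|apply G_b3].
Qed.
Lemma G_b4 j : good l j (b4 G U Phi).
Proof.
  apply (good_ext l j (fun x => (Phi_entry 0 x * b3 G U x - Phi_entry 2 x * a3 G U x) / detPhi x)); [easy|].
  apply good_div; [easy|apply L_detPhi| |apply G_detPhi]. apply good_minus; apply good_mult; first [apply G_Phi_entry|apply G_a3|apply G_b3].
Qed.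
Lemma G_e10 j : good l j (e10 G U Phi).
Proof. apply (good_ext l j (fun x => e4 G U x * Phi_entry 0 x + e5 G U x * Phi_entry 2 x)); [easy|]. apply good_plus; apply good_mult; first [apply G_Phi_entry|apply G_e4|apply G_e5]. Qed.
Lemma G_e11 j : good l j (e11 G U Phi).
Proof. apply (good_ext l j (fun x => e4 G U x * Phi_entry 1 x + e5 G U x * Phi_entry 3 x)); [easy|]. apply good_plus; apply good_mult; first [apply G_Phi_entry|apply G_e4|apply G_e5]. Qed.
Lemma G_e12 j : good l j (e12 G U Phi).
Proof. apply (good_ext l j (fun x => e8 G U x * Phi_entry 0 x + e9 G U x * Phi_entry 2 x)); [easy|]. apply good_plus; apply good_mult; first [apply G_Phi_entry|apply G_e8|apply G_e9]. Qed.
Lemma G_e13 j : good l j (e13 G U Phi).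
Proof. apply (good_ext l j (fun x => e8 G U x * Phi_entry 1 x + e9 G U x * Phi_entry 3 x)); [easy|]. apply good_plus; apply good_mult; first [apply G_Phi_entry|apply G_e8|apply G_e9]. Qed.
End Coef.

(** * Functions of two variables *)

Definition cont2 (f : R -> R -> R) : Prop := forall x y, continuity_2d_pt f x y.

Lemma cont2_eps f x y eps : cont2 f -> 0 < eps -> exists d, 0 < d /\ forall u v, Rabs (u - x) < d -> Rabs (v - y) < d -> Rabs (f u v - f x y) < eps.
Proof. intros H He. destruct (H x y (mkposreal eps He)) as [d Hd]. exists d. split; [apply cond_pos|exact Hd]. Qed.
Lemma cont2_y f x : cont2 f -> cont (f x).
Proof.
  intros H. apply cont_pt. intros y eps He. destruct (cont2_eps f x y eps H He) as [d [Hd Hb]].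
  exists d. split; [easy|]. intros z [_ Hz]. apply Hb; [rewrite Rminus_diag_eq, Rabs_R0; easy|exact Hz].
Qed.
Lemma cont2_x f y : cont2 f -> cont (fun x => f x y).
Proof.
  intros H. apply cont_pt. intros x eps He. destruct (cont2_eps f x y eps H He) as [d [Hd Hb]].
  exists d. split; [easy|]. intros z [_ Hz]. apply Hb; [exact Hz|rewrite Rminus_diag_eq, Rabs_R0; easy].
Qed.
Lemma cont2_intro f : (forall x y eps, 0 < eps -> exists d, 0 < d /\ forall u v, Rabs (u - x) < d -> Rabs (v - y) < d -> Rabs (f u v - f x y) < eps) -> cont2 f.
Proof.
  intros H x y eps. destruct (H x y eps (cond_pos eps)) as [d [Hd Hb]]. exists (mkposreal d Hd). exact Hb.
Qed.
Lemma cont2_of_y (w : R -> R) : cont w -> cont2 (fun _ y => w y).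
Proof.
  intros H. apply cont2_intro. intros x y eps He. destruct (pt_cont w H y eps He) as [d [Hd Hb]].
  exists d. split; [easy|]. intros u v _ Hv. destruct (Req_dec v y) as [->|Hn]; [rewrite Rminus_diag_eq, Rabs_R0; easy|].
  apply Hb. split; [split; [exact I|auto]|exact Hv].
Qed.
Lemma cont2_of_x (w : R -> R) : cont w -> cont2 (fun x _ => w x).
Proof.
  intros H. apply cont2_intro. intros x y eps He. destruct (pt_cont w H x eps He) as [d [Hd Hb]].
  exists d. split; [easy|]. intros u v Hu _. destruct (Req_dec u x) as [->|Hn]; [rewrite Rminus_diag_eq, Rabs_R0; easy|].
  apply Hb. split; [split; [exact I|auto]|exact Hu].
Qed.
Lemma cont2_mult f g : cont2 f -> cont2 g -> cont2 (fun x y => f x y * g x y).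
Proof. intros Hf Hg x y. now apply continuity_2d_pt_mult. Qed.
Lemma cont2_plus f g : cont2 f -> cont2 g -> cont2 (fun x y => f x y + g x y).
Proof. intros Hf Hg x y. now apply continuity_2d_pt_plus. Qed.

Lemma cont2_unif f a b c d eps : cont2 f -> 0 < eps -> exists del, 0 < del /\ forall x y u v, a <= x <= b -> c <= y <= d -> a <= u <= b -> c <= v <= d ->
  Rabs (u - x) < del -> Rabs (v - y) < del -> Rabs (f u v - f x y) < eps.
Proof.
  intros H He. destruct (uniform_continuity_2d f a b c d) with (eps := mkposreal eps He) as [del Hd]; [intros; apply H|].
  exists del. split; [apply cond_pos|]. exact Hd.
Qed.

Lemma cont_param f a b : a <= b -> cont2 f -> cont (fun x => RInt (f x) a b).
Proof.
  intros Hab H. apply cont_pt. intros x eps He.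
  destruct (cont2_unif f (x - 1) (x + 1) a b (eps / (2 * (b - a + 1))) H) as [del [Hdel Hb]]; [apply Rdiv_lt_0_compat; lra|].
  exists (Rmin del 1). split; [apply Rmin_glb_lt; lra|]. intros u [_ Hu]. simpl in *. unfold Rdist in *.
  pose proof (Rmin_l del 1). pose proof (Rmin_r del 1).
  assert (x - 1 <= u <= x + 1) by (apply Rabs_lt_between in Hu; lra).
  rewrite <- RInt_cminus by now apply cont2_y.
  apply Rle_lt_trans with ((b - a) * (eps / (2 * (b - a + 1)))).
  - apply RInt_abs_cst; [easy|apply cont_minus; now apply cont2_y|]. intros y Hy. left. apply Hb; try lra. rewrite Rminus_diag_eq, Rabs_R0; easy.
  - apply (Rmult_lt_reg_r (2 * (b - a + 1))); [lra|].
    replace ((b - a) * (eps / (2 * (b - a + 1))) * (2 * (b - a + 1))) with ((b - a) * eps) by (field; lra). nra.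
Qed.

Lemma diff_param (f df : R -> R -> R) a b lo hi x : a <= b -> lo < x < hi -> cont2 f -> cont2 df ->
  (forall t y, lo < t < hi -> a < y < b -> is_derive (fun t => f t y) t (df t y)) ->
  is_derive (fun x => RInt (f x) a b) x (RInt (df x) a b).
Proof.
  intros Hab Hx Hf Hdf Hd. apply is_derive_Reals. intros eps He.
  destruct (cont2_unif df (x - 1) (x + 1) a b (eps / (2 * (b - a + 1))) Hdf) as [del [Hdel Hb]]; [apply Rdiv_lt_0_compat; lra|].
  set (m := Rmin (Rmin del 1) (Rmin (x - lo) (hi - x))).
  assert (Hm : 0 < m) by (unfold m; repeat apply Rmin_glb_lt; lra).
  exists (mkposreal m Hm). intros h Hh0 Hh. simpl in Hh.
  assert (m <= del /\ m <= 1 /\ m <= x - lo /\ m <= hi - x) as [M1 [M2 [M3 M4]]].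
  { unfold m, Rmin. repeat destruct Rle_dec; lra. }
  apply Rabs_lt_between in Hh.
  assert (E : (RInt (f (x + h)) a b - RInt (f x) a b) / h - RInt (df x) a b = RInt (fun y => / h * (f (x + h) y - f x y) - df x y) a b).
  { pose proof (cont2_y f (x + h) Hf). pose proof (cont2_y f x Hf). pose proof (cont2_y df x Hdf).
    rewrite RInt_cminus, RInt_cscal, RInt_cminus by auto with cont. unfold Rdiv. ring. }
  rewrite E.
  (* The bound for the difference quotient holds for interior [y]; clamping leaves the integral
     unchanged and yields a continuous integrand bounded on the closed interval. *)
  rewrite (RInt_eq_open _ (fun y => clamp (- (eps / (2 * (b - a + 1)))) (eps / (2 * (b - a + 1))) (/ h * (f (x + h) y - f x y) - df x y))).
  2: easy.
  2:{ intros y Hy. symmetry. apply clamp_id.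
      destruct (mvt (fun t => f t y) (fun t => df t y) x (x + h)) as [z [Hz Ez]].
      { intros t Ht. apply Hd; [|easy]. revert Ht. unfold Rmin, Rmax. destruct Rle_dec; lra. }
      replace (/ h * (f (x + h) y - f x y) - df x y) with (df z y - df x y) by (rewrite Ez; field; easy).
      apply Rabs_le_between. left.
      assert (Rabs (z - x) < del). { revert Hz. unfold Rmin, Rmax. destruct Rle_dec; intros; apply Rabs_lt_between; lra. }
      assert (x - 1 <= z <= x + 1). { revert Hz. unfold Rmin, Rmax. destruct Rle_dec; lra. }
      apply Hb; try lra. rewrite Rminus_diag_eq, Rabs_R0; easy. }
  set (e := eps / (2 * (b - a + 1))). assert (He0 : 0 < e) by (apply Rdiv_lt_0_compat; lra).
  apply Rle_lt_trans with ((b - a) * e).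
  - apply RInt_abs_cst; [easy| |].
    + apply (cont_comp (fun y => / h * (f (x + h) y - f x y) - df x y) (clamp (- e) e)); [|apply cont_clamp].
      pose proof (cont2_y f (x + h) Hf). pose proof (cont2_y f x Hf). pose proof (cont2_y df x Hdf). auto with cont.
    + intros y _. apply Rabs_le. apply clamp_in. lra.
  - unfold e. apply (Rmult_lt_reg_r (2 * (b - a + 1))); [lra|].
    replace ((b - a) * (eps / (2 * (b - a + 1))) * (2 * (b - a + 1))) with ((b - a) * eps) by (field; lra). nra.
Qed.

Lemma cont2_RInt_x (f : R -> R -> R) : cont2 f -> cont2 (fun x y => RInt (fun t => f t y) 0 x).
Proof.
  intros Hf. apply cont2_intro. intros x y eps He.
  set (L := Rabs x + 1). assert (HL : 0 < L) by (unfold L; pose proof (Rabs_pos x); lra).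
  destruct (cont2_unif f (- L) L (y - 1) (y + 1) (eps / (4 * L)) Hf) as [del [Hdel Hb]]; [apply Rdiv_lt_0_compat; lra|].
  pose proof (cont_RInt (fun t => f t y) 0 (cont2_x f y Hf)) as Hc.
  destruct (pt_cont _ Hc x (eps / 2) ltac:(lra)) as [d2 [Hd2 Hb2]].
  exists (Rmin (Rmin del 1) d2). split; [repeat apply Rmin_glb_lt; lra|]. intros u v Hu Hv.
  assert (Rmin (Rmin del 1) d2 <= del /\ Rmin (Rmin del 1) d2 <= 1 /\ Rmin (Rmin del 1) d2 <= d2) as [M1 [M2 M3]].
  { unfold Rmin. repeat destruct Rle_dec; lra. }
  assert (Hux : Rabs (RInt (fun t => f t y) 0 u - RInt (fun t => f t y) 0 x) < eps / 2).
  { destruct (Req_dec u x) as [->|Hn]; [rewrite Rminus_diag_eq, Rabs_R0; lra|]. apply Hb2. split; [split; [exact I|auto]|]. simpl; unfold Rdist. lra. }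
  apply Rabs_lt_between in Hv. assert (HuL : - L <= u <= L).
  { apply Rabs_lt_between in Hu. unfold L, Rabs in *. destruct Rcase_abs; lra. }
  assert (Huv : Rabs (RInt (fun t => f t v) 0 u - RInt (fun t => f t y) 0 u) <= eps / 4).
  { rewrite <- RInt_cminus by (now apply cont2_x).
    assert (Hcc : cont (fun t => f t v - f t y)) by (apply cont_minus; now apply cont2_x).
    assert (Hfb : forall t, - L <= t <= L -> Rabs (f t v - f t y) <= eps / (4 * L)).
    { intros t Ht. left. apply Hb; try lra; [rewrite Rminus_diag_eq, Rabs_R0; easy|apply Rabs_lt_between; lra]. }
    assert (0 < eps / (4 * L)) by (apply Rdiv_lt_0_compat; lra).
    assert (HLe : L * (eps / (4 * L)) = eps / 4) by (field; lra).
    destruct (Rle_dec 0 u).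
    - eapply Rle_trans; [apply (RInt_abs_cst _ 0 u (eps / (4 * L))); [easy|easy|intros; apply Hfb; lra]|]. rewrite <- HLe. apply Rmult_le_compat_r; lra.
    - rewrite <- (opp_RInt_swap (V := R_CompleteNormedModule)) by now apply ex_RInt_cont. change (opp ?z) with (- z). rewrite Rabs_Ropp.
      eapply Rle_trans; [apply (RInt_abs_cst _ u 0 (eps / (4 * L))); [lra|easy|intros; apply Hfb; lra]|]. rewrite <- HLe. apply Rmult_le_compat_r; lra. }
  replace (_ - _) with ((RInt (fun t => f t v) 0 u - RInt (fun t => f t y) 0 u) + (RInt (fun t => f t y) 0 u - RInt (fun t => f t y) 0 x)) by ring.
  eapply Rle_lt_trans; [apply Rabs_triang|]. lra.
Qed.

(** Both sides vanish at [x = 0] and have the same derivative in [x], by differentiation under the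
    integral on the left and the fundamental theorem on the right. *)
Lemma fubini (f : R -> R -> R) a b x : a <= b -> cont2 f ->
  RInt (fun y => RInt (fun t => f t y) 0 x) a b = RInt (fun t => RInt (f t) a b) 0 x.
Proof.
  intros Hab Hf.
  set (P := fun x => RInt (fun y => RInt (fun t => f t y) 0 x) a b - RInt (fun t => RInt (f t) a b) 0 x).
  assert (HP : forall x, is_derive P x 0).
  { intros z. replace 0 with (RInt (f z) a b - RInt (f z) a b) by ring.
    apply (is_derive_minus (fun x => RInt (fun y => RInt (fun t => f t y) 0 x) a b) (fun x => RInt (fun t => RInt (f t) a b) 0 x)).
    - apply (diff_param (fun x y => RInt (fun t => f t y) 0 x) f a b (z - 1) (z + 1)); [easy|lra|now apply cont2_RInt_x|easy|].
      intros t y _ _. apply (derive_RInt (fun t => f t y)). now apply cont2_x.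
    - apply (derive_RInt (fun t => RInt (f t) a b)). now apply cont_param. }
  destruct (mvt P (fun _ => 0) 0 x) as [z [_ Hz]]; [intros; apply HP|].
  assert (P 0 = 0) as H0.
  { unfold P. rewrite RInt_nil, (RInt_eq _ (fun _ => 0)) by (intros; apply RInt_nil). rewrite RInt_cst. ring. }
  rewrite H0 in Hz. unfold P in Hz.
  assert (forall u v : R, u - v - 0 = 0 * (x - 0) -> u = v) as G by (intros; lra). now apply G.
Qed.

Lemma C1_eq_RInt (F f Phi : R -> R) a b : a < b -> cont F -> cont Phi -> (forall t, a < t < b -> F t = f t) ->
  (forall t, a < t < b -> is_derive f t (Phi t)) -> forall t, a <= t <= b -> F t = F a + RInt Phi a t.
Proof.
  intros Hab HF HP He Hd t Ht. destruct (Req_dec t a) as [->|Hta]; [rewrite RInt_nil; ring|].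
  destruct (MVT_gen (fun t => F t - RInt Phi a t) a t (fun _ => 0)) as [z [_ Hz]].
  - intros x Hx. rewrite Rmin_left, Rmax_right in Hx by lra. replace 0 with (Phi x - Phi x) by ring.
    apply (is_derive_minus F (fun t => RInt Phi a t)); [|now apply derive_RInt].
    apply (is_derive_ext_loc f); [|apply Hd; lra].
    generalize (locally_Ioo a b x ltac:(lra)). apply filter_imp. intros y Hy. symmetry; now apply He.
  - intros x _. apply pt_cont. auto with cont.
  - simpl in Hz. rewrite RInt_nil in Hz. lra.
Qed.

Lemma is_derive_within_intro (I : R -> Prop) f x d : is_derive f x d -> is_derive_within I f x d.
Proof.
  intros H. apply is_derive_Reals in H. apply (filterlim_locally (F := within I (locally' x))). intros eps.
  destruct (H eps (cond_pos eps)) as [del Hd].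
  assert (HG : forall y : R, Rabs (y - x) < del -> y <> x -> Rabs ((f y - f x) / (y - x) - d) < eps).
  { intros y Hy Hn. specialize (Hd (y - x) ltac:(lra) Hy). now replace (x + (y - x)) with y in Hd by ring. }
  exists del. intros y Hy Hn _. exact (HG y Hy Hn).
Qed.
Lemma is_derive_within_ext (I : R -> Prop) f g x d : I x -> (forall t, I t -> f t = g t) -> is_derive_within I f x d -> is_derive_within I g x d.
Proof.
  intros Hx He H. unfold is_derive_within in *. intros P HP. specialize (H P HP). unfold filtermap, locally', within in *.
  revert H. apply filter_imp. intros y Hy Hn Iy. rewrite <- !He by easy. now apply Hy.
Qed.
Lemma is_derive_within_unique (a b : R) f x d d' : a < b -> a <= x <= b -> is_derive_within (Icc a b) f x d -> is_derive_within (Icc a b) f x d' -> d = d'.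
Proof.
  intros Hab Hx H H'. unfold is_derive_within in *.
  assert (HP : ProperFilter' (within (Icc a b) (locally' x))).
  { constructor.
    - intros [del Hd].
      set (m := Rmin del (b - a) / 2). assert (0 < Rmin del (b - a)) by (apply Rmin_glb_lt; [apply cond_pos|lra]).
      pose proof (Rmin_l del (b - a)). pose proof (Rmin_r del (b - a)).
      destruct (Rle_dec (x + m) b).
      + apply (Hd (x + m)); [apply ball_R; replace (x + m - x) with m by ring; rewrite Rabs_pos_eq; unfold m; lra|unfold m; lra|unfold Icc, m in *; lra].
      + apply (Hd (x - m)); [apply ball_R; replace (x - m - x) with (- m) by ring; rewrite Rabs_Ropp, Rabs_pos_eq; unfold m; lra|unfold m; lra|unfold Icc, m in *; lra].
    - apply within_filter. unfold locally'. apply within_filter, locally_filter. }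
  apply (filterlim_locally_unique (F := within (Icc a b) (locally' x)) (V := R_NormedModule) (fun t => (f t - f x) / (t - x)) d d'); easy.
Qed.

(** A one-sided derivative at an end point is the limit of the interior derivatives, since the
    function is the integral of the extension [Phi]. Boundary conditions thus become values of
    continuous extensions. *)
Lemma one_sided (F f Phi : R -> R) a b d x : a < b -> a <= x <= b -> cont F -> cont Phi -> (forall t, a <= t <= b -> F t = f t) ->
  (forall t, a < t < b -> is_derive f t (Phi t)) -> is_derive_within (Icc a b) f x d <-> d = Phi x.
Proof.
  intros Hab Hx HF HP He Hd.
  assert (H : is_derive_within (Icc a b) f x (Phi x)).
  { apply (is_derive_within_ext _ (fun t => F a + RInt Phi a t)); [easy| |].
    - intros t Ht. rewrite <- He by easy. symmetry. apply (C1_eq_RInt F f Phi a b); auto. intros; apply He; lra.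
    - apply is_derive_within_intro. replace (Phi x) with (0 + Phi x) by ring.
      apply (is_derive_plus (fun _ => F a) (fun t => RInt Phi a t)); [apply derive_cst|now apply derive_RInt]. }
  split.
  - intros H1. now apply (is_derive_within_unique a b f x).
  - intros ->. easy.
Qed.

Lemma cont2_clamp (l : R) (F : R * R -> R) : 0 < l -> continuous_on (Omega_bar l) F ->
  cont2 (fun x y => F (clamp 0 l x, clamp 0 PI y)).
Proof.
  intros Hl HF. pose proof PI_RGT_0. apply cont2_intro. intros x y eps He.
  assert (Hz : Omega_bar l (clamp 0 l x, clamp 0 PI y)) by (split; apply clamp_in; lra).
  pose proof (proj1 (filterlim_locally F _) (HF _ Hz) (mkposreal eps He)) as [d Hd].
  exists d. split; [apply cond_pos|]. intros u v Hu Hv.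
  apply (Hd (clamp 0 l u, clamp 0 PI v)).
  - split; apply ball_R; simpl; (eapply Rle_lt_trans; [apply clamp_lip|easy]).
  - split; apply clamp_in; lra.
Qed.

Lemma Omega_closure l : 0 < l -> forall z, Omega_bar l z -> forall d : posreal, exists y, ball z d y /\ Omega l y.
Proof.
  intros Hl [x y] [Hx Hy] d. simpl in Hx, Hy. unfold Icc in *. pose proof PI_RGT_0.
  (* The point is moved towards the centre by the fraction [t]; [l + PI] bounds the displacement in
     both coordinates. *)
  set (t := Rmin (/ 2) (d / (l + PI))).
  assert (H0 : 0 < d / (l + PI)) by (apply Rdiv_lt_0_compat; [apply cond_pos|lra]).
  assert (Ht : 0 < t <= / 2 /\ t <= d / (l + PI)) by (unfold t, Rmin; destruct Rle_dec; lra).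
  assert (Htd : t * (l + PI) <= d).
  { apply Rle_trans with (d / (l + PI) * (l + PI)); [apply Rmult_le_compat_r; lra|]. right; field; lra. }
  exists (x + t * (l / 2 - x), y + t * (PI / 2 - y)). split.
  - split; apply ball_R; simpl; apply Rabs_def1; nra.
  - split; simpl; unfold Ioo; nra.
Qed.

Lemma extend_cont2 l (f : R * R -> R) : 0 < l -> extends_to (Omega l) (Omega_bar l) f ->
  exists F, cont2 F /\ forall x y, Omega l (x, y) -> F x y = f (x, y).
Proof.
  intros Hl Hf. destruct (extend_cont (Omega l) (Omega_bar l) f) as [F [HF HE]]; [now apply Omega_closure|easy|].
  exists (fun x y => F (clamp 0 l x, clamp 0 PI y)). split; [now apply cont2_clamp|].
  intros x y [Hx Hy]. simpl in *. unfold Ioo in *. rewrite !clamp_id by lra. apply HE; split; simpl; unfold Ioo, Icc; lra.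
Qed.

Lemma fcoef_cont f n : cont2 f -> cont (fun x => fcoef (f x) n).
Proof.
  intros Hf. unfold fcoef. pose proof PI_RGT_0. apply cont_mult; [auto with cont|].
  apply (cont_param (fun x s => f x s * cosn n s)); [lra|]. apply cont2_mult; [easy|apply cont2_of_y; auto with cont].
Qed.
Lemma fcoef_diff f df n lo hi x : lo < x < hi -> cont2 f -> cont2 df ->
  (forall t y, lo < t < hi -> 0 < y < PI -> is_derive (fun t => f t y) t (df t y)) ->
  is_derive (fun x => fcoef (f x) n) x (fcoef (df x) n).
Proof.
  intros Hx Hf Hdf Hd. unfold fcoef. pose proof PI_RGT_0.
  apply (is_derive_scal (fun x => RInt (fun s => f x s * cosn n s) 0 PI) x).
  assert (cont2 (fun _ s => cosn n s)) by (apply cont2_of_y; auto with cont).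
  apply (diff_param (fun x s => f x s * cosn n s) (fun x s => df x s * cosn n s) 0 PI lo hi); [lra|easy|now apply cont2_mult|now apply cont2_mult|].
  intros t y Ht Hy. apply (is_derive_ext (fun t => cosn n y * f t y)); [intros; apply Rmult_comm|].
  rewrite Rmult_comm. apply (is_derive_scal (fun t => f t y) t (cosn n y)). auto.
Qed.
Lemma fcoef_int_x (a : R -> R) f n x : cont a -> cont2 f -> fcoef (fun y => RInt (fun t => a t * f t y) 0 x) n = RInt (fun t => a t * fcoef (f t) n) 0 x.
Proof.
  intros Ha Hf. pose proof PI_RGT_0. unfold fcoef. set (k := _ / PI).
  assert (Haf : cont2 (fun t y => a t * f t y)) by (apply cont2_mult; [now apply cont2_of_x|easy]).
  assert (Hfc : cont2 (fun t y => f t y * cosn n y)) by (apply cont2_mult; [easy|apply cont2_of_y; auto with cont]).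
  rewrite (RInt_eq (fun s => RInt (fun t => a t * f t s) 0 x * cosn n s) (fun s => RInt (fun t => a t * (f t s * cosn n s)) 0 x)).
  2:{ intros s. rewrite Rmult_comm, <- RInt_cscal by now apply (cont2_x (fun t y => a t * f t y)). apply RInt_eq. intros; ring. }
  rewrite (fubini (fun t s => a t * (f t s * cosn n s)) 0 PI x); [|lra|apply cont2_mult; [now apply cont2_of_x|easy]].
  rewrite <- RInt_cscal.
  - apply RInt_eq. intros t. rewrite RInt_cscal by now apply (cont2_y (fun t y => f t y * cosn n y)). ring.
  - apply (cont_param (fun t s => a t * (f t s * cosn n s))); [lra|]. apply cont2_mult; [now apply cont2_of_x|easy].
Qed.
Lemma fcoef_cst k n : fcoef (fun _ => k) n = match n with O => k | _ => 0 end.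
Proof.
  rewrite (fcoef_ext _ (fun s => k * cosn 0 s)) by (intros; rewrite cosn_0; ring). rewrite fcoef_scal, fcoef_cosn by auto with cont.
  destruct n; simpl; ring.
Qed.
Lemma cont_zero_closed f l : 0 < l -> cont f -> (forall x, 0 < x < l -> f x = 0) -> forall x, 0 <= x <= l -> f x = 0.
Proof.
  intros Hl Hf H x Hx. destruct (Req_dec (f x) 0) as [|Hn]; [easy|exfalso].
  destruct (pt_cont f Hf x (Rabs (f x))) as [d [Hd Hb]]; [now apply Rabs_pos_lt|].
  set (m := Rmin d l). assert (Hm : 0 < m /\ m <= d /\ m <= l) by (unfold m, Rmin; destruct Rle_dec; lra).
  assert (exists y, 0 < y < l /\ Rabs (y - x) < d /\ y <> x) as [y [Hy1 [Hy2 Hy3]]].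
  { destruct (Rle_dec x (l / 2)).
    - exists (x + m / 3). split; [lra|]. split; [|lra]. replace (x + m / 3 - x) with (m / 3) by ring. rewrite Rabs_pos_eq; lra.
    - exists (x - m / 3). split; [lra|]. split; [|lra]. replace (x - m / 3 - x) with (- (m / 3)) by ring. rewrite Rabs_Ropp, Rabs_pos_eq; lra. }
  specialize (Hb y). simpl in Hb. unfold Rdist in Hb. rewrite (H y Hy1) in Hb.
  replace (0 - f x) with (- f x) in Hb by ring. rewrite Rabs_Ropp in Hb. apply (Rlt_irrefl (Rabs (f x))). apply Hb. split; [split; [exact I|auto]|easy].
Qed.

(** * Cosine modes of a solution *)

Section ModeOf.
Variables (G : data) (U : flow) (Phi : R -> mat22) (l : R).
Variables (r aa bb : R -> R) (b c r1 r2 : nat -> R -> R).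
Hypothesis l_pos : 0 < l.
Hypotheses (r_cont : cont r) (aa_cont : cont aa) (bb_cont : cont bb) (b_cont : forall n, cont (b n)) (c_cont : forall n, cont (c n))
  (r1_cont : forall n, cont (r1 n)) (r2_cont : forall n, cont (r2 n)).
(** Selects mode [0], the only one seen by the averages over [y]; this makes the coefficients depend
    on the mode. *)
Let ifz (n : nat) (z : R) : R := match n with O => z | _ => 0 end.
Hypothesis coef : forall x, 0 < x < l -> e1 G U x * r x = -1 /\ aa x = a4 G U Phi x /\ bb x = b4 G U Phi x /\
  forall n, b n x = (lambda G * e2 G U x + ifz n (PI * e6 G U x)) * r x /\
  c n x = (e3 G U x + ifz n (PI * e7 G U x)) * r x /\
  r1 n x = lambda G * (e10 G U Phi x + ifz n (PI * e12 G U Phi x)) * r x /\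
  r2 n x = lambda G * (e11 G U Phi x + ifz n (PI * e13 G U Phi x)) * r x.
Let kap := lambda G * gamma0 G U.

(** Cosine coefficients are taken in the equation and in the boundary conditions. The two
    [y]-derivatives are moved by parts onto the cosines, where the Neumann condition removes the
    boundary terms. *)
Lemma mode_of_solution (k : nat) (h : R * R -> R) (g0 gl G0 Gl : R -> R) (q : R * R -> R) (n : nat) : (2 <= k)%nat ->
  continuous_on (Omega_bar l) h -> cont G0 -> cont Gl -> (forall y, Ioo 0 PI y -> G0 y = g0 y) -> (forall y, Ioo 0 PI y -> Gl y = gl y) ->
  Ck2 (Omega l) (Omega_bar l) k q -> solves G U Phi l h g0 gl q ->
  exists v dv, mode_sol_of l kap r (b n) (c n) (r1 n) (r2 n) aa bb (INR n ^ 2)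
     (fun x => fcoef (fun y => h (clamp 0 l x, clamp 0 PI y)) n) (fcoef G0 n) (fcoef Gl n) v dv /\
    forall x, 0 <= x <= l -> v x = fcoef (fun y => q (clamp 0 l x, clamp 0 PI y)) n.
Proof.
  intros Hk Hh HG0 HGl EG0 EGl [Hqc Hqa] [Hop [Hw [H0 Hl]]]. pose proof PI_RGT_0 as HPI.
  destruct k as [|[|k]]; [lia|lia|]. simpl in Hqa.
  destruct Hqa as [_ [Hd [[Hdx [Hdxd [Hdxx _]]] [Hdy [Hdyd [_ Hdyy]]]]]].
  assert (Hdxx' : extends_to (Omega l) (Omega_bar l) (dx (dx q))) by (destruct k; apply Hdxx).
  assert (Hdyy' : extends_to (Omega l) (Omega_bar l) (dy (dy q))) by (destruct k; apply Hdyy).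
  destruct (extend_cont2 l _ l_pos Hdx) as [Q1 [C1 E1]]. destruct (extend_cont2 l _ l_pos Hdxx') as [Q2 [C2 E2]].
  destruct (extend_cont2 l _ l_pos Hdy) as [Y1 [D1 F1]]. destruct (extend_cont2 l _ l_pos Hdyy') as [Y2 [D2 F2]].
  set (Q0 := fun x y => q (clamp 0 l x, clamp 0 PI y)).
  assert (C0 : cont2 Q0) by now apply cont2_clamp.
  assert (E0 : forall x y, 0 <= x <= l -> 0 <= y <= PI -> Q0 x y = q (x, y)) by (intros; unfold Q0; now rewrite !clamp_id).
  set (hq := fun x y => h (clamp 0 l x, clamp 0 PI y)).
  assert (Ch : cont2 hq) by now apply cont2_clamp.
  assert (DQ0 : forall x y, 0 < x < l -> 0 < y < PI -> is_derive (fun t => q (t, y)) x (Q1 x y)).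
  { intros x y Hx Hy. assert (Omega l (x, y)) as HO by now split. rewrite E1 by easy. apply Derive_correct. apply (Hd (x, y) HO). }
  assert (DQ1 : forall x y, 0 < x < l -> 0 < y < PI -> is_derive (fun t => Q1 t y) x (Q2 x y)).
  { intros x y Hx Hy. assert (Omega l (x, y)) as HO by now split. rewrite E2 by easy.
    apply (is_derive_ext_loc (fun t => dx q (t, y))).
    - generalize (locally_Ioo 0 l x Hx). apply filter_imp. intros t Ht. symmetry. apply E1. now split.
    - apply Derive_correct. apply (Hdxd (x, y) HO). }
  assert (DQ0' : forall x y, 0 < x < l -> 0 < y < PI -> is_derive (fun t => Q0 t y) x (Q1 x y)).
  { intros x y Hx Hy. apply (is_derive_ext_loc (fun t => q (t, y))); [|now apply DQ0].
    generalize (locally_Ioo 0 l x Hx). apply filter_imp. intros t Ht. symmetry. apply E0; lra. }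
  assert (DY0 : forall x y, 0 < x < l -> 0 < y < PI -> is_derive (fun t => q (x, t)) y (Y1 x y)).
  { intros x y Hx Hy. assert (Omega l (x, y)) as HO by now split. rewrite F1 by easy. apply Derive_correct. apply (Hd (x, y) HO). }
  assert (DY1 : forall x y, 0 < x < l -> 0 < y < PI -> is_derive (fun t => Y1 x t) y (Y2 x y)).
  { intros x y Hx Hy. assert (Omega l (x, y)) as HO by now split. rewrite F2 by easy.
    apply (is_derive_ext_loc (fun t => dy q (x, t))).
    - generalize (locally_Ioo 0 PI y Hy). apply filter_imp. intros t Ht. symmetry. apply F1. now split.
    - apply Derive_correct. apply (Hdyd (x, y) HO). }
  set (A0 := fun x => fcoef (Q0 x) n). set (A1 := fun x => fcoef (Q1 x) n). set (A2 := fun x => fcoef (Q2 x) n).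
  assert (CA0 : cont A0) by now apply fcoef_cont. assert (CA1 : cont A1) by now apply fcoef_cont. assert (CA2 : cont A2) by now apply fcoef_cont.
  assert (DA0 : forall x, 0 < x < l -> is_derive A0 x (A1 x)) by (intros x Hx; now apply (fcoef_diff Q0 Q1 n 0 l)).
  assert (DA1 : forall x, 0 < x < l -> is_derive A1 x (A2 x)) by (intros x Hx; now apply (fcoef_diff Q1 Q2 n 0 l)).
  (* The coefficients are known to be differentiable inside [(0, l)]; rebuilding them as primitives
     gives functions differentiable on the line, as [ode] asks, and equal to them on [[0, l]]. *)
  set (dv := fun x => A1 0 + RInt A2 0 x). set (v := fun x => A0 0 + RInt dv 0 x).
  assert (Cdv : cont dv) by (unfold dv; auto with cont).
  assert (Edv : forall x, 0 <= x <= l -> dv x = A1 x) by (intros x Hx; symmetry; now apply (C1_eq_RInt A1 A1 A2 0 l)).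
  assert (Ev : forall x, 0 <= x <= l -> v x = A0 x).
  { intros x Hx. unfold v. rewrite (RInt_eq_open dv A1) by (lra || (intros; apply Edv; lra)). symmetry; now apply (C1_eq_RInt A0 A0 A1 0 l). }
  assert (Dv : forall x, is_derive v x (dv x)).
  { intros x. unfold v. replace (dv x) with (0 + dv x) by ring.
    apply (is_derive_plus (fun _ => A0 0) (fun x => RInt dv 0 x)); [apply derive_cst|now apply derive_RInt]. }
  assert (Ddv : forall x, is_derive dv x (A2 x)).
  { intros x. unfold dv. replace (A2 x) with (0 + A2 x) by ring.
    apply (is_derive_plus (fun _ => A1 0) (fun x => RInt A2 0 x)); [apply derive_cst|now apply derive_RInt]. }
  assert (Cv : cont v) by now apply (cont_derive v dv).
  exists v, dv. split; [|intros x Hx; rewrite Ev by easy; reflexivity].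
  split; [split; [easy|split; [easy|]]|split].
  - set (R := rhs r (b n) (c n) (r1 n) (r2 n) aa bb (INR n ^ 2) (fun x => fcoef (hq x) n) v dv).
    assert (CR : cont R) by (apply cont_rhs; auto; now apply fcoef_cont).
    enough (HR : forall x, 0 < x < l -> A2 x = R x).
    { intros x Hx. pose proof (cont_zero_closed (fun x => A2 x - R x) l l_pos ltac:(auto with cont) ltac:(intros; cbv beta; rewrite HR by easy; ring) x Hx) as Hz.
      simpl in Hz. change (is_derive dv x (R x)). replace (R x) with (A2 x) by lra. apply Ddv. }
    intros x Hx. destruct (coef x Hx) as [Er [Ea [Eb Ecf]]].
    set (Ia := fun y => RInt (fun t => aa t * Q0 t y) 0 x). set (Ib := fun y => RInt (fun t => bb t * Q0 t y) 0 x).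
    assert (HIc : forall a, cont a -> cont (fun y => RInt (fun t => a t * Q0 t y) 0 x)).
    { intros a Ha. apply (cont2_y (fun x y => RInt (fun t => a t * Q0 t y) 0 x) x). apply (cont2_RInt_x (fun t y => a t * Q0 t y)).
      apply cont2_mult; [now apply cont2_of_x|easy]. }
    assert (CIa : cont Ia) by now apply HIc. assert (CIb : cont Ib) by now apply HIc.
    (* The averaged terms are constant in [y], so they contribute to the coefficient of order [0]
       only. *)
    set (K := r x * (e6 G U x * RInt (Q1 x) 0 PI + e7 G U x * RInt (Q0 x) 0 PI
        + lambda G * e12 G U Phi x * RInt Ia 0 PI + lambda G * e13 G U Phi x * RInt Ib 0 PI)).
    assert (Ia_eq : forall y, 0 < y < PI -> RInt (fun t => a4 G U Phi t * q (t, y)) 0 x = Ia y).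
    { intros y Hy. apply RInt_eq_open; [lra|]. intros t Ht. destruct (coef t ltac:(lra)) as [_ [<- _]]. now rewrite E0 by lra. }
    assert (Ib_eq : forall y, 0 < y < PI -> RInt (fun t => b4 G U Phi t * q (t, y)) 0 x = Ib y).
    { intros y Hy. apply RInt_eq_open; [lra|]. intros t Ht. destruct (coef t ltac:(lra)) as [_ [_ [<- _]]]. now rewrite E0 by lra. }
    assert (Heq : forall y, 0 < y < PI -> Q2 x y = (- r x) * Y2 x y + (lambda G * e2 G U x * r x) * Q1 x y + (e3 G U x * r x) * Q0 x y + K
       + (lambda G * e10 G U Phi x * r x) * Ia y + (lambda G * e11 G U Phi x * r x) * Ib y + (- r x) * hq x y).
    { intros y Hy. assert (Omega l (x, y)) as HO by now split. pose proof (Hop (x, y) HO) as Ho. unfold L1op in Ho.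
      rewrite <- E2, <- F2, <- E1 in Ho by easy. rewrite Ia_eq, Ib_eq in Ho by easy.
      rewrite (RInt_eq_open (fun y' => dx q (x, y')) (Q1 x)) in Ho by (lra || (intros; symmetry; apply E1; now split)).
      rewrite (RInt_eq_open (fun y' => q (x, y')) (Q0 x)) in Ho by (lra || (intros; symmetry; apply E0; lra)).
      rewrite (RInt_eq_open (fun y' => RInt (fun t => a4 G U Phi t * q (t, y')) 0 x) Ia) in Ho by (lra || (intros; now apply Ia_eq)).
      rewrite (RInt_eq_open (fun y' => RInt (fun t => b4 G U Phi t * q (t, y')) 0 x) Ib) in Ho by (lra || (intros; now apply Ib_eq)).
      rewrite <- (E0 x y) in Ho by lra. replace (h (x, y)) with (hq x y) in Ho by (unfold hq; now rewrite !clamp_id by lra).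
      unfold K. rewrite <- Ho.
      match goal with |- _ = ?R => transitivity (- (e1 G U x * r x) * Q2 x y); [rewrite Er; ring|ring] end. }
    unfold A2. rewrite (fcoef_ext _ _ n Heq).
    pose proof (cont2_y Y2 x D2). pose proof (cont2_y Q1 x C1). pose proof (cont2_y Q0 x C0). pose proof (cont2_y hq x Ch).
    rewrite !fcoef_plus, !fcoef_scal, fcoef_cst by auto 12 with cont.
    fold (A1 x) (A0 x).
    assert (HY : fcoef (Y2 x) n = - INR n ^ 2 * A0 x).
    { destruct (Hw x Hx) as [W0 Wpi].
      assert (EQ : forall t, 0 <= t <= PI -> Q0 x t = (fun t => q (x, t)) t) by (intros; apply E0; lra).
      pose proof (cont2_y Y1 x D1) as CY1.
      apply (one_sided (Q0 x) (fun t => q (x, t)) (Y1 x) 0 PI 0 0) in W0; try easy; try lra; [|intros; now apply DY0].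
      apply (one_sided (Q0 x) (fun t => q (x, t)) (Y1 x) 0 PI 0 PI) in Wpi; try easy; try lra; [|intros; now apply DY0].
      (* Primitives on the whole line agreeing with [Y1 x] and [Q0 x] on [[0, PI]]: [Q0 x] is
         clamped and may fail to be differentiable at the ends. *)
      set (f1 := fun y => Y1 x 0 + RInt (Y2 x) 0 y). set (f0 := fun y => Q0 x 0 + RInt f1 0 y).
      assert (Cf1 : cont f1) by (unfold f1; auto with cont).
      assert (Ef1 : forall y, 0 <= y <= PI -> f1 y = Y1 x y).
      { intros y Hy. symmetry. apply (C1_eq_RInt (Y1 x) (Y1 x) (Y2 x) 0 PI); auto; lra. }
      assert (Ef0 : forall y, 0 <= y <= PI -> f0 y = Q0 x y).
      { intros y Hy. unfold f0. rewrite (RInt_eq_open f1 (Y1 x)) by (lra || (intros; apply Ef1; lra)). symmetry.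
        apply (C1_eq_RInt (Q0 x) (fun t => q (x, t)) (Y1 x) 0 PI); auto; try lra; intros; [apply EQ; lra]. }
      rewrite (fcoef_second f0 f1 (Y2 x) n); auto.
      - f_equal. apply fcoef_ext. intros; apply Ef0; lra.
      - intros y. unfold f0. replace (f1 y) with (0 + f1 y) by ring.
        apply (is_derive_plus (fun _ => Q0 x 0) (fun x => RInt f1 0 x)); [apply derive_cst|now apply derive_RInt].
      - intros y. unfold f1. replace (Y2 x y) with (0 + Y2 x y) by ring.
        apply (is_derive_plus (fun _ => Y1 x 0) (fun z => RInt (Y2 x) 0 z)); [apply derive_cst|now apply derive_RInt].
      - rewrite Ef1 by lra. easy.
      - rewrite Ef1 by lra. easy. }
    assert (HIa : fcoef Ia n = RInt (fun t => aa t * A0 t) 0 x) by now apply (fcoef_int_x aa Q0).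
    assert (HIb : fcoef Ib n = RInt (fun t => bb t * A0 t) 0 x) by now apply (fcoef_int_x bb Q0).
    rewrite HY, HIa, HIb. unfold R, rhs, nonloc. rewrite Edv, Ev by lra.
    rewrite (RInt_eq_open (fun t => aa t * v t) (fun t => aa t * A0 t)) by (lra || (intros; rewrite Ev by lra; easy)).
    rewrite (RInt_eq_open (fun t => bb t * v t) (fun t => bb t * A0 t)) by (lra || (intros; rewrite Ev by lra; easy)).
    destruct (Ecf n) as [-> [-> [-> ->]]].
    assert (HKK : ifz n K = ifz n (r x * PI * (e6 G U x * A1 x + e7 G U x * A0 x
        + lambda G * e12 G U Phi x * RInt (fun t => aa t * A0 t) 0 x + lambda G * e13 G U Phi x * RInt (fun t => bb t * A0 t) 0 x))).
    { unfold ifz. destruct n; [|easy].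
      assert (Hm : forall f, RInt f 0 PI = PI * fcoef f 0).
      { intros f. unfold fcoef. rewrite (RInt_eq (fun s => f s * cosn 0 s) f) by (intros; rewrite cosn_0; ring). fold_R. field. lra. }
      unfold K. rewrite (Hm (Q1 x)), (Hm (Q0 x)), (Hm Ia), (Hm Ib), HIa, HIb. fold (A1 x) (A0 x). ring. }
    fold (ifz n K). rewrite HKK. fold (hq x). unfold ifz. destruct n; ring.
  - rewrite (Edv 0), (Ev 0) by lra. unfold A1, A0, kap. rewrite <- fcoef_scal, <- fcoef_plus.
    + apply fcoef_ext. intros y Hy. rewrite EG0 by easy. destruct (H0 y Hy) as [d [Hd0 Hd1]]. rewrite <- Hd1.
      apply (one_sided (fun t => Q0 t y) (fun t => q (t, y)) (fun t => Q1 t y) 0 l d 0) in Hd0; try lra.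
      * rewrite Hd0, E0 by lra. easy.
      * now apply cont2_x.
      * now apply cont2_x.
      * intros; apply E0; lra.
      * intros; now apply DQ0.
    + now apply cont2_y.
    + apply cont_mult; [auto with cont|now apply cont2_y].
    + now apply cont2_y.
  - rewrite Ev by lra. apply fcoef_ext. intros y Hy. rewrite E0 by lra. rewrite EGl by easy. now apply Hl.
Qed.

Lemma continuous_on_cont (D : R -> Prop) f : cont f -> continuous_on D f.
Proof.
  intros H x _ P HP. specialize (H x P HP). unfold filtermap, within in *. revert H. apply filter_imp. auto.
Qed.
Lemma extends_cont (D E : R -> Prop) f F : cont F -> (forall x, D x -> F x = f x) -> extends_to D E f.
Proof.
  intros H He z _. exists (F z). intros P HP. specialize (H z P HP). unfold filtermap, within in *. revert H. apply filter_imp.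
  intros y Hy Dy. now rewrite <- He.
Qed.

(** A solution of the homogeneous mode problem is [C^2], its second derivative being given by the
    equation; multiplied by [e1], with [e1 * r = -1], that equation is the one of the
    S-condition. *)
Lemma uniq_of_S (n : nat) : S_condition G U Phi l -> uniq l kap r (b n) (c n) (r1 n) (r2 n) aa bb (INR n ^ 2).
Proof.
  intros HS v dv [Hv [Hdc Hdv]] Hb Hl x Hx. assert (Cv : cont v) by now apply (cont_derive v dv).
  assert (ED : forall x, Derive v x = dv x) by (intros; apply is_derive_unique, Hv).
  set (R := rhs r (b n) (c n) (r1 n) (r2 n) aa bb (INR n ^ 2) (fun _ => 0) v dv).
  assert (CR : cont R) by (apply cont_rhs; auto with cont).
  assert (ED2 : forall x, 0 < x < l -> Derive_n v 2 x = R x).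
  { intros z Hz. simpl. rewrite (Derive_ext _ dv) by apply ED. apply is_derive_unique. apply Hdv; lra. }
  apply (HS n v); [| | |easy].
  - split; [now apply continuous_on_cont|]. intros m Hm. destruct m as [|[|[|m]]]; [| | |lia].
    + split; [easy|]. now apply (extends_cont _ _ _ v).
    + split; [intros z _; exists (dv z); apply Hv|]. apply (extends_cont _ _ _ dv); [easy|]. intros z _. symmetry; apply ED.
    + split.
      * intros z Hz. simpl. apply (ex_derive_ext dv); [intros; symmetry; apply ED|]. exists (R z). apply Hdv. unfold Ioo in Hz; lra.
      * apply (extends_cont _ _ _ R); [easy|]. intros z Hz. symmetry; now apply ED2.
  - split; [|easy]. exists (dv 0). split; [apply is_derive_within_intro, Hv|exact Hb].
  - intros z Hz. destruct (coef z Hz) as [Er [Ea [Eb Ecf]]]. destruct (Ecf n) as [Eb' [Ec' [E1' E2']]].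
    assert (Ia : RInt (fun t => a4 G U Phi t * v t) 0 z = RInt (fun t => aa t * v t) 0 z).
    { apply RInt_eq_open; [destruct Hz; lra|]. intros t Ht. destruct (coef t ltac:(destruct Hz; lra)) as [_ [<- _]]. easy. }
    assert (Ib : RInt (fun t => b4 G U Phi t * v t) 0 z = RInt (fun t => bb t * v t) 0 z).
    { apply RInt_eq_open; [destruct Hz; lra|]. intros t Ht. destruct (coef t ltac:(destruct Hz; lra)) as [_ [_ [<- _]]]. easy. }
    assert (E : e1 G U z * R z = - (INR n ^ 2 * v z + (lambda G * e2 G U z + ifz n (PI * e6 G U z)) * dv z + (e3 G U z + ifz n (PI * e7 G U z)) * v z
       + lambda G * (e10 G U Phi z + ifz n (PI * e12 G U Phi z)) * RInt (fun t => aa t * v t) 0 z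
       + lambda G * (e11 G U Phi z + ifz n (PI * e13 G U Phi z)) * RInt (fun t => bb t * v t) 0 z)).
    { unfold R, rhs, nonloc. rewrite Eb', Ec', E1', E2'.
      match goal with |- _ = - ?Z => transitivity (e1 G U z * r z * Z); [ring|rewrite Er; ring] end. }
    destruct n as [|n].
    + unfold mode0_eq. rewrite ED2, ED, Ia, Ib, E by easy. unfold ifz. simpl. ring.
    + unfold mode_eq. rewrite ED2, ED, Ia, Ib, E by easy. unfold ifz. ring.
Qed.
End ModeOf.

(** * Hölder classes on the rectangle *)

(** For the empty set the supremum is minus infinity and [real] returns [0], which is why [K >= 0]
    is asked. In [Lub_ge] the upper bound excludes an infinite supremum. *)
Lemma Lub_le (S : R -> Prop) K : 0 <= K -> (forall r, S r -> r <= K) -> real (Lub_Rbar S) <= K.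
Proof.
  intros HK H. destruct (Lub_Rbar_correct S) as [H1 H2].
  assert (HL : Rbar_le (Lub_Rbar S) K) by (apply H2; intros r Hr; now apply H).
  destruct (Lub_Rbar S); simpl in *; lra.
Qed.
Lemma Lub_ge (S : R -> Prop) K r : (forall r, S r -> r <= K) -> S r -> r <= real (Lub_Rbar S).
Proof.
  intros H Hr. destruct (Lub_Rbar_correct S) as [H1 H2]. specialize (H1 r Hr).
  assert (HL : Rbar_le (Lub_Rbar S) K) by (apply H2; intros s Hs; now apply H).
  destruct (Lub_Rbar S); simpl in *; easy.
Qed.
Lemma Lub_pos (S : R -> Prop) : (forall r, S r -> 0 <= r) -> 0 <= real (Lub_Rbar S).
Proof.
  intros H. destruct (Lub_Rbar_correct S) as [H1 H2].
  destruct (Lub_Rbar S) as [z| |] eqn:E; simpl; try lra.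
  destruct (Rle_dec 0 z) as [|Hz]; [easy|exfalso].
  assert (Hall : forall r, S r -> False). { intros r Hr. specialize (H1 r Hr). specialize (H r Hr). simpl in H1. lra. }
  specialize (H2 (z - 1)). simpl in H2. enough (z <= z - 1) by lra. apply H2. intros r Hr. now apply Hall in Hr.
Qed.

Lemma sup_norm_pos {T} (D : T -> Prop) f : 0 <= sup_norm D f.
Proof. apply Lub_pos. intros r [z [_ ->]]. apply Rabs_pos. Qed.
Lemma sup_norm_le {T} (D : T -> Prop) f K : 0 <= K -> (forall z, D z -> Rabs (f z) <= K) -> sup_norm D f <= K.
Proof. intros HK H. apply Lub_le; [easy|]. intros r [z [Hz ->]]. auto. Qed.
Lemma sup_norm_ge {T} (D : T -> Prop) f z : bounded_on D f -> D z -> Rabs (f z) <= sup_norm D f.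
Proof. intros [K HK] Hz. apply (Lub_ge _ K); [intros r [w [Hw ->]]; auto|now exists z]. Qed.
Lemma holder_seminorm_pos {V : NormedModule R_AbsRing} al (D : V -> Prop) f : 0 <= holder_seminorm al D f.
Proof.
  apply Lub_pos. intros r [z [w [_ [_ [_ ->]]]]]. apply Rdiv_le_0_compat; [apply Rabs_pos|apply exp_pos].
Qed.
Lemma holder_seminorm_le {V : NormedModule R_AbsRing} al (D : V -> Prop) f K : 0 <= K ->
  (forall z w, D z -> D w -> z <> w -> Rabs (f z - f w) <= K * Rpower (norm (minus z w)) al) -> holder_seminorm al D f <= K.
Proof.
  intros HK H. apply Lub_le; [easy|]. intros r [z [w [Hz [Hw [Hn ->]]]]].
  assert (0 < Rpower (norm (minus z w)) al) by apply exp_pos.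
  apply (Rmult_le_reg_r (Rpower (norm (minus z w)) al)); [easy|]. unfold Rdiv. rewrite Rmult_assoc, Rinv_l by lra.
  rewrite Rmult_1_r. auto.
Qed.
Lemma holder_seminorm_ge {V : NormedModule R_AbsRing} al (D : V -> Prop) f z w : holder_on al D f -> D z -> D w -> z <> w ->
  Rabs (f z - f w) <= holder_seminorm al D f * Rpower (norm (minus z w)) al.
Proof.
  intros [K HK] Hz Hw Hn. assert (Hp : forall z w : V, 0 < Rpower (norm (minus z w)) al) by (intros; apply exp_pos).
  pose proof (Hp z w) as Hp0.
  assert (Rabs (f z - f w) / Rpower (norm (minus z w)) al <= holder_seminorm al D f) as H.
  { apply (Lub_ge _ K).
    - intros r [z' [w' [Hz' [Hw' [Hn' ->]]]]]. pose proof (Hp z' w').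
      apply (Rmult_le_reg_r (Rpower (norm (minus z' w')) al)); [easy|]. unfold Rdiv. rewrite Rmult_assoc, Rinv_l by lra.
      rewrite Rmult_1_r. auto.
    - now exists z, w. }
  apply (Rmult_le_compat_r (Rpower (norm (minus z w)) al)) in H; [|lra].
  unfold Rdiv in H. rewrite Rmult_assoc, Rinv_l, Rmult_1_r in H by lra. easy.
Qed.

Lemma sum_n_le (a : nat -> R) k K : (forall i, (i <= k)%nat -> a i <= K) -> sum_n a k <= INR (S k) * K.
Proof.
  induction k; intros H.
  - rewrite sum_O. simpl. rewrite Rmult_1_l. auto.
  - rewrite sum_Sn, S_INR. change (plus ?x ?y) with (x + y).
    pose proof (IHk ltac:(auto)). pose proof (H (S k) (Nat.le_refl _)). lra.
Qed.
Lemma sum_n_pos (a : nat -> R) k : (forall i, 0 <= a i) -> 0 <= sum_n a k.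
Proof.
  intros H. induction k; [rewrite sum_O; auto|]. rewrite sum_Sn. change (plus ?x ?y) with (x + y). pose proof (H (S k)). lra.
Qed.
Lemma sum_n_ge (a : nat -> R) k i : (forall i, 0 <= a i) -> (i <= k)%nat -> a i <= sum_n a k.
Proof.
  intros H. induction k; intros Hi.
  - rewrite sum_O. replace i with 0%nat by lia. lra.
  - rewrite sum_Sn. change (plus ?x ?y) with (x + y). pose proof (H (S k)). pose proof (sum_n_pos a k H).
    destruct (Nat.eq_dec i (S k)) as [->|]; [lra|]. pose proof (IHk ltac:(lia)). lra.
Qed.

Lemma le_plus_r a b : 0 <= a -> b <= a + b.
Proof. lra. Qed.
Lemma Cka2_norm_pos D k al f : 0 <= Cka2_norm D k al f.
Proof.
  apply Rplus_le_le_0_compat; apply sum_n_pos; intros i; [apply sum_n_pos; intros; apply sup_norm_pos|apply holder_seminorm_pos].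
Qed.
Lemma Cka1_norm_pos D k al f : 0 <= Cka1_norm D k al f.
Proof. apply Rplus_le_le_0_compat; [apply sum_n_pos; intros; apply sup_norm_pos|apply holder_seminorm_pos]. Qed.

Lemma Cka2_sup D k al f i j z : (i + j <= k)%nat -> bounded_on D (dxy i j f) -> D z -> Rabs (dxy i j f z) <= Cka2_norm D k al f.
Proof.
  intros Hk Hb Hz. eapply Rle_trans; [now apply (sup_norm_ge D)|].
  unfold Cka2_norm.
  assert (0 <= sum_n (fun i => holder_seminorm (V := prod_NormedModule _ R_NormedModule R_NormedModule) al D (dxy i (k - i) f)) k)
    by (apply sum_n_pos; intros; apply holder_seminorm_pos).
  pose proof (sum_n_ge (fun n => sum_n (fun i => sup_norm D (dxy i (n - i) f)) n) k (i + j)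
    ltac:(intros; apply sum_n_pos; intros; apply sup_norm_pos) Hk) as H1.
  pose proof (sum_n_ge (fun i0 => sup_norm D (dxy i0 (i + j - i0) f)) (i + j) i ltac:(intros; apply sup_norm_pos) ltac:(lia)) as H2.
  cbv beta in H1, H2. replace (i + j - i)%nat with j in H2 by lia. lra.
Qed.
Lemma Cka2_hol D k al f i j z w : (i + j = k)%nat -> holder_on (V := prod_NormedModule _ R_NormedModule R_NormedModule) al D (dxy i j f) ->
  D z -> D w -> z <> w -> Rabs (dxy i j f z - dxy i j f w) <= Cka2_norm D k al f * Rpower (norm (minus (z : prod_NormedModule _ R_NormedModule R_NormedModule) w)) al.
Proof.
  intros Hk Hb Hz Hw Hn. eapply Rle_trans; [apply (holder_seminorm_ge (V := prod_NormedModule _ R_NormedModule R_NormedModule) al D); eassumption|].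
  apply Rmult_le_compat_r; [left; apply exp_pos|]. unfold Cka2_norm.
  assert (0 <= sum_n (fun n => sum_n (fun i => sup_norm D (dxy i (n - i) f)) n) k)
    by (apply sum_n_pos; intros; apply sum_n_pos; intros; apply sup_norm_pos).
  pose proof (sum_n_ge (fun i => holder_seminorm (V := prod_NormedModule _ R_NormedModule R_NormedModule) al D (dxy i (k - i) f)) k i
    ltac:(intros; apply holder_seminorm_pos) ltac:(lia)) as H2.
  cbv beta in H2. replace (k - i)%nat with j in H2 by lia.
  refine (Rle_trans _ _ _ H2 _). apply le_plus_r. exact H.
Qed.
Lemma Cka1_sup D k al f i z : (i <= k)%nat -> bounded_on D (Derive_n f i) -> D z -> Rabs (Derive_n f i z) <= Cka1_norm D k al f.
Proof.
  intros Hk Hb Hz. eapply Rle_trans; [now apply (sup_norm_ge D)|]. unfold Cka1_norm.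
  pose proof (holder_seminorm_pos (V := R_NormedModule) al D (Derive_n f k)).
  pose proof (sum_n_ge (fun n => sup_norm D (Derive_n f n)) k i ltac:(intros; apply sup_norm_pos) Hk) as H1. cbv beta in H1. lra.
Qed.
Lemma Cka1_hol D k al f z w : holder_on (V := R_NormedModule) al D (Derive_n f k) ->
  D z -> D w -> z <> w -> Rabs (Derive_n f k z - Derive_n f k w) <= Cka1_norm D k al f * Rpower (Rabs (z - w)) al.
Proof.
  intros Hb Hz Hw Hn. eapply Rle_trans; [apply (holder_seminorm_ge (V := R_NormedModule) al D); eassumption|].
  apply Rmult_le_compat_r; [left; apply exp_pos|]. unfold Cka1_norm.
  pose proof (sum_n_pos (fun n => sup_norm D (Derive_n f n)) k ltac:(intros; apply sup_norm_pos)). apply le_plus_r; assumption.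
Qed.

(** Separate moduli in [x] and in [y], as the series provides them; moving along the axes gives the
    Euclidean modulus with a factor [2]. The same [K] also bounds the size, which makes products
    easy. *)
Definition holO (al l K : R) (f : R -> R -> R) : Prop :=
  (forall x y, 0 < x < l -> 0 < y < PI -> Rabs (f x y) <= K) /\
  (forall x x' y, 0 < x < l -> 0 < x' < l -> 0 < y < PI -> Rabs (f x y - f x' y) <= K * hpow al (Rabs (x - x'))) /\
  (forall x y y', 0 < x < l -> 0 < y < PI -> 0 < y' < PI -> Rabs (f x y - f x y') <= K * hpow al (Rabs (y - y'))).

Lemma holO_le al l K K' f : K <= K' -> holO al l K f -> holO al l K' f.
Proof.
  intros HK [H1 [H2 H3]]. split; [|split].
  - intros; eapply Rle_trans; [now apply H1|easy].
  - intros; eapply Rle_trans; [now apply H2|]. apply Rmult_le_compat_r; [apply hpow_pos|easy].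
  - intros; eapply Rle_trans; [now apply H3|]. apply Rmult_le_compat_r; [apply hpow_pos|easy].
Qed.
Lemma holO_ext al l K f g : (forall x y, 0 < x < l -> 0 < y < PI -> f x y = g x y) -> holO al l K f -> holO al l K g.
Proof. intros H [H1 [H2 H3]]. split; [|split]; intros; rewrite <- !H by easy; auto. Qed.
Lemma holO_plus al l K1 K2 f g : holO al l K1 f -> holO al l K2 g -> holO al l (K1 + K2) (fun x y => f x y + g x y).
Proof.
  intros [A1 [A2 A3]] [B1 [B2 B3]]. split; [|split]; intros.
  - eapply Rle_trans; [apply Rabs_triang|]. apply Rplus_le_compat; auto.
  - replace (_ - _) with ((f x y - f x' y) + (g x y - g x' y)) by ring. rewrite Rmult_plus_distr_r.
    eapply Rle_trans; [apply Rabs_triang|]. apply Rplus_le_compat; auto.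
  - replace (_ - _) with ((f x y - f x y') + (g x y - g x y')) by ring. rewrite Rmult_plus_distr_r.
    eapply Rle_trans; [apply Rabs_triang|]. apply Rplus_le_compat; auto.
Qed.
Lemma prod_diff a b a' b' K1 K2 h : Rabs a <= K1 -> Rabs b' <= K2 -> Rabs (a - a') <= K1 * h -> Rabs (b - b') <= K2 * h ->
  Rabs (a * b - a' * b') <= 2 * K1 * K2 * h.
Proof.
  intros H1 H2 H3 H4. replace (a * b - a' * b') with (a * (b - b') + (a - a') * b') by ring.
  eapply Rle_trans; [apply Rabs_triang|]. rewrite !Rabs_mult.
  pose proof (Rmult_le_compat _ _ _ _ (Rabs_pos _) (Rabs_pos _) H1 H4).
  pose proof (Rmult_le_compat _ _ _ _ (Rabs_pos _) (Rabs_pos _) H3 H2). lra.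
Qed.
Lemma holO_mult al l K1 K2 f g : 0 <= K1 -> 0 <= K2 -> holO al l K1 f -> holO al l K2 g -> holO al l (2 * K1 * K2) (fun x y => f x y * g x y).
Proof.
  intros P1 P2 [A1 [A2 A3]] [B1 [B2 B3]]. split; [|split]; intros.
  - rewrite Rabs_mult. pose proof (Rmult_le_compat _ _ _ _ (Rabs_pos _) (Rabs_pos _) (A1 x y H H0) (B1 x y H H0)).
    assert (0 <= K1 * K2) by now apply Rmult_le_pos. lra.
  - apply prod_diff; auto.
  - apply prod_diff; auto.
Qed.

Lemma hpow_small al eps : 0 < al -> 0 < eps -> exists d, 0 < d /\ forall t, t < d -> hpow al t < eps.
Proof.
  intros Ha He. exists (Rpower eps (/ al)). split; [apply exp_pos|]. intros t Ht.
  destruct (Rle_dec t 0) as [H|H].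
  - apply Rle_lt_trans with (hpow al 0); [now apply hpow_mono|]. now rewrite hpow_0.
  - rewrite hpow_Rpower by lra. apply Rlt_le_trans with (Rpower (Rpower eps (/ al)) al).
    + unfold Rpower at 1 2. apply exp_increasing. apply Rmult_lt_compat_l; [easy|]. apply ln_increasing; lra.
    + rewrite Rpower_mult, Rinv_l, Rpower_1; lra.
Qed.

Definition uncur (f : R -> R -> R) : R * R -> R := fun z => f (fst z) (snd z).

Lemma holO_pair al l K f z w : 0 < al -> 0 <= K -> holO al l K f -> Omega l z -> Omega l w ->
  Rabs (uncur f z - uncur f w) <= K * hpow al (Rabs (fst z - fst w)) + K * hpow al (Rabs (snd z - snd w)).
Proof.
  intros Ha HK [_ [H2 H3]] [Hz1 Hz2] [Hw1 Hw2]. unfold uncur.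
  replace (_ - _) with ((f (fst z) (snd z) - f (fst w) (snd z)) + (f (fst w) (snd z) - f (fst w) (snd w))) by ring.
  eapply Rle_trans; [apply Rabs_triang|]. apply Rplus_le_compat; auto.
Qed.
Lemma half_tri a b c d : Rabs (a - c) < d / 2 -> Rabs (b - c) < d / 2 -> Rabs (a - b) < d.
Proof.
  intros H1 H2. replace (a - b) with ((a - c) + - (b - c)) by ring.
  eapply Rle_lt_trans; [apply Rabs_triang|]; rewrite Rabs_Ropp; lra.
Qed.
Lemma holO_extends al l K f : 0 < l -> 0 < al -> 0 <= K -> holO al l K f -> extends_to (Omega l) (Omega_bar l) (uncur f).
Proof.
  intros Hl Ha HK Hf z Hz.
  pose proof (proper_within (Omega l) z (Omega_closure l Hl z Hz)) as HP.
  apply (filterlim_locally_cauchy (F := within (Omega l) (locally z)) (uncur f)). intros eps.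
  destruct (hpow_small al (eps / (2 * (K + 1))) Ha) as [d [Hd Hs]]; [apply Rdiv_lt_0_compat; [apply cond_pos|lra]|].
  exists (fun w => ball z (pos_div_2 (mkposreal d Hd)) w /\ Omega l w). split.
  - exists (pos_div_2 (mkposreal d Hd)). intros w Hw Dw. easy.
  - intros u v [Hu Du] [Hv Dv].
    assert (Huv : Rabs (fst v - fst u) < d /\ Rabs (snd v - snd u) < d).
    { destruct Hu as [U1 U2], Hv as [V1 V2]. apply ball_R in U1, U2, V1, V2. simpl in *.
      split; [apply (half_tri _ _ (fst z))|apply (half_tri _ _ (snd z))]; assumption. }
    apply ball_R. pose proof (holO_pair al l K f v u Ha HK Hf Dv Du) as H.
    destruct Huv as [H1 H2]. apply Hs in H1, H2. pose proof (hpow_pos al (Rabs (fst v - fst u))). pose proof (hpow_pos al (Rabs (snd v - snd u))).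
    assert (K * hpow al (Rabs (fst v - fst u)) <= (K + 1) * hpow al (Rabs (fst v - fst u))) by (apply Rmult_le_compat_r; lra).
    assert (K * hpow al (Rabs (snd v - snd u)) <= (K + 1) * hpow al (Rabs (snd v - snd u))) by (apply Rmult_le_compat_r; lra).
    assert ((K + 1) * hpow al (Rabs (fst v - fst u)) < eps / 2) by (replace (eps / 2) with ((K + 1) * (eps / (2 * (K + 1)))) by (field; lra); apply Rmult_lt_compat_l; lra).
    assert ((K + 1) * hpow al (Rabs (snd v - snd u)) < eps / 2) by (replace (eps / 2) with ((K + 1) * (eps / (2 * (K + 1)))) by (field; lra); apply Rmult_lt_compat_l; lra).
    lra.
Qed.
Lemma norm2_ge (z w : R * R) : Rabs (fst z - fst w) <= norm (minus (z : prod_NormedModule _ R_NormedModule R_NormedModule) w) /\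
  Rabs (snd z - snd w) <= norm (minus (z : prod_NormedModule _ R_NormedModule R_NormedModule) w).
Proof.
  split.
  - apply (norm_le_prod_norm_1 (U := R_NormedModule) (V := R_NormedModule) (minus (z : prod_NormedModule _ R_NormedModule R_NormedModule) w)).
  - apply (norm_le_prod_norm_2 (U := R_NormedModule) (V := R_NormedModule) (minus (z : prod_NormedModule _ R_NormedModule R_NormedModule) w)).
Qed.
Lemma holO_norm al l K f z w : 0 < al -> 0 <= K -> holO al l K f -> Omega l z -> Omega l w -> z <> w ->
  Rabs (uncur f z - uncur f w) <= 2 * K * Rpower (norm (minus (z : prod_NormedModule _ R_NormedModule R_NormedModule) w)) al.
Proof.
  intros Ha HK Hf Hz Hw Hn. eapply Rle_trans; [now apply (holO_pair al l K f)|].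
  destruct (norm2_ge z w) as [H1 H2]. set (nn := norm _) in *.
  assert (0 < nn).
  { destruct (Rle_dec nn 0) as [Hle|]; [exfalso|lra]. apply Hn. destruct z as [z1 z2], w as [w1 w2]. simpl in *.
    pose proof (Rabs_pos (z1 - w1)). pose proof (Rabs_pos (z2 - w2)).
    assert (Rabs (z1 - w1) = 0) as E1 by lra. assert (Rabs (z2 - w2) = 0) as E2 by lra.
    f_equal; apply Rminus_diag_uniq; destruct (Req_dec (z1 - w1) 0), (Req_dec (z2 - w2) 0); auto; exfalso.
    all: first [now apply (Rabs_no_R0 (z1 - w1))|now apply (Rabs_no_R0 (z2 - w2))]. }
  rewrite <- hpow_Rpower by easy. pose proof (hpow_mono al _ _ Ha H1). pose proof (hpow_mono al _ _ Ha H2).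
  pose proof (Rmult_le_compat_l K _ _ HK H0). pose proof (Rmult_le_compat_l K _ _ HK H3). lra.
Qed.

Section Family.
Variables (al l K : R) (k : nat) (Q : nat -> nat -> R -> R -> R) (p : R * R -> R).
Hypotheses (l_pos : 0 < l) (al_pos : 0 < al) (K_pos : 0 <= K).
Hypothesis Hp : forall z, Omega l z -> p z = uncur (Q 0 0) z.
Hypothesis HD : forall i j x y, (i + j < k)%nat -> 0 < x < l -> 0 < y < PI ->
  is_derive (fun t => Q i j t y) x (Q (S i) j x y) /\ is_derive (fun t => Q i j x t) y (Q i (S j) x y).
Hypothesis HH : forall i j, (i + j <= k)%nat -> holO al l K (Q i j).

Lemma fam_dx i j f z : (i + j < k)%nat -> (forall z, Omega l z -> f z = uncur (Q i j) z) -> Omega l z ->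
  is_derive (fun t => f (t, snd z)) (fst z) (uncur (Q (S i) j) z).
Proof.
  intros Hk Hf [Hz1 Hz2]. apply (is_derive_ext_loc (fun t => Q i j t (snd z))).
  - generalize (locally_Ioo 0 l (fst z) Hz1). apply filter_imp. intros t Ht. symmetry. apply Hf. now split.
  - now apply HD.
Qed.
Lemma fam_dy i j f z : (i + j < k)%nat -> (forall z, Omega l z -> f z = uncur (Q i j) z) -> Omega l z ->
  is_derive (fun t => f (fst z, t)) (snd z) (uncur (Q i (S j)) z).
Proof.
  intros Hk Hf [Hz1 Hz2]. apply (is_derive_ext_loc (fun t => Q i j (fst z) t)).
  - generalize (locally_Ioo 0 PI (snd z) Hz2). apply filter_imp. intros t Ht. symmetry. apply Hf. now split.
  - now apply HD.
Qed.
Lemma extends_ext (f g : R * R -> R) : (forall z, Omega l z -> f z = g z) -> extends_to (Omega l) (Omega_bar l) f -> extends_to (Omega l) (Omega_bar l) g.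
Proof.
  intros He H z Hz. destruct (H z Hz) as [v Hv]. exists v. intros P HP. specialize (Hv P HP).
  unfold filtermap, within in *. revert Hv. apply filter_imp. intros y Hy Dy. rewrite <- He by easy. auto.
Qed.
(** [Q i j] depends only on the number of derivatives in each variable, so a single table covers
    every order of differentiation and the induction may branch into [dx] and [dy]. *)
Lemma fam_Ck2 m : forall i j f, (i + j + m <= k)%nat -> (forall z, Omega l z -> f z = uncur (Q i j) z) -> Ck2_aux (Omega l) (Omega_bar l) m f.
Proof.
  induction m; intros i j f Hk Hf; (split; [apply (extends_ext (uncur (Q i j))); [intros; symmetry; auto|apply (holO_extends al l K); auto; apply HH; lia]|]); [easy|].
  split; [|split].
  - intros z Hz. split; [exists (uncur (Q (S i) j) z)|exists (uncur (Q i (S j)) z)]; [apply fam_dx|apply fam_dy]; auto; lia.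
  - apply (IHm (S i) j); [lia|]. intros z Hz. apply is_derive_unique. apply fam_dx; auto; lia.
  - apply (IHm i (S j)); [lia|]. intros z Hz. apply is_derive_unique. apply fam_dy; auto; lia.
Qed.
Lemma fam_dxy i j : (i + j <= k)%nat -> forall z, Omega l z -> dxy i j p z = uncur (Q i j) z.
Proof.
  intros Hk. assert (Hj : forall j, (j <= k)%nat -> forall z, Omega l z -> Nat.iter j dy p z = uncur (Q 0 j) z).
  { clear i j Hk. induction j; intros Hk z Hz; [now apply Hp|]. simpl. apply is_derive_unique. apply fam_dy; auto; try lia. intros; apply IHj; auto; lia. }
  unfold dxy. revert Hk. induction i; intros Hk z Hz; [apply Hj; auto; lia|].
  simpl. apply is_derive_unique. apply fam_dx; auto; try lia. intros; apply IHi; auto; lia.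
Qed.
(** The norm consists of at most [(k + 1) ^ 2] suprema and of [k + 1] seminorms, the latter with the
    factor [2] of [holO_norm]. *)
Lemma fam_result : continuous_on (Omega_bar l) p ->
  Cka2 (Omega l) (Omega_bar l) k al p /\ Cka2_norm (Omega l) k al p <= (INR (S k) ^ 2 + 2 * INR (S k)) * K.
Proof.
  intros Hc.
  assert (Hb : forall i j z, (i + j <= k)%nat -> Omega l z -> Rabs (dxy i j p z) <= K).
  { intros i j z Hk Hz. rewrite fam_dxy by easy. destruct Hz as [Hz1 Hz2]. now apply (HH i j Hk). }
  assert (Hh : forall i j (z w : R * R), (i + j <= k)%nat -> Omega l z -> Omega l w -> z <> w ->
     Rabs (dxy i j p z - dxy i j p w) <= 2 * K * Rpower (norm (minus (z : prod_NormedModule _ R_NormedModule R_NormedModule) w)) al).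
  { intros i j z w Hk Hz Hw Hn. rewrite !fam_dxy by easy. apply (holO_norm al l); auto. }
  split; [split; [split; [easy|]|split]|].
  - apply (fam_Ck2 k 0 0); [lia|apply Hp].
  - intros i j Hk. exists K. intros z Hz. now apply Hb.
  - intros i j Hk. exists (2 * K). intros z w Hz Hw Hn. apply Hh; auto; lia.
  - unfold Cka2_norm. rewrite Rmult_plus_distr_r. apply Rplus_le_compat.
    + replace (INR (S k) ^ 2 * K) with (INR (S k) * (INR (S k) * K)) by ring. apply sum_n_le. intros n Hn.
      eapply Rle_trans; [apply (sum_n_le _ n K)|].
      * intros i Hi. apply sup_norm_le; [easy|]. intros z Hz. apply Hb; auto; lia.
      * apply Rmult_le_compat_r; [easy|]. apply le_INR; lia.
    + replace (2 * INR (S k) * K) with (INR (S k) * (2 * K)) by ring. apply sum_n_le. intros i Hi.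
      apply holder_seminorm_le; [lra|]. intros z w Hz Hw Hn. apply Hh; auto; lia.
Qed.
End Family.

(** * The data *)

Lemma closed_le f M a b : a < b -> cont f -> (forall x, a < x < b -> f x <= M) -> forall x, a <= x <= b -> f x <= M.
Proof.
  intros Hl Hf H x Hx.
  (* Twice the positive part of the excess over [M]: it is continuous and vanishes inside, hence
     also at the ends. *)
  assert (cont (fun z => f (a + z) - M + Rabs (f (a + z) - M))) as HC.
  { assert (cont (fun z => f (a + z))) by (apply (cont_comp (fun z => a + z) f); [auto using cont_id with cont|easy]).
    assert (cont (fun z => f (a + z) - M)) by auto with cont. auto with cont. }
  assert (f (a + (x - a)) - M + Rabs (f (a + (x - a)) - M) = 0) as HZ.
  { apply (cont_zero_closed (fun z => f (a + z) - M + Rabs (f (a + z) - M)) (b - a)); [lra|easy| |lra].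
    intros z Hz. specialize (H (a + z) ltac:(lra)). rewrite Rabs_left1; lra. }
  replace (a + (x - a)) with x in HZ by ring. pose proof (Rabs_pos (f x - M)). lra.
Qed.
Lemma cont2_comp F u v : cont2 F -> cont u -> cont v -> cont (fun t => F (u t) (v t)).
Proof.
  intros HF Hu Hv. apply cont_pt. intros t eps He. destruct (cont2_eps F (u t) (v t) eps HF He) as [d [Hd Hb]].
  destruct (pt_cont u Hu t d Hd) as [d1 [Hd1 Hb1]]. destruct (pt_cont v Hv t d Hd) as [d2 [Hd2 Hb2]].
  exists (Rmin d1 d2). split; [now apply Rmin_glb_lt|]. intros s [Hs1 Hs2]. simpl in *. unfold Rdist in *.
  pose proof (Rmin_l d1 d2). pose proof (Rmin_r d1 d2). apply Hb; [apply Hb1|apply Hb2]; (split; [easy|lra]).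
Qed.

Lemma scale_in x L t : 0 <= x <= L -> 0 < L -> 0 < t < 1 -> 0 < x + t * (L / 2 - x) < L.
Proof. intros Hx HL Ht. nra. Qed.
Lemma scale_diff x x' c t : 0 < t < 1 -> Rabs ((x + t * (c - x)) - (x' + t * (c - x'))) <= Rabs (x - x').
Proof.
  intros Ht. replace (_ - _) with ((1 - t) * (x - x')) by ring. rewrite Rabs_mult, (Rabs_pos_eq (1 - t)) by lra.
  pose proof (Rabs_pos (x - x')). nra.
Qed.

(** Shrinking both points towards the centre of the rectangle does not increase their distance. *)
Lemma closed_hol F l al K x x' y y' : 0 < l -> 0 < al -> 0 <= K -> cont2 F ->
  (forall x x' y y', 0 < x < l -> 0 < x' < l -> 0 < y < PI -> 0 < y' < PI ->
     Rabs (F x y - F x' y') <= K * hpow al (Rabs (x - x')) + K * hpow al (Rabs (y - y'))) ->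
  0 <= x <= l -> 0 <= x' <= l -> 0 <= y <= PI -> 0 <= y' <= PI ->
  Rabs (F x y - F x' y') <= K * hpow al (Rabs (x - x')) + K * hpow al (Rabs (y - y')).
Proof.
  intros Hl Ha HK HF H Hx Hx' Hy Hy'. pose proof PI_RGT_0.
  assert (HS : forall a c : R, cont (fun t => a + t * (c - a))) by (intros; auto using cont_id with cont).
  set (M := _ + _).
  assert (Hz : Rabs (F (x + 0 * (l / 2 - x)) (y + 0 * (PI / 2 - y)) - F (x' + 0 * (l / 2 - x')) (y' + 0 * (PI / 2 - y'))) <= M).
  { apply (closed_le (fun t => Rabs (F (x + t * (l / 2 - x)) (y + t * (PI / 2 - y)) - F (x' + t * (l / 2 - x')) (y' + t * (PI / 2 - y')))) M 0 1); [lra| | |lra].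
    - apply cont_abs. apply cont_minus; now apply (cont2_comp F (fun t => _ + t * (_ - _)) (fun t => _ + t * (_ - _))).
    - intros t Ht. eapply Rle_trans; [apply H; now apply scale_in|]. unfold M.
      apply Rplus_le_compat; apply Rmult_le_compat_l; auto; apply hpow_mono; auto; now apply scale_diff. }
  rewrite !Rmult_0_l, !Rplus_0_r in Hz. exact Hz.
Qed.

Definition jackson_cst (al : R) : R := 400 * 7680000 * 12 * (1 + fejer_cst al).
Lemma jackson_cst_pos al : 0 < al < 1 -> 0 < jackson_cst al.
Proof. intros H. pose proof (fejer_cst_pos al H). unfold jackson_cst. lra. Qed.

(** Orders [0] and [1] are direct; [2] and [3] are reduced to them by [jackson_up]. [f] lists the
    successive derivatives, of which the odd ones vanish at both ends, as for an even extension. *)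
Lemma jackson (s : nat) (f : nat -> R -> R) al K j : 0 < al < 1 -> 0 <= K -> (s <= 3)%nat ->
  (forall i y, (i < s)%nat -> is_derive (f i) y (f (S i) y)) -> cont (f s) ->
  (forall i, (i <= s)%nat -> (i = 1 \/ i = 3)%nat -> f i 0 = 0 /\ f i PI = 0) -> holdI al K (f s) ->
  forall y, Rabs (dyblock j (fun n => fcoef (f 0%nat) n * cosn n y)) <= jackson_cst al * K * ratio al ^ j / (2 ^ j) ^ s.
Proof.
  intros Ha HK Hs Hd Hc H0 Hh y. pose proof (fejer_cst_pos al Ha). pose proof (ratio_bounds al Ha). pose proof (pow2_pos j).
  assert (HX : 0 <= K * ratio al ^ j) by (apply Rmult_le_pos; [easy|apply pow_le; lra]).
  assert (HC : 0 <= fejer_cst al * (K * ratio al ^ j)) by (apply Rmult_le_pos; lra).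
  assert (Hq : forall c m, c * (1 + fejer_cst al) <= jackson_cst al -> 0 <= c -> c * fejer_cst al * K * ratio al ^ j / (2 ^ j) ^ m <= jackson_cst al * K * ratio al ^ j / (2 ^ j) ^ m).
  { intros c m Hcm Hc0. apply Rmult_le_compat_r; [left; apply Rinv_0_lt_compat; now apply pow_lt|].
    replace (c * fejer_cst al * K * ratio al ^ j) with (c * fejer_cst al * (K * ratio al ^ j)) by ring. rewrite (Rmult_assoc (jackson_cst al)). apply Rmult_le_compat_r; [easy|].
    nra. }
  destruct s as [|[|[|[|s]]]]; [| | | |lia].
  - eapply Rle_trans; [apply (jackson0 (f 0%nat) al K); auto|].
    replace (12 * fejer_cst al * K * ratio al ^ j) with (12 * fejer_cst al * K * ratio al ^ j / (2 ^ j) ^ 0) by (simpl; field).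
    apply Hq; [unfold jackson_cst|]; lra.
  - eapply Rle_trans; [apply (jackson1 (f 0%nat) (f 1%nat) al K); auto; apply (H0 1%nat); lia|].
    replace (7680000 * fejer_cst al * K * ratio al ^ j / 2 ^ j) with (7680000 * fejer_cst al * K * ratio al ^ j / (2 ^ j) ^ 1) by (simpl; field; lra).
    apply Hq; [unfold jackson_cst|]; lra.
  - eapply Rle_trans; [apply (jackson_up (f 0%nat) (f 1%nat) (f 2%nat) j (12 * fejer_cst al * K * ratio al ^ j)); auto; try (apply (H0 1%nat); lia)|].
    + replace (12 * fejer_cst al * K * ratio al ^ j) with (12 * (fejer_cst al * (K * ratio al ^ j))) by ring. lra.
    + now apply jackson0.
    + replace (400 * (12 * fejer_cst al * K * ratio al ^ j)) with ((400 * 12) * fejer_cst al * K * ratio al ^ j) by ring.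
      apply Hq; [unfold jackson_cst|]; lra.
  - eapply Rle_trans; [apply (jackson_up (f 0%nat) (f 1%nat) (f 2%nat) j (7680000 * fejer_cst al * K * ratio al ^ j / 2 ^ j)); auto; try (apply (H0 1%nat); lia)|].
    + apply (cont_derive _ (f 3%nat)). intros; apply Hd; lia.
    + apply Rdiv_le_0_compat; [|easy]. replace (7680000 * fejer_cst al * K * ratio al ^ j) with (7680000 * (fejer_cst al * (K * ratio al ^ j))) by ring. lra.
    + apply (jackson1 _ (f 3%nat)); auto; apply (H0 3%nat); lia.
    + replace (400 * (7680000 * fejer_cst al * K * ratio al ^ j / 2 ^ j) / (2 ^ j) ^ 2) with ((400 * 7680000) * fejer_cst al * K * ratio al ^ j / (2 ^ j) ^ 3) by (simpl; field; lra).
      apply Hq; [unfold jackson_cst|]; lra.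
Qed.

Lemma lip_holdI f L al : 0 < al < 1 -> 0 <= L -> (forall y s, 0 <= y <= PI -> 0 <= s <= PI -> Rabs (f y - f s) <= L * Rabs (y - s)) ->
  holdI al (L * (1 + PI)) f.
Proof.
  intros Ha HL H y s Hy Hs. eapply Rle_trans; [now apply H|]. rewrite Rmult_assoc. apply Rmult_le_compat_l; [easy|].
  apply hpow_lin; [easy|]. split; [apply Rabs_pos|]. apply Rabs_le. lra.
Qed.

Lemma fejer_series f al K y J : 0 < al < 1 -> 0 <= K -> cont f -> holdI al K f -> 0 <= y <= PI ->
  Rabs (psum (fun j => dyblock j (fun n => fcoef f n * cosn n y)) J - (f y - fcoef f 0)) <= 6 * (fejer_cst al * K) * ratio al ^ J.
Proof.
  intros Ha HK Hf Hh Hy. rewrite vpsum_tele, cosn_0.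
  replace (_ - _) with (vpsum J (fun n => fcoef f n * cosn n y) - f y) by ring.
  apply dyadic_approx; [easy|apply Rmult_le_pos; [left; now apply fejer_cst_pos|easy]|]. intros m Hm. now apply fejer_approx.
Qed.
Lemma fejer_series_d f df al K y J : 0 < al < 1 -> 0 <= K -> (forall y, is_derive f y (df y)) -> cont df -> holdI al K df ->
  df 0 = 0 -> df PI = 0 -> 0 <= y <= PI ->
  Rabs (psum (fun j => dyblock j (fun n => fcoef f n * dcosn 1 n y)) J - df y) <= 6 * (fejer_cst al * K) * ratio al ^ J.
Proof.
  intros Ha HK Hd Hc Hh H0 HP Hy. rewrite vpsum_tele, (dcosn_0l 1) by lia.
  replace (_ - _) with (vpsum J (fun n => fcoef f n * dcosn 1 n y) - df y) by ring.
  apply dyadic_approx; [easy|apply Rmult_le_pos; [left; now apply fejer_cst_pos|easy]|]. intros m Hm. now apply fejer_approx_d.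
Qed.

Lemma sym_derive f df a sg : (forall y, is_derive f y (df y)) -> (forall y, f (a + y) = sg * f (a - y)) ->
  forall y, df (a + y) = - sg * df (a - y).
Proof.
  intros Hd H y. pose proof (Hd (a + y)) as H1.
  assert (H2 : is_derive (fun t => sg * f (2 * a - t)) (a + y) (sg * (-1 * df (2 * a - (a + y))))).
  { apply (is_derive_scal (fun t => f (2 * a - t)) (a + y) sg). apply (is_derive_comp f (fun t => 2 * a - t)); [apply Hd|].
    auto_derive; [easy|ring]. }
  assert (H3 : is_derive f (a + y) (sg * (-1 * df (2 * a - (a + y))))).
  { apply (is_derive_ext (fun t => sg * f (2 * a - t))); [|exact H2]. intros t.
    assert (forall t : R, sg * f (2 * a - t) = f t) as HG; [|apply HG]. clear t. intros t.
    replace t with (a + (t - a)) at 2 by ring. rewrite H. do 2 f_equal. ring. }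
  apply is_derive_unique in H1. apply is_derive_unique in H3. rewrite <- H1, H3.
  replace (2 * a - (a + y)) with (a - y) by ring. fold_R; ring.
Qed.

Lemma even_at_ends f : even_about_multiples_of_PI f -> forall y, f (0 + y) = 1 * f (0 - y) /\ f (PI + y) = 1 * f (PI - y).
Proof.
  intros H y. pose proof (H 0%Z y) as H0. pose proof (H 1%Z y) as H1. simpl in H0, H1.
  rewrite Rmult_0_l in H0. rewrite Rmult_1_l in H1. split; lra.
Qed.

Lemma line_cont f : extends_to line line f -> cont f.
Proof.
  intros H. destruct (extend_cont line line f) as [F [HF HE]]; [|easy|].
  - intros z _ d. exists z. split; [apply ball_center|easy].
  - apply (cont_ext F); [intros; now apply HE|]. intros x P HP. pose proof (HF x I P HP) as Hx. unfold filtermap, within in *.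
    revert Hx. apply filter_imp. intros y Hy. now apply Hy.
Qed.

(** The even extension supplies smoothness across the ends and the vanishing of odd derivatives; the
    constants come from the norm of [g] on [(0, PI)], where the derivatives of [g] and of the
    extension agree. *)
Lemma data_1d (s : nat) al (g : R -> R) : 0 < al < 1 -> (1 <= s <= 3)%nat -> Cka1 (Ioo 0 PI) (Ioo 0 PI) s al g -> even_extension_Cka1 s al g ->
  let E := Cka1_norm (Ioo 0 PI) s al g in
  exists G0, cont G0 /\ (forall y, Ioo 0 PI y -> G0 y = g y) /\ (forall y, 0 <= y <= PI -> Rabs (G0 y) <= E) /\
    (forall j y, Rabs (dyblock j (fun n => fcoef G0 n * cosn n y)) <= jackson_cst al * E * ratio al ^ j / (2 ^ j) ^ s) /\
    exists E', 0 <= E' /\ forall y J, 0 <= y <= PI -> Rabs (psum (fun j => dyblock j (fun n => fcoef G0 n * cosn n y)) J - (G0 y - fcoef G0 0)) <= E' * ratio al ^ J.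
Proof.
  intros Ha Hs Hg [G0 [Heq [Hev [[Gc good] _]]]] E. pose proof PI_RGT_0 as HPI. pose proof (fejer_cst_pos al Ha) as HCB.
  assert (HE : 0 <= E) by apply Cka1_norm_pos.
  assert (HD : forall i y, (i < s)%nat -> is_derive (Derive_n G0 i) y (Derive_n G0 (S i) y)).
  { intros i y Hi. apply Derive_correct. apply (proj1 (good (S i) ltac:(lia)) y I). }
  assert (HC : forall i, (i <= s)%nat -> cont (Derive_n G0 i)) by (intros i Hi; apply line_cont, (good i Hi)).
  assert (Hng : forall i y, Ioo 0 PI y -> Derive_n g i y = Derive_n G0 i y).
  { intros i y Hy. apply Derive_n_ext_loc. generalize (locally_Ioo 0 PI y Hy). apply filter_imp. intros t Ht. symmetry. now apply Heq. }
  assert (Hopp : forall i, (i <= s)%nat -> (i = 1 \/ i = 3)%nat -> Derive_n G0 i 0 = 0 /\ Derive_n G0 i PI = 0).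
  { assert (HG : forall a, (forall y, G0 (a + y) = 1 * G0 (a - y)) -> forall i, (i <= s)%nat -> (i = 1 \/ i = 3)%nat -> Derive_n G0 i a = 0).
    { intros a H0 i Hi Hi3.
      assert (H1 : forall y, Derive_n G0 1 (a + y) = - 1 * Derive_n G0 1 (a - y)) by (apply (sym_derive G0 (Derive_n G0 1)); [intros; apply (HD 0%nat); lia|easy]).
      destruct Hi3 as [-> | ->].
      - specialize (H1 0). rewrite Rplus_0_r, Rminus_0_r in H1. lra.
      - assert (H2 : forall y, Derive_n G0 2 (a + y) = - - 1 * Derive_n G0 2 (a - y)) by (apply (sym_derive (Derive_n G0 1) (Derive_n G0 2)); [intros; apply (HD 1%nat); lia|easy]).
        pose proof (sym_derive (Derive_n G0 2) (Derive_n G0 3) a (- -1) ltac:(intros; apply (HD 2%nat); lia) H2 0) as H3.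
        rewrite Rplus_0_r, Rminus_0_r in H3. lra. }
    intros i Hi Hi3. split; apply HG; auto; intros y; apply (even_at_ends G0 Hev y). }
  assert (Hsup : forall i y, (i <= s)%nat -> 0 <= y <= PI -> Rabs (Derive_n G0 i y) <= E).
  { intros i y Hi. pose proof (HC i Hi). apply (closed_le (fun y => Rabs (Derive_n G0 i y)) E 0 PI HPI); [auto with cont|].
    intros z Hz. cbv beta. rewrite <- Hng by easy. apply Cka1_sup; auto. now apply Hg. }
  assert (Hhol : holdI al E (Derive_n G0 s)).
  (* The one-variable case of [closed_hol]: a function constant in [x], on an auxiliary interval of
     length [1]. *)
  { intros y z Hy Hz. pose proof (closed_hol (fun _ => Derive_n G0 s) 1 al E 0 0 y z ltac:(lra) ltac:(lra) HE) as H.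
    cbv beta in H. replace (0 - 0) with 0 in H by ring. rewrite Rabs_R0, hpow_0, Rmult_0_r, Rplus_0_l in H. apply H; try lra.
    - apply cont2_of_y. apply HC; lia.
    - intros ? ? u w ? ? Hu Hw. apply Rle_trans with (E * hpow al (Rabs (u - w))).
      + destruct (Req_dec u w) as [->|Hn]; [rewrite Rminus_diag_eq, Rabs_R0 by easy; apply Rmult_le_pos; [easy|apply hpow_pos]|].
        rewrite <- !Hng by easy. rewrite hpow_Rpower by (apply Rabs_pos_lt; lra).
        apply Cka1_hol; auto; try easy. apply Hg.
      + apply le_plus_r. apply Rmult_le_pos; [easy|apply hpow_pos]. }
  assert (C0 : cont G0) by (apply (HC 0%nat); lia).
  exists G0. split; [easy|]. split; [easy|]. split; [apply (fun y => Hsup 0%nat y ltac:(lia))|]. split.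
  - intros j y. apply (jackson s (Derive_n G0) al E j Ha HE); auto; try lia.
  - exists (6 * (fejer_cst al * (E * (1 + PI)))).
    assert (0 <= E * (1 + PI)) by (apply Rmult_le_pos; lra).
    split; [apply Rmult_le_pos; [lra|apply Rmult_le_pos; lra]|]. intros y J Hy.
    apply fejer_series; auto. apply lip_holdI; auto. intros u w Hu Hw.
    apply (mvt_le G0 (Derive_n G0 1) 0 PI w u E); auto.
    + intros; apply (HD 0%nat); lia.
    + intros. apply Hsup; auto; lia.
Qed.

Lemma norm2_h (x x' y : R) : norm (minus ((x, y) : prod_NormedModule _ R_NormedModule R_NormedModule) (x', y)) = Rabs (x - x').
Proof.
  change (sqrt (Rabs (x - x') ^ 2 + Rabs (y - y) ^ 2) = Rabs (x - x')).
  rewrite (Rminus_diag_eq y y), Rabs_R0 by easy. rewrite <- (sqrt_pow2 (Rabs (x - x'))) at 2 by apply Rabs_pos. f_equal. ring.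
Qed.
Lemma norm2_v (x y y' : R) : norm (minus ((x, y) : prod_NormedModule _ R_NormedModule R_NormedModule) (x, y')) = Rabs (y - y').
Proof.
  change (sqrt (Rabs (x - x) ^ 2 + Rabs (y - y') ^ 2) = Rabs (y - y')).
  rewrite (Rminus_diag_eq x x), Rabs_R0 by easy. rewrite <- (sqrt_pow2 (Rabs (y - y'))) at 2 by apply Rabs_pos. f_equal. ring.
Qed.

Lemma holO_of_Cka2 l m al h i j : Cka2 (Omega l) (Omega_bar l) m al h -> (i + j = m)%nat ->
  holO al l (Cka2_norm (Omega l) m al h) (fun x y => dxy i j h (x, y)).
Proof.
  intros [_ [Hb Hh]] Hij. set (E := Cka2_norm _ _ _ _). assert (HE : 0 <= E) by apply Cka2_norm_pos.
  split; [|split].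
  - intros x y Hx Hy. apply Cka2_sup; [lia|apply Hb; lia|now split].
  - intros x x' y Hx Hx' Hy. destruct (Req_dec x x') as [->|Hn]; [rewrite Rminus_diag_eq, Rabs_R0 by easy; apply Rmult_le_pos; [easy|apply hpow_pos]|].
    rewrite hpow_Rpower by (apply Rabs_pos_lt; lra). rewrite <- (norm2_h x x' y).
    apply (Cka2_hol (Omega l) m al h i j (x, y) (x', y)); auto; [now split|now split|congruence].
  - intros x y y' Hx Hy Hy'. destruct (Req_dec y y') as [->|Hn]; [rewrite Rminus_diag_eq, Rabs_R0 by easy; apply Rmult_le_pos; [easy|apply hpow_pos]|].
    rewrite hpow_Rpower by (apply Rabs_pos_lt; lra). rewrite <- (norm2_v x y y').
    apply (Cka2_hol (Omega l) m al h i j (x, y) (x, y')); auto; [now split|now split|congruence].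
Qed.

Lemma holO_closed al l K F : 0 < l -> 0 < al -> 0 <= K -> cont2 F -> holO al l K F ->
  (forall x y, 0 <= x <= l -> 0 <= y <= PI -> Rabs (F x y) <= K) /\
  (forall x x' y, 0 <= x <= l -> 0 <= x' <= l -> 0 <= y <= PI -> Rabs (F x y - F x' y) <= K * hpow al (Rabs (x - x'))) /\
  (forall x, 0 <= x <= l -> holdI al K (F x)).
Proof.
  intros Hl Ha HK HF H. pose proof PI_RGT_0 as HPI.
  pose proof (fun x x' y y' => closed_hol F l al K x x' y y' Hl Ha HK HF (fun x x' y y' Hx Hx' Hy Hy' => holO_pair al l K F (x, y) (x', y') Ha HK H (conj Hx Hy) (conj Hx' Hy'))) as HC.
  split; [|split].
  - intros x y Hx Hy.
    assert (HS : forall a c : R, cont (fun t => a + t * (c - a))) by (intros; auto using cont_id with cont).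
    assert (Hz : Rabs (F (x + 0 * (l / 2 - x)) (y + 0 * (PI / 2 - y))) <= K).
    { apply (closed_le (fun t => Rabs (F (x + t * (l / 2 - x)) (y + t * (PI / 2 - y)))) K 0 1); [lra| | |lra].
      - apply cont_abs. now apply (cont2_comp F (fun t => _ + t * (_ - _)) (fun t => _ + t * (_ - _))).
      - intros t Ht. apply H; now apply scale_in. }
    rewrite !Rmult_0_l, !Rplus_0_r in Hz. exact Hz.
  - intros x x' y Hx Hx' Hy. specialize (HC x x' y y Hx Hx' Hy Hy). replace (y - y) with 0 in HC by ring.
    rewrite Rabs_R0, hpow_0, Rmult_0_r, Rplus_0_r in HC. easy.
  - intros x Hx y y' Hy Hy'. specialize (HC x x y y' Hx Hx Hy Hy'). replace (x - x) with 0 in HC by ring.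
    rewrite Rabs_R0, hpow_0, Rmult_0_r, Rplus_0_l in HC. easy.
Qed.

Lemma holO_of_derive al l K f fx fy : 0 < l -> 0 < al < 1 -> 0 <= K ->
  (forall x y, 0 < x < l -> 0 < y < PI -> is_derive (fun t => f t y) x (fx x y) /\ is_derive (fun t => f x t) y (fy x y)) ->
  (forall x y, 0 < x < l -> 0 < y < PI -> Rabs (f x y) <= K /\ Rabs (fx x y) <= K /\ Rabs (fy x y) <= K) ->
  holO al l (K * (1 + l + PI)) f.
Proof.
  intros Hl Ha HK Hd Hb. pose proof PI_RGT_0 as HPI.
  assert (HL : forall L d, 0 <= L -> L <= l + PI -> 0 <= d <= L -> K * d <= K * (1 + l + PI) * hpow al d).
  { intros L d HL HLl Hd'. rewrite Rmult_assoc. apply Rmult_le_compat_l; [easy|].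
    eapply Rle_trans; [apply (hpow_lin al d L Ha Hd')|]. apply Rmult_le_compat_r; [apply hpow_pos|lra]. }
  assert (HM : forall u v M, 0 < u < M -> 0 < v < M -> Rabs (u - v) <= M) by (intros; apply Rabs_le; lra).
  split; [|split].
  - intros x y Hx Hy. apply Rle_trans with K; [now apply Hb|]. nra.
  - intros x x' y Hx Hx' Hy. apply Rle_trans with (K * Rabs (x - x')).
    + apply (mvt_le (fun t => f t y) (fun t => fx t y) (Rmin x x') (Rmax x x')); unfold Rmin, Rmax; destruct Rle_dec; try lra;
        intros t Ht; first [apply Hd; lra|apply Hb; lra].
    + apply (HL l); try lra. split; [apply Rabs_pos|now apply HM].
  - intros x y y' Hx Hy Hy'. apply Rle_trans with (K * Rabs (y - y')).
    + apply (mvt_le (fun t => f x t) (fun t => fy x t) (Rmin y y') (Rmax y y')); unfold Rmin, Rmax; destruct Rle_dec; try lra;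
        intros t Ht; first [apply Hd; lra|apply Hb; lra].
    + apply (HL PI); try lra. split; [apply Rabs_pos|now apply HM].
Qed.

(** The extension is even about [0] and about [PI], so its [y]-derivative is odd about both points
    and vanishes there. *)
Lemma dy_vanish l H : extends_to (strip l) (strip_bar l) (dy H) -> (forall x y, 0 < x < l -> ex_derive (fun t => H (x, t)) y) ->
  (forall x, Icc 0 l x -> even_about_multiples_of_PI (fun y => H (x, y))) ->
  forall x, 0 < x < l -> cont (fun y => dy H (x, y)) /\ dy H (x, 0) = 0 /\ dy H (x, PI) = 0.
Proof.
  intros HE Hd Hev x Hx. split.
  - destruct (extend_cont (strip l) (strip l) (dy H)) as [F [HF EF]].
    + intros z Hz d. exists z. split; [apply ball_center|easy].
    + intros z Hz. apply HE. unfold strip, strip_bar, Ioo, Icc in *. lra.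
    + apply (cont_ext (fun y => F (x, y))); [intros y; now apply EF|]. apply cont_pt. intros y eps He.
      pose proof (proj1 (filterlim_locally F _) (HF (x, y) Hx) (mkposreal eps He)) as [d Hdd].
      exists d. split; [apply cond_pos|]. intros t [_ Ht]. apply (Hdd (x, t)); [|exact Hx].
      split; apply ball_R; simpl; [rewrite Rminus_diag_eq, Rabs_R0 by easy; apply cond_pos|exact Ht].
  - assert (HH : forall a, (forall y, H (x, a + y) = 1 * H (x, a - y)) -> dy H (x, a) = 0).
    { intros a Ha. pose proof (sym_derive (fun y => H (x, y)) (fun y => dy H (x, y)) a 1 ltac:(intros y; apply Derive_correct, Hd, Hx) Ha 0) as H1.
      cbv beta in H1. rewrite Rplus_0_r, Rminus_0_r in H1. apply (fun G : forall v : R, v = - (1) * v -> v = 0 => G _ H1). intros; lra. }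
    assert (Icc 0 l x) as Hi by (unfold Icc; lra).
    split; apply HH; intros y; apply (even_at_ends (fun y => H (x, y)) (Hev x Hi) y).
Qed.

Lemma cont_dyblock_fcoef j hq y : cont2 hq -> cont (fun x => dyblock j (fun n => fcoef (hq x) n * cosn n y)).
Proof.
  intros Hh. unfold dyblock. apply (psum_cont (fun n x => dyad j n * (fcoef (hq x) n * cosn n y))). intros n. pose proof (fcoef_cont hq n Hh). auto with cont.
Qed.

Definition clamp2 (l : R) (h : R * R -> R) : R -> R -> R := fun x y => h (clamp 0 l x, clamp 0 PI y).

Lemma clamp2_id l h x y : 0 <= x <= l -> 0 <= y <= PI -> clamp2 l h x y = h (x, y).
Proof. intros Hx Hy. unfold clamp2. now rewrite !clamp_id. Qed.

Lemma data_2d_0 l al h : 0 < l -> 0 < al < 1 -> Cka2 (Omega l) (Omega_bar l) 0 al h ->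
  let E := Cka2_norm (Omega l) 0 al h in let hq := clamp2 l h in
  holO al l E hq /\
  (forall j x y, 0 <= x <= l -> Rabs (dyblock j (fun n => fcoef (hq x) n * cosn n y)) <= jackson_cst al * E * ratio al ^ j / (2 ^ j) ^ 0).
Proof.
  intros Hl Ha Hh E hq. assert (HE : 0 <= E) by apply Cka2_norm_pos. pose proof PI_RGT_0 as HPI.
  assert (Hc : cont2 hq) by (apply cont2_clamp; [easy|apply Hh]).
  assert (HO : holO al l E hq).
  { apply (holO_ext al l E (fun x y => dxy 0 0 h (x, y))); [|now apply holO_of_Cka2]. intros x y Hx Hy. symmetry. apply clamp2_id; lra. }
  split; [easy|]. intros j x y Hx. apply (jackson 0 (fun _ => hq x) al E j Ha HE); try lia.
  - now apply cont2_y.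
  - now apply (holO_closed al l E hq Hl (proj1 Ha) HE Hc HO).
Qed.

Lemma data_2d_1 l al h : 0 < l -> 0 < al < 1 -> Cka2 (Omega l) (Omega_bar l) 1 al h -> even_extension_Cka2 l 1 al h ->
  let E := Cka2_norm (Omega l) 1 al h in let hq := clamp2 l h in
  holO al l (E * (1 + l + PI)) hq /\
  (forall j x y, 0 <= x <= l -> Rabs (dyblock j (fun n => fcoef (hq x) n * cosn n y)) <= jackson_cst al * E * ratio al ^ j / (2 ^ j) ^ 1) /\
  exists Hx Hy, cont2 Hx /\ cont2 Hy /\ holO al l E Hx /\ holO al l E Hy /\
    (forall x y, 0 < x < l -> 0 < y < PI -> is_derive (fun t => hq t y) x (Hx x y) /\ is_derive (fun t => hq x t) y (Hy x y)) /\
    (forall x y J, 0 < x < l -> 0 < y < PI -> Rabs (psum (fun j => dyblock j (fun n => fcoef (hq x) n * dcosn 1 n y)) J - Hy x y) <= 6 * (fejer_cst al * E) * ratio al ^ J).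
Proof.
  intros Hl Ha Hh [H [Heq [Hev [[_ [_ [HD [_ [HY _]]]]] _]]]] E hq. assert (HE : 0 <= E) by apply Cka2_norm_pos. pose proof PI_RGT_0 as HPI.
  pose proof Hh as [[Hhc [_ [Hhd [[Hhx _] [Hhy _]]]]] [Hhb _]].
  assert (Hc : cont2 hq) by (apply cont2_clamp; [easy|apply Hh]).
  destruct (extend_cont2 l _ Hl Hhx) as [Hx [Cx Ex]]. destruct (extend_cont2 l _ Hl Hhy) as [Hy [Cy Ey]].
  assert (HOx : holO al l E Hx).
  { apply (holO_ext al l E (fun x y => dxy 1 0 h (x, y))); [|now apply holO_of_Cka2]. intros x y Hx' Hy'. symmetry. now apply Ex. }
  assert (HOy : holO al l E Hy).
  { apply (holO_ext al l E (fun x y => dxy 0 1 h (x, y))); [|now apply holO_of_Cka2]. intros x y Hx' Hy'. symmetry. now apply Ey. }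
  assert (Hder : forall x y, 0 < x < l -> 0 < y < PI -> is_derive (fun t => hq t y) x (Hx x y) /\ is_derive (fun t => hq x t) y (Hy x y)).
  { intros x y Px Py. assert (Omega l (x, y)) as HO by now split. rewrite Ex, Ey by easy. split.
    - apply (is_derive_ext_loc (fun t => h (t, y))).
      + generalize (locally_Ioo 0 l x Px). apply filter_imp. intros t Ht. symmetry. apply clamp2_id; lra.
      + apply Derive_correct. apply (Hhd (x, y) HO).
    - apply (is_derive_ext_loc (fun t => h (x, t))).
      + generalize (locally_Ioo 0 PI y Py). apply filter_imp. intros t Ht. symmetry. apply clamp2_id; lra.
      + apply Derive_correct. apply (Hhd (x, y) HO). }
  pose proof (holO_closed al l E Hy Hl (proj1 Ha) HE Cy HOy) as [_ [_ HhI]].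
  assert (Hvan : forall x, 0 < x < l -> Hy x 0 = 0 /\ Hy x PI = 0).
  { intros x Px. destruct (dy_vanish l H HY ltac:(intros u w Hu; apply (HD (u, w) Hu)) Hev x Px) as [HC [V0 V1]].
    assert (HZ : forall y, 0 <= y <= PI -> Hy x y - dy H (x, y) = 0).
    { apply (cont_zero_closed (fun y => Hy x y - dy H (x, y)) PI HPI).
      - apply cont_minus; [now apply cont2_y|easy].
      - intros y Py. rewrite Ey by now split. apply Rminus_diag_eq. apply Derive_ext_loc. simpl.
        generalize (locally_Ioo 0 PI y Py). apply filter_imp. intros t Ht. symmetry. apply Heq. split; simpl; unfold Icc; lra. }
    pose proof (HZ 0 ltac:(lra)). pose proof (HZ PI ltac:(lra)). lra. }
  (* [hq x] is clamped in [y] and may fail to be differentiable at the ends. The primitive of [Hy x]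
     is differentiable everywhere and has the same cosine coefficients, since the two agree on
     [[0, PI]]. *)
  set (f := fun x (i : nat) y => match i with O => hq x 0 + RInt (Hy x) 0 y | _ => Hy x y end).
  assert (CHy : forall x, cont (Hy x)) by (intros; now apply cont2_y).
  assert (Df : forall x y, is_derive (f x 0%nat) y (Hy x y)).
  { intros x y. unfold f. replace (Hy x y) with (0 + Hy x y) by ring.
    apply (is_derive_plus (fun _ => hq x 0) (fun y => RInt (Hy x) 0 y)); [apply derive_cst|now apply derive_RInt]. }
  assert (Ecc : forall x n, 0 < x < l -> fcoef (f x 0%nat) n = fcoef (hq x) n).
  { intros x n Px. apply fcoef_ext. intros y Py. symmetry. apply (C1_eq_RInt (hq x) (hq x) (Hy x) 0 PI); auto; try lra; [now apply cont2_y|].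
    intros t Ht. now apply Hder. }
  assert (HWe : forall (g : nat -> R -> R) x y j, 0 < x < l -> dyblock j (fun n => fcoef (f x 0%nat) n * g n y) = dyblock j (fun n => fcoef (hq x) n * g n y)).
  { intros g x y j Px. unfold dyblock. apply psum_ext. intros i _. now rewrite Ecc. }
  split; [|split].
  - apply (holO_of_derive al l E hq Hx Hy); auto. intros x y Px Py. split; [|split; [now apply HOx|now apply HOy]].
    unfold hq. rewrite clamp2_id by lra. apply (Cka2_sup (Omega l) 1 al h 0 0 (x, y)); [lia|apply Hhb; lia|now split].
  (* The estimate is made for [0 < x < l], where the derivatives exist; the ends follow because a
     block is continuous in [x]. *)
  - intros j x y Px. apply (closed_le (fun x => Rabs (dyblock j (fun n => fcoef (hq x) n * cosn n y))) _ 0 l); auto.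
    + apply cont_abs. now apply cont_dyblock_fcoef.
    + clear x Px. intros x Px. cbv beta. rewrite <- HWe by easy. apply (jackson 1 (f x) al E j Ha HE); try lia.
      * intros i z Hi. destruct i; [apply Df|lia].
      * apply CHy.
      * intros i Hi [->| ->]; [now apply Hvan|lia].
      * apply HhI; lra.
  - exists Hx, Hy. do 5 (split; [easy|]). intros x y J Px Py.
    rewrite (psum_ext _ (fun j => dyblock j (fun n => fcoef (f x 0%nat) n * dcosn 1 n y))) by (intros; symmetry; now apply HWe).
    apply fejer_series_d; auto; try apply Hvan; auto; try lra. apply HhI; lra.
Qed.

Lemma cont2_swap f : cont2 f -> cont2 (fun y x => f x y).
Proof.
  intros H. apply cont2_intro. intros y x eps He. destruct (cont2_eps f x y eps H He) as [d [Hd Hb]].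
  exists d. split; [easy|]. intros; now apply Hb.
Qed.
Lemma cont2_of_hol F K al : 0 < al -> (forall x x' y, Rabs (F x y - F x' y) <= K * hpow al (Rabs (x - x'))) ->
  (forall x y y', Rabs (F x y - F x y') <= K * hpow al (Rabs (y - y'))) -> cont2 F.
Proof.
  intros Ha H1 H2. apply cont2_intro. intros x y eps He. pose proof (Rabs_pos K) as HK.
  destruct (hpow_small al (eps / (2 * (Rabs K + 1))) Ha) as [d [Hd Hs]]; [apply Rdiv_lt_0_compat; lra|].
  exists d. split; [easy|]. intros u v Hu Hv. apply Hs in Hu, Hv.
  assert (HG : forall t, hpow al t < eps / (2 * (Rabs K + 1)) -> K * hpow al t < eps / 2).
  { intros t Ht. pose proof (hpow_pos al t) as Hp. apply Rle_lt_trans with ((Rabs K + 1) * hpow al t).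
    - apply Rmult_le_compat_r; [easy|]. pose proof (Rle_abs K). lra.
    - replace (eps / 2) with ((Rabs K + 1) * (eps / (2 * (Rabs K + 1)))) by (field; lra). apply Rmult_lt_compat_l; lra. }
  apply HG in Hu, Hv. replace (F u v - F x y) with ((F u v - F x v) + (F x v - F x y)) by ring.
  eapply Rle_lt_trans; [apply Rabs_triang|]. pose proof (H1 u x v). pose proof (H2 x v y). lra.
Qed.
Lemma holO_minus al l K1 K2 f g : holO al l K1 f -> holO al l K2 g -> holO al l (K1 + K2) (fun x y => f x y - g x y).
Proof.
  intros Hf [B1 [B2 B3]]. apply (holO_ext al l (K1 + K2) (fun x y => f x y + - g x y)); [intros; ring|].
  apply holO_plus; [easy|]. split; [|split]; intros.
  - rewrite Rabs_Ropp; auto.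
  - replace (- g x y - - g x' y) with (- (g x y - g x' y)) by ring. rewrite Rabs_Ropp; auto.
  - replace (- g x y - - g x y') with (- (g x y - g x y')) by ring. rewrite Rabs_Ropp; auto.
Qed.
Lemma holO_int al l K M a f : 0 < l -> 0 < al < 1 -> 0 <= K -> 0 <= M -> cont a -> cont2 f -> (forall x, 0 <= x <= l -> Rabs (a x) <= K) ->
  holO al l M f -> holO al l ((1 + l) * K * M) (fun x y => RInt (fun t => a t * f t y) 0 x).
Proof.
  intros Hl Ha HK HM Hca Hcf Hab Hf. destruct (holO_closed al l M f Hl (proj1 Ha) HM Hcf Hf) as [F1 [F2 F3]].
  assert (HKM : 0 <= K * M) by now apply Rmult_le_pos.
  assert (Cf : forall y, cont (fun t => a t * f t y)) by (intros y; pose proof (cont2_x f y Hcf); auto with cont).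
  assert (Hp : forall t y, 0 <= t <= l -> 0 < y < PI -> Rabs (a t * f t y) <= K * M).
  { intros t y Ht Hy. rewrite Rabs_mult. apply Rmult_le_compat; try apply Rabs_pos; auto. apply F1; lra. }
  split; [|split].
  - intros x y Hx Hy. apply Rle_trans with ((x - 0) * (K * M)); [apply RInt_abs_cst; [lra|easy|intros; apply Hp; lra]|].
    rewrite Rmult_assoc. apply Rmult_le_compat_r; lra.
  - assert (HS : forall x x' y, 0 < x < l -> 0 < x' < l -> 0 < y < PI -> x' <= x ->
       Rabs (RInt (fun t => a t * f t y) 0 x - RInt (fun t => a t * f t y) 0 x') <= (1 + l) * K * M * hpow al (Rabs (x - x'))).
    { intros x x' y Hx Hx' Hy Hxx. rewrite <- (RInt_chasles _ 0 x' x) by easy.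
      replace (_ + _ - _) with (RInt (fun t => a t * f t y) x' x) by (fold_R; ring).
      apply Rle_trans with ((x - x') * (K * M)); [apply RInt_abs_cst; [lra|easy|intros; apply Hp; lra]|].
      rewrite Rabs_pos_eq by lra. replace ((1 + l) * K * M * hpow al (x - x')) with ((1 + l) * hpow al (x - x') * (K * M)) by ring.
      apply Rmult_le_compat_r; [easy|]. apply hpow_lin; lra. }
    intros x x' y Hx Hx' Hy. destruct (Rle_dec x' x); [now apply HS|].
    rewrite Rabs_minus_sym, (Rabs_minus_sym x). apply HS; auto; lra.
  - intros x y y' Hx Hy Hy'. rewrite <- RInt_cminus by easy.
    assert (0 <= K * (M * hpow al (Rabs (y - y')))) by (apply Rmult_le_pos; [easy|apply Rmult_le_pos; [easy|apply hpow_pos]]).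
    apply Rle_trans with ((x - 0) * (K * (M * hpow al (Rabs (y - y'))))).
    + apply RInt_abs_cst; [lra|apply cont_minus; easy|]. intros t Ht. replace (_ - _) with (a t * (f t y - f t y')) by ring.
      rewrite Rabs_mult. apply Rmult_le_compat; try apply Rabs_pos; [apply Hab; lra|]. apply F3; lra.
    + replace ((1 + l) * K * M * hpow al (Rabs (y - y'))) with ((1 + l) * (K * (M * hpow al (Rabs (y - y'))))) by ring.
      apply Rmult_le_compat_r; lra.
Qed.
Lemma holO_of_x al l K f : (forall x, 0 < x < l -> Rabs (f x) <= K) ->
  (forall x x', 0 < x < l -> 0 < x' < l -> Rabs (f x - f x') <= K * hpow al (Rabs (x - x'))) -> holO al l K (fun x _ => f x).
Proof.
  intros H1 H2. split; [|split]; auto. intros x y y' Hx _ _. rewrite Rminus_diag_eq, Rabs_R0 by easy.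
  apply Rmult_le_pos; [eapply Rle_trans; [apply Rabs_pos|apply (H1 x Hx)]|apply hpow_pos].
Qed.
Lemma holO_of_derive1 al l K f df : 0 < l -> 0 < al < 1 -> 0 <= K -> (forall x, 0 < x < l -> is_derive f x (df x)) ->
  (forall x, 0 < x < l -> Rabs (f x) <= K /\ Rabs (df x) <= K) -> holO al l (K * (1 + l + PI)) (fun x _ => f x).
Proof.
  intros Hl Ha HK Hd Hb. apply (holO_of_derive al l K (fun x _ => f x) (fun x _ => df x) (fun _ _ => 0)); auto.
  - intros x y Hx Hy. split; [now apply Hd|apply derive_cst].
  - intros x y Hx Hy. rewrite Rabs_R0. split; [|split]; auto; now apply Hb.
Qed.
Lemma fcoef0_bound f M : cont f -> (forall y, 0 <= y <= PI -> Rabs (f y) <= M) -> Rabs (fcoef f 0) <= M.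
Proof.
  intros Hf Hb. pose proof PI_RGT_0. unfold fcoef.
  rewrite (RInt_eq (fun s => f s * cosn 0 s) f) by (intros; rewrite cosn_0; ring).
  pose proof (RInt_abs_cst f 0 PI M ltac:(lra) Hf Hb) as HH. rewrite Rabs_mult, Rabs_pos_eq by (apply Rdiv_le_0_compat; lra).
  apply (Rmult_le_reg_l PI); [easy|]. rewrite <- Rmult_assoc. replace (PI * (1 / PI)) with 1 by (field; lra). rewrite Rmult_1_l. lra.
Qed.
Lemma fcoef0_holO al l K f : 0 < l -> 0 < al -> 0 <= K -> cont2 f -> holO al l K f -> holO al l K (fun x _ => fcoef (f x) 0).
Proof.
  intros Hl Ha HK Hc Hf. destruct (holO_closed al l K f Hl Ha HK Hc Hf) as [F1 [F2 F3]]. apply holO_of_x.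
  - intros x Hx. apply fcoef0_bound; [now apply cont2_y|]. intros; apply F1; lra.
  - intros x x' Hx Hx'. replace (fcoef (f x) 0 - fcoef (f x') 0) with (fcoef (fun y => f x y + -1 * f x' y) 0).
    + pose proof (cont2_y f x Hc). pose proof (cont2_y f x' Hc). apply fcoef0_bound; [auto with cont|].
      intros y Hy. replace (f x y + -1 * f x' y) with (f x y - f x' y) by ring. apply F2; lra.
    + pose proof (cont2_y f x Hc). pose proof (cont2_y f x' Hc). rewrite fcoef_plus, fcoef_scal by auto with cont. ring.
Qed.
Lemma cont2_continuous_on l F : cont2 F -> continuous_on (Omega_bar l) (fun z => F (fst z) (snd z)).
Proof.
  intros HF z _. apply (filterlim_locally (F := within (Omega_bar l) (locally z))). intros eps.
  destruct (cont2_eps F (fst z) (snd z) eps HF (cond_pos eps)) as [d [Hd Hb]].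
  exists (mkposreal d Hd). intros w [Hw1 Hw2] _. apply ball_R. now apply Hb.
Qed.
Lemma dplus (f g : R -> R) x a b : is_derive f x a -> is_derive g x b -> is_derive (fun t => f t + g t) x (a + b).
Proof. apply (is_derive_plus f g). Qed.
Lemma dminus (f g : R -> R) x a b : is_derive f x a -> is_derive g x b -> is_derive (fun t => f t - g t) x (a - b).
Proof. apply (is_derive_minus f g). Qed.
Lemma dmult (f g : R -> R) x a b : is_derive f x a -> is_derive g x b -> is_derive (fun t => f t * g t) x (a * g x + f x * b).
Proof. intros Hf Hg. apply (is_derive_mult f g x a b Hf Hg Rmult_comm). Qed.
Lemma dscal (k : R) (g : R -> R) x b : is_derive g x b -> is_derive (fun t => k * g t) x (k * b).
Proof. intros Hg. now apply (is_derive_scal g x k). Qed.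

(** * Regularity of the solution *)

Section Solve.
Variables (l kap al : R) (k : nat) (co dco : nat -> R -> R) (KC KB V0 E : R) (hq Hx Hy : R -> R -> R)
  (an bn : nat -> R) (v dv : nat -> R -> R) (vz dvz : R -> R).
Local Notation r := (co 0%nat).
Local Notation aa := (co 1%nat).
Local Notation bb := (co 2%nat).
Local Notation b := (co 3%nat).
Local Notation c := (co 4%nat).
Local Notation r1 := (co 5%nat).
Local Notation r2 := (co 6%nat).
Local Notation bz := (co 7%nat).
Local Notation cz := (co 8%nat).
Local Notation r1z := (co 9%nat).
Local Notation r2z := (co 10%nat).
Hypotheses (l_pos : 0 < l) (al_in : 0 < al < 1) (k23 : k = 2%nat \/ k = 3%nat).
Hypotheses (KC_ge1 : 1 <= KC) (KB_ge1 : 1 <= KB) (V0_pos : 0 <= V0) (E_pos : 0 <= E).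
Hypothesis co_cont : forall i, cont (co i).
Hypothesis co_der : forall i x, 0 < x < l -> is_derive (co i) x (dco i x).
Hypothesis co_hol : forall i, (i < 11)%nat -> holO al l KC (fun x _ => co i x) /\ holO al l KC (fun x _ => dco i x).
Hypothesis HKB : block_bound_by l kap r b c r1 r2 aa bb KB.
Let fn (n : nat) (x : R) : R := fcoef (hq x) n.
Hypothesis hq_cont : cont2 hq.
Hypothesis hq_hol : holO al l E hq.
Hypothesis fn_bd : forall j x y, 0 <= x <= l -> Rabs (dyblock j (fun n => fn n x * cosn n y)) <= block_size al E k 2 j.
Hypothesis an_bd : forall j y, Rabs (dyblock j (fun n => an n * cosn n y)) <= block_size al E k 1 j.
Hypothesis bn_bd : forall j y, Rabs (dyblock j (fun n => bn n * cosn n y)) <= block_size al E k 0 j.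
Hypothesis h_lim : forall x y J, 0 < x < l -> 0 < y < PI ->
  Rabs (psum (fun j => dyblock j (fun n => fn n x * cosn n y)) J - (hq x y - fn 0%nat x)) <= 6 * (fejer_cst al * E) * ratio al ^ J.
Hypothesis h3 : k = 3%nat -> holO al l E Hx /\ holO al l E Hy /\
  (forall x y, 0 < x < l -> 0 < y < PI -> is_derive (fun t => hq t y) x (Hx x y) /\ is_derive (fun t => hq x t) y (Hy x y)) /\
  (forall x y J, 0 < x < l -> 0 < y < PI -> Rabs (psum (fun j => dyblock j (fun n => fn n x * dcosn 1 n y)) J - Hy x y) <= 6 * (fejer_cst al * E) * ratio al ^ J).
Hypothesis v_sol : forall n, (1 <= n)%nat -> mode_sol_of l kap r b c r1 r2 aa bb (INR n ^ 2) (fn n) (an n) (bn n) (v n) (dv n).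
Hypothesis v_zero : forall x, v 0%nat x = 0.
Hypothesis dv_zero : forall x, dv 0%nat x = 0.
Hypothesis vz_sol : mode_sol_of l kap r bz cz r1z r2z aa bb (INR 0 ^ 2) (fn 0%nat) (an 0%nat) (bn 0%nat) vz dvz.
Hypothesis vz_bd : forall x, 0 <= x <= l -> Rabs (vz x) <= V0 * E /\ Rabs (dvz x) <= V0 * E.

Local Notation P := (useries l v dv).

Lemma co_le i x : (i < 11)%nat -> 0 <= x <= l -> Rabs (co i x) <= KC.
Proof.
  intros Hi Hx0. pose proof PI_RGT_0.
  apply (holO_closed al l KC (fun x _ => co i x) l_pos (proj1 al_in) ltac:(lra) (cont2_of_x _ (co_cont i)) (proj1 (co_hol i Hi)) ) with (y := 0); lra.
Qed.
Lemma Q_bd x : 0 <= x <= l -> Rabs (r x) <= KC /\ Rabs (b x) <= KC /\ Rabs (c x) <= KC /\ Rabs (r1 x) <= KC /\ Rabs (r2 x) <= KC /\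
  Rabs (aa x) <= KC /\ Rabs (bb x) <= KC.
Proof. intros Hx0. do 6 (split; [apply co_le; [lia|easy]|]). apply co_le; [lia|easy]. Qed.
Lemma fn_cont n : cont (fn n).
Proof. now apply fcoef_cont. Qed.

(** The sum of the forcing blocks, which lack mode [0]; after a [y]-derivative the subtracted mean
    disappears. *)
Definition fsum (q : nat) (x y : R) : R := match q with O => hq x y - fn 0%nat x | _ => Hy x y end.
Lemma fsum_lim q J x y : (q + 2 <= k)%nat -> 0 < x < l -> 0 < y < PI ->
  Rabs (psum (fun j => fblock fn q j x y) J - fsum q x y) <= 6 * (fejer_cst al * E) * ratio al ^ J.
Proof.
  intros Hq Hx0 Hy0.
  assert (HW : forall j, fblock fn q j x y = dyblock j (fun n => fn n x * dcosn q n y)).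
  { intros j. unfold fblock, dyblock. rewrite psum_S, dyad_hi by lia. rewrite Rmult_0_l, Rmult_0_l, Rplus_0_r. apply psum_ext. intros; ring. }
  rewrite (psum_ext _ (fun j => dyblock j (fun n => fn n x * dcosn q n y))) by (intros; apply HW).
  destruct q as [|q].
  - rewrite (psum_ext _ (fun j => dyblock j (fun n => fn n x * cosn n y))); [now apply h_lim|].
    intros i _. unfold dyblock. apply psum_ext. intros; now rewrite dcosn_0.
  - destruct h3 as [_ [_ [_ HL]]]; [lia|]. assert (q = 0)%nat as -> by lia. now apply HL.
Qed.

Lemma aa_c : cont aa. Proof. apply co_cont. Qed.
Lemma bb_c : cont bb. Proof. apply co_cont. Qed.

Definition P_bd := useries_bound l kap r b c r1 r2 aa bb KC l_pos aa_c bb_c KC_ge1 al E KB k fn an bn v dv al_in E_pos KB_ge1 HKB fn_cont fn_bd an_bd bn_bd v_sol.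
Definition P_hy := useries_hol_y l kap r b c r1 r2 aa bb KC l_pos aa_c bb_c KC_ge1 al E KB k fn an bn v dv al_in E_pos KB_ge1 HKB fn_cont fn_bd an_bd bn_bd v_sol.
Definition P_hx := useries_hol_x l kap r b c r1 r2 aa bb KC l_pos aa_c bb_c KC_ge1 Q_bd al E KB k fn an bn v dv al_in E_pos KB_ge1 HKB fn_cont fn_bd an_bd bn_bd v_sol v_zero dv_zero.
Definition P_dy := useries_dy l kap r b c r1 r2 aa bb KC l_pos aa_c bb_c KC_ge1 al E KB k fn an bn v dv al_in E_pos KB_ge1 HKB fn_cont fn_bd an_bd bn_bd v_sol.
Definition P_dx0 := useries_dx0 l kap r b c r1 r2 aa bb KC l_pos aa_c bb_c KC_ge1 al E KB k fn an bn v dv al_in E_pos KB_ge1 HKB fn_cont fn_bd an_bd bn_bd v_sol v_zero dv_zero.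
Lemma E'_pos : 0 <= 6 * (fejer_cst al * E).
Proof. pose proof (fejer_cst_pos al al_in). assert (0 <= fejer_cst al * E) by (apply Rmult_le_pos; lra). lra. Qed.
Definition P_dx1 := useries_dx1 l kap r b c r1 r2 aa bb KC l_pos aa_c bb_c KC_ge1 Q_bd al E KB k fn an bn v dv al_in E_pos KB_ge1 HKB fn_cont fn_bd an_bd bn_bd v_sol v_zero dv_zero
  fsum (6 * (fejer_cst al * E)) E'_pos fsum_lim.
Definition P_bc0 := useries_bc0 l kap r b c r1 r2 aa bb KC l_pos aa_c bb_c KC_ge1 al E KB k fn an bn v dv al_in E_pos KB_ge1 HKB fn_cont fn_bd an_bd bn_bd v_sol.
Definition P_bcl := useries_bcl l kap r b c r1 r2 aa bb KC l_pos aa_c bb_c KC_ge1 al E KB k fn an bn v dv al_in E_pos KB_ge1 HKB fn_cont fn_bd an_bd bn_bd v_sol.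
Definition P_mean := useries_mean l kap r b c r1 r2 aa bb KC l_pos aa_c bb_c KC_ge1 al E KB k fn an bn v dv al_in E_pos KB_ge1 HKB fn_cont fn_bd an_bd bn_bd v_sol.
Definition P_int_mean := useries_int_mean l kap r b c r1 r2 aa bb KC l_pos aa_c bb_c KC_ge1 al E KB k fn an bn v dv al_in E_pos KB_ge1 HKB fn_cont fn_bd an_bd bn_bd v_sol v_zero dv_zero.

Local Notation KO := (ublock_cst l KC KB).
Lemma KO_pos : 0 <= KO.
Proof. eapply ublock_cst_pos; eauto; lra. Qed.
Definition zcst : R := V0 + 2 * KC * V0 + 2 * KC ^ 2 * l * V0 + KC.
(** Covers, in this order, the suprema and the Hölder constants of the series, the zero mode, and
    the data. Later bounds are explicit multiples of [base_cst * E], tracked by [holM]. *)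
Definition base_cst : R := KO / (1 - ratio al) + hol_cst al * KO + zcst * (1 + l + PI) + 1.
Lemma zcst_pos : 0 <= zcst /\ V0 <= zcst.
Proof.
  assert (0 <= KC * V0) by (apply Rmult_le_pos; lra). assert (0 <= KC * V0 * (KC * l)) by (apply Rmult_le_pos; [easy|apply Rmult_le_pos; lra]).
  unfold zcst. replace (2 * KC ^ 2 * l * V0) with (2 * (KC * V0 * (KC * l))) by ring. lra.
Qed.
Lemma base_cst_ge : KO / (1 - ratio al) <= base_cst /\ hol_cst al * KO <= base_cst /\ zcst * (1 + l + PI) <= base_cst /\ 1 <= base_cst.
Proof.
  pose proof (ratio_bounds al al_in). pose proof KO_pos. pose proof (hol_cst_pos al al_in). pose proof PI_RGT_0. pose proof zcst_pos.
  assert (0 <= KO / (1 - ratio al)) by (apply Rdiv_le_0_compat; lra).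
  assert (0 <= hol_cst al * KO) by (apply Rmult_le_pos; lra). assert (0 <= zcst * (1 + l + PI)) by (apply Rmult_le_pos; lra).
  unfold base_cst. lra.
Qed.
Definition holM (m : R) (f : R -> R -> R) : Prop := 0 <= m /\ holO al l (m * (base_cst * E)) f.
Lemma base_cst_E_pos : 0 <= base_cst * E.
Proof. apply Rmult_le_pos; [|easy]. pose proof base_cst_ge. lra. Qed.
Lemma holM_le m m' f : m <= m' -> holM m f -> holM m' f.
Proof. intros H [Hm Hf]. split; [lra|]. apply (holO_le al l (m * (base_cst * E))); [|easy]. apply Rmult_le_compat_r; [apply base_cst_E_pos|easy]. Qed.
Lemma holM_plus m1 m2 f g : holM m1 f -> holM m2 g -> holM (m1 + m2) (fun x y => f x y + g x y).
Proof. intros [P1 H1] [P2 H2]. split; [lra|]. rewrite Rmult_plus_distr_r. now apply holO_plus. Qed.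
Lemma holM_minus m1 m2 f g : holM m1 f -> holM m2 g -> holM (m1 + m2) (fun x y => f x y - g x y).
Proof. intros [P1 H1] [P2 H2]. split; [lra|]. rewrite Rmult_plus_distr_r. now apply holO_minus. Qed.
Lemma holM_co i m f : (i < 11)%nat -> holM m f -> holM (2 * KC * m) (fun x y => co i x * f x y).
Proof.
  intros Hi [Hm Hf]. assert (0 <= KC * m) by (apply Rmult_le_pos; lra). split; [lra|].
  replace (2 * KC * m * (base_cst * E)) with (2 * KC * (m * (base_cst * E))) by ring. apply (holO_mult al l KC _ (fun x _ => co i x)); [lra| |now apply co_hol|easy].
  apply Rmult_le_pos; [easy|apply base_cst_E_pos].
Qed.
Lemma holM_dco i m f : (i < 11)%nat -> holM m f -> holM (2 * KC * m) (fun x y => dco i x * f x y).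
Proof.
  intros Hi [Hm Hf]. assert (0 <= KC * m) by (apply Rmult_le_pos; lra). split; [lra|].
  replace (2 * KC * m * (base_cst * E)) with (2 * KC * (m * (base_cst * E))) by ring. apply (holO_mult al l KC _ (fun x _ => dco i x)); [lra| |now apply co_hol|easy].
  apply Rmult_le_pos; [easy|apply base_cst_E_pos].
Qed.
Lemma holM_int i m f : (i < 11)%nat -> cont2 f -> holM m f -> holM ((1 + l) * KC * m) (fun x y => RInt (fun t => co i t * f t y) 0 x).
Proof.
  intros Hi Hc [Hm Hf]. split; [apply Rmult_le_pos; [apply Rmult_le_pos; lra|easy]|].
  replace ((1 + l) * KC * m * (base_cst * E)) with ((1 + l) * KC * (m * (base_cst * E))) by ring.
  apply holO_int; auto; [lra|apply Rmult_le_pos; [easy|apply base_cst_E_pos]|intros; now apply co_le].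
Qed.
Lemma holM_E f : holO al l E f -> holM 1 f.
Proof. intros H. split; [lra|]. apply (holO_le al l E); [|easy]. pose proof base_cst_ge. nra. Qed.

Lemma P_cont2 i q : (i <= 1)%nat -> (q <= 3)%nat -> (q + i <= k)%nat -> cont2 (P i q).
Proof.
  intros Hi Hq Hk. apply (cont2_of_hol _ (hol_cst al * (KO * E)) al (proj1 al_in)); intros; [now apply P_hx|now apply P_hy].
Qed.
Lemma P_holM i q : (i <= 1)%nat -> (q <= 3)%nat -> (q + i <= k)%nat -> holM 1 (P i q).
Proof.
  intros Hi Hq Hk. split; [lra|]. rewrite Rmult_1_l. pose proof base_cst_ge. pose proof KO_pos.
  assert (H1 : KO * E / (1 - ratio al) <= base_cst * E).
  { replace (KO * E / (1 - ratio al)) with (KO / (1 - ratio al) * E) by (unfold Rdiv; ring). apply Rmult_le_compat_r; [easy|lra]. }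
  assert (H2 : hol_cst al * (KO * E) <= base_cst * E) by (rewrite <- Rmult_assoc; apply Rmult_le_compat_r; [easy|lra]).
  split; [|split]; intros.
  - eapply Rle_trans; [now apply P_bd|easy].
  - eapply Rle_trans; [now apply P_hx|]. apply Rmult_le_compat_r; [apply hpow_pos|easy].
  - eapply Rle_trans; [now apply P_hy|]. apply Rmult_le_compat_r; [apply hpow_pos|easy].
Qed.

Definition vz_xx (x : R) : R := bz x * dvz x + cz x * vz x + (r1z x * RInt (fun t => aa t * vz t) 0 x + r2z x * RInt (fun t => bb t * vz t) 0 x) - r x * fn 0%nat x.
Lemma vz_der x : is_derive vz x (dvz x).
Proof. apply vz_sol. Qed.
Lemma vz_cont : cont vz.
Proof. apply (cont_derive vz dvz), vz_der. Qed.
Lemma dvz_der x : 0 <= x <= l -> is_derive dvz x (vz_xx x).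
Proof.
  intros Hx0. destruct vz_sol as [[_ [_ H]] _]. specialize (H x Hx0). unfold rhs, nonloc in H.
  replace (vz_xx x) with (INR 0 ^ 2 * r x * vz x + bz x * dvz x + cz x * vz x + (r1z x * RInt (fun t => aa t * vz t) 0 x + r2z x * RInt (fun t => bb t * vz t) 0 x) - r x * fn 0%nat x); [easy|].
  unfold vz_xx. simpl. ring.
Qed.
Lemma fn0_holM : holM 1 (fun x _ => fn 0%nat x).
Proof. apply holM_E. now apply fcoef0_holO. Qed.
Lemma vz_holM : holM 1 (fun x _ => vz x) /\ holM 1 (fun x _ => dvz x).
Proof.
  pose proof zcst_pos as [HK HV]. pose proof base_cst_ge. pose proof PI_RGT_0. assert (HKE : 0 <= zcst * E) by now apply Rmult_le_pos.
  assert (HVK : V0 * E <= zcst * E) by now apply Rmult_le_compat_r.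
  assert (Hz : forall x, 0 <= x <= l -> Rabs (vz x) <= zcst * E /\ Rabs (dvz x) <= zcst * E) by (intros x Hx0; destruct (vz_bd x Hx0); lra).
  assert (HM : zcst * E * (1 + l + PI) <= 1 * (base_cst * E)).
  { rewrite Rmult_1_l. replace (zcst * E * (1 + l + PI)) with (zcst * (1 + l + PI) * E) by ring. apply Rmult_le_compat_r; lra. }
  assert (HR : forall x, 0 < x < l -> Rabs (vz_xx x) <= zcst * E).
  { intros x Hx0. destruct (vz_bd x ltac:(lra)) as [B0 B1]. assert (0 <= V0 * E) by now apply Rmult_le_pos.
    assert (HI : forall i, (i < 11)%nat -> Rabs (RInt (fun t => co i t * vz t) 0 x) <= l * (KC * (V0 * E))).
    { intros i Hi. pose proof (co_cont i). pose proof vz_cont. assert (0 <= KC * (V0 * E)) by (apply Rmult_le_pos; lra).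
      eapply Rle_trans; [apply (RInt_abs_cst _ 0 x (KC * (V0 * E))); [lra|auto with cont|]|apply Rmult_le_compat_r; lra].
      intros t Ht. rewrite Rabs_mult. apply Rmult_le_compat; try apply Rabs_pos; [apply co_le; [easy|lra]|apply vz_bd; lra]. }
    pose proof (HI 1%nat ltac:(lia)) as I1. pose proof (HI 2%nat ltac:(lia)) as I2.
    assert (HF : Rabs (fn 0%nat x) <= E). { destruct (fcoef0_holO al l E hq l_pos (proj1 al_in) E_pos hq_cont hq_hol) as [HF _]. apply (HF x (PI / 2)); lra. }
    pose proof (fun i Hi => co_le i x Hi ltac:(lra)) as HC.
    assert (HP : forall i z Z, (i < 11)%nat -> Rabs z <= Z -> Rabs (co i x * z) <= KC * Z).
    { intros i z Z Hi HzZ. rewrite Rabs_mult. apply Rmult_le_compat; try apply Rabs_pos; auto. }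
    unfold vz_xx. rewrite <- Rplus_assoc.
    replace (zcst * E) with (KC * (V0 * E) + KC * (V0 * E) + KC * (l * (KC * (V0 * E))) + KC * (l * (KC * (V0 * E))) + (KC * E) + V0 * E) by (unfold zcst; ring).
    match goal with |- ?A <= _ => assert (A <= KC * (V0 * E) + KC * (V0 * E) + KC * (l * (KC * (V0 * E))) + KC * (l * (KC * (V0 * E))) + (KC * E)); [|lra] end.
    apply Rabs_sum5; apply HP; auto; lia. }
  split; (split; [lra|]); (apply (holO_le al l (zcst * E * (1 + l + PI))); [easy|]).
  - apply (holO_of_derive1 al l (zcst * E) vz dvz); auto; [intros; apply vz_der|]. intros; apply Hz; lra.
  - apply (holO_of_derive1 al l (zcst * E) dvz vz_xx); auto; [intros; apply dvz_der; lra|]. intros; split; [apply Hz; lra|now apply HR].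
Qed.

Definition psol_xx (x y : R) : R :=
  (bz x * dvz x + cz x * vz x + (r1z x * RInt (fun t => aa t * vz t) 0 x + r2z x * RInt (fun t => bb t * vz t) 0 x))
  + (b x * P 1 0 x y + c x * P 0 0 x y + (r1 x * RInt (fun t => aa t * P 0 0 t y) 0 x + r2 x * RInt (fun t => bb t * P 0 0 t y) 0 x))
  - r x * (P 0 2 x y + hq x y).
Definition u_xx (x y : R) : R :=
  (b x * P 1 0 x y + c x * P 0 0 x y + (r1 x * RInt (fun t => aa t * P 0 0 t y) 0 x + r2 x * RInt (fun t => bb t * P 0 0 t y) 0 x))
  - r x * (P 0 2 x y + (hq x y - fn 0%nat x)).
Definition psol_xxy (x y : R) : R :=
  (b x * P 1 1 x y + c x * P 0 1 x y + (r1 x * RInt (fun t => aa t * P 0 1 t y) 0 x + r2 x * RInt (fun t => bb t * P 0 1 t y) 0 x))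
  - r x * (P 0 3 x y + Hy x y).
Definition psol_xxx (x y : R) : R :=
  ((dco 7 x * dvz x + bz x * vz_xx x) + (dco 8 x * vz x + cz x * dvz x)
    + ((dco 9 x * RInt (fun t => aa t * vz t) 0 x + r1z x * (aa x * vz x)) + (dco 10 x * RInt (fun t => bb t * vz t) 0 x + r2z x * (bb x * vz x))))
  + ((dco 3 x * P 1 0 x y + b x * u_xx x y) + (dco 4 x * P 0 0 x y + c x * P 1 0 x y)
    + ((dco 5 x * RInt (fun t => aa t * P 0 0 t y) 0 x + r1 x * (aa x * P 0 0 x y)) + (dco 6 x * RInt (fun t => bb t * P 0 0 t y) 0 x + r2 x * (bb x * P 0 0 x y))))
  - (dco 0 x * (P 0 2 x y + hq x y) + r x * (P 1 2 x y + Hx x y)).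
(** The table of derivatives. At most one [x]-derivative is taken in the series; higher ones are
    read off the equation and, for [psol_xxx], off its derivative. The zero mode [vz] drops out with
    the first [y]-derivative; the default case serves [i <= 1] and [j >= 1]. *)
Definition psol_d (i j : nat) : R -> R -> R :=
  match i, j with
  | O, O => fun x y => vz x + P 0 0 x y
  | 1%nat, O => fun x y => dvz x + P 1 0 x y
  | 2%nat, O => psol_xx
  | 2%nat, 1%nat => psol_xxy
  | 3%nat, O => psol_xxx
  | _, _ => P i j
  end.
Definition deriv_cst : R := 400 * KC ^ 3 * (1 + l) * base_cst.

(** Builds the multiple of [base_cst * E] as an existential variable while following the expression;
    [holM_le] then compares it with the announced polynomial in [KC] and [l]. *)
Ltac holM_auto := first
  [ refine (holM_plus _ _ _ _ _ _); [holM_auto|holM_auto]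
  | refine (holM_minus _ _ _ _ _ _); [holM_auto|holM_auto]
  | refine (holM_co _ _ _ _ _); [lia|holM_auto]
  | refine (holM_dco _ _ _ _ _); [lia|holM_auto]
  | exact (proj1 vz_holM) | exact (proj2 vz_holM)
  | exact fn0_holM
  | exact (holM_E _ hq_hol)
  | refine (holM_int _ _ (fun x _ => vz x) _ _ _); [lia|exact (cont2_of_x _ vz_cont)|holM_auto]
  | refine (holM_int _ _ (P 0 _) _ _ _); [lia|apply P_cont2; lia|holM_auto]
  | apply P_holM; lia
  | eassumption ].
Lemma poly_facts : KC <= KC ^ 3 /\ KC ^ 2 <= KC ^ 3 /\ 1 <= KC ^ 3 /\ 0 <= KC * l /\ KC * l <= KC ^ 3 * l /\ KC ^ 2 * l <= KC ^ 3 * l /\ l <= KC ^ 3 * l.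
Proof.
  assert (H1 : 1 <= KC ^ 2) by (apply pow_R1_Rle; lra). assert (H2 : KC <= KC ^ 2) by nra.
  assert (H3 : KC ^ 2 <= KC ^ 3) by (replace (KC ^ 3) with (KC ^ 2 * KC) by ring; nra).
  assert (forall u v, u <= v -> u * l <= v * l) by (intros; apply Rmult_le_compat_r; lra).
  repeat match goal with |- _ /\ _ => split end; try lra; try (apply H; lra).
  - apply Rmult_le_pos; lra.
  - rewrite <- (Rmult_1_l l) at 1. apply H; lra.
Qed.
Lemma vz_xx_holM : holM (20 * KC ^ 2 * (1 + l)) (fun x _ => vz_xx x).
Proof.
  unfold vz_xx. pose proof poly_facts. assert (KC <= KC ^ 2) by nra.
  eapply holM_le; [|holM_auto]. assert (KC * l <= KC ^ 2 * l) by (apply Rmult_le_compat_r; lra). lra.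
Qed.
Lemma u_xx_holM : holM (20 * KC ^ 2 * (1 + l)) u_xx.
Proof.
  unfold u_xx. pose proof poly_facts. assert (KC <= KC ^ 2) by nra.
  eapply holM_le; [|holM_auto]. assert (KC * l <= KC ^ 2 * l) by (apply Rmult_le_compat_r; lra). lra.
Qed.
Lemma psol_d_hol i j : (i + j <= k)%nat -> holO al l (deriv_cst * E) (psol_d i j).
Proof.
  intros Hij. enough (H : holM (400 * KC ^ 3 * (1 + l)) (psol_d i j)).
  { replace (deriv_cst * E) with (400 * KC ^ 3 * (1 + l) * (base_cst * E)) by (unfold deriv_cst; ring). apply H. }
  pose proof poly_facts.
  destruct i as [|[|[|[|i]]]]; [| | | |lia].
  - destruct j as [|j]; simpl.
    + eapply holM_le; [|holM_auto]. lra.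
    + eapply holM_le; [|apply P_holM; lia]. lra.
  - destruct j as [|j]; simpl.
    + eapply holM_le; [|holM_auto]. lra.
    + eapply holM_le; [|apply P_holM; lia]. lra.
  - destruct j as [|[|j]]; [| |lia]; simpl.
    + unfold psol_xx. eapply holM_le; [|holM_auto]. lra.
    + destruct h3 as [_ [HHy _]]; [lia|]. apply holM_E in HHy. unfold psol_xxy. eapply holM_le; [|holM_auto]. lra.
  - destruct j as [|j]; [|lia]; simpl. destruct h3 as [HHx _]; [lia|]. apply holM_E in HHx. pose proof vz_xx_holM. pose proof u_xx_holM.
    unfold psol_xxx. eapply holM_le; [|holM_auto]. lra.
Qed.

Lemma P_dx1_0 x y : 0 < x < l -> 0 < y < PI -> is_derive (fun x => P 1 0 x y) x (u_xx x y).
Proof. intros Hx0 Hy0. apply (P_dx1 0 x y); auto; lia. Qed.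
Lemma int_dx (a : R -> R) (f : R -> R) x : cont a -> cont f -> is_derive (fun x => RInt (fun t => a t * f t) 0 x) x (a x * f x).
Proof. intros Ha Hf. apply (derive_RInt (fun t => a t * f t)). auto with cont. Qed.
Lemma int_dy (a : R -> R) x y : k = 3%nat -> cont a -> 0 <= x -> is_derive (fun y => RInt (fun t => a t * P 0 0 t y) 0 x) y (RInt (fun t => a t * P 0 1 t y) 0 x).
Proof.
  intros Hk Ha Hx0. apply (diff_param (fun y t => a t * P 0 0 t y) (fun y t => a t * P 0 1 t y) 0 x (y - 1) (y + 1)); [easy|lra| | |].
  - apply (cont2_swap (fun t y => a t * P 0 0 t y)). apply cont2_mult; [now apply cont2_of_x|apply P_cont2; lia].
  - apply (cont2_swap (fun t y => a t * P 0 1 t y)). apply cont2_mult; [now apply cont2_of_x|apply P_cont2; lia].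
  - intros w t _ _. apply dscal. apply P_dy; lia.
Qed.

Lemma psol_d_derive i j x y : (i + j < k)%nat -> 0 < x < l -> 0 < y < PI ->
  is_derive (fun t => psol_d i j t y) x (psol_d (S i) j x y) /\ is_derive (fun t => psol_d i j x t) y (psol_d i (S j) x y).
Proof.
  intros Hij Hx0 Hy0.
  assert (H0 : forall q, (q + 1 <= k)%nat -> is_derive (fun t => P 0 q t y) x (P 1 q x y)) by (intros q Hq; apply P_dx0; auto; lia).
  assert (HPc : forall i q, (i <= 1)%nat -> (q <= 3)%nat -> (q + i <= k)%nat -> cont (fun t => P i q t y)) by (intros; now apply (cont2_x (P i0 q)), P_cont2).
  destruct i as [|[|[|i]]]; [| | |lia].
  - destruct j as [|[|[|j]]]; [| | |lia]; simpl; (split; [|]).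
    + apply dplus; [apply vz_der|apply H0; lia].
    + rewrite <- (Rplus_0_l (P 0 1 x y)). apply (dplus (fun _ => vz x)); [apply derive_cst|apply P_dy; lia].
    + apply H0; lia.
    + apply P_dy; lia.
    + apply H0; lia.
    + apply P_dy; lia.
  - destruct j as [|[|j]]; [| |lia]; simpl; (split; [|]).
    + replace (psol_xx x y) with (vz_xx x + u_xx x y) by (unfold psol_xx, vz_xx, u_xx; ring). apply dplus; [apply dvz_der; lra|now apply P_dx1_0].
    + rewrite <- (Rplus_0_l (P 1 1 x y)). apply (dplus (fun _ => dvz x)); [apply derive_cst|apply P_dy; lia].
    + apply (P_dx1 1 x y); auto; lia.
    + apply P_dy; lia.
  - destruct j as [|j]; [|lia]. assert (Hk : k = 3%nat) by lia. destruct (h3 Hk) as [_ [_ [HD _]]]. destruct (HD x y Hx0 Hy0) as [HDx HDy].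
    simpl; (split; [|]).
    + unfold psol_xx, psol_xxx. pose proof vz_cont. pose proof (HPc 0%nat 0%nat ltac:(lia) ltac:(lia) ltac:(lia)).
      apply dminus; [apply dplus; [apply dplus; [apply dplus|apply dplus]|apply dplus; [apply dplus|apply dplus]]|];
      refine (dmult _ _ _ _ _ _ _); auto; try (apply int_dx; now auto); try (apply (int_dx _ (fun t => P 0 0 t y)); now auto).
      * apply dvz_der; lra.
      * apply vz_der.
      * now apply P_dx1_0.
      * apply H0; lia.
      * apply (dplus (fun t => P 0 2 t y) (fun t => hq t y)); [apply H0; lia|easy].
    + unfold psol_xx, psol_xxy. match goal with |- is_derive _ _ (?A - ?B) => replace (A - B) with ((0 + A) - B) by ring end.
      apply (dminus _ (fun t => r x * (P 0 2 x t + hq x t))); [apply dplus; [apply derive_cst|apply dplus; [apply dplus|apply dplus]]|]; apply dscal.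
      * apply P_dy; lia.
      * apply P_dy; lia.
      * apply int_dy; auto; lra.
      * apply int_dy; auto; lra.
      * apply dplus; [apply P_dy; lia|easy].
Qed.

Definition psol (z : R * R) : R := vz (fst z) + P 0 0 (fst z) (snd z).
Lemma psol_cont2 : cont2 (fun x y => vz x + P 0 0 x y).
Proof. apply cont2_plus; [apply cont2_of_x, vz_cont|apply P_cont2; lia]. Qed.
Lemma psol_reg : Cka2 (Omega l) (Omega_bar l) k al psol /\ Cka2_norm (Omega l) k al psol <= (INR (S k) ^ 2 + 2 * INR (S k)) * (deriv_cst * E).
Proof.
  apply (fam_result al l (deriv_cst * E) k psol_d psol); auto; try apply al_in.
  - apply Rle_trans with (0 * (base_cst * E)); [lra|]. unfold deriv_cst. rewrite (Rmult_assoc _ base_cst). apply Rmult_le_compat_r; [apply base_cst_E_pos|].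
    pose proof poly_facts. nra.
  - intros i j x y Hij Hx0 Hy0. now apply psol_d_derive.
  - intros i j Hij. now apply psol_d_hol.
  - apply (cont2_continuous_on l (fun x y => vz x + P 0 0 x y) psol_cont2).
Qed.
Lemma psol_dxy i j x y : (i + j <= k)%nat -> 0 < x < l -> 0 < y < PI -> dxy i j psol (x, y) = psol_d i j x y.
Proof.
  intros Hij Hx0 Hy0. apply (fam_dxy l k psol_d psol (fun _ _ => eq_refl) psol_d_derive i j Hij (x, y)). now split.
Qed.

Variables (G : data) (U : flow) (Phi : R -> mat22).
Hypothesis kap_eq : kap = lambda G * gamma0 G U.
Hypothesis coef : forall x, 0 < x < l -> e1 G U x * r x = -1 /\ aa x = a4 G U Phi x /\ bb x = b4 G U Phi x /\
  b x = lambda G * e2 G U x * r x /\ c x = e3 G U x * r x /\ r1 x = lambda G * e10 G U Phi x * r x /\ r2 x = lambda G * e11 G U Phi x * r x /\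
  bz x = (lambda G * e2 G U x + PI * e6 G U x) * r x /\ cz x = (e3 G U x + PI * e7 G U x) * r x /\
  r1z x = lambda G * (e10 G U Phi x + PI * e12 G U Phi x) * r x /\ r2z x = lambda G * (e11 G U Phi x + PI * e13 G U Phi x) * r x.

(** The series has zero average, so the averaged terms see [vz] only. The coefficients of the zero
    mode contain exactly these terms, and adding the two equations gives the operator. *)
Lemma psol_L1 x y : 0 < x < l -> 0 < y < PI -> L1op G U Phi psol (x, y) = hq x y.
Proof.
  intros Hx0 Hy0. pose proof PI_RGT_0 as HPI. unfold L1op.
  assert (E20 : dx (dx psol) (x, y) = psol_xx x y) by (apply (psol_dxy 2 0); auto; lia).
  assert (E02 : dy (dy psol) (x, y) = P 0 2 x y) by (apply (psol_dxy 0 2); auto; lia).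
  assert (E10 : forall y, 0 < y < PI -> dx psol (x, y) = dvz x + P 1 0 x y) by (intros; apply (psol_dxy 1 0); auto; lia).
  assert (CP : forall i, (i <= 1)%nat -> cont (P i 0 x)) by (intros; now apply cont2_y, P_cont2; lia).
  assert (HM : forall i, (i <= 1)%nat -> RInt (P i 0 x) 0 PI = 0) by (intros i Hi; apply (P_mean i x Hi); lia).
  rewrite (RInt_eq_open (fun y' => dx psol (x, y')) (fun y' => dvz x + P 1 0 x y')) by (lra || (intros; now apply E10)).
  rewrite (RInt_eq (fun y' => psol (x, y')) (fun y' => vz x + P 0 0 x y')) by reflexivity.
  rewrite (RInt_cplus (fun _ => dvz x)), (RInt_cplus (fun _ => vz x)), !RInt_cst, !HM by (auto with cont).
  assert (HI : forall i a y, (forall t, 0 < t < l -> co i t = a t) ->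
     RInt (fun t => a t * psol (t, y)) 0 x = RInt (fun t => co i t * vz t) 0 x + RInt (fun t => co i t * P 0 0 t y) 0 x).
  { intros i a w Ha. rewrite (RInt_eq_open _ (fun t => co i t * vz t + co i t * P 0 0 t w)).
    - pose proof vz_cont. pose proof (co_cont i). assert (cont (fun t => P 0 0 t w)) by (apply (cont2_x (P 0 0)), P_cont2; lia). apply RInt_cplus; auto with cont.
    - lra.
    - intros t Ht. rewrite <- Ha by lra. unfold psol. simpl. ring. }
  assert (HII : forall i a, (forall t, 0 < t < l -> co i t = a t) ->
     RInt (fun y' => RInt (fun t => a t * psol (t, y')) 0 x) 0 PI = PI * RInt (fun t => co i t * vz t) 0 x).
  { intros i a Ha. rewrite (RInt_eq _ (fun y' => RInt (fun t => co i t * vz t) 0 x + RInt (fun t => co i t * P 0 0 t y') 0 x)) by (intros; now apply HI).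
    rewrite (RInt_cplus (fun _ => RInt (fun t => co i t * vz t) 0 x)), RInt_cst, (P_int_mean (co i) x); auto with cont; try lra; try lia.
    - apply (cont2_y (fun x y => RInt (fun t => co i t * P 0 0 t y) 0 x) x). apply (cont2_RInt_x (fun t y => co i t * P 0 0 t y)).
      apply cont2_mult; [now apply cont2_of_x|apply P_cont2; lia]. }
  assert (Ha4 : forall t, 0 < t < l -> aa t = a4 G U Phi t) by (intros; now apply coef).
  assert (Hb4 : forall t, 0 < t < l -> bb t = b4 G U Phi t) by (intros; now apply coef).
  rewrite (HII 1%nat _ Ha4), (HII 2%nat _ Hb4), (HI 1%nat _ y Ha4), (HI 2%nat _ y Hb4).
  rewrite E20, E02, E10 by easy. unfold psol; simpl fst; simpl snd.
  destruct (coef x Hx0) as [Er [_ [_ [Eb [Ec [E1 [E2 [Ebz [Ecz [E1z E2z]]]]]]]]]].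
  unfold psol_xx. rewrite Eb, Ec, E1, E2, Ebz, Ecz, E1z, E2z.
  set (Y0 := RInt (fun t => aa t * vz t) 0 x). set (Y1 := RInt (fun t => bb t * vz t) 0 x).
  set (Y2 := RInt (fun t => aa t * P 0 0 t y) 0 x). set (Y3 := RInt (fun t => bb t * P 0 0 t y) 0 x).
  (* The intermediate expression is weighted by [e1 * r]: it equals the left side identically, and
     the right side once [e1 * r = -1] is used. *)
  match goal with |- _ = ?h => transitivity (- (e1 G U x * r x) * h + (1 + e1 G U x * r x) *
    (- P 0 2 x y + lambda G * e2 G U x * (dvz x + P 1 0 x y) + e3 G U x * (vz x + P 0 0 x y) + e6 G U x * (PI * dvz x) + e7 G U x * (PI * vz x)
     + lambda G * e10 G U Phi x * (Y0 + Y2) + lambda G * e11 G U Phi x * (Y1 + Y3) + lambda G * e12 G U Phi x * (PI * Y0) + lambda G * e13 G U Phi x * (PI * Y1))) end;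
  [ring|rewrite Er; ring].
Qed.

Lemma P01_ends x y : y = 0 \/ y = PI -> P 0 1 x y = 0.
Proof.
  intros Hy0. unfold useries. apply (eq_of_small _ _ 0 (1/2)); [lra|]. intros n.
  enough (dsum (fun j => ublock v dv 0 1 j (clamp 0 l x) y) = 0) as -> by (rewrite Rminus_diag_eq, Rabs_R0 by easy; lra).
  assert (H : forall j, ublock v dv 0 1 j (clamp 0 l x) y = 0).
  { intros j. unfold ublock. apply psum_zero. intros i _. rewrite dcosn_1. replace (sin (INR i * y)) with 0; [ring|].
    destruct Hy0 as [-> | ->].
    - now rewrite Rmult_0_r, sin_0.
    - symmetry. apply (sin_eq_0_1 (INR i * PI)). exists (Z.of_nat i). now rewrite INR_IZR_INZ. }
  pose proof (ssum_bound (fun j => ublock v dv 0 1 j (clamp 0 l x) y) 0 (1/2) ltac:(lra) ltac:(lra)) as HB.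
  destruct (Req_dec (dsum (fun j => ublock v dv 0 1 j (clamp 0 l x) y)) 0) as [|Hn]; [easy|exfalso].
  apply (Rabs_no_R0 _ Hn). apply Rle_antisym; [|apply Rabs_pos]. eapply Rle_trans; [apply HB|right; field].
  intros j. rewrite H, Rabs_R0. lra.
Qed.

Variables (h : R * R -> R) (g0 gl G0 Gl : R -> R) (E2 : R).
Hypothesis hq_eq : forall x y, 0 < x < l -> 0 < y < PI -> hq x y = h (x, y).
Hypotheses (EG0 : forall y, 0 < y < PI -> G0 y = g0 y) (EGl : forall y, 0 < y < PI -> Gl y = gl y).
Hypothesis E2_pos : 0 <= E2.
Hypothesis an_lim : forall y J, 0 <= y <= PI -> Rabs (psum (fun j => dyblock j (fun n => an n * cosn n y)) J - (G0 y - an 0%nat)) <= E2 * ratio al ^ J.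
Hypothesis bn_lim : forall y J, 0 <= y <= PI -> Rabs (psum (fun j => dyblock j (fun n => bn n * cosn n y)) J - (Gl y - bn 0%nat)) <= E2 * ratio al ^ J.

Lemma psol_solves : solves G U Phi l h g0 gl psol.
Proof.
  pose proof PI_RGT_0 as HPI. destruct vz_sol as [_ [B0 Bl]].
  split; [|split; [|split]].
  - intros [x y] [Hx0 Hy0]. rewrite psol_L1 by easy. now apply hq_eq.
  - intros x Hx0. assert (HW : forall y, y = 0 \/ y = PI -> is_derive_within (Icc 0 PI) (fun t => psol (x, t)) y 0).
    { intros y Hy0. apply is_derive_within_intro. unfold psol. simpl. replace 0 with (0 + P 0 1 x y) by (rewrite P01_ends by easy; ring).
      apply (dplus (fun _ => vz x)); [apply derive_cst|apply P_dy; lia]. }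
    split; apply HW; auto.
  - intros y Hy'. assert (Hy0 : 0 < y < PI) by exact Hy'. exists (dvz 0 + P 1 0 0 y). split.
    + apply (one_sided (fun t => psol (t, y)) (fun t => psol (t, y)) (fun t => dvz t + P 1 0 t y) 0 l _ 0); auto; try lra.
      * apply (cont2_x _ y psol_cont2).
      * apply cont_plus; [apply vz_sol|apply (cont2_x (P 1 0)), P_cont2; lia].
      * intros t Ht. apply (psol_d_derive 0 0 t y); auto; lia.
    + unfold psol. simpl. rewrite <- kap_eq.
      pose proof (P_bc0 E2 E2_pos y (G0 y - an 0%nat) ltac:(lia) ltac:(intros; apply an_lim; lra)) as HB. rewrite <- EG0 by easy.
      replace (G0 y) with (G0 y - an 0%nat + an 0%nat) by ring. rewrite <- HB, <- B0. ring.
  - intros y Hy'. assert (Hy0 : 0 < y < PI) by exact Hy'. unfold psol. simpl. pose proof (P_bcl E2 E2_pos y (Gl y - bn 0%nat) ltac:(intros; apply bn_lim; lra)) as HB.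
    rewrite HB, Bl, <- EGl by easy. ring.
Qed.
End Solve.

(** * Existence, uniqueness and estimate *)

Lemma C1_extension l al f : 0 < l -> 0 < al < 1 -> good l 2 f -> exists (F dF : R -> R) (K : R), cont F /\ (forall x, 0 < x < l -> F x = f x) /\
  (forall x, 0 < x < l -> is_derive F x (dF x)) /\ holO al l K (fun x _ => F x) /\ holO al l K (fun x _ => dF x).
Proof.
  intros Hl Ha [[F [HF EF]] [f' [Hf' [[F1 [HF1 EF1]] [f'' [Hf'' [[F2 [HF2 EF2]] _]]]]]]]. pose proof PI_RGT_0.
  destruct (cont_bounded F 0 l ltac:(lra) HF) as [M0 [P0 B0]]. destruct (cont_bounded F1 0 l ltac:(lra) HF1) as [M1 [P1 B1]].
  destruct (cont_bounded F2 0 l ltac:(lra) HF2) as [M2 [P2 B2]].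
  assert (D0 : forall x, 0 < x < l -> is_derive F x (F1 x)).
  { intros x Hx. rewrite <- EF1 by easy. apply (is_derive_eq_on l f); auto. }
  assert (D1 : forall x, 0 < x < l -> is_derive F1 x (F2 x)).
  { intros x Hx. rewrite <- EF2 by easy. apply (is_derive_eq_on l f'); auto. }
  exists F, F1, ((M0 + M1 + M2) * (1 + l + PI)). split; [easy|]. split; [intros; symmetry; auto|]. split; [easy|].
  split; [apply (holO_of_derive1 al l _ F F1)|apply (holO_of_derive1 al l _ F1 F2)]; auto; try lra; intros x Hx;
    pose proof (B0 x ltac:(lra)); pose proof (B1 x ltac:(lra)); pose proof (B2 x ltac:(lra)); lra.
Qed.

Lemma max_upto (K : nat -> R) n : exists M, 1 <= M /\ forall i, (i < n)%nat -> K i <= M.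
Proof.
  induction n as [|n [M [H1 H2]]]; [exists 1; split; [lra|lia]|].
  exists (Rmax M (K n)). pose proof (Rmax_l M (K n)). pose proof (Rmax_r M (K n)). split; [lra|]. intros i Hi.
  destruct (Nat.eq_dec i n) as [->|]; [easy|]. pose proof (H2 i ltac:(lia)). lra.
Qed.

Lemma block_bound_mono l kap r b c r1 r2 aa bb K K' : K <= K' -> block_bound_by l kap r b c r1 r2 aa bb K -> block_bound_by l kap r b c r1 r2 aa bb K'.
Proof.
  intros HK H N fn an bn v dv d HN Hd H1 H2 H3 H4 H5 H6 H7 H8 x y Hx.
  destruct (H N fn an bn v dv d HN Hd H1 H2 H3 H4 H5 H6 H7 H8 x y Hx) as [A B]. pose proof (pos_INR N).
  split; (eapply Rle_trans; [eassumption|]); apply Rmult_le_compat_r; auto. now apply Rmult_le_compat_r.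
Qed.

Lemma mode_sol_of_unique l kap r b c r1 r2 aa bb nu f g0 gl v dv v' dv' : cont aa -> cont bb -> uniq l kap r b c r1 r2 aa bb nu ->
  mode_sol_of l kap r b c r1 r2 aa bb nu f g0 gl v dv -> mode_sol_of l kap r b c r1 r2 aa bb nu f g0 gl v' dv' ->
  forall x, 0 <= x <= l -> v x = v' x.
Proof.
  intros Ha Hb Hu H H' x Hx.
  pose proof (mode_sol_of_lin l kap r b c r1 r2 aa bb Ha Hb nu _ _ _ _ _ _ _ _ _ _ (-1) H H') as [O [B1 B2]].
  apply (ode_ext l r b c r1 r2 aa bb nu _ (fun _ => 0)) in O; [|intros; ring].
  pose proof (Hu _ _ O ltac:(lra) ltac:(lra) x Hx) as HZ. cbv beta in HZ. lra.
Qed.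

Lemma Cka2_lip l al k q : 0 < l -> 0 < al < 1 -> (1 <= k)%nat -> Cka2 (Omega l) (Omega_bar l) k al q -> exists K, 0 <= K /\ holO al l K (clamp2 l q).
Proof.
  intros Hl Ha Hk [[_ Hq] [Hb _]]. destruct k as [|k]; [lia|]. destruct Hq as [_ [Hd _]]. pose proof PI_RGT_0.
  destruct (Hb 0%nat 0%nat ltac:(lia)) as [K0 B0]. destruct (Hb 1%nat 0%nat ltac:(lia)) as [K1 B1]. destruct (Hb 0%nat 1%nat ltac:(lia)) as [K2 B2].
  set (K := Rabs K0 + Rabs K1 + Rabs K2). pose proof (Rabs_pos K0). pose proof (Rabs_pos K1). pose proof (Rabs_pos K2).
  exists (K * (1 + l + PI)). split; [apply Rmult_le_pos; unfold K; lra|].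
  apply (holO_of_derive al l K (clamp2 l q) (fun x y => dx q (x, y)) (fun x y => dy q (x, y))); auto; [unfold K; lra| |].
  - intros x y Hx Hy. assert (Omega l (x, y)) as HO by now split. split.
    + apply (is_derive_ext_loc (fun t => q (t, y))).
      * generalize (locally_Ioo 0 l x Hx). apply filter_imp. intros t Ht. symmetry. apply clamp2_id; lra.
      * apply Derive_correct. apply (Hd (x, y) HO).
    + apply (is_derive_ext_loc (fun t => q (x, t))).
      * generalize (locally_Ioo 0 PI y Hy). apply filter_imp. intros t Ht. symmetry. apply clamp2_id; lra.
      * apply Derive_correct. apply (Hd (x, y) HO).
  - intros x y Hx Hy. assert (Omega l (x, y)) as HO by now split. rewrite clamp2_id by lra.
    pose proof (B0 _ HO) as A0. pose proof (B1 _ HO) as A1. pose proof (B2 _ HO) as A2. unfold dxy in A0, A1, A2. simpl in A0, A1, A2.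
    pose proof (Rle_abs K0). pose proof (Rle_abs K1). pose proof (Rle_abs K2). unfold K. lra.
Qed.

(** A Hölder function is recovered from its cosine coefficients: the partial block sums, the same
    for both functions, converge to each of them minus the common mean. *)
Lemma eq_of_modes l al q p : 0 < l -> 0 < al < 1 -> continuous_on (Omega_bar l) q -> continuous_on (Omega_bar l) p ->
  (exists K, 0 <= K /\ holO al l K (clamp2 l q)) -> (exists K, 0 <= K /\ holO al l K (clamp2 l p)) ->
  (forall n x, 0 <= x <= l -> fcoef (clamp2 l q x) n = fcoef (clamp2 l p x) n) -> forall z, Omega_bar l z -> q z = p z.
Proof.
  intros Hl Ha Hq Hp [K [HK Kq]] [K' [HK' Kp]] Hcc [x y] [Hx Hy]. simpl in Hx, Hy. unfold Icc in *. pose proof (fejer_cst_pos al Ha).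
  assert (Cq : cont2 (clamp2 l q)) by now apply cont2_clamp. assert (Cp : cont2 (clamp2 l p)) by now apply cont2_clamp.
  destruct (holO_closed al l K _ Hl (proj1 Ha) HK Cq Kq) as [_ [_ Jq]]. destruct (holO_closed al l K' _ Hl (proj1 Ha) HK' Cp Kp) as [_ [_ Jp]].
  rewrite <- !(clamp2_id l) by easy.
  pose proof (cont2_y _ x Cq) as cq. pose proof (cont2_y _ x Cp) as cp. pose proof (ratio_bounds al Ha).
  assert (HE : forall J, ratio al ^ J >= 0) by (intros; apply Rle_ge, pow_le; lra).
  enough (clamp2 l q x y - fcoef (clamp2 l q x) 0 = clamp2 l p x y - fcoef (clamp2 l p x) 0) by (rewrite (Hcc 0%nat x Hx) in *; lra).
  apply (lim_unique_geom (psum (fun j => dyblock j (fun n => fcoef (clamp2 l q x) n * cosn n y))) _ _ (6 * (fejer_cst al * K) + 6 * (fejer_cst al * K')) (ratio al)); [lra| |]; intros J;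
    (eapply Rle_trans; [|rewrite Rmult_plus_distr_r]).
  - apply (fejer_series (clamp2 l q x) al K y J); auto.
  - pose proof (HE J). assert (0 <= fejer_cst al * K') by (apply Rmult_le_pos; lra). assert (0 <= 6 * (fejer_cst al * K') * ratio al ^ J) by (apply Rmult_le_pos; lra). lra.
  - rewrite (psum_ext _ (fun j => dyblock j (fun n => fcoef (clamp2 l p x) n * cosn n y))); [apply (fejer_series (clamp2 l p x) al K' y J); auto|].
    intros j _. unfold dyblock. apply psum_ext. intros n _. now rewrite Hcc.
  - pose proof (HE J). assert (0 <= fejer_cst al * K) by (apply Rmult_le_pos; lra). assert (0 <= 6 * (fejer_cst al * K) * ratio al ^ J) by (apply Rmult_le_pos; lra). lra.
Qed.

(** The summands [1 + l + PI] beside the Jackson constant are room for the passage from Lipschitz to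
    Hölder bounds in [data_2d_1]. *)
Lemma block_size_of l al X En E k s i j : 0 < l -> 0 < al < 1 -> (s + i = k)%nat -> 0 <= En -> En <= E ->
  X <= jackson_cst al * En * ratio al ^ j / (2 ^ j) ^ s -> X <= block_size al ((jackson_cst al + 1 + l + PI) * E) k i j.
Proof.
  intros Hl Ha Hk HEn HE HX. eapply Rle_trans; [exact HX|]. unfold block_size. pose proof (ratio_bounds al Ha). pose proof (jackson_cst_pos al Ha). pose proof (pow2_pos j). pose proof PI_RGT_0.
  rewrite <- Hk, pow_add.
  replace (_ * (2 ^ j) ^ i / ((2 ^ j) ^ s * (2 ^ j) ^ i)) with ((jackson_cst al + 1 + l + PI) * E * ratio al ^ j / (2 ^ j) ^ s).
  2:{ field. split; apply pow_nonzero; lra. }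
  apply Rmult_le_compat_r; [left; apply Rinv_0_lt_compat; now apply pow_lt|]. apply Rmult_le_compat_r; [apply pow_le; lra|].
  apply Rmult_le_compat; lra.
Qed.

Lemma data_2d l al k h : 0 < l -> 0 < al < 1 -> (k = 2%nat \/ k = 3%nat) -> Cka2 (Omega l) (Omega_bar l) (k - 2) al h -> even_extension_Cka2 l (k - 2) al h ->
  forall E1, Cka2_norm (Omega l) (k - 2) al h * (jackson_cst al + 1 + l + PI) <= E1 ->
  let hq := clamp2 l h in
  holO al l E1 hq /\
  (forall j x y, 0 <= x <= l -> Rabs (dyblock j (fun n => fcoef (hq x) n * cosn n y)) <= block_size al E1 k 2 j) /\
  (forall x y J, 0 < x < l -> 0 < y < PI -> Rabs (psum (fun j => dyblock j (fun n => fcoef (hq x) n * cosn n y)) J - (hq x y - fcoef (hq x) 0)) <= 6 * (fejer_cst al * E1) * ratio al ^ J) /\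
  exists Hx Hy, k = 3%nat -> holO al l E1 Hx /\ holO al l E1 Hy /\
  (forall x y, 0 < x < l -> 0 < y < PI -> is_derive (fun t => hq t y) x (Hx x y) /\ is_derive (fun t => hq x t) y (Hy x y)) /\
  (forall x y J, 0 < x < l -> 0 < y < PI -> Rabs (psum (fun j => dyblock j (fun n => fcoef (hq x) n * dcosn 1 n y)) J - Hy x y) <= 6 * (fejer_cst al * E1) * ratio al ^ J).
Proof.
  intros Hl Ha Hk Hh Hev E1 HE1 hq. pose proof PI_RGT_0. pose proof (jackson_cst_pos al Ha). pose proof (fejer_cst_pos al Ha). pose proof (ratio_bounds al Ha).
  set (En := Cka2_norm _ _ _ _) in *. assert (HEn : 0 <= En) by apply Cka2_norm_pos.
  assert (HJ : 0 <= En * (jackson_cst al)) by (apply Rmult_le_pos; lra). assert (Hl' : 0 <= En * (l + PI)) by (apply Rmult_le_pos; lra).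
  assert (HE1p : 0 <= E1) by lra.
  assert (Hc : cont2 hq) by (apply cont2_clamp; [easy|apply Hh]).
  set (CE := jackson_cst al + 1 + l + PI) in *. assert (HCE : 0 < CE) by (unfold CE; lra).
  assert (Hg : forall s X j, (s + 2 = k)%nat -> X <= jackson_cst al * En * ratio al ^ j / (2 ^ j) ^ s -> X <= block_size al E1 k 2 j).
  { intros s X j Hs HX. replace E1 with (CE * (E1 / CE)) by (field; lra). apply (block_size_of l al X En (E1 / CE) k s 2 j); auto.
    apply (Rmult_le_reg_r CE); [easy|]. replace (E1 / CE * CE) with E1 by (field; lra). easy. }
  enough (HM : holO al l E1 hq /\ (forall j x y, 0 <= x <= l -> Rabs (dyblock j (fun n => fcoef (hq x) n * cosn n y)) <= block_size al E1 k 2 j) /\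
    exists Hx Hy, k = 3%nat -> holO al l E1 Hx /\ holO al l E1 Hy /\
  (forall x y, 0 < x < l -> 0 < y < PI -> is_derive (fun t => hq t y) x (Hx x y) /\ is_derive (fun t => hq x t) y (Hy x y)) /\
  (forall x y J, 0 < x < l -> 0 < y < PI -> Rabs (psum (fun j => dyblock j (fun n => fcoef (hq x) n * dcosn 1 n y)) J - Hy x y) <= 6 * (fejer_cst al * E1) * ratio al ^ J)).
  { destruct HM as [M1 [M2 M3]]. split; [easy|]. split; [easy|]. split; [|easy]. intros x y J Hx Hy.
    apply fejer_series; auto; [now apply cont2_y| |lra]. apply (holO_closed al l E1 hq Hl (proj1 Ha) HE1p Hc M1). lra. }
  unfold CE in HE1. destruct Hk as [-> | ->]; simpl in *.
  - destruct (data_2d_0 l al h Hl Ha Hh) as [A1 A2]. split; [|split].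
    + apply (holO_le al l En); [lra|easy].
    + intros j x y Hx. apply (Hg 0%nat); [easy|]. now apply A2.
    (* For [k = 2] the pair is a placeholder: the clause about it speaks of [k = 3]. *)
    + exists hq, hq. intros HF; discriminate HF.
  - destruct (data_2d_1 l al h Hl Ha Hh Hev) as [A1 [A2 [Hx [Hy [_ [_ [A3 [A4 [A5 A6]]]]]]]]]. split; [|split].
    + apply (holO_le al l (En * (1 + l + PI))); [lra|easy].
    + intros j x y Px. apply (Hg 1%nat); [easy|]. now apply A2.
    + exists Hx, Hy. intros _. split; [apply (holO_le al l En); [lra|easy]|]. split; [apply (holO_le al l En); [lra|easy]|]. split; [easy|].
      intros x y J Px Py. eapply Rle_trans; [now apply A6|]. apply Rmult_le_compat_r; [apply pow_le; lra|].
      apply Rmult_le_compat_l; [lra|]. apply Rmult_le_compat_l; [lra|]. fold En. lra.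
Qed.

(** All coefficients in one family, so that regularity and bounds are proved once. Entries [3] to
    [6] belong to the modes [n >= 1], entries [7] to [10] to mode [0] with the averaged terms; the
    factor [r] comes from the division by [- e1]. *)
Definition coef_list (G : data) (U : flow) (Phi : R -> mat22) (i : nat) (x : R) : R :=
  let r := / (1 - Mb G U x ^ 2) in
  match i with
  | 0%nat => r
  | 1%nat => a4 G U Phi x
  | 2%nat => b4 G U Phi x
  | 3%nat => lambda G * e2 G U x * r
  | 4%nat => e3 G U x * r
  | 5%nat => lambda G * e10 G U Phi x * r
  | 6%nat => lambda G * e11 G U Phi x * r
  | 7%nat => (lambda G * e2 G U x + PI * e6 G U x) * r
  | 8%nat => (e3 G U x + PI * e7 G U x) * r
  | 9%nat => lambda G * (e10 G U Phi x + PI * e12 G U Phi x) * r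
  | 10%nat => lambda G * (e11 G U Phi x + PI * e13 G U Phi x) * r
  | _ => 0
  end.

Lemma good_coef_list G U Phi l : admissible G -> background_on G U (l_star G) -> is_fundamental_matrix G U (l_star G) Phi ->
  0 < l -> Rbar_lt l (l_star G) -> forall i j, good l j (coef_list G U Phi i).
Proof.
  intros Ha Hb Hf Hl Hls i j.
  assert (Hr : good l j (fun x => / (1 - Mb G U x ^ 2))).
  { apply good_inv; [easy|now apply L_e1|]. apply good_minus; [apply good_const|]. apply good_pow. now apply G_M. }
  unfold coef_list.
  assert (Hc : forall c f, good l j f -> good l j (fun x => c * f x)) by (intros c f Hg; apply (good_mult l j (fun _ => c)); [apply good_const|easy]).
  assert (Hm : forall f, good l j f -> good l j (fun x => f x * / (1 - Mb G U x ^ 2))) by (intros f Hg; now apply good_mult).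
  assert (He2 : good l j (e2 G U)) by now apply G_e2. assert (He3 : good l j (e3 G U)) by now apply G_e3.
  assert (He6 : good l j (e6 G U)) by now apply G_e6. assert (He7 : good l j (e7 G U)) by now apply G_e7.
  assert (He10 : good l j (e10 G U Phi)) by now apply G_e10. assert (He11 : good l j (e11 G U Phi)) by now apply G_e11.
  assert (He12 : good l j (e12 G U Phi)) by now apply G_e12. assert (He13 : good l j (e13 G U Phi)) by now apply G_e13.
  destruct i as [|[|[|[|[|[|[|[|[|[|[|i]]]]]]]]]]].
  - exact Hr.
  - now apply G_a4.
  - now apply G_b4.
  - apply Hm, Hc, He2.
  - apply Hm, He3.
  - apply Hm, Hc, He10.
  - apply Hm, Hc, He11.
  - apply (Hm (fun x => lambda G * e2 G U x + PI * e6 G U x)), good_plus; now apply Hc.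
  - apply (Hm (fun x => e3 G U x + PI * e7 G U x)), good_plus; [easy|now apply Hc].
  - apply (Hm (fun x => lambda G * (e10 G U Phi x + PI * e12 G U Phi x))), (Hc _ (fun x => e10 G U Phi x + PI * e12 G U Phi x)), good_plus; [easy|now apply Hc].
  - apply (Hm (fun x => lambda G * (e11 G U Phi x + PI * e13 G U Phi x))), (Hc _ (fun x => e11 G U Phi x + PI * e13 G U Phi x)), good_plus; [easy|now apply Hc].
  - apply good_const.
Qed.

Theorem theorem5p1
  (G : data) (U : flow) (Phi : R -> mat22) (l alpha : R) (k : nat) :
  admissible G ->
  background_on G U (l_star G) ->
  is_fundamental_matrix G U (l_star G) Phi ->
  0 < l -> Rbar_lt l (l_star G) ->
  S_condition G U Phi l ->
  0 < alpha < 1 ->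
  (k = 2%nat \/ k = 3%nat) ->
  exists C : R,
  forall (h : R * R -> R) (g0 gl : R -> R),
    Cka2 (Omega l) (Omega_bar l) (k - 2) alpha h ->
    Cka1 (Ioo 0 PI) (Ioo 0 PI) (k - 1) alpha g0 ->
    Cka1 (Ioo 0 PI) (Ioo 0 PI) k alpha gl ->
    even_extension_Cka2 l (k - 2) alpha h ->
    even_extension_Cka1 (k - 1) alpha g0 ->
    even_extension_Cka1 k alpha gl ->
    exists p : R * R -> R,
      (Cka2 (Omega l) (Omega_bar l) k alpha p /\ solves G U Phi l h g0 gl p) /\
      (forall q : R * R -> R,
         Cka2 (Omega l) (Omega_bar l) k alpha q -> solves G U Phi l h g0 gl q ->
         forall z, Omega_bar l z -> q z = p z) /\
      Cka2_norm (Omega l) k alpha p <=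
        C * (Cka2_norm (Omega l) (k - 2) alpha h
             + Cka1_norm (Ioo 0 PI) (k - 1) alpha g0
             + Cka1_norm (Ioo 0 PI) k alpha gl).
Proof.
  intros Hadm Hbg Hfm Hl Hls HS Ha Hk. pose proof PI_RGT_0 as HPI. pose proof (jackson_cst_pos alpha Ha) as HJJ.
  pose proof (fun i => C1_extension l alpha _ Hl Ha (good_coef_list G U Phi l Hadm Hbg Hfm Hl Hls i 2)) as Hex.
  (* Extensions, their derivatives and their bounds are chosen index by index; the finitely many
     bounds are then replaced by one constant [KC]. *)
  set (co := fun i => proj1_sig (constructive_indefinite_description _ (Hex i))).
  assert (Hco : forall i, exists (dF : R -> R) (K : R), cont (co i) /\ (forall x, 0 < x < l -> co i x = coef_list G U Phi i x) /\
    (forall x, 0 < x < l -> is_derive (co i) x (dF x)) /\ holO alpha l K (fun x _ => co i x) /\ holO alpha l K (fun x _ => dF x)).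
  { intros i. exact (proj2_sig (constructive_indefinite_description _ (Hex i))). }
  clearbody co. clear Hex.
  set (dco := fun i => proj1_sig (constructive_indefinite_description _ (Hco i))).
  assert (Hdco : forall i, exists (K : R), cont (co i) /\ (forall x, 0 < x < l -> co i x = coef_list G U Phi i x) /\
    (forall x, 0 < x < l -> is_derive (co i) x (dco i x)) /\ holO alpha l K (fun x _ => co i x) /\ holO alpha l K (fun x _ => dco i x)).
  { intros i. exact (proj2_sig (constructive_indefinite_description _ (Hco i))). }
  clearbody dco. clear Hco.
  assert (HKC : exists KC, 1 <= KC /\ forall i, (i < 11)%nat -> holO alpha l KC (fun x _ => co i x) /\ holO alpha l KC (fun x _ => dco i x)).
  { set (K := fun i => proj1_sig (constructive_indefinite_description _ (Hdco i))). destruct (max_upto K 11) as [KC [H1 H2]].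
    exists KC. split; [easy|]. intros i Hi. destruct (proj2_sig (constructive_indefinite_description _ (Hdco i))) as [_ [_ [_ [A B]]]].
    split; (apply (holO_le alpha l (K i)); [now apply H2|easy]). }
  destruct HKC as [KC [HKC1 co_hol]].
  assert (co_cont : forall i, cont (co i)) by (intros i; now destruct (Hdco i) as [K [A _]]).
  assert (co_eq : forall i x, 0 < x < l -> co i x = coef_list G U Phi i x) by (intros i x Hx; destruct (Hdco i) as [K [_ [A _]]]; auto).
  assert (co_der : forall i x, 0 < x < l -> is_derive (co i) x (dco i x)) by (intros i x Hx; destruct (Hdco i) as [K [_ [_ [A _]]]]; auto).
  clear Hdco.
  assert (Er : forall x, 0 < x < l -> e1 G U x * co 0%nat x = -1).
  { intros x Hx. rewrite co_eq by easy. unfold e1, coef_list. destruct (pos_bg G U l Hbg Hls x ltac:(lra)) as [_ [_ HM]].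
    field. nra. }
  (* Inside, [0 < 1 - M ^ 2 <= 1] gives [r >= 1], and continuity extends this to the ends; hence
     [r0 = 1] in the maximum principle. *)
  assert (r_low : forall x, 0 <= x <= l -> 1 <= co 0%nat x).
  { intros x Hx. assert (- co 0%nat x <= -1); [|lra]. pose proof (co_cont 0%nat). apply (closed_le (fun x => - co 0%nat x) (-1) 0 l); auto with cont.
    clear x Hx. intros x Hx. cbv beta. specialize (Er x Hx). unfold e1 in Er. destruct (pos_bg G U l Hbg Hls x ltac:(lra)) as [_ [_ HM]].
    set (M := Mb G U x) in *. assert (0 < 1 - M ^ 2 <= 1) by nra. nra. }
  assert (coef : forall x, 0 < x < l -> e1 G U x * co 0%nat x = -1 /\ co 1%nat x = a4 G U Phi x /\ co 2%nat x = b4 G U Phi x /\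
    co 3%nat x = lambda G * e2 G U x * co 0%nat x /\ co 4%nat x = e3 G U x * co 0%nat x /\ co 5%nat x = lambda G * e10 G U Phi x * co 0%nat x /\
    co 6%nat x = lambda G * e11 G U Phi x * co 0%nat x /\
    co 7%nat x = (lambda G * e2 G U x + PI * e6 G U x) * co 0%nat x /\ co 8%nat x = (e3 G U x + PI * e7 G U x) * co 0%nat x /\
    co 9%nat x = lambda G * (e10 G U Phi x + PI * e12 G U Phi x) * co 0%nat x /\ co 10%nat x = lambda G * (e11 G U Phi x + PI * e13 G U Phi x) * co 0%nat x).
  { intros x Hx. split; [auto|]. rewrite !co_eq by easy. unfold coef_list. repeat split; ring. }
  set (pick := fun i j n : nat => match n with O => co i | _ => co j end).
  assert (pick_cont : forall i j n, cont (pick i j n)) by (intros i j [|n]; apply co_cont).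
  assert (coefn : forall x, 0 < x < l -> e1 G U x * co 0%nat x = -1 /\ co 1%nat x = a4 G U Phi x /\ co 2%nat x = b4 G U Phi x /\ forall n,
    pick 7%nat 3%nat n x = (lambda G * e2 G U x + match n with O => PI * e6 G U x | _ => 0 end) * co 0%nat x /\
    pick 8%nat 4%nat n x = (e3 G U x + match n with O => PI * e7 G U x | _ => 0 end) * co 0%nat x /\
    pick 9%nat 5%nat n x = lambda G * (e10 G U Phi x + match n with O => PI * e12 G U Phi x | _ => 0 end) * co 0%nat x /\
    pick 10%nat 6%nat n x = lambda G * (e11 G U Phi x + match n with O => PI * e13 G U Phi x | _ => 0 end) * co 0%nat x).
  { intros x Hx. destruct (coef x Hx) as [A0 [A1 [A2 [A3 [A4 [A5 [A6 [A7 [A8 [A9 A10]]]]]]]]]]. do 3 (split; [easy|]).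
    intros [|n]; unfold pick; [easy|]. rewrite A3, A4, A5, A6. repeat split; ring. }
  set (kap := lambda G * gamma0 G U).
  pose proof (fun n => uniq_of_S G U Phi l (co 0%nat) (co 1%nat) (co 2%nat) (pick 7%nat 3%nat) (pick 8%nat 4%nat) (pick 9%nat 5%nat) (pick 10%nat 6%nat)
    (co_cont _) (co_cont _) (co_cont _) (pick_cont _ _) (pick_cont _ _) (pick_cont _ _) (pick_cont _ _) coefn n HS) as Hu.
  fold kap in Hu.
  assert (Hun : forall n, (1 <= n)%nat -> uniq l kap (co 0%nat) (co 3%nat) (co 4%nat) (co 5%nat) (co 6%nat) (co 1%nat) (co 2%nat) (INR n ^ 2)).
  { intros [|n] Hn; [lia|]. exact (Hu (S n)). }
  pose proof (fun i x Hi Hx => co_le l alpha co dco KC Hl Ha HKC1 co_cont co_hol i x Hi Hx) as cole.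
  assert (Q1 : forall x, 0 <= x <= l -> Rabs (co 0%nat x) <= KC /\ Rabs (co 3%nat x) <= KC /\ Rabs (co 4%nat x) <= KC /\ Rabs (co 5%nat x) <= KC /\
     Rabs (co 6%nat x) <= KC /\ Rabs (co 1%nat x) <= KC /\ Rabs (co 2%nat x) <= KC).
  { intros x Hx. do 6 (split; [apply cole; [lia|easy]|]). apply cole; [lia|easy]. }
  assert (Q2 : forall x, 0 <= x <= l -> Rabs (co 0%nat x) <= KC /\ Rabs (co 7%nat x) <= KC /\ Rabs (co 8%nat x) <= KC /\ Rabs (co 9%nat x) <= KC /\
     Rabs (co 10%nat x) <= KC /\ Rabs (co 1%nat x) <= KC /\ Rabs (co 2%nat x) <= KC).
  { intros x Hx. do 6 (split; [apply cole; [lia|easy]|]). apply cole; [lia|easy]. }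
  destruct (mode_block_bound l kap (co 0%nat) (co 3%nat) (co 4%nat) (co 5%nat) (co 6%nat) (co 1%nat) (co 2%nat) 1 KC Hl (co_cont _) (co_cont _) (co_cont _) (co_cont _)
    (co_cont _) (co_cont _) (co_cont _) Rlt_0_1 r_low HKC1 Q1 Hun) as [KB0 [HKB0 HKB]].
  apply (block_bound_mono _ _ _ _ _ _ _ _ _ KB0 (KB0 + 1)) in HKB; [|lra]. set (KB := KB0 + 1) in *. assert (HKB1 : 1 <= KB) by (unfold KB; lra).
  destruct (bvp l kap (co 0%nat) (co 7%nat) (co 8%nat) (co 9%nat) (co 10%nat) (co 1%nat) (co 2%nat) KC Hl (co_cont _) (co_cont _) (co_cont _) (co_cont _)
    (co_cont _) (co_cont _) (co_cont _) HKC1 Q2 (INR 0 ^ 2) (Hu 0%nat)) as [C0 [HC0 Hz]].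
  (* Each of the three data of mode [0] will be at most [E], hence the factor [3]. *)
  set (V0 := 3 * C0). assert (HV0 : 0 <= V0) by (unfold V0; lra).
  set (CE := jackson_cst alpha + 1 + l + PI). assert (HCE : 1 <= CE) by (unfold CE; lra).
  (* Fixed before the data: the count of [fam_result], the derivative bound [deriv_cst], and [CE],
     which relates the norms of the data to the size [E] of their blocks. *)
  exists ((INR (S k) ^ 2 + 2 * INR (S k)) * (deriv_cst l alpha KC KB V0 * CE)).
  intros h g0 gl Hh Hg0 Hgl Eh Eg0 Egl.
  set (Nh := Cka2_norm _ _ _ h). set (N0 := Cka1_norm _ _ _ g0). set (Nl := Cka1_norm _ _ _ gl).
  assert (0 <= Nh) by apply Cka2_norm_pos. assert (0 <= N0) by apply Cka1_norm_pos. assert (0 <= Nl) by apply Cka1_norm_pos.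
  set (E := CE * (Nh + N0 + Nl)). assert (HE : 0 <= E) by (apply Rmult_le_pos; lra).
  assert (HNE : Nh + N0 + Nl <= E) by (unfold E; nra).
  destruct (data_2d l alpha k h Hl Ha Hk Hh Eh E) as [hq_hol [fn_bd [h_lim [Hx [Hy h3]]]]].
  { fold Nh CE. unfold E. rewrite Rmult_comm. apply Rmult_le_compat_l; lra. }
  set (hq := clamp2 l h) in *. assert (hq_cont : cont2 hq) by (apply cont2_clamp; [easy|apply Hh]).
  destruct (data_1d (k - 1) alpha g0 Ha ltac:(lia) Hg0 Eg0) as [G0 [G0c [EG0 [G0b [an_bd [E0 [HE0 an_lim]]]]]]].
  destruct (data_1d k alpha gl Ha ltac:(lia) Hgl Egl) as [Gl [Glc [EGl [Glb [bn_bd [El [HEl bn_lim]]]]]]].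
  fold N0 in G0b, an_bd. fold Nl in Glb, bn_bd.
  assert (an_bd' : forall j y, Rabs (dyblock j (fun n => fcoef G0 n * cosn n y)) <= block_size alpha E k 1 j).
  { intros j y. unfold E, CE. apply (block_size_of l alpha _ N0 _ k (k - 1)); auto; [lia|lra]. }
  assert (bn_bd' : forall j y, Rabs (dyblock j (fun n => fcoef Gl n * cosn n y)) <= block_size alpha E k 0 j).
  { intros j y. unfold E, CE. apply (block_size_of l alpha _ Nl _ k k); auto; [lia|lra]. }
  assert (fc : forall n, cont (fun x => fcoef (hq x) n)) by (intros n; now apply fcoef_cont).
  assert (Hv : forall n, exists p : (R -> R) * (R -> R), match n with O => forall x, fst p x = 0 /\ snd p x = 0 | _ =>
     mode_sol_of l kap (co 0%nat) (co 3%nat) (co 4%nat) (co 5%nat) (co 6%nat) (co 1%nat) (co 2%nat) (INR n ^ 2) (fun x => fcoef (hq x) n) (fcoef G0 n) (fcoef Gl n) (fst p) (snd p) end).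
  (* Only the existence of each mode is taken from [bvp]; the uniform estimate comes from [KB],
     block by block. Mode [0] of the series is zero, since [vz] is added separately. *)
  { intros [|n]; [exists (fun _ => 0, fun _ => 0); intros; now split|].
    destruct (bvp l kap (co 0%nat) (co 3%nat) (co 4%nat) (co 5%nat) (co 6%nat) (co 1%nat) (co 2%nat) KC Hl (co_cont _) (co_cont _) (co_cont _) (co_cont _)
      (co_cont _) (co_cont _) (co_cont _) HKC1 Q1 (INR (S n) ^ 2) (Hun (S n) ltac:(lia))) as [Cn [_ Hn]].
    destruct (cont_bounded (fun x => fcoef (hq x) (S n)) 0 l ltac:(lra) (fc (S n))) as [F [HF HFb]].
    destruct (Hn (fun x => fcoef (hq x) (S n)) (fcoef G0 (S n)) (fcoef Gl (S n)) F (fc _) HF HFb) as [v [dv [Hm _]]]. now exists (v, dv). }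
  set (vv := fun n => proj1_sig (constructive_indefinite_description _ (Hv n))).
  assert (Hvv : forall n, match n with O => forall x, fst (vv n) x = 0 /\ snd (vv n) x = 0 | _ =>
     mode_sol_of l kap (co 0%nat) (co 3%nat) (co 4%nat) (co 5%nat) (co 6%nat) (co 1%nat) (co 2%nat) (INR n ^ 2) (fun x => fcoef (hq x) n) (fcoef G0 n) (fcoef Gl n) (fst (vv n)) (snd (vv n)) end).
  { intros n. exact (proj2_sig (constructive_indefinite_description _ (Hv n))). }
  clearbody vv. clear Hv. set (v := fun n => fst (vv n)). set (dv := fun n => snd (vv n)).
  assert (v_sol : forall n, (1 <= n)%nat -> mode_sol_of l kap (co 0%nat) (co 3%nat) (co 4%nat) (co 5%nat) (co 6%nat) (co 1%nat) (co 2%nat) (INR n ^ 2)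
    (fun x => fcoef (hq x) n) (fcoef G0 n) (fcoef Gl n) (v n) (dv n)) by (intros [|n] Hn; [lia|exact (Hvv (S n))]).
  assert (v_zero : forall x, v 0%nat x = 0) by (intros; apply (Hvv 0%nat)).
  assert (dv_zero : forall x, dv 0%nat x = 0) by (intros; apply (Hvv 0%nat)).
  assert (HF0 : forall x, 0 <= x <= l -> Rabs (fcoef (hq x) 0) <= E).
  { intros x Px. apply fcoef0_bound; [now apply cont2_y|]. intros y Py. now apply (holO_closed alpha l E hq Hl (proj1 Ha) HE hq_cont hq_hol). }
  destruct (Hz (fun x => fcoef (hq x) 0) (fcoef G0 0) (fcoef Gl 0) E (fc 0%nat) HE HF0) as [vz [dvz [vz_sol vz_bd0]]].
  assert (vz_bd : forall x, 0 <= x <= l -> Rabs (vz x) <= V0 * E /\ Rabs (dvz x) <= V0 * E).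
  { assert (C0 * (E + Rabs (fcoef G0 0) + Rabs (fcoef Gl 0)) <= V0 * E).
    { unfold V0. replace (3 * C0 * E) with (C0 * (3 * E)) by ring. apply Rmult_le_compat_l; [easy|].
      pose proof (fcoef0_bound G0 N0 G0c G0b). pose proof (fcoef0_bound Gl Nl Glc Glb). lra. }
    intros x Px. destruct (vz_bd0 x Px). lra. }
  set (p := psol l v dv vz).
  assert (Hp : Cka2 (Omega l) (Omega_bar l) k alpha p /\ Cka2_norm (Omega l) k alpha p <= (INR (S k) ^ 2 + 2 * INR (S k)) * (deriv_cst l alpha KC KB V0 * E)).
  { apply (psol_reg l kap alpha k co dco KC KB V0 E hq Hx Hy (fcoef G0) (fcoef Gl) v dv vz dvz); auto. }
  assert (Hps : solves G U Phi l h g0 gl p).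
  { apply (psol_solves l kap alpha k co dco KC KB E hq Hx Hy (fcoef G0) (fcoef Gl) v dv vz dvz) with (G0 := G0) (Gl := Gl) (E2 := E0 + El); auto; try lra.
    - intros x y Px Py. apply clamp2_id; lra.
    - intros y J Py. eapply Rle_trans; [now apply an_lim|]. apply Rmult_le_compat_r; [|lra]. apply pow_le. pose proof (ratio_bounds alpha Ha); lra.
    - intros y J Py. eapply Rle_trans; [now apply bn_lim|]. apply Rmult_le_compat_r; [|lra]. apply pow_le. pose proof (ratio_bounds alpha Ha); lra. }
  exists p. split; [split; [apply Hp|apply Hps]|]. split.
  - intros q Hq Hqs.
    (* Both [q] and the constructed [p] are solutions in the class, so their modes solve the same
       problems and agree. *)
    pose proof (mode_of_solution G U Phi l (co 0%nat) (co 1%nat) (co 2%nat) (pick 7%nat 3%nat) (pick 8%nat 4%nat) (pick 9%nat 5%nat) (pick 10%nat 6%nat)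
      Hl (co_cont _) (co_cont _) (co_cont _) (pick_cont _ _) (pick_cont _ _) (pick_cont _ _) (pick_cont _ _) coefn k h g0 gl G0 Gl) as HMd.
    apply (eq_of_modes l alpha); auto; [apply Hq|apply Hp|now apply (Cka2_lip l alpha k); auto; lia|apply (Cka2_lip l alpha k); auto; [lia|apply Hp]|].
    intros n x Px.
    destruct (HMd q n ltac:(lia) (proj1 (proj1 Hh)) G0c Glc EG0 EGl (proj1 Hq) Hqs) as [v1 [w1 [M1 E1]]].
    destruct (HMd p n ltac:(lia) (proj1 (proj1 Hh)) G0c Glc EG0 EGl (proj1 (proj1 Hp)) Hps) as [v2 [w2 [M2 E2]]].
    unfold clamp2. rewrite <- E1, <- E2 by easy. exact (mode_sol_of_unique _ _ _ _ _ _ _ _ _ _ _ _ _ _ _ _ _ (co_cont 1%nat) (co_cont 2%nat) (Hu n) M1 M2 x Px).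
  - eapply Rle_trans; [apply Hp|]. right. fold Nh N0 Nl. unfold E. ring.
Qed.
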